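(* Let $G$ be a locally compact group. For any large ideal $E$ of $B(G)$, the $E$-ization coaction functor $(A,\delta)\mapsto\big((A^m)^E,(\delta^m)^E\big)$ is Morita compatible.
   Context: **Conventions.** $G$ is a locally compact group; ideals of $C^*$-algebras are closed and two-sided; homomorphisms are $*$-homomorphisms; $\otimes$ is the minimal tensor product; $\mathcal K=\mathcal K(L^2(G))$. For $C^*$-algebras $A,C$ put $\widetilde M(A\otimes C)=\{m\in M(A\otimes C): m(1\otimes C)\cup(1\otimes C)m\subset A\otimes C\}$; a homomorphism $\phi:A\to B$ has a canonical extension $\overline{\phi\otimes\mathrm{id}}:\widetilde M(A\otimes C)\to\widetilde M(B\otimes C)$ with $\overline{\phi\otimes\mathrm{id}}(m)(1\otimes c)=(\phi\otimes\mathrm{id})(m(1\otimes c))$. Let $\delta_G:C^*(G)\to M(C^*(G)\otimes C^*(G))$ be the comultiplication, $\delta_G(s)=s\otimes s$ for $s\in G$. **Coactions.** A coaction $(A,\delta)$ of $G$ is a $C^*$-algebra $A$ with an injective nondegenerate homomorphism $\delta:A\to \widetilde M(A\otimes C^*(G))\subset M(A\otimes C^*(G))$ such that $(\delta\otimes\mathrm{id})\circ\delta=(\mathrm{id}\otimes\delta_G)\circ\delta$ and $\overline{\mathrm{span}}\,\delta(A)(1\otimes C^*(G))=A\otimes C^*(G)$. The category $\mathbf{Coact}$ has coactions of $G$ as objects; a morphism $\phi:(A,\delta)\to(B,\epsilon)$ is a homomorphism $\phi:A\to B$ (not into multipliers) with $\epsilon\circ\phi=\overline{\phi\otimes\mathrm{id}}\circ\delta$.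 **Crossed products.** Let $w_G\in M(C_0(G)\otimes C^*(G))$ be the unitary function $w_G(s)=s$. $(A\rtimes_\delta G,j_A,j_G)$ is the crossed product, universal for pairs of nondegenerate homomorphisms $\pi:A\to M(C)$, $\mu:C_0(G)\to M(C)$ satisfying $(\pi\otimes\mathrm{id})\circ\delta(a)=\mathrm{Ad}\,(\mu\otimes\mathrm{id})(w_G)(\pi(a)\otimes1)$; it carries the dual action $\widehat\delta$ of $G$ (fixing $j_A(A)$ and acting by right translation on $j_G(C_0(G))$). It is functorial on $\mathbf{Coact}$, $\phi\mapsto\phi\rtimes G$. With $\lambda,\rho$ the left and right regular representations and $M$ the multiplication representation of $C_0(G)$ on $L^2(G)$, there is a canonical surjection $\Phi=\big((\mathrm{id}\otimes\lambda)\circ\delta\times(1\otimes M)\big)\times(1\otimes\rho):A\rtimes_\delta G\rtimes_{\widehat\delta}G\to A\otimes\mathcal K$. The coaction is maximal if $\Phi$ is an isomorphism. Every coaction $(A,\delta)$ has a maximalization: a maximal coaction $(A^m,\delta^m)$ and a surjective morphism $q^m_A:(A^m,\delta^m)\to(A,\delta)$ with $q^m_A\rtimes G$ an isomorphism; it is unique up to isomorphism and, after choices, a functor on $\mathbf{Coact}$ with $q^m$ natural. **Large ideals and $E$-ization.** $B(G)=C^*(G)^*$ is the Fourier–Stieltjes algebra. For a coaction $(A,\delta)$, $f\in B(G)$, $a\in A$ put $f\cdot a=(\mathrm{id}\otimes f)(\delta(a))\in A$. A large ideal $E$ of $B(G)$ is an ideal that is nonzero, $G$-invariant (under left and right translation),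 and weak* closed (such an ideal contains $B_r(G)=C^*_r(G)^*$). Let ${}^\perp E\subset C^*(G)$ be its preannihilator and $q_E:C^*(G)\to C^*_E(G)=C^*(G)/{}^\perp E$ the quotient map. For a coaction $(A,\delta)$, $A_E:=\{a\in A:E\cdot a=\{0\}\}=\ker(\mathrm{id}\otimes q_E)\circ\delta$ is an ideal of $A$, $A^E:=A/A_E$, $Q^E_A:A\to A^E$ is the quotient map, and $\delta^E$ is the unique coaction on $A^E$ for which $Q^E_A$ is $\delta-\delta^E$ equivariant; this gives a functor $\tau_E$ on $\mathbf{Coact}$. The $E$-ization of $(A,\delta)$ is $\big((A^m)^E,(\delta^m)^E\big)$; $E$-ization is the composition of maximalization followed by $\tau_E$, and is a coaction functor via the natural surjections $Q^E_{A^m}:A^m\to(A^m)^E$. **Morita compatibility.** An $(A,\delta)-(B,\epsilon)$ imprimitivity bimodule $(X,\zeta)$ is an $A-B$ imprimitivity bimodule $X$ with a $\delta-\epsilon$ compatible coaction $\zeta:X\to M(X\otimes C^*(G))$; equivalently $\delta,\zeta,\epsilon$ combine to a coaction on the linking algebra $L(X)$. Let $Y=X\rtimes_\zeta G\rtimes_{\widehat\zeta}G$ be the upper right corner of the double crossed product of $L(X)$, an $(A\rtimes_\delta G\rtimes_{\widehat\delta}G)-(B\rtimes_\epsilon G\rtimes_{\widehat\epsilon}G)$ imprimitivity bimodule. Using the isomorphisms $A\rtimes_\delta G\rtimes_{\widehat\delta}G\cong A^m\rtimes_{\delta^m}G\rtimes_{\widehat{\delta^m}}G\cong A^m\otimes\mathcal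 K$ (inverse of $q^m_A\rtimes G\rtimes G$, then $\Phi$ for $A^m$), and likewise for $B$, regard $Y$ as an $(A^m\otimes\mathcal K)-(B^m\otimes\mathcal K)$ imprimitivity bimodule. Put $X^m=\{m\in M(Y):(1\otimes k)\cdot m=m\cdot(1\otimes k)\in Y\text{ for all }k\in\mathcal K\}$, which is an $A^m-B^m$ imprimitivity bimodule (identifying $A^m=A^m\otimes1$, $B^m=B^m\otimes1$). A coaction functor $\tau$, with natural surjections $q^\tau_A:A^m\to A^\tau$ and $A^m_\tau:=\ker q^\tau_A$, is Morita compatible if for every such $(X,\zeta)$ the Rieffel correspondence of ideals given by $X^m$ satisfies $X^m\text{-}\mathrm{Ind}\,B^m_\tau=A^m_\tau$. *)

(* Defs.v *)
From HB Require Import structures.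
From mathcomp Require Import all_boot all_order all_algebra.
From mathcomp Require Import complex.
From mathcomp Require Import all_classical all_reals all_analysis.

Set Implicit Arguments.
Unset Strict Implicit.
Unset Printing Implicit Defensive.
Import Order.TTheory GRing.Theory Num.Theory numFieldNormedType.Exports.
Local Open Scope ring_scope.
Local Open Scope classical_set_scope.
Local Open Scope complex_scope.

(* Objects that are only determined up to isomorphism (tensor products, C^*(G),
   L^2(G), crossed products, maximalizations, ...) are not constructed here:
   each is given as an arbitrary model of its defining property, and the
   theorem quantifies over all models. *)

(* Definite description: the element satisfying P, or the junk value x0 when
   there is none. It is only used for maps and multipliers which exist and are
   unique by standard C^*-algebra theory. *)
Definition the (T : Type) (x0 : T) (P : T -> Prop) : T :=
  if pselect (exists x, P x) is left h then projT1 (cid h) else x0.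

HB.structure Definition TopologicalGroup := {G of Topological G & Group G}.

(* "Locally compact group" includes the Hausdorff property, as usual. *)
Definition locally_compact_group (G : TopologicalGroup.type) : Prop :=
  [/\ continuous (fun p : G * G => (p.1 * p.2)%g),
      continuous (fun s : G => (s^-1)%g),
      hausdorff_space G & locally_compact [set: G]].

Reserved Notation "a *c b" (at level 40, left associativity).
Reserved Notation "m *M n" (at level 40, left associativity).
Reserved Notation "A ⊗ B" (at level 39, left associativity).
Reserved Notation "m ⊗M n" (at level 39, left associativity).

Section CStarAlgebras.
Variable R : realType.
Local Notation C := R[i].

Record cstarAlgebra := CStarAlgebra {
  cs_sort :> completeNormedModType C;
  cmul : cs_sort -> cs_sort -> cs_sort;
  cadj : cs_sort -> cs_sort;
  cmulA : associative cmul;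
  cmulDl : forall a b c, cmul (a + b) c = cmul a c + cmul b c;
  cmulDr : forall a b c, cmul a (b + c) = cmul a b + cmul a c;
  cmulZl : forall k a b, cmul (k *: a) b = k *: cmul a b;
  cmulZr : forall k a b, cmul a (k *: b) = k *: cmul a b;
  cadjK : involutive cadj;
  cadjD : forall a b, cadj (a + b) = cadj a + cadj b;
  cadjZ : forall k a, cadj (k *: a) = Num.conj k *: cadj a;
  cadjM : forall a b, cadj (cmul a b) = cmul (cadj b) (cadj a);
  cnormM : forall a b, `|cmul a b| <= `|a| * `|b|;
  cnormE : forall a, `|cmul (cadj a) a| = `|a| ^+ 2 }.

Local Notation "a *c b" := (cmul a b).

Definition cspan (V : lmodType C) (S : set V) : set V :=
  [set v | exists n (k : 'I_n -> C) (s : 'I_n -> V),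
     (forall i, S (s i)) /\ v = \sum_(i < n) k i *: s i].

Definition closed_span (V : completeNormedModType C) (S : set V) : set V :=
  closure (cspan S).

Definition starhom (A B : cstarAlgebra) (f : A -> B) : Prop :=
  [/\ linear f, {morph f : a b / a *c b} & {morph f : a / cadj a}].

(* Multipliers as double centralizers: [ml m a] is m a and [mr m a] is a m.
   Linearity and boundedness of the two maps are automatic. *)
Record multiplier (A : cstarAlgebra) := Multiplier {
  ml : A -> A;
  mr : A -> A;
  ml_mr : forall a b, a *c ml b = mr a *c b }.

Section MultiplierOperations.
Variable A : cstarAlgebra.
Implicit Types (m n : multiplier A) (a b : A).

Definition memb a : multiplier A :=
  @Multiplier A (fun b => a *c b) (fun b => b *c a) (fun b c => cmulA b a c).

Definition mone : multiplier A := @Multiplier A id id (fun a b => erefl).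

Fact mzero_subproof a b : a *c 0 = 0 *c b.
Proof. by rewrite -(scale0r 0) cmulZr -(scale0r (0 : A)) cmulZl !scale0r. Qed.
Definition mzero : multiplier A := Multiplier mzero_subproof.

Fact madd_subproof m n a b :
  a *c (ml m b + ml n b) = (mr m a + mr n a) *c b.
Proof. by rewrite cmulDr cmulDl !ml_mr. Qed.
Definition madd m n : multiplier A := Multiplier (madd_subproof m n).

Fact mscale_subproof (k : C) m a b : a *c (k *: ml m b) = (k *: mr m a) *c b.
Proof. by rewrite cmulZr cmulZl ml_mr. Qed.
Definition mscale k m : multiplier A := Multiplier (mscale_subproof k m).

Fact mmul_subproof m n a b : a *c ml m (ml n b) = mr n (mr m a) *c b.
Proof. by rewrite !ml_mr. Qed.
Definition mmul m n : multiplier A := Multiplier (mmul_subproof m n).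

Fact madj_subproof m a b :
  a *c cadj (mr m (cadj b)) = cadj (ml m (cadj a)) *c b.
Proof. by have := ml_mr m (cadj b) (cadj a) => /(congr1 (@cadj A)); rewrite !cadjM !cadjK. Qed.
Definition madj m : multiplier A := Multiplier (madj_subproof m).

End MultiplierOperations.

Local Notation "m *M n" := (mmul m n).

Definition mhom (A B : cstarAlgebra) (f : A -> multiplier B) : Prop :=
  [/\ forall k a b, f (k *: a + b) = madd (mscale k (f a)) (f b),
      forall a b, f (a *c b) = f a *M f b
    & forall a, f (cadj a) = madj (f a)].

Definition nondegenerate (A B : cstarAlgebra) (f : A -> multiplier B) : Prop :=
  closed_span [set x | exists a b, x = ml (f a) b] = setT.

(* Extension of a nondegenerate homomorphism A -> M(B) to M(A). *)
Definition mext (A B : cstarAlgebra) (f : A -> multiplier B)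
    (m : multiplier A) : multiplier B :=
  the (mzero B) (fun n => forall a, n *M f a = f (ml m a)).

Record hilbertSpace := HilbertSpace {
  h_sort :> completeNormedModType C;
  dot : h_sort -> h_sort -> C;
  dotDr : forall x y z, dot x (y + z) = dot x y + dot x z;
  dotZr : forall k x y, dot x (k *: y) = k * dot x y;
  dotC : forall x y, dot y x = Num.conj (dot x y);
  dot_norm : forall x, dot x x = `|x| ^+ 2 }.

Definition faithful_rep (A : cstarAlgebra) (H : hilbertSpace)
    (pi : A -> H -> H) : Prop :=
  [/\ forall a, linear (pi a),
      forall k a b x, pi (k *: a + b) x = k *: pi a x + pi b x,
      forall a b x, pi (a *c b) x = pi a (pi b x),
      forall a x y, dot (pi a x) y = dot x (pi (cadj a) y)
    & injective pi].

Definition is_hilbert_tensor (H1 H2 H : hilbertSpace) (h : H1 -> H2 -> H) : Prop :=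
  [/\ forall k x x' y, h (k *: x + x') y = k *: h x y + h x' y,
      forall k x y y', h x (k *: y + y') = k *: h x y + h x y',
      forall x x' y y', dot (h x y) (h x' y') = dot x x' * dot y y'
    & closed_span [set z | exists x y, z = h x y] = setT].

(* The spatial tensor product: the closed span of the operators
   pi(a) (x) sigma(b) on H1 (x) H2, for faithful pi and sigma. *)
Definition is_min_tensor (A B T : cstarAlgebra) (t : A -> B -> T) : Prop :=
  closed_span [set z | exists a b, z = t a b] = setT /\
  exists (H1 H2 H : hilbertSpace) (h : H1 -> H2 -> H)
         (pi : A -> H1 -> H1) (sigma : B -> H2 -> H2) (Pi : T -> H -> H),
    [/\ is_hilbert_tensor h, faithful_rep pi, faithful_rep sigma,
        faithful_rep Pi
      & forall a b x y, Pi (t a b) (h x y) = h (pi a x) (sigma b y)].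

Record tensorModel := TensorModel {
  tensor : cstarAlgebra -> cstarAlgebra -> cstarAlgebra;
  elt : forall A B : cstarAlgebra, A -> B -> tensor A B;
  eltP : forall A B : cstarAlgebra, is_min_tensor (@elt A B) }.

End CStarAlgebras.

Arguments mone {R A}.
Arguments mzero {R A}.
Notation "a *c b" := (cmul a b).
Notation "m *M n" := (mmul m n).

Section Tensor.
Variables (R : realType) (T : tensorModel R).
Local Notation C := R[i].
Local Notation cstar := (cstarAlgebra R).
Local Notation "A ⊗ B" := (tensor T A B).
Local Notation M := multiplier.
Local Notation elt := (elt T).

Definition melt (A B : cstar) (m : M A) (n : M B) : M (A ⊗ B) :=
  the mzero (fun p => forall a b, ml p (elt a b) = elt (ml m a) (ml n b)).

Definition homtens (A B A' B' : cstar) (f : A -> M A') (g : B -> M B') :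
    A ⊗ B -> M (A' ⊗ B') :=
  the (fun=> mzero)
    (fun h => mhom h /\ forall a b, h (elt a b) = melt (f a) (g b)).

Definition tensA (A B D : cstar) : (A ⊗ B) ⊗ D -> A ⊗ (B ⊗ D) :=
  the (fun=> 0) (fun h => starhom h /\
    forall a b d, h (elt (elt a b) d) = elt a (elt b d)).

Definition tildeM (A B : cstar) (m : M (A ⊗ B)) : Prop :=
  forall b : B, (exists x, m *M melt mone (memb b) = memb x) /\
                (exists x, melt mone (memb b) *M m = memb x).

(* The canonical extension of phi (x) id to tildeM, for phi into B itself. *)
Definition tilde_ext (A B D : cstar) (phi : A -> B) (m : M (A ⊗ D)) : M (B ⊗ D) :=
  the mzero (fun n => tildeM n /\
    forall d x, m *M melt mone (memb d) = memb x ->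
      n *M melt mone (memb d) =
      homtens (fun a => memb (phi a)) (@memb R D) x).

Definition bdual (A : cstar) (f : A -> C^o) : Prop := linear f /\ continuous f.

Definition slice (A B : cstar) (f : B -> C^o) : A ⊗ B -> A :=
  the (fun=> 0) (fun h => [/\ linear h, continuous h
    & forall a b, h (elt a b) = f b *: a]).

(* id (x) f on tildeM: factoring f = g(. c) (Cohen), (id (x) f)(m) is
   (id (x) g)(m (1 (x) c)). *)
Definition slice_tilde (A B : cstar) (f : B -> C^o) (m : M (A ⊗ B)) : A :=
  the 0 (fun a => forall g c x, bdual g -> (forall b, f b = g (b *c c)) ->
    m *M melt mone (memb c) = memb x -> a = slice g x).

End Tensor.

Arguments tensA {R T A B D}.
Arguments tildeM {R T A B}.
Arguments homtens {R T A B A' B'}.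
Arguments tilde_ext {R T A B D}.
Arguments slice {R T A B}.
Arguments slice_tilde {R T A B}.
Arguments melt {R} T {A B}.

Section GroupModels.
Variables (R : realType) (G : TopologicalGroup.type) (T : tensorModel R).
Local Notation C := R[i].
Local Notation cstar := (cstarAlgebra R).
Local Notation M := multiplier.
Implicit Types (A B D : cstar).

(* Strictly continuous unitary representations G -> UM(D). *)
Definition unitary_rep D (v : G -> M D) : Prop :=
  [/\ v 1%g = mone, forall s t, v (s * t)%g = v s *M v t,
      forall s, madj (v s) = v (s^-1)%g
    & forall d, continuous (fun s => ml (v s) d)].

Definition integrates A (u : G -> M A) D (v : G -> M D) (phi : A -> M D) : Prop :=
  [/\ mhom phi, nondegenerate phi & forall s, mext phi (u s) = v s].

Definition is_groupC A (u : G -> M A) : Prop :=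
  unitary_rep u /\
  forall D (v : G -> M D), unitary_rep v -> exists! phi, integrates u v phi.

Definition vanishes_at_infinity (f : G -> C^o) : Prop :=
  forall e : R, 0 < e ->
    exists2 K, compact K & forall s, ~ K s -> `|f s| <= e%:C.

(* [ev s] is evaluation at s. A *-isomorphism being isometric, the norm of A
   is the supremum norm. *)
Definition is_C0 A (ev : G -> A -> C^o) : Prop :=
  [/\ forall s k f g, ev s (k *: f + g) = k * ev s f + ev s g,
      forall s f g, ev s (f *c g) = ev s f * ev s g,
      forall s f, ev s (cadj f) = Num.conj (ev s f),
      forall f g, (forall s, ev s f = ev s g) -> f = g
    & forall p : G -> C^o, (continuous p /\ vanishes_at_infinity p) <->
                           (exists f, forall s, ev s f = p s)].

Definition Cc (f : G -> C^o) : Prop :=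
  continuous f /\ exists2 K, compact K & forall s, ~ K s -> f s = 0.

(* Left Haar integral I on Cc(G), with modular function Delta. *)
Definition is_haar (I : (G -> C^o) -> C) (Delta : G -> R) : Prop :=
  [/\ forall k f g, Cc f -> Cc g -> I (fun t => k * f t + g t) = k * I f + I g,
      forall f, Cc f -> (forall t, 0 <= f t) -> 0 <= I f,
      (exists2 f, Cc f & I f <> 0),
      forall s f, Cc f -> I (fun t => f (s^-1 * t)%g) = I f
    & forall s, 0 < Delta s /\
        forall f, Cc f -> I (fun t => f (t * s)%g) = ((Delta s)^-1)%:C * I f].

(* H is the completion of Cc(G) for the inner product I(conj(f) g). *)
Definition is_L2 (I : (G -> C^o) -> C) (H : hilbertSpace R)
    (iota : (G -> C^o) -> H) : Prop :=
  [/\ forall k f g, Cc f -> Cc g ->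
        iota (fun t => k * f t + g t) = k *: iota f + iota g,
      forall f g, Cc f -> Cc g ->
        dot (iota f) (iota g) = I (fun t => Num.conj (f t) * g t)
    & closure [set x | exists2 f, Cc f & x = iota f] = setT].

(* The compact operators on H: the closed span of the rank one operators. *)
Definition is_compacts A (H : hilbertSpace R) (kap : A -> H -> H) : Prop :=
  [/\ faithful_rep kap,
      forall x y, exists k, forall z, kap k z = dot y z *: x
    & closed_span [set k | exists x y, forall z, kap k z = dot y z *: x] = setT].

Record groupModel := GroupModel {
  CG : cstar;
  uG : G -> M CG;
  CG_P : is_groupC uG;
  C0 : cstar;
  ev : G -> C0 -> C^o;
  C0_P : is_C0 ev;
  haar : (G -> C^o) -> C;
  Delta : G -> R;
  haarP : is_haar haar Delta;
  L2 : hilbertSpace R;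
  iota : (G -> C^o) -> L2;
  L2_P : is_L2 haar iota;
  KL2 : cstar;
  kap : KL2 -> L2 -> L2;
  KL2_P : is_compacts kap }.

End GroupModels.

Section Coactions.
Variables (R : realType) (G : TopologicalGroup.type) (T : tensorModel R).
Variable S : groupModel R G.
Local Notation C := R[i].
Local Notation cstar := (cstarAlgebra R).
Local Notation "A ⊗ B" := (tensor T A B).
Local Notation "m ⊗M n" := (melt T m n).
Local Notation M := multiplier.
Local Notation elt := (elt T).
Local Notation CG := (CG S).
Local Notation C0 := (C0 S).
Local Notation K := (KL2 S).
Local Notation u := (@uG R G S).
Local Notation one c := (melt T mone (memb c)).

(* The integrated form C^*(G) -> M(D) of a unitary representation. *)
Definition gint (D : cstar) (v : G -> M D) : CG -> M D :=
  the (fun=> mzero) (integrates u v).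

Definition deltaG : CG -> M (CG ⊗ CG) := gint (fun s => u s ⊗M u s).

Definition evslice (D : cstar) (s : G) : C0 ⊗ D -> D :=
  the (fun=> 0) (fun h => starhom h /\ forall f d, h (elt f d) = ev s f *: d).

(* The function s |-> s, as an element of M(C_0(G) (x) C^*(G)). *)
Definition wG : M (C0 ⊗ CG) :=
  the mzero (fun w => forall s f c,
    evslice s (ml w (elt f c)) = ev s f *: ml (u s) c).

(* Bounded operators on L^2(G), and B(L^2(G)) = M(K). *)
Definition bop (P : (L2 S -> L2 S) -> Prop) : L2 S -> L2 S :=
  the (fun=> 0) (fun V => [/\ linear V, continuous V & P V]).
Definition opmult (V : L2 S -> L2 S) : M K :=
  the mzero (fun m => forall k x, kap (ml m k) x = V (kap k x)).

Definition lambda (s : G) : M K :=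
  opmult (bop (fun V => forall f, Cc f ->
    V (iota S f) = iota S (fun t => f (s^-1 * t)%g))).
Definition rho (s : G) : M K :=
  opmult (bop (fun V => forall f, Cc f ->
    V (iota S f) = (Num.sqrt (Delta S s))%:C *: iota S (fun t => f (t * s)%g))).
Definition Mrep (f : C0) : M K :=
  opmult (bop (fun V => forall g, Cc g ->
    V (iota S g) = iota S (fun t => ev t f * g t))).

Definition is_coaction (A : cstar) (delta : A -> M (A ⊗ CG)) : Prop :=
  [/\ [/\ mhom delta, nondegenerate delta & injective delta],
      forall a, tildeM (delta a),
      forall a, mext (fun x => memb (tensA x))
                     (mext (homtens delta (@memb R CG)) (delta a)) =
                mext (homtens (@memb R A) deltaG) (delta a)
    & closed_span [set x | exists a c, memb x = delta a *M one c] = setT].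

Record coaction := Coaction {
  co_alg :> cstar;
  co_map : co_alg -> M (co_alg ⊗ CG);
  co_P : is_coaction co_map }.

Definition equivariant (A B : coaction) (phi : A -> B) : Prop :=
  starhom phi /\ forall a, co_map (phi a) = tilde_ext phi (co_map a).

Definition covariant (A : coaction) (D : cstar)
    (pi : A -> M D) (mu : C0 -> M D) : Prop :=
  let W := mext (homtens mu (@memb R CG)) wG in
  [/\ mhom pi, nondegenerate pi, mhom mu, nondegenerate mu
    & forall a, mext (homtens pi (@memb R CG)) (co_map a) =
                W *M (pi a ⊗M mone) *M madj W].

Definition cp_integrates (A : coaction) (P : cstar) (jA : A -> M P)
    (jG : C0 -> M P) (D : cstar) (pi : A -> M D) (mu : C0 -> M D)
    (psi : P -> M D) : Prop :=
  [/\ mhom psi, nondegenerate psi, forall a, mext psi (jA a) = pi a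
    & forall f, mext psi (jG f) = mu f].

Record crossedProduct (A : coaction) := CrossedProduct {
  cp :> cstar;
  jA : A -> M cp;
  jG : C0 -> M cp;
  cp_cov : covariant jA jG;
  cp_mem : forall a f, exists x, memb x = jA a *M jG f;
  cp_span : closed_span [set x | exists a f, memb x = jA a *M jG f] = setT;
  cp_univ : forall (D : cstar) (pi : A -> M D) (mu : C0 -> M D),
    covariant pi mu -> exists! psi, cp_integrates jA jG pi mu psi }.

(* rt s f is the function t |-> f (t s). *)
Definition rt (s : G) (f : C0) : C0 :=
  the 0 (fun g => forall t, ev t g = ev (t * s)%g f).

Definition dual_action (A : coaction) (P : crossedProduct A) (s : G) : P -> P :=
  the id (fun h => [/\ starhom h, bijective h,
    forall a, mext (fun x => memb (h x)) (jA P a) = jA P a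
  & forall f, mext (fun x => memb (h x)) (jG P f) = jG P (rt s f)]).

Definition act_covariant (P : cstar) (alpha : G -> P -> P) (D : cstar)
    (pi : P -> M D) (v : G -> M D) : Prop :=
  [/\ mhom pi, nondegenerate pi, unitary_rep v
    & forall s x, pi (alpha s x) = v s *M pi x *M madj (v s)].

Definition acp_integrates (P Q : cstar) (iP : P -> M Q) (iG : G -> M Q)
    (D : cstar) (pi : P -> M D) (v : G -> M D) (psi : Q -> M D) : Prop :=
  [/\ mhom psi, nondegenerate psi, forall x, mext psi (iP x) = pi x
    & forall s, mext psi (iG s) = v s].

Record actionCrossedProduct (P : cstar) (alpha : G -> P -> P) :=
  ActionCrossedProduct {
  acp :> cstar;
  iP : P -> M acp;
  iG : G -> M acp;
  acp_cov : act_covariant alpha iP iG;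
  acp_mem : forall x c, exists y, memb y = iP x *M gint iG c;
  acp_span : closed_span [set y | exists x c, memb y = iP x *M gint iG c] = setT;
  acp_univ : forall (D : cstar) (pi : P -> M D) (v : G -> M D),
    act_covariant alpha pi v -> exists! psi, acp_integrates iP iG pi v psi }.

Record crossedModel := CrossedModel {
  crossed : forall A : coaction, crossedProduct A;
  double_crossed : forall A : coaction,
    actionCrossedProduct (@dual_action A (crossed A)) }.

Variable X : crossedModel.
Local Notation cr := (crossed X).
Local Notation dcr := (double_crossed X).

(* phi |-> phi x G and phi |-> phi x G x G on equivariant homomorphisms. *)
Definition cr_map (A B : coaction) (phi : A -> B) : cr A -> cr B :=
  the (fun=> 0) (fun h => starhom h /\
    forall a f x, memb x = jA (cr A) a *M jG (cr A) f ->
      memb (h x) = jA (cr B) (phi a) *M jG (cr B) f).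

Definition dcr_map (A B : coaction) (phi : A -> B) : dcr A -> dcr B :=
  the (fun=> 0) (fun h => starhom h /\
    forall x c y, memb y = iP (dcr A) x *M gint (iG (dcr A)) c ->
      memb (h y) = iP (dcr B) (cr_map phi x) *M gint (iG (dcr B)) c).

(* The canonical surjection Phi onto A (x) K, as a map into M(A (x) K). *)
Definition Theta (A : coaction) : cr A -> M (A ⊗ K) :=
  the (fun=> mzero) (cp_integrates (jA (cr A)) (jG (cr A))
    (fun a => mext (homtens (@memb R A) (gint lambda)) (co_map a))
    (fun f => mone ⊗M Mrep f)).

Definition Phi (A : coaction) : dcr A -> M (A ⊗ K) :=
  the (fun=> mzero) (acp_integrates (iP (dcr A)) (iG (dcr A))
    (@Theta A) (fun s => mone ⊗M rho s)).

Definition maximal (A : coaction) : Prop :=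
  exists Phi0 : dcr A -> A ⊗ K,
    bijective Phi0 /\ forall y, Phi y = memb (Phi0 y).

Definition Phi_inv (A : coaction) (t : A ⊗ K) : dcr A :=
  the 0 (fun y => Phi y = memb t).

Record maximalization (A : coaction) := Maximalization {
  mx :> coaction;
  mq : mx -> A;
  mx_max : maximal mx;
  mq_equiv : equivariant mq;
  mq_surj : forall a, exists b, mq b = a;
  mq_iso : bijective (cr_map mq) }.

Variable maxi : forall A : coaction, maximalization A.

Definition mx_map (A B : coaction) (phi : A -> B) : maxi A -> maxi B :=
  the (fun=> 0) (fun psi => equivariant psi /\
    forall a, mq (psi a) = phi (mq a)).

Record coactionFunctor := CoactionFunctor {
  cf_obj : coaction -> coaction;
  cf_map : forall A B : coaction, (A -> B) -> cf_obj A -> cf_obj B;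
  cf_equiv : forall (A B : coaction) (phi : A -> B),
    equivariant phi -> equivariant (cf_map phi);
  cf_id : forall A : coaction, cf_map (@id A) = id;
  cf_comp : forall (A B D : coaction) (psi : B -> D) (phi : A -> B),
    equivariant psi -> equivariant phi ->
    cf_map (psi \o phi) = cf_map psi \o cf_map phi;
  cf_q : forall A : coaction, maxi A -> cf_obj A;
  cf_q_equiv : forall A : coaction, equivariant (@cf_q A);
  cf_q_surj : forall (A : coaction) b, exists a, @cf_q A a = b;
  cf_q_nat : forall (A B : coaction) (phi : A -> B), equivariant phi ->
    forall a, cf_q (mx_map phi a) = cf_map phi (cf_q a) }.

Definition ker (A B : cstar) (f : A -> B) : set A := [set a | f a = 0].

(* The function s |-> f(s) on G attached to f in B(G) = C^*(G)^*. *)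
Definition fs_fun (f : CG -> C^o) (s : G) : C :=
  the 0 (fun z => forall g c, bdual g -> (forall b, f b = g (b *c c)) ->
    z = g (ml (u s) c)).

Definition large_ideal (E : set (CG -> C^o)) : Prop :=
  [/\ (forall f, E f -> bdual f) /\ (exists2 f, E f & exists x, f x <> 0),
      forall (k : C) f g, E f -> E g -> E (fun x => k * f x + g x),
      forall f g h, E f -> bdual g -> bdual h ->
        (forall s, fs_fun h s = fs_fun f s * fs_fun g s) -> E h,
      forall f s, E f -> E (fun x => f (ml (u s) x)) /\ E (fun x => f (mr (u s) x))
    & forall f, bdual f -> closure (E : set {ptws CG -> C^o}) f -> E f].

Definition dual_act (A : coaction) (f : CG -> C^o) (a : A) : A :=
  slice_tilde f (co_map a).

Definition sub_E (E : set (CG -> C^o)) (A : coaction) : set A :=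
  [set a | forall f, E f -> dual_act f a = 0].

(* tau is E-ization: q^tau_A is, up to isomorphism, the quotient map of A^m by
   (A^m)_E; its equivariance forces the coaction on the quotient to be
   (delta^m)^E, and its naturality forces the action of tau on morphisms. *)
Definition is_Eization (E : set (CG -> C^o)) (tau : coactionFunctor) : Prop :=
  forall A : coaction, ker (@cf_q tau A) = sub_E (A := maxi A) E.

End Coactions.

Section Bimodules.
Variable R : realType.
Local Notation C := R[i].
Local Notation cstar := (cstarAlgebra R).
Local Notation M := multiplier.

Record imprimitivityBimodule (A B : cstar) := ImprimitivityBimodule {
  ib_sort :> completeNormedModType C;
  lact : A -> ib_sort -> ib_sort;
  ract : ib_sort -> B -> ib_sort;
  lip : ib_sort -> ib_sort -> A;
  rip : ib_sort -> ib_sort -> B;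
  lactDl : forall k a a' x, lact (k *: a + a') x = k *: lact a x + lact a' x;
  lactDr : forall k a x x', lact a (k *: x + x') = k *: lact a x + lact a x';
  ractDl : forall k x x' b, ract (k *: x + x') b = k *: ract x b + ract x' b;
  ractDr : forall k x b b', ract x (k *: b + b') = k *: ract x b + ract x b';
  lactM : forall a a' x, lact (a *c a') x = lact a (lact a' x);
  ractM : forall x b b', ract x (b *c b') = ract (ract x b) b';
  lractA : forall a x b, ract (lact a x) b = lact a (ract x b);
  lipDl : forall k x x' y, lip (k *: x + x') y = k *: lip x y + lip x' y;
  ripDr : forall k x y y', rip x (k *: y + y') = k *: rip x y + rip x y';
  lip_act : forall a x y, lip (lact a x) y = a *c lip x y;
  rip_act : forall x y b, rip x (ract y b) = rip x y *c b;
  lipC : forall x y, lip y x = cadj (lip x y);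
  ripC : forall x y, rip y x = cadj (rip x y);
  lip_ge0 : forall x, exists a, lip x x = cadj a *c a;
  rip_ge0 : forall x, exists b, rip x x = cadj b *c b;
  lip_norm : forall x, `|lip x x| = `|x| ^+ 2;
  rip_norm : forall x, `|rip x x| = `|x| ^+ 2;
  rip_lact : forall a x y, rip (lact a x) y = rip x (lact (cadj a) y);
  lip_ract : forall x b y, lip (ract x b) y = lip x (ract y (cadj b));
  lip_rip : forall x y z, lact (lip x y) z = ract x (rip y z);
  lip_full : closed_span [set a | exists x y, a = lip x y] = setT;
  rip_full : closed_span [set b | exists x y, b = rip x y] = setT }.

Definition rieffel_Ind (A B : cstar) (X : imprimitivityBimodule A B)
    (I : set B) : set A :=
  closed_span [set a | exists (x y : X) b, I b /\ a = lip (ract x b) y].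

(* The linking algebra L(X) of matrices with rows (a, x) and (y~, b); the norm
   is the unique C^*-norm. *)
Record linkingAlgebra (A B : cstar) (X : imprimitivityBimodule A B) :=
  LinkingAlgebra {
  lk :> cstar;
  lkA : A -> lk;
  lkB : B -> lk;
  lkX : X -> lk;
  lkA_hom : starhom lkA;
  lkB_hom : starhom lkB;
  lkX_lin : linear lkX;
  lkAX : forall a x, lkA a *c lkX x = lkX (lact a x);
  lkXB : forall x b, lkX x *c lkB b = lkX (ract x b);
  lkXXadj : forall x y, lkX x *c cadj (lkX y) = lkA (lip x y);
  lkXadjX : forall x y, cadj (lkX x) *c lkX y = lkB (rip x y);
  lkAB : forall a b, lkA a *c lkB b = 0;
  lkXA : forall x a, lkX x *c lkA a = 0;
  lkBX : forall b x, lkB b *c lkX x = 0;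
  lkXX : forall x y, lkX x *c lkX y = 0;
  lk_bij : bijective (fun z : (A * B) * (X * X) =>
    lkA z.1.1 + lkX z.2.1 + cadj (lkX z.2.2) + lkB z.1.2) }.

(* The projection p in M(L(X)) onto the upper row. *)
Definition lk_proj (A B : cstar) (X : imprimitivityBimodule A B)
    (L : linkingAlgebra X) : M L :=
  the mzero (fun p => forall a x y b,
    ml p (lkA L a + lkX L x + cadj (lkX L y) + lkB L b) = lkA L a + lkX L x).

(* Multipliers of an imprimitivity bimodule (Echterhoff--Raeburn): [bA m a] is
   a m and [bB m b] is m b. *)
Record bmultiplier (A B : cstar) (Y : imprimitivityBimodule A B) := BMultiplier {
  bA : A -> Y;
  bB : B -> Y;
  bA_bB : forall a b, ract (bA a) b = lact a (bB b) }.

Section BMultiplierOperations.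
Variables (A B : cstar) (Y : imprimitivityBimodule A B).

Definition bemb (y : Y) : bmultiplier Y :=
  @BMultiplier A B Y (fun a => lact a y) (fun b => ract y b)
    (fun a b => lractA a y b).

(* n m and m n for m in M(Y) and n in M(A), resp. n in M(B). *)
Definition blact (n : M A) (m : bmultiplier Y) : bmultiplier Y :=
  the m (fun m' => forall a, bA m' a = bA m (mr n a)).
Definition bract (m : bmultiplier Y) (n : M B) : bmultiplier Y :=
  the m (fun m' => forall b, bB m' b = bB m (ml n b)).

End BMultiplierOperations.
End Bimodules.

Section MoritaCompatibility.
Variables (R : realType) (G : TopologicalGroup.type) (T : tensorModel R).
Variables (S : groupModel R G) (X : crossedModel T S).
Variable maxi : forall A : coaction T S, maximalization X A.
Local Notation "A ⊗ B" := (tensor T A B).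
Local Notation "m ⊗M n" := (melt T m n).
Local Notation K := (KL2 S).
Local Notation coaction := (coaction T S).
Local Notation dcr := (double_crossed X).

(* An (A,delta)-(B,epsilon) imprimitivity bimodule (X,zeta), where zeta is given
   by the coaction on the linking algebra that delta, zeta, epsilon combine to. *)
Record coactionBimodule (A B : coaction) := CoactionBimodule {
  cb_mod :> imprimitivityBimodule A B;
  cb_lk : linkingAlgebra cb_mod;
  cb_map : cb_lk -> multiplier (cb_lk ⊗ CG S);
  cb_P : is_coaction cb_map;
  cb_A : equivariant (B := Coaction cb_P) (lkA cb_lk);
  cb_B : equivariant (B := Coaction cb_P) (lkB cb_lk) }.

Definition cb_co (A B : coaction) (Z : coactionBimodule A B) : coaction :=
  Coaction (cb_P Z).

(* A^m (x) K -> A x G x G -> L(Z) x G x G, the first map being the composite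
   isomorphism, the second the inclusion of the upper left corner; similarly
   for the lower right corner. *)
Definition corner_A (A B : coaction) (Z : coactionBimodule A B)
    (t : maxi A ⊗ K) : dcr (cb_co Z) :=
  dcr_map (B := cb_co Z) (lkA (cb_lk Z)) (dcr_map (mq (m := maxi A)) (Phi_inv X t)).
Definition corner_B (A B : coaction) (Z : coactionBimodule A B)
    (t : maxi B ⊗ K) : dcr (cb_co Z) :=
  dcr_map (B := cb_co Z) (lkB (cb_lk Z)) (dcr_map (mq (m := maxi B)) (Phi_inv X t)).

Definition corner_proj (A B : coaction) (Z : coactionBimodule A B) :
    multiplier (dcr (cb_co Z)) :=
  mext (iP (dcr (cb_co Z))) (mext (jA (crossed X (cb_co Z))) (lk_proj (cb_lk Z))).

(* The upper right corner Y of L(Z) x G x G, as an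
   (A^m (x) K)-(B^m (x) K) imprimitivity bimodule. *)
Record cornerBimodule (A B : coaction) (Z : coactionBimodule A B) :=
  CornerBimodule {
  cY :> imprimitivityBimodule (maxi A ⊗ K) (maxi B ⊗ K);
  kY : cY -> dcr (cb_co Z);
  kY_lin : linear kY;
  kY_inj : injective kY;
  kY_range : forall z, (exists y, kY y = z) <->
    (ml (corner_proj Z) z = z /\ mr (corner_proj Z) z = 0);
  kY_lact : forall t y, kY (lact t y) = corner_A Z t *c kY y;
  kY_ract : forall y t, kY (ract y t) = kY y *c corner_B Z t;
  kY_lip : forall y z, corner_A Z (lip y z) = kY y *c cadj (kY z);
  kY_rip : forall y z, corner_B Z (rip y z) = cadj (kY y) *c kY z }.

Definition Xm_set (A B : coaction) (Z : coactionBimodule A B)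
    (Y : cornerBimodule Z) : set (bmultiplier Y) :=
  [set m | forall k : K, exists y : Y,
     blact (mone ⊗M memb k) m = bemb y /\ bract m (mone ⊗M memb k) = bemb y].

(* X^m as an A^m - B^m imprimitivity bimodule, with the operations of M(Y)
   under A^m = A^m (x) 1 and B^m = B^m (x) 1. The inner products are those of
   M(Y): t <m,n> t'^* = <t m, t' n> on the left, and on the right
   t^* <m,n> t' = <m t, n t'>. *)
Record XmBimodule (A B : coaction) (Z : coactionBimodule A B)
    (Y : cornerBimodule Z) := XmBimod {
  cXm :> imprimitivityBimodule (maxi A) (maxi B);
  kX : cXm -> bmultiplier Y;
  kX_inj : injective kX;
  kX_range : range kX = Xm_set (Y := Y);
  kX_lin : forall k x y t, bB (kX (k *: x + y)) t = k *: bB (kX x) t + bB (kX y) t;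
  kX_lact : forall a x, kX (lact a x) = blact (memb a ⊗M mone) (kX x);
  kX_ract : forall x b, kX (ract x b) = bract (kX x) (memb b ⊗M mone);
  kX_lip : forall x y t t',
    lip (bA (kX x) t) (bA (kX y) t') =
    t *c ml (memb (lip x y) ⊗M mone) (cadj t');
  kX_rip : forall x y t t',
    rip (bB (kX x) t) (bB (kX y) t') =
    cadj t *c ml (memb (rip x y) ⊗M mone) t' }.

Definition Morita_compatible (tau : coactionFunctor maxi) : Prop :=
  forall (A B : coaction) (Z : coactionBimodule A B) (Y : cornerBimodule Z)
         (Xm : XmBimodule Y),
    rieffel_Ind Xm (ker (@cf_q _ _ _ _ _ _ tau B)) =
    ker (@cf_q _ _ _ _ _ _ tau A).

End MoritaCompatibility.

(* Main.v *)
(** Let L be the linking coaction, Q its double crossed product and W in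
    M(Q (x) C^*(G)) the image of w_G. The coaction of G on Q that is trivial on
    L x G and sends iG s to iG s (x) s, followed by Ad W, is a homomorphism
    T : Q -> M(Q (x) C^*(G)) which extends the coaction of L, while
    T(x) = x (x) 1 for x in C_0(G) and in G. Hence, on the corner A^m (x) K of
    Q, slicing T by f is the action of f on A^m tensored with the identity of K;
    this uses that f . (g . a) = g . (f . a), as the comultiplication of C^*(G)
    is symmetric. So J = {z | (id (x) f)(T(z) w) = 0 for all f in E and all w}
    meets the corners A^m (x) K and B^m (x) K in A^m_E (x) K and B^m_E (x) K, and
    the off-diagonal corner Y carries J from one corner to the other.

    J is a two-sided ideal because E is stable under f |-> f(c . ) and
    f |-> f( . c) for c in C^*(G). Being weak* closed, E is the annihilator of
    N = {y | f y = 0 for all f in E}, and N is stable under G. The multipliers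
    n of C^*(G) such that n and n^* preserve N and have norm continuous
    translates form a C^*-algebra, which acts nondegenerately as it contains
    products of slices of W; the universal property of C^*(G) maps C^*(G) into
    its multipliers, and therefore C^*(G) preserves N.

    The descriptions ([the]) in the statement could a priori be junk, but then
    the corner maps A^m (x) K -> Q would be constant, whereas they are injective
    because A^m (x) K acts faithfully on Y. *)

From HB Require Import structures.
From mathcomp Require Import all_boot all_order all_algebra.
From mathcomp Require Import complex.
From mathcomp Require Import all_classical all_reals all_analysis.
From mathcomp Require Import ring lra.
Require Import Defs.
Set Implicit Arguments.
Unset Strict Implicit.
Unset Printing Implicit Defensive.
Import Order.TTheory GRing.Theory Num.Theory numFieldNormedType.Exports.
Local Open Scope ring_scope.
Local Open Scope classical_set_scope.
Local Open Scope complex_scope.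

(** * Real-valued norms, formal linear combinations and extension by density *)

Section RealNorm.
Variable R : realType.
Local Notation C := R[i].

(** Phi sends the copy of a to (id ⊗ lambda)(delta(a)), not to a ⊗ 1, so it is not evident that
    slicing T touches only the first leg of A^m ⊗ K. Slicing the K leg by a functional om gives the
    action on a of c |-> om(lambda(c) k); commutation of the two actions is therefore exactly what
    lets the slice of T pass the K leg.

    The group algebra is known by its universal property alone, so there is no dense algebra of
    functions along which invariance of E under G could be integrated. This forces the auxiliary
    algebra of multipliers: norm continuity of translates makes left translation strictly continuous
    on it, and slices of W^* have this continuity because covariance moves the translation to the
    other leg, where it acts on vectors.

    The C^*-theory in use flows from one source, an iteration producing q with (1 - q)^2 = 1 - y for
    |y| <= 1, with q commuting with everything that commutes with y. It yields contractivity of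
    homomorphisms, approximate units, isometry of faithful representations and the bounds for slices
    and amplifications. Faithful representations themselves are supplied by the tensor product
    model. *)

Definition nm (V : normedZmodType C) (v : V) : R := complex.Re `|v|.

Lemma nmE (V : normedZmodType C) (v : V) : `|v| = (nm v)%:C.
Proof.
have := normr_ge0 v; rewrite /nm; case: `|v| => a b.
by rewrite lecE /= => /andP[/eqP -> _].
Qed.

Lemma lec_nm (a b : R) : (a%:C <= b%:C :> C) = (a <= b).
Proof. by rewrite lecR. Qed.

Section Zmod.
Variable V : normedZmodType C.
Implicit Types (v w : V) (k : C).

Lemma nm_ge0 v : 0 <= nm v.
Proof. by rewrite -lec_nm -nmE normr_ge0. Qed.
Lemma nm0 : nm (0 : V) = 0.
Proof. by rewrite /nm normr0. Qed.
Lemma nm_eq0 v : nm v = 0 -> v = 0.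
Proof. by move=> h; apply/eqP; rewrite -normr_eq0 nmE h. Qed.
Lemma nmD v w : nm (v + w) <= nm v + nm w.
Proof. by rewrite -lec_nm rmorphD /= -!nmE ler_normD. Qed.
Lemma nmN v : nm (- v) = nm v.
Proof. by rewrite /nm normrN. Qed.
Lemma nmB v w : nm (v - w) <= nm v + nm w.
Proof. by rewrite -(nmN w) nmD. Qed.
Lemma nm_sym v w : nm (v - w) = nm (w - v).
Proof. by rewrite -opprB nmN. Qed.
Lemma nm_trans u v w : nm (v - w) <= nm (v - u) + nm (u - w).
Proof. by rewrite -[v - w](subrKA u) nmD. Qed.
Lemma nm_le0 v : nm v <= 0 -> v = 0.
Proof. by move=> h; apply: nm_eq0; apply/le_anti; rewrite h nm_ge0. Qed.

Lemma nm_small v : (forall e : R, 0 < e -> nm v <= e) -> v = 0.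
Proof.
move=> h; apply: nm_le0; apply/ler_addgt0Pr => e e0.
by rewrite add0r h.
Qed.

End Zmod.

Lemma nmZ (V : normedModType C) (k : C) (v : V) : nm (k *: v) = nm k * nm v.
Proof.
have /eqP := normrZ k v; rewrite !nmE -rmorphM /=.
by move=> /eqP /(congr1 (@complex.Re R)).
Qed.

End RealNorm.

Lemma the_spec (T : Type) (x0 : T) (P : T -> Prop) : (exists x, P x) -> P (the x0 P).
Proof. by rewrite /the; case: pselect => // h _; exact: projT2 (cid h). Qed.

Lemma the_uniq (T : Type) (x0 x : T) (P : T -> Prop) :
  P x -> (forall y, P y -> y = x) -> the x0 P = x.
Proof. by move=> Px; apply; apply: the_spec; exists x. Qed.

(** How a failed description is exploited: the described object becomes a constant, and either this
    contradicts a nonzero object at hand or the case at issue is trivial. *)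
Lemma the_junk (T : Type) (x0 : T) (P : T -> Prop) : ~ (exists x, P x) -> the x0 P = x0.
Proof. by rewrite /the; case: pselect. Qed.

Section Scalars.
Variable R : realType.
Local Notation C := R[i].
Lemma nmM (k l : C) : nm (k * l) = nm k * nm l.
Proof. have := nmZ k (l : C^o). by []. Qed.
Lemma nm1 : nm (1 : C) = 1.
Proof. by rewrite /nm normr1. Qed.
Lemma nm_real (r : R) : 0 <= r -> nm (r%:C) = r.
Proof. by move=> r0; rewrite /nm ger0_norm // lecR. Qed.
Lemma nm_conj (k : C) : nm (Num.conj k) = nm k.
Proof. by rewrite /nm norm_conjC. Qed.
Lemma nm_imag : nm ('i : C) = 1.
Proof. by rewrite /nm normCi. Qed.
Lemma nm_sum (V : normedModType C) (I : Type) (l : seq I) (F : I -> V) :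
  nm (\sum_(i <- l) F i) <= \sum_(i <- l) nm (F i).
Proof.
elim: l => [|i l IH]; first by rewrite !big_nil nm0.
by rewrite !big_cons (le_trans (nmD _ _)) // lerD2l.
Qed.
End Scalars.

Section Topo.
Variable R : realType.
Local Notation C := R[i].
Variable V : normedModType C.

Lemma closureP_nm (S : set V) x :
  closure S x <-> forall e : R, 0 < e -> exists2 y, S y & nm (x - y) < e.
Proof.
split=> [cl e e0|h].
  have /cl[y []] : nbhs x (ball x e%:C) by apply: nbhsx_ballx; rewrite ltcR.
  move=> Sy; rewrite -ball_normE /= nmE ltcR => ?; by exists y.
move=> B /nbhs_ballP[/= e e0 Be].
have [e' eE] : exists r : R, e = r%:C.
  by exists (complex.Re e); move: e0; case: e {Be} => a b; rewrite ltcE /= => /andP[/eqP -> _].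
subst e; have [|y Sy yx] := h e'; first by rewrite -ltcR.
exists y; split => //; apply: Be; rewrite -ball_normE /= nmE ltcR //.
Qed.

Definition tends (u : nat -> V) (l : V) :=
  forall e : R, 0 < e -> exists N, forall n, (N <= n)%N -> nm (u n - l) < e.

End Topo.

Lemma complete_nm (R : realType) (V : completeNormedModType R[i]) (u : nat -> V) :
  (forall e : R, 0 < e -> exists N, forall m n, (N <= m)%N -> (N <= n)%N ->
     nm (u m - u n) < e) -> exists l, tends u l.
Proof.
move=> cu.
have : cauchy (u @ \oo).
  apply/cauchyP => /= e e0.
  have [e' eE] : exists r : R, e = r%:C.
    by exists (complex.Re e); move: e0; case: e => a b; rewrite ltcE /= => /andP[/eqP -> _].
  subst e; have e'0 : 0 < e' by rewrite -ltcR.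
  have [N hN] := cu _ e'0; exists (u N).
  exists N => // n /= Nn.
  by rewrite -ball_normE /= nmE ltcR; apply: hN.
move/cauchy_cvgP/cvg_ex => [l cl]; exists l => e e0.
have /cl [N _ hN] : nbhs l (ball l e%:C) by apply: nbhsx_ballx; rewrite ltcR.
exists N => n Nn; have := hN n Nn.
by rewrite -ball_normE /= nmE ltcR nm_sym.
Qed.

Section LinearMaps.
Variables (R : realType) (V W : lmodType R[i]) (f : V -> W).
Hypothesis lf : linear f.
Lemma linP k u v : f (k *: u + v) = k *: f u + f v. Proof. exact: lf. Qed.
Lemma lin0 : f 0 = 0.
Proof. have := lf (-1) 0 0; rewrite !scaler0 !addr0 => /esym; rewrite scaleN1r => /eqP; rewrite addNr => /eqP <-. by []. Qed.
Lemma linZ k u : f (k *: u) = k *: f u.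
Proof. by have := lf k u 0; rewrite !addr0 lin0 addr0. Qed.
Lemma linD u v : f (u + v) = f u + f v.
Proof. by have := lf 1 u v; rewrite !scale1r. Qed.
Lemma linN u : f (- u) = - f u.
Proof. by rewrite -scaleN1r linZ scaleN1r. Qed.
Lemma linB u v : f (u - v) = f u - f v.
Proof. by rewrite linD linN. Qed.
Lemma lin_sum (I : Type) (l : seq I) (F : I -> V) :
  f (\sum_(i <- l) F i) = \sum_(i <- l) f (F i).
Proof. by elim: l => [|i l IH]; rewrite ?big_nil ?lin0 // !big_cons linD IH. Qed.
End LinearMaps.

Section LinearCombinations.
Variable R : realType.
Local Notation C := R[i].

(** A list of coefficients and indices, so that the same formal combination can be evaluated along
    two families in different spaces and the two values compared in norm. *)
Definition lc (V : lmodType C) (I : Type) (g : I -> V) (l : seq (C * I)) : V :=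
  \sum_(p <- l) p.1 *: g p.2.

Definition lscale (I : Type) (k : C) (l : seq (C * I)) := [seq (k * p.1, p.2) | p <- l].

Section Basic.
Variables (V : lmodType C) (I : Type) (g : I -> V).
Lemma lc_nil : lc g [::] = 0. Proof. exact: big_nil. Qed.
Lemma lc_cons p l : lc g (p :: l) = p.1 *: g p.2 + lc g l. Proof. exact: big_cons. Qed.
Lemma lc_cat l l' : lc g (l ++ l') = lc g l + lc g l'. Proof. exact: big_cat. Qed.
Lemma lc_scale k l : lc g (lscale k l) = k *: lc g l.
Proof. by rewrite /lc big_map scaler_sumr; apply: eq_bigr => p _; rewrite scalerA. Qed.
Lemma lc_one i : lc g [:: (1, i)] = g i.
Proof. by rewrite lc_cons lc_nil addr0 scale1r. Qed.
End Basic.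

Lemma lc_lin (V W : lmodType C) (f : V -> W) (lf : linear f) (I : Type) (g : I -> V) l :
  f (lc g l) = lc (f \o g) l.
Proof. by rewrite /lc lin_sum //; apply: eq_bigr => p _; rewrite linZ. Qed.

Lemma cspan_sub (V : lmodType C) (S : set V) v : S v -> cspan S v.
Proof.
move=> Sv; exists 1%N, (fun=> 1), (fun=> v); split => //.
by rewrite big_ord1 scale1r.
Qed.

Lemma cspan_ind (V : lmodType C) (S P : set V) :
  P 0 -> (forall k s v, S s -> P v -> P (k *: s + v)) -> forall v, cspan S v -> P v.
Proof.
move=> P0 PS v [n [k [s [Ss ->]]]].
elim/big_rec: _ => // i x _ Px; exact: PS.
Qed.

Lemma cspan_fam (V : lmodType C) (S : set V) (I : Type) (g : I -> V) :
  (forall v, S v -> exists i, v = g i) -> forall v, cspan S v -> exists l, v = lc g l.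
Proof.
move=> Sg; apply: cspan_ind; first by exists [::]; rewrite lc_nil.
by move=> k _ _ /Sg[i ->] [l ->]; exists ((k, i) :: l); rewrite lc_cons.
Qed.

Lemma cspan_lc (V : lmodType C) (S : set V) (I : Type) (g : I -> V) l :
  (forall i, S (g i)) -> cspan S (lc g l).
Proof.
move=> Sg; elim: l => [|p l [n [k [s [Ss lE]]]]].
  rewrite lc_nil; exists 0%N, (fun=> 0), (fun=> 0); split; first by case.
  by rewrite big_ord0.
rewrite lc_cons lE.
exists n.+1, (fun i => if unlift ord0 i is Some j then k j else p.1),
  (fun i => if unlift ord0 i is Some j then s j else g p.2); split.
  by move=> i; case: (unlift ord0 i).
rewrite big_ord_recl unlift_none; congr (_ + _).
by apply: eq_bigr => i _; rewrite liftK.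
Qed.

(** These closed subspaces are the motives of [total_ind]: such a property holds everywhere once it
    holds on a total set. *)
Definition is_linclosed (V : normedModType C) (P : set V) :=
  [/\ P 0, forall k u v, P u -> P v -> P (k *: u + v)
    & forall v, (forall e : R, 0 < e -> exists2 u, P u & nm (v - u) < e) -> P v].

Lemma closed_span_ind (V : completeNormedModType C) (S P : set V) :
  is_linclosed P -> (forall s, S s -> P s) -> forall v, closed_span S v -> P v.
Proof.
move=> [P0 PD Pc] SP v /closureP_nm cv; apply: Pc => e /cv[y Sy vy].
exists y => //; move: Sy; apply: cspan_ind => // k s u Ss Pu; apply: PD => //; exact: SP.
Qed.

Lemma total_ind (V : completeNormedModType C) (S P : set V) :
  closed_span S = setT -> is_linclosed P -> (forall s, S s -> P s) -> forall v, P v.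
Proof.
move=> ST cP SP v; apply: (@closed_span_ind _ S) => //; by rewrite ST.
Qed.

Lemma closed_span_linclosed (V : completeNormedModType C) (S : set V) :
  is_linclosed (closed_span S).
Proof.
have app I (g : I -> V) l : (forall i, S (g i)) -> closed_span S (lc g l).
  by move=> Sg; apply: subset_closure; exact: cspan_lc.
have fam v : cspan S v -> exists l : seq (C * {s | S s}), v = lc sval l.
  by apply: cspan_fam => s Ss; exists (exist _ s Ss).
have sv (i : {s | S s}) : S (sval i) by case: i.
split.
- rewrite -(lc_nil (@sval V S)); exact: app.
- move=> k u v /closureP_nm cu /closureP_nm cv; apply/closureP_nm => e e0.
  have k0 : 0 < nm k + 1 by have := nm_ge0 (k : C^o); rewrite /nm; lra.
  have [y /fam[l ->] uy] := cu (e / 2 / (nm k + 1)) ltac:(by rewrite !divr_gt0).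
  have [z /fam[l' ->] vz] := cv (e / 2) ltac:(by rewrite !divr_gt0).
  exists (lc sval (lscale k l ++ l')); first exact: cspan_lc.
  rewrite lc_cat lc_scale opprD addrACA -scalerBr.
  rewrite (le_lt_trans (nmD _ _)) // nmZ [ltRHS](splitr e) ltr_leD // 1?ltW //.
  move: uy; rewrite ltr_pdivlMr // mulrC => /(le_lt_trans _); apply.
  by rewrite ler_wpM2r ?nm_ge0 //; lra.
- move=> v h; apply/closureP_nm => e e0.
  have [u /closureP_nm cu vu] := h (e / 2) ltac:(by rewrite divr_gt0).
  have [y Sy uy] := cu (e / 2) ltac:(by rewrite divr_gt0).
  exists y => //; rewrite (le_lt_trans (nm_trans u _ _)) // (splitr e) ltrD //.
Qed.

Lemma closed_span_sub (V : completeNormedModType C) (S : set V) s : S s -> closed_span S s.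
Proof. by move=> Ss; apply: subset_closure; exact: cspan_sub. Qed.

Lemma total_approx (V : completeNormedModType C) (S : set V) (I : Type) (g : I -> V) :
  closed_span S = setT -> (forall v, S v -> exists i, v = g i) ->
  forall v (e : R), 0 < e -> exists l, nm (v - lc g l) < e.
Proof.
move=> ST Sg v e e0; have : closed_span S v by rewrite ST.
move/closureP_nm => /(_ _ e0)[y /(cspan_fam Sg)[l ->] h]; by exists l.
Qed.

Lemma total_sub (V : completeNormedModType C) (S S' : set V) :
  closed_span S = setT -> (forall s, S s -> closed_span S' s) -> closed_span S' = setT.
Proof.
move=> ST SS; apply/seteqP; split => // v _.
apply: (total_ind ST) => //; exact: closed_span_linclosed.
Qed.

Lemma inv_lt_exists (e : R) : 0 < e -> exists N : nat, forall n, (N <= n)%N -> n.+1%:R^-1 < e.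
Proof.
move=> e0; exists (Num.trunc e^-1) => n Nn.
rewrite -[e]invrK ltf_pV2 ?posrE ?invr_gt0 ?ltr0Sn //.
by rewrite (lt_le_trans (truncnS_gt _)) // ler_nat.
Qed.

(** The bound alone makes the prescription consistent: two lists with the same value under [g] have
    the same value under [g']. Independence of the generators is never at issue. *)
Lemma extend (V : normedModType C) (W : completeNormedModType C) (I : Type) (g : I -> V) (g' : I -> W)
    (c : R) : 0 <= c ->
  (forall v (e : R), 0 < e -> exists l, nm (v - lc g l) < e) ->
  (forall l, nm (lc g' l) <= c * nm (lc g l)) ->
  exists h : V -> W, [/\ linear h, forall v, nm (h v) <= c * nm v & forall i, h (g i) = g' i].
Proof.
move=> c0 dg bd.
have bd2 l l' : nm (lc g' l - lc g' l') <= c * nm (lc g l - lc g l').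
  have := bd (l ++ lscale (-1) l').
  by rewrite !lc_cat !lc_scale !scaleN1r.
(* The image of v is characterised against all lists at once rather than along one sequence, so that
   linearity, the bound and the values on generators follow by choosing convenient lists. *)
have ex v : exists w, forall l, nm (w - lc g' l) <= c * nm (v - lc g l).
  have [ls hls] := choice (fun n : nat => dg v n.+1%:R^-1 ltac:(by rewrite invr_gt0 ltr0Sn)).
  have [|w tw] := @complete_nm R W (fun n => lc g' (ls n)).
    move=> e e0; have [N hN] := inv_lt_exists (e := e / 2 / (c + 1)) ltac:(by rewrite !divr_gt0 //; lra).
    exists N => m n Nm Nn; apply: (le_lt_trans (bd2 _ _)).
    have h : nm (lc g (ls m) - lc g (ls n)) <= e / (c + 1).
      rewrite (le_trans (nm_trans v _ _)) // nm_sym.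
      have -> : e / (c + 1) = e / 2 / (c + 1) + e / 2 / (c + 1) by field; lra.
      by rewrite lerD // ltW // (lt_trans (hls _)) // hN.
    have : c * nm (lc g (ls m) - lc g (ls n)) <= c * (e / (c + 1)) by rewrite ler_wpM2l.
    move/le_lt_trans; apply; rewrite mulrA ltr_pdivrMr; [nra|lra].
  exists w => l; apply/ler_addgt0Pr => e e0.
  have [N hN] := tw (e / 2) ltac:(by rewrite divr_gt0).
  have [N' hN'] := inv_lt_exists (e := e / 2 / (c + 1)) ltac:(by rewrite !divr_gt0 //; lra).
  pose n := maxn N N'.
  have h1 := hN n (leq_maxl _ _); have h2 := hN' n (leq_maxr _ _).
  rewrite (le_trans (nm_trans (lc g' (ls n)) _ _)) //.
  have h3 : nm (lc g' (ls n) - lc g' l) <= c * (nm (v - lc g l) + n.+1%:R^-1).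
    rewrite (le_trans (bd2 _ _)) // ler_wpM2l // (le_trans (nm_trans v _ _)) //.
    by rewrite addrC lerD2l nm_sym ltW // hls.
  have h4 : c * n.+1%:R^-1 <= e / 2.
    rewrite ltr_pdivlMr in h2; last lra.
    have i0 : 0 <= n.+1%:R^-1 :> R by rewrite invr_ge0.
    move: h2 i0; set i := (n.+1%:R)^-1; nra.
  move: h1 h3 h4; rewrite [nm (w - _)]nm_sym mulrDr; set i := c / _; lra.
have [h hh] := choice ex.
have h0 v : (forall e : R, 0 < e -> nm v <= e * (c + 1)) -> v = 0 :> W.
  move=> hv; apply: nm_small => e e0.
  have := hv (e / (c + 1)) ltac:(by rewrite divr_gt0 //; lra).
  by rewrite divfK // gt_eqF //; lra.
exists h; split.
- move=> k u v; apply/eqP; rewrite -subr_eq0; apply/eqP; apply: nm_small => e e0.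
  have k0 := nm_ge0 (k : C^o).
  (* The two error terms are each at most c (|k| + 1) d; the final + 1 keeps the denominator
     positive when c = 0. *)
  pose d := e / (2 * (c * (nm k + 1)) + 1).
  have D0 : 0 < 2 * (c * (nm k + 1)) + 1 by rewrite ltr_wpDl // !mulr_ge0 // addr_ge0.
  have d0 : 0 < d by rewrite divr_gt0.
  have [l hl] := dg u _ d0; have [l' hl'] := dg v _ d0.
  have A1 := hh (k *: u + v) (lscale k l ++ l').
  have A2 := hh u l; have A3 := hh v l'.
  rewrite !lc_cat !lc_scale in A1.
  set X := lc g' l in A1 A2; set Y := lc g' l' in A1 A3.
  have B1 : nm ((k *: u + v) - (k *: lc g l + lc g l')) <= nm k * d + d.
    rewrite opprD addrACA -scalerBr (le_trans (nmD _ _)) // nmZ.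
    by apply: lerD; [rewrite ler_wpM2l // ltW|exact: ltW].
  have -> : h (k *: u + v) - (k *: h u + h v) =
     (h (k *: u + v) - (k *: X + Y)) - (k *: (h u - X) + (h v - Y)).
    by rewrite scalerBr [X in _ = _ - X]addrACA -opprD opprB subrKA.
  rewrite (le_trans (nmB _ _)) //.
  have : nm (k *: (h u - X) + (h v - Y)) <= nm k * (c * d) + c * d.
    rewrite (le_trans (nmD _ _)) // nmZ lerD //.
      by rewrite ler_wpM2l // (le_trans A2) // ler_wpM2l // ltW.
    by rewrite (le_trans A3) // ler_wpM2l // ltW.
  have : c * nm (k *: u + v - (k *: lc g l + lc g l')) <= c * (nm k * d + d) by rewrite ler_wpM2l.
  have : d * (2 * (c * (nm k + 1)) + 1) = e by rewrite /d divfK // gt_eqF.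
  move: A1; nra.
- move=> v; have := hh v [::]; by rewrite !lc_nil !subr0.
- move=> i; apply/eqP; rewrite -subr_eq0; apply/eqP; apply: nm_le0.
  by have := hh (g i) [:: (1, i)]; rewrite !lc_one subrr nm0 mulr0.
Qed.

End LinearCombinations.

Section BoundedFunctionals.
Variable R : realType.
Local Notation C := R[i].
Variables (V W : normedModType C).

Definition bounded (f : V -> W) := exists2 c : R, 0 <= c & forall v, nm (f v) <= c * nm v.

Lemma bounded_continuous (f : V -> W) : linear f -> bounded f -> continuous f.
Proof.
move=> lf [c c0 hc] x; apply/cvgrPdist_lt => e e0.
have [e' eE] : exists r : R, e = r%:C.
  by exists (complex.Re e); move: e0; case: e => a b; rewrite ltcE /= => /andP[/eqP -> _].
subst e; rewrite ltcR in e0.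
apply/nbhs_ballP; exists (e' / (c + 1))%:C => /=; first by rewrite ltcR divr_gt0 //; lra.
move=> y; rewrite -ball_normE /= nmE ltcR => xy.
rewrite nmE ltcR -linB // (le_lt_trans (hc _)) //.
move: xy; rewrite ltr_pdivlMr; last lra.
have := nm_ge0 (x - y); nra.
Qed.

Lemma continuous_bounded (f : V -> W) : linear f -> continuous f -> bounded f.
Proof.
move=> lf cf.
have /cvgrPdist_lt /(_ 1 ltr01) := cf 0.
rewrite lin0 // => /nbhs_ballP[/= e e0 h].
have [e' eE] : exists r : R, e = r%:C.
  by exists (complex.Re e); move: e0; case: e {h} => a b; rewrite ltcE /= => /andP[/eqP -> _].
subst e; rewrite ltcR in e0.
exists (2 / e'); first by rewrite divr_ge0 // ltW.
move=> v; have [->|v0] := eqVneq v 0; first by rewrite lin0 // !nm0 mulr0.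
have nv : 0 < nm v by rewrite lt_neqAle nm_ge0 andbT eq_sym; apply/eqP => /nm_eq0/eqP; apply/negP.
pose k : R := e' / 2 / nm v.
have k0 : 0 < k by rewrite !divr_gt0.
have /h : ball 0 e'%:C (k%:C *: v).
  rewrite -ball_normE /= sub0r normrN nmE ltcR nmZ nm_real ?(ltW k0) //.
  by rewrite /k divfK ?gt_eqF // ltr_pdivrMr // ltr_pMr // ltr1n.
rewrite /= sub0r normrN nmE (_ : 1 = 1%:C) // ltcR linZ // nmZ nm_real ?(ltW k0) //.
rewrite -ltr_pdivlMl // => /ltW /le_trans; apply.
by rewrite mulr1 /k !invf_div mulrC.
Qed.

End BoundedFunctionals.

Lemma bdualP (R : realType) (C := R[i]) (A : cstarAlgebra R) (f : A -> C^o) :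
  bdual f <-> linear f /\ exists2 c : R, 0 <= c & forall v, nm (f v) <= c * nm v.
Proof.
split=> [[lf cf]|[lf bf]]; split => //.
  exact: (@continuous_bounded R A (C^o : normedModType C)).
exact: (@bounded_continuous R A (C^o : normedModType C)).
Qed.

(** * C*-algebras and multipliers *)

Section CStarBasics.
Variable R : realType.
Local Notation C := R[i].
Variable A : cstarAlgebra R.
Implicit Types (a b c : A).

Lemma cmul_linr a : linear (cmul a).
Proof. by move=> k b c; rewrite cmulDr cmulZr. Qed.
Lemma cmul_linl b : linear (fun a : A => a *c b).
Proof. by move=> k a c; rewrite cmulDl cmulZl. Qed.
Lemma cmul0r a : a *c 0 = 0. Proof. exact: (lin0 (cmul_linr a)). Qed.
Lemma cmul0l a : 0 *c a = 0. Proof. exact: (lin0 (cmul_linl a)). Qed.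
Lemma cmulNr a b : a *c (- b) = - (a *c b). Proof. exact: (linN (cmul_linr a)). Qed.
Lemma cmulNl a b : (- a) *c b = - (a *c b). Proof. exact: (linN (cmul_linl b)). Qed.
Lemma cmulBr a b c : a *c (b - c) = a *c b - a *c c. Proof. by rewrite cmulDr cmulNr. Qed.
Lemma cmulBl a b c : (a - b) *c c = a *c c - b *c c. Proof. by rewrite cmulDl cmulNl. Qed.
Lemma cadjP (k : C) a b : cadj (k *: a + b) = Num.conj k *: cadj a + cadj b.
Proof. by rewrite cadjD cadjZ. Qed.
Lemma cadj0 : cadj (0 : A) = 0.
Proof. by rewrite -[X in cadj X](scale0r (0 : A)) cadjZ conjC0 scale0r. Qed.
Lemma cadjN a : cadj (- a) = - cadj a.
Proof. by rewrite -scaleN1r cadjZ rmorphN rmorph1 scaleN1r. Qed.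
Lemma cadjB a b : cadj (a - b) = cadj a - cadj b.
Proof. by rewrite cadjD cadjN. Qed.
Lemma cmul_suml (I : Type) (l : seq I) (F : I -> A) a :
  (\sum_(i <- l) F i) *c a = \sum_(i <- l) F i *c a.
Proof. exact: (lin_sum (cmul_linl a)). Qed.
Lemma cmul_sumr (I : Type) (l : seq I) (F : I -> A) a :
  a *c (\sum_(i <- l) F i) = \sum_(i <- l) a *c F i.
Proof. exact: (lin_sum (cmul_linr a)). Qed.

Lemma nmMle a b : nm (a *c b) <= nm a * nm b.
Proof. by rewrite -lec_nm rmorphM /= -!nmE cnormM. Qed.
Lemma nm_adjM a : nm (cadj a *c a) = nm a ^+ 2.
Proof. by have := cnormE a; rewrite !nmE -rmorphXn /= => /(congr1 (@complex.Re R)). Qed.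
Lemma nm_adj a : nm (cadj a) = nm a.
Proof.
have le b : nm b <= nm (cadj b).
  have [->|b0] := eqVneq b 0; first by rewrite cadj0.
  have nb : 0 < nm b by rewrite lt_neqAle nm_ge0 andbT eq_sym; apply/eqP => /nm_eq0/eqP; apply/negP.
  by rewrite -(ler_pM2r nb) -expr2 -nm_adjM nmMle.
by apply/le_anti; rewrite (le a) -{2}(cadjK a) le.
Qed.
Lemma nm_Madj a : nm (a *c cadj a) = nm a ^+ 2.
Proof. by rewrite -{1}(cadjK a) nm_adjM nm_adj. Qed.
Lemma nm_sq a : cadj a = a -> nm (a *c a) = nm a ^+ 2.
Proof. by move=> h; rewrite -{1}h nm_adjM. Qed.
Lemma adjM_eq0 a : cadj a *c a = 0 -> a = 0.
Proof.
move=> h; apply: nm_eq0; apply/eqP; rewrite -sqrf_eq0; apply/eqP.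
by rewrite -nm_adjM h nm0.
Qed.
(** No unit is at hand, but the choice a = x^* and the C^*-identity suffice. This cancellation is
    what makes double centralizers automatically linear. *)
Lemma cancel_r (x : A) : (forall a, a *c x = 0) -> x = 0.
Proof. by move=> h; apply: adjM_eq0. Qed.
Lemma cancel_l (x : A) : (forall a, x *c a = 0) -> x = 0.
Proof.
move=> h; rewrite -(cadjK x) (cancel_r (x := cadj x)) ?cadj0 // => a.
by rewrite -(cadjK a) -cadjM h cadj0.
Qed.
Lemma cancel_rP (x y : A) : (forall a, a *c x = a *c y) -> x = y.
Proof. by move=> h; apply/eqP; rewrite -subr_eq0; apply/eqP/cancel_r => a; rewrite cmulBr h subrr. Qed.
Lemma cancel_lP (x y : A) : (forall a, x *c a = y *c a) -> x = y.
Proof. by move=> h; apply/eqP; rewrite -subr_eq0; apply/eqP/cancel_l => a; rewrite cmulBl h subrr. Qed.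

Section Mult.
Implicit Types m : multiplier A.
Lemma ml_linear m : linear (ml m).
Proof.
move=> k b c; apply: cancel_rP => a.
by rewrite ml_mr cmulDr cmulZr -!ml_mr -cmulZr -cmulDr.
Qed.
Lemma mr_linear m : linear (mr m).
Proof.
move=> k b c; apply: cancel_lP => a.
by rewrite -ml_mr cmulDl cmulZl !ml_mr -cmulZl -cmulDl.
Qed.
Lemma mlM m a b : ml m (a *c b) = ml m a *c b.
Proof. by apply: cancel_rP => c; rewrite ml_mr !cmulA ml_mr. Qed.

Lemma mult_ext m (n : multiplier A) : (forall a, ml m a = ml n a) -> m = n.
Proof.
case: m n => [l r h] [l' r' h'] /= e.
have el : l = l' by apply/funext.
have er : r = r'.
  by apply/funext => a; apply: cancel_lP => b; rewrite -h -h' el.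
by subst; congr Multiplier; exact: Prop_irrelevance.
Qed.

(* Gliding hump: otherwise some x has x (m b_n) unbounded along unit vectors b_n. *)
Lemma ml_bounded m : exists2 c : R, 0 <= c & forall b, nm (ml m b) <= c * nm b.
Proof.
have [//|h] := pselect (exists2 c : R, 0 <= c & forall b, nm (ml m b) <= c * nm b).
pose r (n : nat) : R := 3^-1 ^+ n.
have r0 n : 0 < r n by rewrite /r exprn_gt0 // invr_gt0.
have ex n : exists b, [/\ nm b <= 1, 0 < nm (ml m b) & n%:R < nm (ml m b) * r n].
  apply/not_existsP => hn; apply: h; exists (n%:R / r n).
    by rewrite divr_ge0 // ltW.
  move=> b; have [->|b0] := eqVneq b 0; first by rewrite (lin0 (ml_linear m)) !nm0 mulr0.
  have nb : 0 < nm b by rewrite lt_neqAle nm_ge0 andbT eq_sym; apply/eqP => /nm_eq0/eqP; apply/negP.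
  rewrite leNgt; apply/negP => hb.
  have nk : nm ((nm b)^-1%:C : C) = (nm b)^-1 by rewrite nm_real // invr_ge0 ltW.
  apply: (hn ((nm b)^-1%:C *: b)); rewrite (linZ (ml_linear m)) !nmZ nk; split.
  - by rewrite mulVf // gt_eqF.
  - rewrite mulr_gt0 ?invr_gt0 // (le_lt_trans _ hb) // !mulr_ge0 ?invr_ge0 ?nm_ge0 //.
    exact: ltW.
  - by rewrite -ltr_pdivrMr // [X in _ < X]mulrC ltr_pdivlMr.
have [b hb] := choice ex.
pose z n := ml m (b n).
pose y n := (r n / nm (z n))%:C *: cadj (z n).
have zgt n : 0 < nm (z n) by case: (hb n).
have ny n : nm (y n) = r n.
  rewrite /y nmZ nm_adj nm_real ?divfK ?gt_eqF // divr_ge0 // ltW //.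
have yz n : nm (y n *c z n) = r n * nm (z n).
  rewrite /y cmulZl nmZ nm_adjM nm_real ?divr_ge0 ?ltW // expr2 mulrA divfK ?gt_eqF //.
(* The two candidates differ by 2 y_k, so one of them has a product with z_k of norm at least r_k
   |z_k|. With ratio 1/3 all later corrections sum to at most r_k / 2, which leaves half of this
   gain in the limit X. *)
pose x := fix x n := if n is k.+1 then
   (if r k * nm (z k) <= nm ((x k + y k) *c z k) then x k + y k else x k - y k) else 0.
have xz n : r n * nm (z n) <= nm (x n.+1 *c z n).
  rewrite /=; case: ifPn => //; rewrite -ltNge => lt.
  have : nm (y n *c z n + y n *c z n) <= nm ((x n + y n) *c z n) + nm ((x n - y n) *c z n).
    apply: le_trans (nmB _ _).
    by rewrite cmulBl cmulDl opprB [X in _ <= nm X]addrC addrA subrK.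
  rewrite -mulr2n -scaler_nat nmZ yz (_ : nm (2 : C) = 2); last first.
    by rewrite -(nm_real (r := 2)) //; congr nm; rewrite rmorph_nat.
  lra.
have xx n : nm (x n.+1 - x n) <= r n.
  rewrite /=; case: ifP => _; first by rewrite addrAC subrr add0r ny.
  by rewrite addrAC subrr add0r nmN ny.
have rS n : r n.+1 = r n / 3 by rewrite /r exprSr.
have xtail n (j : nat) : nm (x (n + j)%N - x n) <= r n * (3 / 2) - r (n + j)%N * (3 / 2).
  elim: j => [|j IH]; first by rewrite addn0 !subrr nm0.
  rewrite (le_trans (nm_trans (x (n + j)%N) _ _)) // addnS.
  have := xx (n + j)%N; rewrite rS; lra.
have rsmall (e : R) : 0 < e -> exists N, forall n, (N <= n)%N -> r n < e.
  move=> e0; have [N hN] := inv_lt_exists e0; exists N => n Nn.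
  apply: le_lt_trans (hN n Nn).
  rewrite /r exprVn lef_pV2 ?posrE ?exprn_gt0 //.
  by rewrite -natrX ler_nat; exact: ltn_expl.
have [e e0|X hX] := @complete_nm R A x.
  have [N hN] := rsmall (e / 3) ltac:(by rewrite divr_gt0).
  have aux p q : (N <= p)%N -> (p <= q)%N -> nm (x q - x p) < e.
    move=> Np pq; have := xtail p (q - p)%N; rewrite subnKC //.
    have := hN p Np; have := r0 q; lra.
  exists N => p q Np Nq; case: (leqP p q) => [pq|/ltnW qp]; last exact: aux.
  by rewrite nm_sym aux.
have Xtail n : nm (X - x n.+1) <= r n / 2.
  apply/ler_addgt0Pr => e e0.
  have [N hN] := hX e e0.
  have := hN (n.+1 + N)%N (leq_addl _ _); have := xtail n.+1 N.
  have := nm_trans (x (n.+1 + N)%N) X (x n.+1); have := r0 (n.+1 + N)%N.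
  rewrite [nm (X - x (_ + _)%N)]nm_sym rS; set p := nm (x _ - X); set q := nm (x _ - x _); set s := r (_ + _)%N.
  lra.
have lower n : r n * nm (z n) <= 2 * nm (mr m X).
  have A1 : nm (X *c z n) <= nm (mr m X).
    rewrite /z ml_mr (le_trans (nmMle _ _)) //.
    by rewrite ler_piMr ?nm_ge0 //; case: (hb n).
  have A2 : nm ((X - x n.+1) *c z n) <= r n / 2 * nm (z n).
    by rewrite (le_trans (nmMle _ _)) // ler_wpM2r ?nm_ge0.
  have A3 : nm (x n.+1 *c z n) <= nm (X *c z n) + nm ((X - x n.+1) *c z n).
    rewrite -[X in X *c _](subKr X) cmulBl; exact: nmB.
  have := xz n; lra.
have := lower (Num.trunc (2 * nm (mr m X))).+1.
have [_ _] := hb (Num.trunc (2 * nm (mr m X))).+1.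
have := truncnS_gt (2 * nm (mr m X)).
rewrite mulrC -/(z _); lra.
Qed.

End Mult.
End CStarBasics.

(** A complete space is required to have limits of Cauchy filters, whereas the constructions produce
    limits of sequences; the filter is followed through centres of balls of radius 1/(n+1) belonging
    to it. *)
Lemma seq_complete (R : realType) (V : normedModType R[i]) :
  (forall u : nat -> V, (forall e : R, 0 < e -> exists N, forall m n, (N <= m)%N -> (N <= n)%N ->
     nm (u m - u n) < e) -> exists l, tends u l) ->
  forall F : set_system V, ProperFilter F -> cauchy F -> cvg F.
Proof.
move=> cV F FF /cauchyP cF.
have ex n : exists x, F (ball x (n.+1%:R^-1 : R)%:C).
  by apply: cF; rewrite ltcR invr_gt0 ltr0Sn.
have [x hx] := choice ex.
have [e e0|l hl] := cV x.
  have [N hN] := inv_lt_exists (e := e / 2) ltac:(by rewrite divr_gt0).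
  exists N => m n Nm Nn.
  have [y []] := filter_ex (filterI (hx m) (hx n)).
  rewrite -!ball_normE /= !nmE !ltcR => h1 h2.
  rewrite (le_lt_trans (nm_trans y _ _)) // [ltRHS](splitr e) ltrD //.
    by rewrite (lt_trans h1) // hN.
  by rewrite nm_sym (lt_trans h2) // hN.
apply/cvg_ex; exists l => B /nbhs_ballP[/= e e0 Be].
have [e' eE] : exists r : R, e = r%:C.
  by exists (complex.Re e); move: e0; case: e {Be} => a b; rewrite ltcE /= => /andP[/eqP -> _].
subst e; rewrite ltcR in e0.
have [N hN] := inv_lt_exists (e := e' / 2) ltac:(by rewrite divr_gt0).
have [N' hN'] := hl (e' / 2) ltac:(by rewrite divr_gt0).
pose n := maxn N N'.
apply: filterS (hx n) => y hy; apply: Be; move: hy; rewrite -!ball_normE /= !nmE !ltcR => hy.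
rewrite (le_lt_trans (nm_trans (x n) _ _)) // [ltRHS](splitr e') ltrD //.
  by rewrite nm_sym hN' // leq_maxr.
by rewrite (lt_trans hy) // hN // leq_maxl.
Qed.

(** * The multiplier algebra as a C^*-algebra *)

Section MultiplierAlgebra.
Variable R : realType.
Local Notation C := R[i].
Variable A : cstarAlgebra R.
Local Notation M := (multiplier A).
Implicit Types (m n p : M) (a b : A).

HB.instance Definition _ := gen_eqMixin M.
HB.instance Definition _ := gen_choiceMixin M.

Definition mopp m : M := mscale (-1) m.
Fact maddA : associative (@madd R A).
Proof. by move=> m n p; apply: mult_ext => a /=; rewrite addrA. Qed.
Fact maddC : commutative (@madd R A).
Proof. by move=> m n; apply: mult_ext => a /=; rewrite addrC. Qed.
Fact madd0 : left_id (@mzero R A) (@madd R A).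
Proof. by move=> m; apply: mult_ext => a /=; rewrite add0r. Qed.
Fact maddN : left_inverse (@mzero R A) mopp (@madd R A).
Proof. by move=> m; apply: mult_ext => a /=; rewrite scaleN1r addNr. Qed.
HB.instance Definition _ := GRing.isZmodule.Build M maddA maddC madd0 maddN.

Fact mscaleA (k l : C) m : mscale k (mscale l m) = mscale (k * l) m.
Proof. by apply: mult_ext => a /=; rewrite scalerA. Qed.
Fact mscale1 : left_id 1 (@mscale R A).
Proof. by move=> m; apply: mult_ext => a /=; rewrite scale1r. Qed.
Fact mscaleDr : right_distributive (@mscale R A) +%R.
Proof. by move=> k m n; apply: mult_ext => a /=; rewrite scalerDr. Qed.
Fact mscaleDl m : {morph (@mscale R A)^~ m : k l / k + l}.
Proof. by move=> k l; apply: mult_ext => a /=; rewrite scalerDl. Qed.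
HB.instance Definition _ :=
  GRing.Zmodule_isLmodule.Build C M mscaleA mscale1 mscaleDr mscaleDl.

Definition opn m : R := sup [set nm (ml m b) | b in [set b | nm b <= 1]].

Lemma opn_has_sup m : has_sup [set nm (ml m b) | b in [set b | nm b <= 1]].
Proof.
split; first by exists (nm (ml m 0)), 0; rewrite //= nm0 ler01.
have [c c0 hc] := ml_bounded m; exists c => _ [b /= b1 <-].
by rewrite (le_trans (hc b)) // ler_piMr.
Qed.

Lemma opn_le m b : nm (ml m b) <= opn m * nm b.
Proof.
have [->|b0] := eqVneq b 0; first by rewrite (lin0 (ml_linear m)) !nm0 mulr0.
have nb : 0 < nm b by rewrite lt_neqAle nm_ge0 andbT eq_sym; apply/eqP => /nm_eq0/eqP; apply/negP.
have nk : nm ((nm b)^-1%:C : C) = (nm b)^-1 by rewrite nm_real // invr_ge0 ltW.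
rewrite -ler_pdivrMr // mulrC -nk -nmZ -(linZ (ml_linear m)).
apply: sup_upper_bound; first exact: opn_has_sup.
by exists ((nm b)^-1%:C *: b) => //=; rewrite nmZ nk mulVf // gt_eqF.
Qed.

Lemma opn_leP m c : 0 <= c -> (forall b, nm (ml m b) <= c * nm b) -> opn m <= c.
Proof.
move=> c0 hc; apply: sup_le_ub; first by case: (opn_has_sup m).
by move=> _ [b /= b1 <-]; rewrite (le_trans (hc b)) // ler_piMr.
Qed.

Lemma opn_ge0 m : 0 <= opn m.
Proof.
apply: sup_upper_bound; first exact: opn_has_sup.
by exists 0; rewrite /= ?nm0 ?(lin0 (ml_linear m)) ?nm0 ?ler01.
Qed.

Lemma opn_eq0 m : opn m = 0 -> m = 0.
Proof.
move=> h; apply: mult_ext => a /=; apply: nm_le0.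
by rewrite (le_trans (opn_le _ _)) // h mul0r.
Qed.

Lemma opnD m n : opn (m + n) <= opn m + opn n.
Proof.
apply: opn_leP => [|b /=]; first by rewrite addr_ge0 // opn_ge0.
by rewrite (le_trans (nmD _ _)) // mulrDl lerD // opn_le.
Qed.

Lemma opnZ (k : C) m : opn (k *: m) = nm k * opn m.
Proof.
have le (l : C) p : opn (l *: p) <= nm l * opn p.
  apply: opn_leP => [|b /=]; first by rewrite mulr_ge0 ?opn_ge0 // nm_ge0.
  by rewrite nmZ -mulrA ler_wpM2l ?opn_le // nm_ge0.
apply/le_anti; rewrite le /=.
have [->|k0] := eqVneq k 0; first by rewrite nm0 mul0r opn_ge0.
have nk : 0 < nm k by rewrite lt_neqAle nm_ge0 andbT eq_sym; apply/eqP => /nm_eq0/eqP; apply/negP.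
have := le (k^-1) (k *: m); rewrite scalerA mulVf // scale1r => h.
rewrite -ler_pdivlMl // (le_trans h) // ler_wpM2r ?opn_ge0 //.
have : nm (k^-1) * nm k = 1 by rewrite -nmM mulVf // nm1.
by move/(canRL (mulfK (negbT (gt_eqF nk)))) ->; rewrite mul1r.
Qed.

Definition mnorm m : C := (opn m)%:C.
Fact mnormD m n : mnorm (m + n) <= mnorm m + mnorm n.
Proof. by rewrite /mnorm -rmorphD lec_nm opnD. Qed.
Fact mnormZ (k : C) m : mnorm (k *: m) = `|k| * mnorm m.
Proof. by rewrite /mnorm opnZ rmorphM /= -nmE. Qed.
Fact mnorm0_eq0 m : mnorm m = 0 -> m = 0.
Proof. by move=> /(congr1 (@complex.Re R)) /= /opn_eq0. Qed.
HB.instance Definition _ := @Lmodule_isNormed.Build C M mnorm mnormD mnormZ mnorm0_eq0.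

Lemma nm_opn m : nm m = opn m.
Proof. by []. Qed.

(** The norm looks at left multiplication only; with this it controls right multiplication as well.
    The reason is |n b|^2 = |(n b)^* (n b)|, where n is moved to the left factor and becomes its
    adjoint acting on n b. *)
Lemma opn_adj m : opn (madj m) = opn m.
Proof.
have le n : opn n <= opn (madj n).
  apply: opn_leP => [|b]; first exact: opn_ge0.
  have [->|b0] := eqVneq (ml n b) 0; first by rewrite nm0 mulr_ge0 ?opn_ge0 ?nm_ge0.
  have nb : 0 < nm (ml n b).
    by rewrite lt_neqAle nm_ge0 andbT eq_sym; apply/eqP => /nm_eq0/eqP; apply/negP.
  rewrite -(ler_pM2l nb) -expr2 -nm_adjM ml_mr (le_trans (nmMle _ _)) //.
  rewrite mulrA ler_wpM2r ?nm_ge0 // [X in _ <= X]mulrC -nm_adj.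
  exact: (opn_le (madj n)).
have K : madj (madj m) = m by apply: mult_ext => a /=; rewrite !cadjK.
by apply/le_anti; rewrite le -{2}K le.
Qed.

Lemma nm_mr m a : nm (mr m a) <= opn m * nm a.
Proof.
have := opn_le (madj m) (cadj a); rewrite /= !cadjK !nm_adj.
by rewrite opn_adj.
Qed.

Lemma mult_complete (u : nat -> M) : (forall e : R, 0 < e -> exists N, forall m n : nat, (N <= m)%N -> (N <= n)%N ->
     nm (u m - u n) < e) -> exists l, tends u l.
Proof.
move=> cu.
have lim (f : M -> A -> A) : (forall (m n : M) a, f (m - n) a = f m a - f n a) ->
    (forall m a, nm (f m a) <= nm m * nm a) -> forall a, exists l, tends (fun n : nat => f (u n) a) l.
  move=> fB fb a; apply: complete_nm => e e0.
  have a1 : 0 < nm a + 1 by have := nm_ge0 a; lra.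
  have [N hN] := cu (e / (nm a + 1)) ltac:(by rewrite divr_gt0).
  exists N => p q Np Nq; rewrite -fB (le_lt_trans (fb _ _)) //.
  have := hN p q Np Nq; rewrite ltr_pdivlMr //; have := nm_ge0 (u p - u q); nra.
have fl (m n : M) a : ml (m - n) a = ml m a - ml n a by rewrite /= scaleN1r.
have fr (m n : M) a : mr (m - n) a = mr m a - mr n a by rewrite /= scaleN1r.
have [l hl] := choice (lim (fun m a => ml m a) fl (fun m a => opn_le m a)).
have [r hr] := choice (lim (fun m a => mr m a) fr (fun m a => nm_mr m a)).
have lr a b : a *c l b = r a *c b.
  apply/eqP; rewrite -subr_eq0; apply/eqP; apply: nm_small => e e0.
  have c0 : 0 < nm a + nm b + 1 by have := nm_ge0 a; have := nm_ge0 b; lra.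
  have [N hN] := hl b (e / (nm a + nm b + 1)) ltac:(by rewrite divr_gt0).
  have [N' hN'] := hr a (e / (nm a + nm b + 1)) ltac:(by rewrite divr_gt0).
  pose n := maxn N N'.
  have {hN} h1 := hN n (leq_maxl _ _); have {hN'} h2 := hN' n (leq_maxr _ _).
  have -> : a *c l b - r a *c b = (mr (u n) a - r a) *c b - a *c (ml (u n) b - l b).
    by rewrite cmulBl cmulBr ml_mr opprB [X in _ = X]addrC subrKA.
  rewrite (le_trans (nmB _ _)) // (le_trans (lerD (nmMle _ _) (nmMle _ _))) //.
  move: h1 h2; rewrite !ltr_pdivlMr //.
  have := nm_ge0 a; have := nm_ge0 b; have := nm_ge0 (ml (u n) b - l b).
  have := nm_ge0 (mr (u n) a - r a).
  set x := nm (mr _ _ - _); set y := nm (ml _ _ - _); set s := nm a; set t := nm b; nra.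
exists (Multiplier lr) => e e0.
have [N hN] := cu (e / 2) ltac:(by rewrite divr_gt0).
exists N => n Nn; apply: (@le_lt_trans _ _ (e / 2)); last by lra.
apply: opn_leP => [|b]; first lra.
rewrite /= scaleN1r; apply/ler_addgt0Pr => d d0.
have [N' hN'] := hl b d d0.
have h1 := hN' (maxn N N') (leq_maxr _ _).
have h2 := hN n (maxn N N') Nn (leq_maxl _ _).
rewrite (le_trans (nm_trans (ml (u (maxn N N')) b) _ _)) // lerD ?(ltW h1) //.
by rewrite -fl (le_trans (opn_le _ _)) // ler_wpM2r ?nm_ge0 // ltW.
Qed.

HB.instance Definition _ := Uniform_isComplete.Build M (seq_complete mult_complete).

Definition Mcarrier : completeNormedModType C := M.

Fact mmulA : associative (@mmul R A).
Proof. by move=> m n p; exact: mult_ext. Qed.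
Fact mmulDl m n p : (m + n) *M p = m *M p + n *M p.
Proof. exact: mult_ext. Qed.
Fact mmulDr m n p : m *M (n + p) = m *M n + m *M p.
Proof. by apply: mult_ext => a /=; rewrite (linD (ml_linear m)). Qed.
Fact mmulZl (k : C) m n : (k *: m) *M n = k *: (m *M n).
Proof. exact: mult_ext. Qed.
Fact mmulZr (k : C) m n : m *M (k *: n) = k *: (m *M n).
Proof. by apply: mult_ext => a /=; rewrite (linZ (ml_linear m)). Qed.
Fact madjK : involutive (@madj R A).
Proof. by move=> m; apply: mult_ext => a /=; rewrite !cadjK. Qed.
Fact madjD m n : madj (m + n) = madj m + madj n.
Proof. by apply: mult_ext => a /=; rewrite cadjD. Qed.
Fact madjZ (k : C) m : madj (k *: m) = Num.conj k *: madj m.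
Proof. by apply: mult_ext => a /=; rewrite cadjZ. Qed.
Fact madjM m n : madj (m *M n) = madj n *M madj m.
Proof. by apply: mult_ext => a /=; rewrite cadjK. Qed.
Lemma opnM m n : opn (m *M n) <= opn m * opn n.
Proof.
apply: opn_leP => [|b /=]; first by rewrite mulr_ge0 ?opn_ge0.
by rewrite (le_trans (opn_le _ _)) // -mulrA ler_wpM2l ?opn_le ?opn_ge0.
Qed.
Fact mnormM m n : `|m *M n| <= `|m| * `|n|.
Proof. by rewrite !nmE !nm_opn -rmorphM lec_nm opnM. Qed.
Fact mnormE m : `|madj m *M m| = `|m| ^+ 2.
Proof.
rewrite !nmE !nm_opn -rmorphXn; congr (_%:C); apply/le_anti/andP; split.
  by rewrite (le_trans (opnM _ _)) // opn_adj expr2.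
rewrite -[leRHS]sqr_sqrtr ?opn_ge0 // ler_pXn2r ?nnegrE ?opn_ge0 ?sqrtr_ge0 //.
apply: opn_leP => [|b]; first exact: sqrtr_ge0.
rewrite -(@ler_pXn2r _ 2) ?nnegrE ?mulr_ge0 ?nm_ge0 ?sqrtr_ge0 //.
rewrite exprMn sqr_sqrtr ?opn_ge0 // -nm_adjM.
have -> : cadj (ml m b) *c ml m b = cadj b *c ml (madj m *M m) b.
  by rewrite /= -[in RHS]cadjM -[in RHS]ml_mr [in RHS]cadjM cadjK.
rewrite (le_trans (nmMle _ _)) // nm_adj expr2 mulrA mulrC ler_wpM2r ?nm_ge0 //.
exact: opn_le.
Qed.

(** With M(A) again a C^*-algebra, an [mhom] into multipliers is just a [starhom] into [MA], and
    every result on homomorphisms applies to it. *)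
Definition MA : cstarAlgebra R :=
  @CStarAlgebra R Mcarrier (@mmul R A) (@madj R A) mmulA mmulDl mmulDr mmulZl mmulZr
    madjK madjD madjZ madjM mnormM mnormE.

Lemma nm_memb a : nm (memb a : MA) = nm a.
Proof.
apply/le_anti/andP; split; first by apply: opn_leP; [exact: nm_ge0|exact: nmMle].
have [->|a0] := eqVneq a 0; first by rewrite nm0 nm_ge0.
have nb : 0 < nm a by rewrite lt_neqAle nm_ge0 andbT eq_sym; apply/eqP => /nm_eq0/eqP; apply/negP.
by have := opn_le (memb a) (cadj a); rewrite /= nm_Madj nm_adj expr2 ler_pM2r.
Qed.

End MultiplierAlgebra.

(** * Linear identities decided by comparing coefficients *)

Inductive mexp (C : Type) := MAt of nat | MZero | MPlus of mexp C & mexp C | MNeg of mexp C | MScal of C & mexp C.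
Arguments MAt {C}. Arguments MZero {C}.

Section ModuleReflection.
Variables (K : comNzRingType) (V : lmodType K).
Fixpoint meval (env : seq V) (e : mexp K) : V :=
  match e with
  | MAt i => nth 0 env i
  | MZero => 0
  | MPlus a b => meval env a + meval env b
  | MNeg a => - meval env a
  | MScal k a => k *: meval env a
  end.
Fixpoint mcoef (i : nat) (e : mexp K) : K :=
  match e with
  | MAt j => if Nat.eqb i j then 1 else 0
  | MZero => 0
  | MPlus a b => mcoef i a + mcoef i b
  | MNeg a => - mcoef i a
  | MScal k a => k * mcoef i a
  end.
Fixpoint meqc (n : nat) (e f : mexp K) : Prop :=
  if n is k.+1 then mcoef k e = mcoef k f /\ meqc k e f else True.

Lemma meval_coef env e : meval env e = \sum_(i < size env) mcoef i e *: nth 0 env i.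
Proof.
elim: e => [j||a IHa b IHb|a IHa|k a IHa] /=; rewrite ?IHa ?IHb.
- have [jn|nj] := ltnP j (size env).
    rewrite (bigD1 (Ordinal jn)) //= PeanoNat.Nat.eqb_refl scale1r big1 ?addr0 // => i /eqP ij.
    case: PeanoNat.Nat.eqb_spec => [e|_]; last by rewrite scale0r.
    by case: ij; apply/val_inj.
  rewrite nth_default // big1 // => i _.
  case: PeanoNat.Nat.eqb_spec => [e|_]; last by rewrite scale0r.
  by move: (ltn_ord i); rewrite e ltnNge nj.
- by rewrite big1 // => i _; rewrite scale0r.
- by rewrite -big_split /=; apply: eq_bigr => i _; rewrite scalerDl.
- by rewrite -sumrN; apply: eq_bigr => i _; rewrite scaleNr.
- by rewrite scaler_sumr; apply: eq_bigr => i _; rewrite scalerA.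
Qed.

Lemma meval_eq env e f : meqc (size env) e f -> meval env e = meval env f.
Proof.
move=> h; rewrite !meval_coef; apply: eq_bigr => i _; congr (_ *: _).
elim: (size env) h i => [_ []//|n IH /= [h1 h2] [i /= ]].
rewrite ltnS leq_eqVlt => /orP[/eqP -> //|lt]; exact: (IH h2 (Ordinal lt)).
Qed.
End ModuleReflection.

Ltac mod_mem x l :=
  lazymatch l with
  | nil => false
  | cons x _ => true
  | cons _ ?l' => mod_mem x l'
  end.
Ltac mod_index x l :=
  lazymatch l with
  | cons x _ => constr:(O)
  | cons _ ?l' => let i := mod_index x l' in constr:(S i)
  end.
Ltac mod_atoms e l :=
  lazymatch e with
  | (?a + ?b)%R => let l1 := mod_atoms a l in mod_atoms b l1
  | (- ?a)%R => mod_atoms a l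
  | (?k *: ?a)%R => mod_atoms a l
  | 0%R => l
  | _ => let b := mod_mem e l in
         lazymatch b with true => l | false => constr:(cons e l) end
  end.
Ltac mod_reify K e l :=
  lazymatch e with
  | (?a + ?b)%R => let x := mod_reify K a l in let y := mod_reify K b l in constr:(@MPlus K x y)
  | (- ?a)%R => let x := mod_reify K a l in constr:(@MNeg K x)
  | (?k *: ?a)%R => let x := mod_reify K a l in constr:(@MScal K k x)
  | 0%R => constr:(@MZero K)
  | _ => let i := mod_index e l in constr:(@MAt K i)
  end.
(* Decides identities between linear combinations over R[i]. *)
Ltac module_with K V tac :=
  lazymatch goal with
  | |- @eq _ ?e ?f =>
    let l0 := mod_atoms e (@nil V) in
    let l := mod_atoms f l0 in
    let x := mod_reify K e l in let y := mod_reify K f l in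
    refine (@meval_eq K V l x y _);
    cbv beta iota delta [size meqc mcoef Nat.eqb];
    repeat split; tac
  end.

Section StarNotations.
Variable R : realType.
Local Notation C := R[i].

Lemma nm_half : nm ((2 : C)^-1) = 2^-1.
Proof.
rewrite -[RHS]nm_real; last by rewrite invr_ge0.
by congr nm; rewrite fmorphV rmorph_nat.
Qed.

Lemma nm_nat (n : nat) : nm (n%:R : C) = n%:R.
Proof. by rewrite -[RHS]nm_real ?ler0n // rmorph_nat. Qed.

Section Tends.
Variable V : normedModType C.
Implicit Types (u v : nat -> V) (l m : V).
Lemma tends_uniq u l l' : tends u l -> tends u l' -> l = l'.
Proof.
move=> h h'; apply/eqP; rewrite -subr_eq0; apply/eqP; apply: nm_small => e e0.
have [N hN] := h (e/2) ltac:(by rewrite divr_gt0).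
have [N' hN'] := h' (e/2) ltac:(by rewrite divr_gt0).
have := hN _ (leq_maxl N N'); have := hN' _ (leq_maxr N N').
have := nm_trans (u (maxn N N')) l l'; rewrite (nm_sym l (u _)); lra.
Qed.
Lemma tends_const l : tends (fun=> l) l.
Proof. by move=> e e0; exists 0%N => n _; rewrite subrr nm0. Qed.
Lemma tends_shift u l : tends u l -> tends (fun n => u n.+1) l.
Proof. by move=> h e /h[N hN]; exists N => n Nn; apply: hN; exact: leqW. Qed.
Lemma tends_eq u v l : (forall n, u n = v n) -> tends u l -> tends v l.
Proof. by move=> uv; rewrite (_ : v = u) //; apply/funext => n; rewrite uv. Qed.
Lemma tendsD u v l m : tends u l -> tends v m -> tends (fun n => u n + v n) (l + m).
Proof.
move=> h h' e e0.
have [N hN] := h (e/2) ltac:(by rewrite divr_gt0).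
have [N' hN'] := h' (e/2) ltac:(by rewrite divr_gt0).
exists (maxn N N') => n; rewrite geq_max => /andP[/hN a /hN' b].
rewrite opprD addrACA (le_lt_trans (nmD _ _)) //; lra.
Qed.
Lemma tends_le u l c : (forall n, nm (u n) <= c) -> tends u l -> nm l <= c.
Proof.
move=> h t; apply/ler_addgt0Pr => e /t[N /(_ N (leqnn _)) hN].
have := h N; have := nmD (u N) (l - u N); rewrite addrC subrK (nm_sym l) => *; lra.
Qed.
End Tends.

Lemma boundedZ (V : normedModType C) (k : C) : bounded (fun v : V => k *: v).
Proof. by exists (nm k) => [|v]; rewrite ?nm_ge0 ?nmZ. Qed.
Lemma linearZ_ (V : lmodType C) (k : C) : linear (fun v : V => k *: v).
Proof. by move=> l u v; rewrite scalerDr !scalerA mulrC. Qed.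
Lemma bounded_cmulr (A : cstarAlgebra R) (a : A) : bounded (cmul a).
Proof. by exists (nm a) => [|v]; rewrite ?nm_ge0 ?nmMle. Qed.
Lemma bounded_cmull (A : cstarAlgebra R) (b : A) : bounded (fun a : A => a *c b).
Proof. by exists (nm b) => [|v]; rewrite ?nm_ge0 // mulrC nmMle. Qed.
Lemma bounded_ml (A : cstarAlgebra R) (m : multiplier A) : bounded (ml m).
Proof. by have [c c0 h] := ml_bounded m; exists c. Qed.

Lemma tendsM (A : cstarAlgebra R) (u v : nat -> A) l m :
  tends u l -> tends v m -> tends (fun n => u n *c v n) (l *c m).
Proof.
move=> h h' e e0.
have c0 : 0 < nm l + nm m + 1 by have := nm_ge0 l; have := nm_ge0 m; lra.
pose d := Num.min 1 (e / (nm l + nm m + 1) / 2).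
have d0 : 0 < d by rewrite lt_min ltr01 !divr_gt0.
have d1 : d <= 1 by rewrite ge_min lexx.
have d2 : d * (2 * (nm l + nm m + 1)) <= e.
  have : d <= e / (nm l + nm m + 1) / 2 by rewrite ge_min lexx orbT.
  rewrite ler_pdivlMr // ler_pdivlMr //; lra.
have [N hN] := h d d0; have [N' hN'] := h' d d0.
exists (maxn N N') => n; rewrite geq_max => /andP[/hN a /hN' b].
have -> : u n *c v n - l *c m = (u n - l) *c (v n - m) + (u n - l) *c m + l *c (v n - m).
  by rewrite -cmulDr subrK cmulBl cmulBr addrA subrK.
rewrite (le_lt_trans (nmD _ _)) // (le_lt_trans (lerD (nmD _ _) (lexx _))) //.
have := nmMle (u n - l) (v n - m); have := nmMle (u n - l) m; have := nmMle l (v n - m).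
have := nm_ge0 (u n - l); have := nm_ge0 (v n - m); have := nm_ge0 l; have := nm_ge0 m.
move: a b d0 d1 d2; set x := nm (u n - l); set y := nm (v n - m).
set s := nm l; set t := nm m => *.
have : x * y <= d * d by nra.
have : x * t <= d * t by nra.
have : s * y <= s * d by nra.
nra.
Qed.

Lemma tends_adj (A : cstarAlgebra R) (u : nat -> A) l :
  tends u l -> tends (fun n => cadj (u n)) (cadj l).
Proof. by move=> h e /h[N hN]; exists N => n /hN; rewrite -cadjB nm_adj. Qed.

End StarNotations.

Ltac cmod R V := module_with (R[i] : comNzRingType) V ltac:(by field).

(** * Square roots and the norm estimates they give *)

Section SquareRoot.
Variable R : realType.
Local Notation C := R[i].
Variable A : cstarAlgebra R.

(* The iteration q |-> (y + q^2)/2 is majorised by the scalar one for y = 1. *)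
Lemma square_root (y : A) : nm y <= 1 ->
  exists q : A, [/\ nm q <= 1, q + q = y + q *c q, cadj y = y -> cadj q = q
    & forall z, z *c y = y *c z -> z *c q = q *c z].
Proof.
move=> y1.
(* The limit satisfies (1 - q)^2 = 1 - y, written as 2 q = y + q^2 so that A needs no unit. *)
pose Q := fix Q n : A := if n is k.+1 then (2 : C)^-1 *: (y + Q k *c Q k) else 0.
pose p := fix p n : R := if n is k.+1 then (1 + p k ^+ 2) / 2 else 0.
have p01 n : 0 <= p n <= 1.
  by elim: n => [|n /andP[h0 h1]] /=; [rewrite lexx ler01|apply/andP; split; nra].
have pS n : p n <= p n.+1 by have := p01 n; rewrite /=; nra.
have Qp n : nm (Q n) <= p n.
  elim: n => [|n IH]; first by rewrite nm0.
  rewrite [nm _]nmZ nm_half [X in _ <= X]mulrC ler_wpM2l ?invr_ge0 //.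
  rewrite (le_trans (nmD _ _)) // lerD // expr2 (le_trans (nmMle _ _)) //.
  by rewrite ler_pM ?nm_ge0.
have Qc z n : z *c y = y *c z -> z *c Q n = Q n *c z.
  move=> zy; elim: n => [|n IH]; first by rewrite /= cmul0l cmul0r.
  by rewrite [Q n.+1]/= cmulZr cmulZl cmulDr cmulDl zy cmulA IH -cmulA IH cmulA.
have Qa n : cadj y = y -> cadj (Q n) = Q n.
  move=> ya; elim: n => [|n IH]; first exact: cadj0.
  by rewrite /= cadjZ cadjD ya cadjM IH fmorphV rmorph_nat.
have QQ n : nm (Q n.+1 - Q n) <= p n.+1 - p n.
  elim: n => [|n IH].
    have -> : Q 1%N - Q 0%N = (2 : C)^-1 *: y by rewrite /= cmul0l addr0 subr0.
    rewrite nmZ nm_half /= expr2 mul0r addr0 subr0 mul1r; lra.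
  (* A difference of squares, which factors because the iterates commute; the scalar sequence p
     satisfies the same recursion, and so its increments majorise these. *)
  have -> : Q n.+2 - Q n.+1 = (2 : C)^-1 *: ((Q n.+1 - Q n) *c (Q n.+1 + Q n)).
    have cc : Q n *c Q n.+1 = Q n.+1 *c Q n by apply: (Qc); apply/esym; exact: Qc.
    transitivity ((2 : C)^-1 *: (y + Q n.+1 *c Q n.+1) - (2 : C)^-1 *: (y + Q n *c Q n)) => //.
    rewrite -scalerBr; congr (_ *: _); rewrite cmulBl !cmulDr cc; cmod R A.
  rewrite nmZ nm_half.
  have h1 := nmMle (Q n.+1 - Q n) (Q n.+1 + Q n).
  have h2 := nmD (Q n.+1) (Q n).
  have := Qp n; have := Qp n.+1; have := pS n; have := nm_ge0 (Q n.+1 + Q n).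
  have := nm_ge0 (Q n.+1 - Q n); have := p01 n.
  have -> : p n.+2 - p n.+1 = (p n.+1 - p n) * (p n.+1 + p n) / 2.
    transitivity ((1 + p n.+1 ^+ 2) / 2 - (1 + p n ^+ 2) / 2) => //; by field.
  move: IH h1 h2; set a := nm (_ *c _); set b := nm (_ - _); set c := nm (_ + _).
  set x := p n; set x' := p n.+1 => *.
  have : b * c <= (x' - x) * (x' + x) by nra.
  lra.
have pmono n k : p n <= p (n + k)%N by elim: k => [|k IH]; rewrite ?addn0 // addnS (le_trans IH).
have QQk n k : nm (Q (n + k)%N - Q n) <= p (n + k)%N - p n.
  elim: k => [|k IH]; first by rewrite addn0 !subrr nm0.
  rewrite addnS (le_trans (nm_trans (Q (n + k)%N) _ _)) //; have := QQ (n + k)%N; lra.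
have pc (e : R) : 0 < e -> exists N, forall n, (N <= n)%N -> p n - p N < e.
  move=> e0.
  have hs : has_sup (range p).
    by split; [exists (p 0%N), 0%N|exists 1 => _ [n _ <-]; case/andP: (p01 n)].
  have [_ [N _ <-] hN] := sup_adherent e0 hs.
  exists N => n Nn.
  have : p n <= sup (range p) by apply: sup_upper_bound => //; exists n.
  lra.
have [e e0|q tq] := @complete_nm R A Q.
  have [N hN] := pc (e / 2) ltac:(by rewrite divr_gt0).
  exists N => m n Nm Nn.
  have h1 : nm (Q m - Q N) < e / 2 by have := QQk N (m - N)%N; rewrite subnKC // => /le_lt_trans; apply; exact: hN.
  have h2 : nm (Q n - Q N) < e / 2 by have := QQk N (n - N)%N; rewrite subnKC // => /le_lt_trans; apply; exact: hN.
  by rewrite (le_lt_trans (nm_trans (Q N) _ _)) // [X in _ + X]nm_sym [ltRHS](splitr e) ltrD.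
exists q; split.
- by apply: tends_le tq => n; rewrite (le_trans (Qp n)) //; case/andP: (p01 n).
- apply: (@tends_uniq R A (fun n => Q n.+1 + Q n.+1)).
    by apply: tendsD; exact: tends_shift.
  apply: (@tends_eq R A (fun n => y + Q n *c Q n)).
    move=> n; rewrite /= -scalerDl (_ : _ + _ = 1) ?scale1r //.
    by field.
  by apply: tendsD; [exact: tends_const|exact: tendsM].
- move=> ya; apply: (@tends_uniq R A Q) => //.
  by apply: (@tends_eq R A (fun n => cadj (Q n))); [move=> n; exact: Qa|exact: tends_adj].
- move=> z zy; apply: (@tends_uniq R A (fun n => z *c Q n)).
    by apply: tendsM => //; exact: tends_const.
  apply: (@tends_eq R A (fun n => Q n *c z)); first by move=> n; rewrite Qc.
  by apply: tendsM => //; exact: tends_const.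
Qed.

End SquareRoot.

Lemma conj_real (R : realType) (r : R) : Num.conj (r%:C : R[i]) = r%:C.
Proof. by rewrite conj_Creal // complex_real. Qed.

Section Unital.
Variable R : realType.
Local Notation C := R[i].
Variables (U : cstarAlgebra R) (e : U).
Hypotheses (el : forall a, e *c a = a) (er : forall a, a *c e = a).
Implicit Types (a b c d p : U).

Lemma adj_unit : cadj e = e.
Proof. by rewrite -(el (cadj e)) -{1}(cadjK e) -cadjM el cadjK. Qed.

Lemma nm_unit : nm e <= 1.
Proof.
have [->|e0] := eqVneq e 0; first by rewrite nm0 ler01.
have nb : 0 < nm e by rewrite lt_neqAle nm_ge0 andbT eq_sym; apply/eqP => /nm_eq0/eqP; apply/negP.
by have := nm_sq adj_unit; rewrite el expr2 -{1}[nm e]mul1r => /(mulIf (negbT (gt_eqF nb))) <-.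
Qed.

Lemma nm_isometry a : cadj a *c a = e -> nm a <= 1.
Proof.
move=> h; rewrite -(@ler_pXn2r _ 2) ?nnegrE ?nm_ge0 // expr1n -nm_adjM h.
exact: nm_unit.
Qed.

(* d + i p is unitary. *)
Lemma pythagoras d p : cadj d = d -> cadj p = p -> d *c p = p *c d ->
  d *c d + p *c p = e -> nm d <= 1 /\ nm p <= 1.
Proof.
move=> da pa dp h; pose u := d + ('i : C) *: p.
have ua : cadj u = d - ('i : C) *: p by rewrite cadjD cadjZ da pa conjCi scaleNr.
have ii : ('i : C) * 'i = -1 by rewrite -expr2 sqrCi.
have uu : cadj u *c u = e.
  rewrite ua cmulBl !cmulDr !cmulZl !cmulZr dp scalerA ii -h; cmod R U.
have uu' : cadj (cadj u) *c cadj u = e.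
  rewrite cadjK ua cmulDl !cmulBr !cmulZl !cmulZr dp scalerA ii -h; cmod R U.
have := nm_isometry uu; have := nm_isometry uu'; rewrite nm_adj => _ u1.
have n2 : nm ((2 : C)^-1) = 2^-1 by exact: nm_half.
split.
  have -> : d = (2 : C)^-1 *: (u + cadj u) by rewrite ua /u; cmod R U.
  by rewrite nmZ n2; have := nmD u (cadj u); rewrite nm_adj; lra.
have -> : nm p = nm (('i : C) *: p) by rewrite nmZ nm_imag mul1r.
have -> : ('i : C) *: p = (2 : C)^-1 *: (u - cadj u) by rewrite ua /u; cmod R U.
by rewrite nmZ n2; have := nmB u (cadj u); rewrite nm_adj; lra.
Qed.

(** A sine p for the cosine c, namely p = 1 - q with (1 - q)^2 = 1 - c^2. The commutation clause is
    what makes c + i p unitary. *)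
Lemma sqrt_complement c : cadj c = c -> nm c <= 1 ->
  exists p, [/\ cadj p = p, nm p <= 1, c *c c + p *c p = e
    & forall z, z *c c = c *c z -> z *c p = p *c z].
Proof.
move=> ca c1.
have [|q [q1 qE qa qc]] := @square_root R U (c *c c).
  by rewrite nm_sq // expr_le1 ?nm_ge0.
have com z : z *c c = c *c z -> z *c (e - q) = (e - q) *c z.
  move=> zc; rewrite cmulBr cmulBl el er qc //.
  by rewrite cmulA zc -cmulA zc cmulA.
have pa : cadj (e - q) = e - q by rewrite cadjB adj_unit qa // cadjM ca.
have h : c *c c + (e - q) *c (e - q) = e.
  have -> : c *c c = q + q - q *c q by rewrite qE addrK.
  rewrite cmulBl !cmulBr !el er; cmod R U.
exists (e - q); split => //.
by case: (pythagoras ca pa (com _ erefl) h).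
Qed.

Lemma nm_one_sub_sq c : cadj c = c -> nm c <= 1 -> nm (e - c *c c) <= 1.
Proof.
move=> ca c1; have [p [pa p1 <- _]] := sqrt_complement ca c1.
by rewrite addrAC subrr add0r nm_sq // expr_le1 ?nm_ge0.
Qed.

(** Double angle formula: 2 c^2 - 1 is the real part of the square of the unitary c + i p. *)
Lemma nm_cos2 c : cadj c = c -> nm c <= 1 -> nm (c *c c + c *c c - e) <= 1.
Proof.
move=> ca c1; have [p [pa p1 h com]] := sqrt_complement ca c1.
have cp := com _ erefl.
have ii : ('i : C) * 'i = -1 by rewrite -expr2 sqrCi.
pose u := c + ('i : C) *: p.
have ua : cadj u = c - ('i : C) *: p by rewrite cadjD cadjZ ca pa conjCi scaleNr.
have uu : cadj u *c u = e.
  rewrite ua cmulBl !cmulDr !cmulZl !cmulZr cp scalerA ii -h; cmod R U.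
have u1 := nm_isometry uu.
have -> : c *c c + c *c c - e = (2 : C)^-1 *: (u *c u + cadj u *c cadj u).
  rewrite ua /u cmulBl !cmulDl !cmulBr !cmulDr !cmulZl !cmulZr cp !scalerA ii -h; cmod R U.
rewrite nmZ nm_half; have := nmD (u *c u) (cadj u *c cadj u).
have := nmMle u u; have := nmMle (cadj u) (cadj u); rewrite nm_adj.
have := nm_ge0 u; nra.
Qed.

End Unital.

Section MembFacts.
Variable R : realType.
Variable A : cstarAlgebra R.
Definition one : MA A := mone.
Definition mb (a : A) : MA A := memb a.
Lemma one_l (a : MA A) : one *c a = a. Proof. exact: mult_ext. Qed.
Lemma one_r (a : MA A) : a *c one = a. Proof. exact: mult_ext. Qed.
Lemma mb_lin : linear mb.
Proof. by move=> k a b; apply: mult_ext => x /=; rewrite cmulDl cmulZl. Qed.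
Lemma mbM a b : mb (a *c b) = mb a *c mb b.
Proof. by apply: mult_ext => x /=; rewrite cmulA. Qed.
Lemma mb_adj a : mb (cadj a) = cadj (mb a).
Proof. by apply: mult_ext => x /=; rewrite cadjM cadjK. Qed.
Lemma nm_mb a : nm (mb a) = nm a. Proof. exact: nm_memb. Qed.
Lemma mb_inj : injective mb.
Proof.
move=> a b h; apply/eqP; rewrite -subr_eq0; apply/eqP/nm_eq0.
by rewrite -nm_mb (linB mb_lin) h subrr nm0.
Qed.
Lemma mul_mb (m : MA A) a : m *c mb a = mb (ml m a).
Proof. by apply: mult_ext => x /=; rewrite mlM. Qed.
Lemma mb_mul (m : MA A) a : mb a *c m = mb (mr m a).
Proof. by apply: mult_ext => x /=; rewrite ml_mr. Qed.
Lemma nm_one : nm one <= 1.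
Proof. exact: (nm_unit one_l). Qed.
Lemma nm_ml (m : MA A) a : nm (ml m a) <= nm m * nm a.
Proof. exact: opn_le. Qed.
Lemma nm_mlP (m : MA A) c : 0 <= c -> (forall a, nm (ml m a) <= c * nm a) -> nm m <= c.
Proof. exact: opn_leP. Qed.
End MembFacts.
Arguments one {R A}.

Section Contractive.
Variable R : realType.
Local Notation C := R[i].

Lemma starhom_lin (A B : cstarAlgebra R) (f : A -> B) : starhom f -> linear f.
Proof. by case. Qed.
Lemma starhomM (A B : cstarAlgebra R) (f : A -> B) a b : starhom f -> f (a *c b) = f a *c f b.
Proof. by case. Qed.
Lemma starhom_adj (A B : cstarAlgebra R) (f : A -> B) a : starhom f -> f (cadj a) = cadj (f a).
Proof. by case. Qed.

Lemma normalize (V : normedModType C) (v : V) : exists2 k : R, 0 < k & nm (k%:C *: v) <= 1 /\ forall c : R, nm (k%:C *: v) <= c * k -> nm v <= c.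
Proof.
exists ((nm v + 1)^-1); have v1 : 0 < nm v + 1 by have := nm_ge0 v; lra.
  by rewrite invr_gt0.
have k0 : 0 < (nm v + 1)^-1 by rewrite invr_gt0.
rewrite nmZ nm_real ?(ltW k0) // ler_pdivrMl //; split; first lra.
by move=> c; rewrite mulrC ler_pM2r.
Qed.

(** No spectrum is involved. For a self-adjoint contraction d, the element q with (1 - q)^2 = 1 -
    d^2 is carried along by f, and in M(B) the pair f d, 1 - f q satisfies the identity of
    [pythagoras]. Scaling and the C^*-identity extend this from d to all of A. *)
Theorem starhom_contractive (A B : cstarAlgebra R) (f : A -> B) : starhom f ->
  forall a, nm (f a) <= nm a.
Proof.
move=> hf; have lf := starhom_lin hf.
have one_ d : cadj d = d -> nm d <= 1 -> nm (f d) <= 1.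
  move=> da d1; have [|q [q1 qE qa qc]] := @square_root R A (d *c d).
    by rewrite nm_sq // expr_le1 ?nm_ge0.
  rewrite -nm_mb.
  have com : f q *c f d = f d *c f q.
    by rewrite -!starhomM // qc // cmulA.
  have [] // := @pythagoras R (MA B) one (@one_l R B) (mb (f d)) (one - mb (f q)).
  - by rewrite -mb_adj -starhom_adj // da.
  - by rewrite cadjB (adj_unit (@one_l R B)) -mb_adj -starhom_adj // qa // cadjM da.
  - by rewrite cmulBl cmulBr one_l one_r -!mbM com.
  have -> : mb (f d) *c mb (f d) = mb (f q) + mb (f q) - mb (f q) *c mb (f q).
    rewrite -!mbM -!starhomM // -(linD (@mb_lin R B)) -(linB (@mb_lin R B)) -linD // -linB //.
    by rewrite qE addrK.
  rewrite cmulBl !cmulBr !one_l one_r; cmod R (MA B).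
have sa d : cadj d = d -> nm (f d) <= nm d.
  move=> da; have [->|d0] := eqVneq d 0; first by rewrite lin0 // !nm0.
  have nb : 0 < nm d by rewrite lt_neqAle nm_ge0 andbT eq_sym; apply/eqP => /nm_eq0/eqP; apply/negP.
  have nk : nm ((nm d)^-1%:C : C) = (nm d)^-1 by rewrite nm_real // invr_ge0 ltW.
  have := one_ ((nm d)^-1%:C *: d); rewrite cadjZ da linZ // !nmZ nk mulVf ?gt_eqF //.
  rewrite conj_real => /(_ erefl (lexx _)); rewrite ler_pdivrMl // mulr1 //.
move=> a; rewrite -(@ler_pXn2r _ 2) ?nnegrE ?nm_ge0 // -!nm_adjM -starhom_adj // -starhomM //.
by apply: sa; rewrite cadjM cadjK.
Qed.

Lemma starhom_bounded (A B : cstarAlgebra R) (f : A -> B) : starhom f -> bounded f.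
Proof. by move=> /starhom_contractive h; exists 1 => // a; rewrite mul1r. Qed.

Lemma mhom_starhom (A B : cstarAlgebra R) (f : A -> multiplier B) :
  mhom f <-> starhom (f : A -> MA B).
Proof. by split; case. Qed.

(* 1 - x is the Cesaro mean of the powers of 1 - c^2, so that c^2 (1 - x) = (1 - (1 - c^2)^N) / N. *)
Lemma approx_unit (A : cstarAlgebra R) (a : A) (eps : R) : 0 < eps ->
  exists2 x : A, nm (a - a *c x) < eps & nm (one - mb x) <= 1.
Proof.
move=> e0.
pose h := cadj a *c a.
have ha : cadj h = h by rewrite /h cadjM cadjK.
have [k k0 [k1 kh]] := normalize h.
pose c := k%:C *: h.
have ca : cadj c = c by rewrite cadjZ conj_real ha.
pose y := c *c c.
pose r : MA A := one - mb y.
have r1 : nm r <= 1.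
  by rewrite /r mbM; apply: (nm_one_sub_sq (@one_l R A) (@one_r R A)); rewrite ?nm_mb // -mb_adj ca.
(* [P n] will be the n-th power of r; its complement [b n] stays in A because r is 1 minus an
   element of A. *)
pose b := fix b n : A := if n is j.+1 then b j + y - b j *c y else 0.
pose P n : MA A := one - mb (b n).
have PS n : P n.+1 = P n *c r.
  rewrite /P /r (_ : b n.+1 = b n + y - b n *c y) // !(linB (@mb_lin R A), linD (@mb_lin R A)) mbM cmulBl !cmulBr !one_l one_r.
  cmod R (MA A).
have P1 n : nm (P n) <= 1.
  elim: n => [|n IH]; first by rewrite /P (_ : b 0%N = 0) // (lin0 (@mb_lin R A)) subr0 nm_one.
  by rewrite PS (le_trans (nmMle _ _)) // mulr_ile1 ?nm_ge0.
pose S n : MA A := \sum_(i < n) P i.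
pose s n : A := \sum_(i < n) b i.
have SS n : S n.+1 = S n + P n by rewrite /S big_ord_recr.
have sS n : s n.+1 = s n + b n by rewrite /s big_ord_recr.
have rP n : r *c P n = P n *c r.
  elim: n => [|n IH]; first by rewrite /P (_ : b 0%N = 0) // (lin0 (@mb_lin R A)) subr0 one_l one_r.
  by rewrite PS cmulA IH -cmulA.
have tel n : mb y *c S n = one - P n.
  have -> : mb y = one - r by rewrite /r opprB addrC subrK.
  elim: n => [|n IH].
    by rewrite /S big_ord0 cmul0r /P (_ : b 0%N = 0) // (lin0 (@mb_lin R A)) subr0 subrr.
  rewrite SS cmulDr IH cmulBl one_l rP -PS; cmod R (MA A).
have SE n : S n = (n%:R : C) *: one - mb (s n).
  elim: n => [|n IH]; first by rewrite /S /s !big_ord0 (lin0 (@mb_lin R A)) subr0 scale0r.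
  rewrite SS sS IH (linD (@mb_lin R A)) /P -natr1 scalerDl scale1r.
  cmod R (MA A).
have S1 n : nm (S n) <= n%:R.
  rewrite /S (le_trans (nm_sum _ _)) // -[X in _ <= X%:R]card_ord -sum1_card natr_sum.
  by apply: ler_sum => i _.
(* [B1] and [B2] below combine to (|a g|^2 k)^2 <= 2 / (N + 1), which this N makes incompatible with
   |a g| >= eps. *)
have [N hN] := inv_lt_exists (e := (eps ^+ 2 * k) ^+ 2 / 4) ltac:(by rewrite divr_gt0 // exprn_gt0 // mulr_gt0 // exprn_gt0).
have {hN} hN := hN N (leqnn _).
pose g : MA A := (N.+1%:R : C)^-1 *: S N.+1.
have nN : nm ((N.+1%:R : C)^-1) = N.+1%:R^-1 :> R.
  by rewrite -[RHS]nm_real ?invr_ge0 // fmorphV rmorph_nat.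
have g1 : nm g <= 1.
  by rewrite nmZ nN ler_pdivrMl ?ltr0Sn // mulr1 S1.
have cg : nm (mb c *c mb c *c g) <= 2 * N.+1%:R^-1.
  rewrite -mbM -/y cmulZr tel nmZ nN mulrC ler_pM2r ?invr_gt0 ?ltr0Sn //.
  have := nmB one (P N.+1); have := P1 N.+1; have := @nm_one R A; lra.
pose x : A := (N.+1%:R : C)^-1 *: s N.+1.
have gx : g = one - mb x.
  rewrite /g SE scalerBr scalerA mulVf ?pnatr_eq0 // scale1r (linZ (@mb_lin R A)) //.
exists x; last by rewrite -gx.
have -> : nm (a - a *c x) = nm (mb a *c g).
  by rewrite gx cmulBr one_r -mbM -(linB (@mb_lin R A)) nm_mb.
have mca : cadj (mb c) = mb c by rewrite -mb_adj ca.
have i0 : 0 < N.+1%:R^-1 :> R by rewrite invr_gt0 ltr0Sn.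
have B1 : nm (mb c *c g) ^+ 2 <= 2 * N.+1%:R^-1.
  rewrite -nm_adjM cadjM mca -cmulA [X in nm (_ *c X)]cmulA (le_trans (nmMle _ _)) // nm_adj.
  by rewrite (le_trans _ cg) // ler_piMl ?nm_ge0.
have B2 : nm (mb a *c g) ^+ 2 * k <= nm (mb c *c g).
  rewrite -nm_adjM cadjM -mb_adj -cmulA [X in nm (_ *c X)]cmulA -mbM -/h.
  have -> : mb c *c g = k%:C *: (mb h *c g) by rewrite /c (linZ (@mb_lin R A)) cmulZl.
  rewrite nmZ nm_real ?(ltW k0) // mulrC ler_pM2l // (le_trans (nmMle _ _)) // nm_adj.
  by rewrite ler_piMl ?nm_ge0.
rewrite ltNge; apply/negP => le.
have : eps ^+ 2 <= nm (mb a *c g) ^+ 2 by rewrite ler_pXn2r ?nnegrE ?nm_ge0 // ltW.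
move=> le2.
have : eps ^+ 2 * k <= nm (mb c *c g) by rewrite (le_trans _ B2) // ler_pM2r.
move=> le3.
have p0 : 0 <= eps ^+ 2 * k by rewrite mulr_ge0 ?sqr_ge0 // ltW.
have : (eps ^+ 2 * k) ^+ 2 <= nm (mb c *c g) ^+ 2 by rewrite ler_pXn2r ?nnegrE ?nm_ge0.
move: B1 hN i0; set i := N.+1%:R^-1; set q := (_ * k) ^+ 2; set p := nm _ ^+ 2; lra.
Qed.

Lemma approx_unit_l (A : cstarAlgebra R) (a : A) (eps : R) : 0 < eps ->
  exists2 x : A, nm (a - x *c a) < eps & nm (one - mb x) <= 1.
Proof.
move=> /(approx_unit (cadj a))[x h1 h2]; exists (cadj x).
  by rewrite -nm_adj cadjB cadjM cadjK.
by rewrite mb_adj -(adj_unit (@one_l R A)) -cadjB nm_adj.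
Qed.

End Contractive.

(** * Representations *)

Section Hilbert.
Variable R : realType.
Local Notation C := R[i].
Variable H : hilbertSpace R.
Implicit Types (x y z : H).

Lemma dotPr x (k : C) y z : dot x (k *: y + z) = k * dot x y + dot x z.
Proof. by rewrite dotDr dotZr. Qed.
Lemma dot_lin x : linear (dot x : H -> C^o).
Proof. by move=> k y z; rewrite dotPr. Qed.
Lemma dotDl x y z : dot (x + y) z = dot x z + dot y z.
Proof. by rewrite dotC dotDr rmorphD /= -!dotC. Qed.
Lemma dotZl (k : C) x y : dot (k *: x) y = Num.conj k * dot x y.
Proof. by rewrite dotC dotZr rmorphM /= -dotC. Qed.
Lemma dot0r x : dot x 0 = 0. Proof. exact: (lin0 (dot_lin x)). Qed.
Lemma dotNr x y : dot x (- y) = - dot x y. Proof. exact: (linN (dot_lin x)). Qed.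
Lemma dotBr x y z : dot x (y - z) = dot x y - dot x z. Proof. exact: (linB (dot_lin x)). Qed.
Lemma dotNl x y : dot (- x) y = - dot x y.
Proof. by rewrite dotC dotNr rmorphN /= -dotC. Qed.
Lemma dotBl x y z : dot (x - y) z = dot x z - dot y z.
Proof. by rewrite dotDl dotNl. Qed.
Lemma dot0l x : dot 0 x = 0.
Proof. by rewrite dotC dot0r rmorph0. Qed.
Lemma dotxx x : dot x x = (nm x ^+ 2)%:C.
Proof. by rewrite dot_norm nmE rmorphXn. Qed.
Lemma nm_dotxx x : nm (dot x x) = nm x ^+ 2.
Proof. by rewrite dotxx nm_real ?sqr_ge0. Qed.
Lemma conj_mul_nm (k : C) : k * Num.conj k = (nm k ^+ 2)%:C.
Proof. by rewrite -normCK nmE rmorphXn. Qed.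

Lemma CauchySchwarz x y : nm (dot x y) <= nm x * nm y.
Proof.
have [->|y0] := eqVneq y 0; first by rewrite dot0r nm0 mulr_ge0 ?nm_ge0.
have ny : 0 < nm y by rewrite lt_neqAle nm_ge0 andbT eq_sym; apply/eqP => /nm_eq0/eqP; apply/negP.
pose a : R := nm y ^+ 2; pose k := dot y x.
have a0 : 0 < a by rewrite exprn_gt0.
have E : ((nm (a%:C *: x - k *: y)) ^+ 2)%:C = (a * (a * nm x ^+ 2 - nm k ^+ 2))%:C :> C.
  rewrite -dotxx dotBl !dotBr !dotZl !dotZr conj_real !dotxx -/a (dotC y x) -/k.
  transitivity (a%:C * (a%:C * (nm x ^+ 2)%:C - k * Num.conj k)); first by ring.
  by rewrite conj_mul_nm !(rmorphM, rmorphB).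
have {E} E := congr1 (@complex.Re R) E.
have h : 0 <= a * (a * nm x ^+ 2 - nm k ^+ 2).
  by move: E => /= <-; rewrite sqr_ge0.
rewrite pmulr_rge0 // subr_ge0 in h.
rewrite -(@ler_pXn2r _ 2) ?nnegrE ?mulr_ge0 ?nm_ge0 //.
by rewrite dotC nm_conj exprMn mulrC.
Qed.

Lemma nm_dotP x (c : R) : 0 <= c -> (forall y, nm (dot y x) <= c * nm y) -> nm x <= c.
Proof.
move=> c0 h; have [->|x0] := eqVneq x 0; first by rewrite nm0.
have nx : 0 < nm x by rewrite lt_neqAle nm_ge0 andbT eq_sym; apply/eqP => /nm_eq0/eqP; apply/negP.
by have := h x; rewrite nm_dotxx expr2 ler_pM2r.
Qed.

End Hilbert.

(* If |v| >= |F a| for a in the unit ball: |v|^2 - |F a|^2 = |v - F q|^2, where 1 - a^* a = (1 - q)^2. *)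
Lemma positive_contraction (R : realType) (A : cstarAlgebra R) (H : hilbertSpace R)
    (F : A -> H) (v : H) : linear F ->
  (forall a b, dot (F a) (F b) = dot v (F (cadj a *c b))) ->
  (forall a, dot (F a) v = dot v (F (cadj a))) ->
  forall a, nm (F a) <= nm a * nm v.
Proof.
move=> lF F1 F2 a.
suff one_ b : nm b <= 1 -> nm (F b) <= nm v.
  have [->|a0] := eqVneq a 0; first by rewrite (lin0 lF) !nm0 mul0r.
  have na : 0 < nm a by rewrite lt_neqAle nm_ge0 andbT eq_sym; apply/eqP => /nm_eq0/eqP; apply/negP.
  have nk : nm ((nm a)^-1%:C : R[i]) = (nm a)^-1 by rewrite nm_real // invr_ge0 ltW.
  have := one_ ((nm a)^-1%:C *: a); rewrite (linZ lF) !nmZ nk mulVf ?gt_eqF //.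
  by move=> /(_ (lexx _)); rewrite ler_pdivrMl.
move=> b1; have [|q [_ qE qa _]] := @square_root R A (cadj b *c b).
  by rewrite nm_adjM expr_le1 ?nm_ge0.
have {}qa : cadj q = q by apply: qa; rewrite cadjM cadjK.
have E : dot v v - dot (F b) (F b) = dot (v - F q) (v - F q).
  rewrite F1.
  have -> : cadj b *c b = q + q - q *c q by rewrite qE addrK.
  by rewrite (linB lF) (linD lF) dotBl !dotBr dotDr F2 F1 qa; ring.
have {E} E := congr1 (@complex.Re R) E.
rewrite -(@ler_pXn2r _ 2) ?nnegrE ?nm_ge0 // -subr_ge0.
move: E; rewrite !dotxx /= => ->; exact: sqr_ge0.
Qed.

Section Representations.
Variable R : realType.
Local Notation C := R[i].
Variables (A : cstarAlgebra R) (H : hilbertSpace R) (pi : A -> H -> H).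
Hypothesis rep : faithful_rep pi.
Implicit Types (a b : A) (x y : H).

Lemma rep_lin a : linear (pi a). Proof. by case: rep. Qed.
Lemma repP (k : C) a b x : pi (k *: a + b) x = k *: pi a x + pi b x. Proof. by case: rep. Qed.
Lemma rep_lin1 x : linear (fun a => pi a x). Proof. by move=> k a b; rewrite repP. Qed.
Lemma repM a b x : pi (a *c b) x = pi a (pi b x). Proof. by case: rep. Qed.
Lemma rep_adj a x y : dot (pi a x) y = dot x (pi (cadj a) y). Proof. by case: rep. Qed.
Lemma rep_inj a b : (forall x, pi a x = pi b x) -> a = b.
Proof. by case: rep => _ _ _ _ inj h; apply: inj; apply/funext. Qed.

Lemma rep_contractive a x : nm (pi a x) <= nm a * nm x.
Proof.
apply: (positive_contraction (rep_lin1 x)) => [b c|b]; last exact: rep_adj.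
by rewrite rep_adj repM.
Qed.

Lemma bounded_rep a : bounded (pi a).
Proof. by exists (nm a) => [|x]; [exact: nm_ge0|exact: rep_contractive]. Qed.
Lemma bounded_rep1 x : bounded (fun a => pi a x).
Proof. by exists (nm x) => [|a]; [exact: nm_ge0|rewrite mulrC rep_contractive]. Qed.

(* If pi(a) were smaller than a, then t = h^(2^k), with h = a^* a / |a|^2, would have norm 1
   and pi(t) norm at most 1/4; the square root w of (1 - 2t)^2 and v = 1 - 2t would then agree
   after pi, because pi(w + v) is bounded below, whereas w = v forces |2t| <= 1. *)
Theorem rep_isometric a (r : R) : 0 <= r -> (forall x, nm (pi a x) <= r * nm x) -> nm a <= r.
Proof.
move=> r0 hr; rewrite leNgt; apply/negP => ra.
have na : 0 < nm a by exact: le_lt_trans ra.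
have nk : nm ((nm a ^+ 2)^-1%:C : C) = (nm a ^+ 2)^-1 by rewrite nm_real // invr_ge0 sqr_ge0.
pose h := (nm a ^+ 2)^-1%:C *: (cadj a *c a).
have ha : cadj h = h by rewrite /h cadjZ conj_real cadjM cadjK.
have nh : nm h = 1 by rewrite /h nmZ nk nm_adjM mulVf // expf_neq0 // gt_eqF.
pose q := r / nm a.
have q0 : 0 <= q by rewrite divr_ge0 // ltW.
have q1 : q < 1 by rewrite ltr_pdivrMr // mul1r.
have hq x : nm (pi h x) <= q * nm x.
  rewrite /h (linZ (rep_lin1 x)) nmZ nk repM ler_pdivrMl ?exprn_gt0 //.
  rewrite (le_trans (rep_contractive _ _)) // nm_adj /q expr2.
  have -> : nm a * nm a * (r / nm a * nm x) = nm a * (r * nm x) by field; rewrite gt_eqF.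
  by rewrite ler_wpM2l ?nm_ge0.
pose t := fix t n : A := if n is k.+1 then t k *c t k else h.
have ta n : cadj (t n) = t n by elim: n => [//|n IH]; rewrite /= cadjM IH.
have nt n : nm (t n) = 1 by elim: n => [//|n IH]; rewrite /= nm_sq // IH expr1n.
have tq n x : nm (pi (t n) x) <= q ^+ n.+1 * nm x.
  elim: n x => [|n IH] x; first by rewrite expr1 hq.
  have qn : 0 <= q ^+ n.+1 by rewrite exprn_ge0.
  rewrite /= repM (le_trans (IH _)) // [q ^+ n.+2]exprSr -mulrA ler_wpM2l //.
  rewrite (le_trans (IH x)) // ler_wpM2r ?nm_ge0 // exprS ler_piMr //.
  by rewrite exprn_ile1 // ltW.
have [n hn] : exists n, q ^+ n.+1 < 4^-1.
  have [q00|qn0] := eqVneq q 0; first by exists 0%N; rewrite q00 expr1.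
  have qp : 0 < q by rewrite lt_neqAle eq_sym qn0.
  have /cvgrPdist_lt /(_ 4^-1 ltac:(by [])) [N _ hN] : (GRing.exp q) @ \oo --> (0 : R).
    by apply: cvg_expr; rewrite ger0_norm.
  by exists N; have := hN N.+1 (leqnSn _); rewrite /= sub0r normrN ger0_norm // exprn_ge0.
have [T TE] : exists T, T = t n *c t n by eexists.
have nT1 : nm T = 1 by rewrite TE; exact: (nt n.+1).
have Tq x : nm (pi T x) <= 4^-1 * nm x.
  rewrite TE (le_trans (tq n.+1 x)) // ler_wpM2r ?nm_ge0 //.
  rewrite (le_trans _ (ltW hn)) // exprS ler_piMl ?exprn_ge0 //; exact: ltW.
pose y := (4 : C) *: (T - T *c T).
(* This is 2 T - 1, a contraction by the double angle formula for [t n]. Since y = 4 (T - T^2) is 1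
   - X^2, it is a contraction too, and its square root may be taken. *)
pose X : MA A := mb (t n) *c mb (t n) + mb (t n) *c mb (t n) - one.
have tna : cadj (mb (t n)) = mb (t n) by rewrite -mb_adj ta.
have X1 : nm X <= 1.
  by apply: (nm_cos2 (@one_l R A) (@one_r R A)) => //; rewrite nm_mb nt.
have Xa : cadj X = X by rewrite /X cadjB cadjD cadjM tna (adj_unit (@one_l R A)).
have y1 : nm y <= 1.
  rewrite -nm_mb (_ : mb y = one - X *c X).
    by apply: (nm_one_sub_sq (@one_l R A) (@one_r R A)).
  rewrite /y /X (linZ (@mb_lin R A)) (linB (@mb_lin R A)) mbM TE mbM.
  set s := mb (t n) *c mb (t n).
  rewrite cmulBl !cmulBr !cmulDl !cmulDr !one_l one_r; cmod R (MA A).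
have [p [p1 pE pa pc]] := @square_root R A y y1.
have [g gE] : exists g, g = T + T - p by eexists.
have pT : p *c T = T *c p.
  apply/esym/pc; rewrite /y cmulZr cmulZl; congr (_ *: _).
  by rewrite cmulBl cmulBr cmulA.
have g0 : g = 0.
  apply: rep_inj => x; rewrite (lin0 (rep_lin1 x)).
  pose z := pi g x.
  (* With w = 1 - p and v = 1 - 2 T this is (w + v)(w - v) = w^2 - v^2 = 0 applied to x. Pairing it
     with z gives 2 |z|^2 <= |z|^2 + |z|^2 / 2, hence z = 0. *)
  have vw : (z - pi p z) + (z - (pi T z + pi T z)) = 0.
    have -> : (z - pi p z) + (z - (pi T z + pi T z)) = pi (g + g - (p *c g + T *c g + T *c g)) x.
      rewrite (linB (rep_lin1 x)) !(linD (rep_lin1 x)) !repM -/z; cmod R H.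
    rewrite (_ : _ - _ = 0) ?(lin0 (rep_lin1 x)) //.
    rewrite gE !cmulBr !cmulDr pT.
    have -> : p *c p = p + p - y by rewrite pE addrAC subrr add0r.
    rewrite /y; cmod R A.
  apply: nm_eq0.
  have ip : dot z (pi p z) = dot z (z + z - (pi T z + pi T z)).
    by congr dot; apply/eqP; rewrite -subr_eq0; apply/eqP; rewrite -oppr0 -vw; cmod R H.
  have nip : nm (dot z (pi p z)) <= nm z ^+ 2.
    rewrite (le_trans (CauchySchwarz _ _)) // expr2 ler_wpM2l ?nm_ge0 //.
    by rewrite (le_trans (rep_contractive _ _)) // ler_piMl ?nm_ge0.
  have nT : nm (dot z (pi T z + pi T z)) <= 2^-1 * nm z ^+ 2.
    rewrite (le_trans (CauchySchwarz _ _)) // expr2.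
    have := nmD (pi T z) (pi T z); have := Tq z; have := nm_ge0 z; nra.
  have : nm (dot z (z + z)) <= nm (dot z (pi p z)) + nm (dot z (pi T z + pi T z)).
    rewrite ip dotBr; set u := dot _ _; set v := dot _ _.
    by rewrite -{1}[u](subrK v) nmD.
  rewrite dotDr dotxx -rmorphD /= nm_real; last by rewrite addr_ge0 ?sqr_ge0.
  move=> h1; have : nm z ^+ 2 <= 0 by lra.
  by rewrite le_eqVlt ltNge sqr_ge0 orbF sqrf_eq0 => /eqP.
have pTT : p = T + T by apply/esym/eqP; rewrite -subr_eq0; apply/eqP; rewrite -gE.
have : nm ((2 : C) *: T) <= 1 by rewrite scaler_nat mulr2n -pTT.
rewrite nmZ nm_nat nT1; lra.
Qed.

Lemma rep_isometric_dot a (r : R) : 0 <= r ->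
  (forall x y, nm (dot x (pi a y)) <= r * nm x * nm y) -> nm a <= r.
Proof.
move=> r0 h; apply: rep_isometric => // y; apply: nm_dotP => [|x].
  by rewrite mulr_ge0 ?nm_ge0.
by rewrite mulrAC h.
Qed.

End Representations.

Section IsometricInjections.
Variables (R : realType) (T : tensorModel R).

(** The Gelfand-Naimark theorem comes with the model: A ⊗ A is given through a faithful
    representation of A. *)
Lemma exists_faithful_rep (A : cstarAlgebra R) :
  exists (H : hilbertSpace R) (pi : A -> H -> H), faithful_rep pi.
Proof.
have [_ [H1 [H2 [H [h [pi [sigma [Pi [_ rp _ _ _]]]]]]]]] := eltP T A A.
by exists H1, pi.
Qed.

(** A faithful representation of B composed with f is a faithful representation of A, from which
    [rep_isometric] recovers the norm of a. *)
Lemma starhom_isometric (A B : cstarAlgebra R) (f : A -> B) :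
  starhom f -> injective f -> forall a, nm (f a) = nm a.
Proof.
move=> hf inj a; apply/le_anti; rewrite starhom_contractive //=.
have [H [pi rep]] := exists_faithful_rep B.
have rep' : faithful_rep (fun a => pi (f a)).
  split.
  - by move=> ?; exact: rep_lin.
  - by move=> k x y v; rewrite starhom_lin // repP.
  - by move=> x y v; rewrite starhomM // repM.
  - by move=> x v w; rewrite (rep_adj rep) starhom_adj.
  - move=> x y h; apply: inj; apply: (rep_inj rep) => v; exact: (congr1 (fun F => F v) h).
apply: (rep_isometric rep') => [|x]; first exact: nm_ge0.
exact: rep_contractive.
Qed.

End IsometricInjections.

(** * Tensor products and slices *)

Section Density.
Variable R : realType.
Local Notation C := R[i].

Lemma dense_bound (V W : normedModType C) (f : V -> W) (I : Type) (g : I -> V) (c : R) :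
  linear f -> bounded f -> 0 <= c ->
  (forall v (e : R), 0 < e -> exists l, nm (v - lc g l) < e) ->
  (forall l, nm (f (lc g l)) <= c * nm (lc g l)) -> forall v, nm (f v) <= c * nm v.
Proof.
move=> lf [K K0 hK] c0 dg hc v; apply/ler_addgt0Pr => e e0.
have k1 : 0 < c + K + 1 by lra.
have [l hl] := dg v (e / (c + K + 1)) ltac:(by rewrite divr_gt0).
have h1 := nmD (f (v - lc g l)) (f (lc g l)).
rewrite -(linD lf) subrK in h1.
have h2 := hK (v - lc g l); have h3 := hc l.
have h4 := nmB v (v - lc g l); rewrite subKr in h4.
move: hl; rewrite ltr_pdivlMr // => hl.
have := nm_ge0 (v - lc g l); nra.
Qed.

Lemma dot_lc (H H' : hilbertSpace R) (I J : Type) (g1 : I -> H) (g2 : J -> H) (g3 : I -> H') (g4 : J -> H') l l' :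
  (forall i j, dot (g1 i) (g2 j) = dot (g3 i) (g4 j)) ->
  dot (lc g1 l) (lc g2 l') = dot (lc g3 l) (lc g4 l').
Proof.
move=> h; elim: l => [|p l IH]; first by rewrite !lc_nil !dot0l.
rewrite !lc_cons !dotDl IH !dotZl; congr (_ * _ + _).
elim: l' {IH} => [|q l' IH]; first by rewrite !lc_nil !dot0r.
by rewrite !lc_cons !dotPr h IH.
Qed.

Lemma lc_linfun (V W : lmodType C) (I : Type) (F : V -> I -> W) l :
  (forall i, linear (F^~ i)) -> linear (fun v => lc (F v) l).
Proof.
move=> h k u v; rewrite /lc scaler_sumr -big_split; apply: eq_bigr => p _ /=.
by rewrite h scalerDr !scalerA mulrC.
Qed.

End Density.

Section TensorData.
Variables (R : realType) (T : tensorModel R).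
Local Notation C := R[i].
Local Notation "A ⊗ B" := (tensor T A B).
Local Notation elt := (elt T).

(** The representations that witness minimality, fixed once for each pair of algebras so that all
    later estimates refer to the same Hilbert spaces. *)
Record tdata (A B : cstarAlgebra R) := TData {
  dH1 : hilbertSpace R; dH2 : hilbertSpace R; dH : hilbertSpace R;
  dh : dH1 -> dH2 -> dH;
  dpi : A -> dH1 -> dH1; dsig : B -> dH2 -> dH2; dPi : A ⊗ B -> dH -> dH;
  dhP : is_hilbert_tensor dh;
  dpiP : faithful_rep dpi; dsigP : faithful_rep dsig; dPiP : faithful_rep dPi;
  dact : forall a b x y, dPi (elt a b) (dh x y) = dh (dpi a x) (dsig b y) }.

Lemma tdata_exists (A B : cstarAlgebra R) : exists d : tdata A B, True.
Proof.
have [_ [H1 [H2 [H [h [pi [sigma [Pi [hh rp rs rP act]]]]]]]]] := eltP T A B.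
by exists (TData hh rp rs rP act).
Qed.
Definition td (A B : cstarAlgebra R) : tdata A B := projT1 (cid (tdata_exists A B)).

Section Basic.
Variables A B : cstarAlgebra R.
Let D := td A B.
Local Notation h := (dh (t := D)).
Local Notation Pi := (dPi (t := D)).
Local Notation pi := (dpi (t := D)).
Local Notation sigma := (dsig (t := D)).
Let rPi : faithful_rep Pi := dPiP D.
Let rpi : faithful_rep pi := dpiP D.
Let rsi : faithful_rep sigma := dsigP D.
Let act a b x y : Pi (elt a b) (h x y) = h (pi a x) (sigma b y) := @dact A B D a b x y.

Lemma h_linl y : linear (h^~ y). Proof. by case: (dhP D) => h1 _ _ _ k x x'; exact: h1. Qed.
Lemma h_linr x : linear (h x). Proof. by case: (dhP D) => _ h1 _ _ k y y'; exact: h1. Qed.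
Lemma dot_h x y x' y' : dot (h x y) (h x' y') = dot x x' * dot y y'.
Proof. by case: (dhP D). Qed.
Lemma h_total : closed_span [set z | exists x y, z = h x y] = setT.
Proof. by case: (dhP D). Qed.
Definition hp (p : dH1 D * dH2 D) : dH D := h p.1 p.2.
Lemma h_dense v (e : R) : 0 < e -> exists l, nm (v - lc hp l) < e.
Proof. by apply: total_approx; [exact: h_total|move=> _ [x [y ->]]; exists (x, y)]. Qed.
Lemma nm_h x y : nm (h x y) = nm x * nm y.
Proof.
apply/eqP; rewrite -(@eqrXn2 _ 2) ?mulr_ge0 ?nm_ge0 //; apply/eqP.
by rewrite -nm_dotxx dot_h nmM !nm_dotxx exprMn.
Qed.

Lemma tens_total : closed_span [set z | exists a b, z = @Defs.elt R T A B a b] = setT.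
Proof. by case: (eltP T A B). Qed.
Definition ep (p : A * B) : A ⊗ B := elt p.1 p.2.
Lemma tens_dense (z : A ⊗ B) (e : R) : 0 < e -> exists l, nm (z - lc ep l) < e.
Proof. by apply: total_approx; [exact: tens_total|move=> _ [a [b ->]]; exists (a, b)]. Qed.

Lemma tens_ext (z w : A ⊗ B) : (forall x y, Pi z (h x y) = Pi w (h x y)) -> z = w.
Proof.
move=> hzw; apply: (rep_inj rPi) => v.
apply: (total_ind h_total (P := fun v => Pi z v = Pi w v)); last by move=> _ [x [y ->]].
split.
- by rewrite !(lin0 (rep_lin rPi _)).
- by move=> k u v' e1 e2; rewrite !(linP (rep_lin rPi _)) e1 e2.
- move=> v' hv; apply/eqP; rewrite -subr_eq0; apply/eqP; apply: nm_small => e e0.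
  have k0 : 0 < nm z + nm w + 1 by have := nm_ge0 z; have := nm_ge0 w; lra.
  have [u uE vu] := hv (e / (nm z + nm w + 1)) ltac:(by rewrite divr_gt0).
  have -> : Pi z v' - Pi w v' = Pi z (v' - u) - Pi w (v' - u).
    by rewrite !(linB (rep_lin rPi _)) uE opprB addrA subrK.
  move: vu; rewrite ltr_pdivlMr // => vu.
  rewrite (le_trans (nmB _ _)) // (le_trans (lerD (rep_contractive rPi _ _) (rep_contractive rPi _ _))) //.
  have := nm_ge0 (v' - u); nra.
Qed.

Lemma elt_linl (b : B) : linear (fun a : A => elt a b).
Proof.
move=> k a a'; apply: tens_ext => x y.
by rewrite (repP rPi) !act (repP rpi) (linP (h_linl _)).
Qed.
Lemma elt_linr (a : A) : linear (@Defs.elt R T A B a).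
Proof.
move=> k b b'; apply: tens_ext => x y.
by rewrite (repP rPi) !act (repP rsi) (linP (h_linr _)).
Qed.
Lemma eltM (a a' : A) (b b' : B) : elt a b *c elt a' b' = elt (a *c a') (b *c b').
Proof.
apply: tens_ext => x y.
by rewrite (repM rPi) !act (repM rpi) (repM rsi).
Qed.
Lemma dense_dot (v w : dH D) : (forall x y, dot (h x y) v = dot (h x y) w) -> v = w.
Proof.
move=> e; apply/eqP; rewrite -subr_eq0; apply/eqP; set u := v - w.
have hu x y : dot (h x y) u = 0 by rewrite dotBr e subrr.
suff hz z : dot z u = 0 by apply/nm_eq0/eqP; rewrite -sqrf_eq0 -nm_dotxx hz nm0.
apply: (total_ind h_total (P := fun z => dot z u = 0)); last by move=> _ [x [y ->]].
split; first by rewrite dot0l.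
- by move=> k p q hp0 hq; rewrite dotDl dotZl hp0 hq mulr0 addr0.
- move=> z' hz; apply: nm_small => d d0.
  have u0 : 0 < nm u + 1 by have := nm_ge0 u; lra.
  have [p pE zp] := hz (d / (nm u + 1)) ltac:(by rewrite divr_gt0).
  rewrite -[z'](subrK p) dotDl pE addr0 (le_trans (CauchySchwarz _ _)) //.
  move: zp; rewrite ltr_pdivlMr //; have := nm_ge0 (z' - p); nra.
Qed.

Lemma elt_adj (a : A) (b : B) : cadj (elt a b) = elt (cadj a) (cadj b).
Proof.
apply: tens_ext => x y; apply: dense_dot => x' y'.
by rewrite -(rep_adj rPi) !act !dot_h (rep_adj rpi) (rep_adj rsi).
Qed.

(** For the upper bound the two legs are treated one after the other: with the vectors fixed, each
    is a linear map out of A or B to which [positive_contraction] applies. For the lower bound one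
    tests on elementary vectors and uses [rep_isometric] once for each leg. *)
Lemma nm_elt (a : A) (b : B) : nm (elt a b) = nm a * nm b.
Proof.
apply/le_anti/andP; split.
  apply: (rep_isometric rPi) => [|v]; first by rewrite mulr_ge0 ?nm_ge0.
  apply: (dense_bound (g := hp)) => //.
  - exact: (rep_lin rPi).
  - exact: (bounded_rep rPi).
  - by rewrite mulr_ge0 ?nm_ge0.
  - exact: h_dense.
  move=> l; rewrite (lc_lin (rep_lin rPi _)).
  have -> : lc (Pi (elt a b) \o hp) l = lc (fun p => h (pi a p.1) (sigma b p.2)) l.
    by apply: eq_bigr => p _; rewrite /= act.
  have h1 : nm (lc (fun p => h (pi a p.1) (sigma b p.2)) l) <= nm a * nm (lc (fun p => h p.1 (sigma b p.2)) l).
    apply: (@positive_contraction R A _ (fun a => lc (fun p => h (pi a p.1) (sigma b p.2)) l)).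
    - apply: (lc_linfun (F := fun a p => h (pi a p.1) (sigma b p.2))) => p k c c' /=.
      by rewrite (repP rpi) (linP (h_linl _)).
    - by move=> c c'; apply: dot_lc => p p'; rewrite !dot_h (rep_adj rpi) (repM rpi).
    - by move=> c; apply: dot_lc => p p'; rewrite !dot_h (rep_adj rpi).
  have h2 : nm (lc (fun p => h p.1 (sigma b p.2)) l) <= nm b * nm (lc hp l).
    apply: (@positive_contraction R B _ (fun b => lc (fun p => h p.1 (sigma b p.2)) l)).
    - apply: (lc_linfun (F := fun b p => h p.1 (sigma b p.2))) => p k c c' /=.
      by rewrite (repP rsi) (linP (h_linr _)).
    - by move=> c c'; apply: dot_lc => p p'; rewrite !dot_h (rep_adj rsi) (repM rsi).
    - by move=> c; apply: dot_lc => p p'; rewrite !dot_h (rep_adj rsi).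
  by rewrite (le_trans h1) // -mulrA ler_wpM2l ?nm_ge0.
have hxy x y : nm (pi a x) * nm (sigma b y) <= nm (elt a b) * (nm x * nm y).
  by rewrite -!nm_h -act rep_contractive.
have hb y : nm a * nm (sigma b y) <= nm (elt a b) * nm y.
  have [e|s0] := eqVneq (nm (sigma b y)) 0; first by rewrite e mulr0 mulr_ge0 ?nm_ge0.
  have sp : 0 < nm (sigma b y) by rewrite lt_neqAle eq_sym s0 nm_ge0.
  rewrite -ler_pdivlMr //; apply: (rep_isometric rpi) => [|x].
    by rewrite divr_ge0 ?mulr_ge0 ?nm_ge0.
  by rewrite mulrAC ler_pdivlMr // (le_trans (hxy x y)) // [nm x * _]mulrC mulrA.
have [->|a0] := eqVneq (nm a) 0; first by rewrite mul0r nm_ge0.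
have ap : 0 < nm a by rewrite lt_neqAle eq_sym a0 nm_ge0.
rewrite mulrC -ler_pdivlMr //; apply: (rep_isometric rsi) => [|y].
  by rewrite divr_ge0 ?nm_ge0.
by rewrite mulrAC ler_pdivlMr // mulrC.
Qed.

(** A matrix coefficient of the sliced element is the value of f at the element b of B obtained by
    applying a vector functional to the first leg, and the matrix coefficients of b are those of the
    tensor at elementary vectors. Isometry of the representations turns both facts into norm bounds,
    for an arbitrary bounded f. *)
Lemma slice_bound (f : B -> C^o) (c : R) : 0 <= c -> linear f -> (forall b, nm (f b) <= c * nm b) ->
  forall l : seq (C * (A * B)), nm (lc (fun p => f p.2 *: p.1) l) <= c * nm (lc ep l).
Proof.
move=> c0 lf hf l; apply: (rep_isometric_dot rpi) => [|x x'].
  by rewrite mulr_ge0 ?nm_ge0.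
pose b := lc (fun p : A * B => dot x (pi p.1 x') *: p.2) l.
have -> : dot x (pi (lc (fun p : A * B => f p.2 *: p.1) l) x') = f b.
  rewrite (lc_lin (rep_lin1 rpi x')) (lc_lin (f := dot x : dH1 D -> C^o) (dot_lin x)) /b (lc_lin lf).
  apply: eq_bigr => p _ /=; congr (_ *: _).
  by rewrite (linZ (rep_lin1 rpi x')) dotZr (linZ lf) mulrC.
rewrite (le_trans (hf b)) // -!mulrA ler_wpM2l //.
apply: (rep_isometric_dot rsi) => [|y y']; first by rewrite !mulr_ge0 ?nm_ge0.
have -> : dot y (sigma b y') = dot (h x y) (Pi (lc ep l) (h x' y')).
  rewrite /b (lc_lin (rep_lin1 rsi y')) (lc_lin (rep_lin1 rPi _)).
  rewrite (lc_lin (f := dot y : dH2 D -> C^o) (dot_lin y)) (lc_lin (f := dot (h x y) : dH D -> C^o) (dot_lin _)).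
  apply: eq_bigr => p _ /=; congr (_ *: _).
  by rewrite (linZ (rep_lin1 rsi y')) dotZr act dot_h.
rewrite (le_trans (CauchySchwarz _ _)) // nm_h.
have := rep_contractive rPi (lc ep l) (h x' y'); rewrite nm_h => h1.
have -> : nm (lc ep l) * (nm x * nm x') * nm y * nm y' = nm x * nm y * (nm (lc ep l) * (nm x' * nm y')) by ring.
by rewrite ler_wpM2l // mulr_ge0 ?nm_ge0.
Qed.

Lemma lslice_bound (f : A -> C^o) (c : R) : 0 <= c -> linear f -> (forall a, nm (f a) <= c * nm a) ->
  forall l : seq (C * (A * B)), nm (lc (fun p => f p.1 *: p.2) l) <= c * nm (lc ep l).
Proof.
move=> c0 lf hf l; apply: (rep_isometric_dot rsi) => [|y y'].
  by rewrite mulr_ge0 ?nm_ge0.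
pose a := lc (fun p : A * B => dot y (sigma p.2 y') *: p.1) l.
have -> : dot y (sigma (lc (fun p : A * B => f p.1 *: p.2) l) y') = f a.
  rewrite (lc_lin (rep_lin1 rsi y')) (lc_lin (f := dot y : dH2 D -> C^o) (dot_lin y)) /a (lc_lin lf).
  apply: eq_bigr => p _ /=; congr (_ *: _).
  by rewrite (linZ (rep_lin1 rsi y')) dotZr (linZ lf) mulrC.
rewrite (le_trans (hf a)) // -!mulrA ler_wpM2l //.
apply: (rep_isometric_dot rpi) => [|x x']; first by rewrite !mulr_ge0 ?nm_ge0.
have -> : dot x (pi a x') = dot (h x y) (Pi (lc ep l) (h x' y')).
  rewrite /a (lc_lin (rep_lin1 rpi x')) (lc_lin (rep_lin1 rPi _)).
  rewrite (lc_lin (f := dot x : dH1 D -> C^o) (dot_lin x)) (lc_lin (f := dot (h x y) : dH D -> C^o) (dot_lin _)).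
  apply: eq_bigr => p _ /=; congr (_ *: _).
  by rewrite (linZ (rep_lin1 rpi x')) dotZr act dot_h mulrC.
rewrite (le_trans (CauchySchwarz _ _)) // nm_h.
have := rep_contractive rPi (lc ep l) (h x' y'); rewrite nm_h => h1.
have -> : nm (lc ep l) * (nm y * nm y') * nm x * nm x' = nm x * nm y * (nm (lc ep l) * (nm x' * nm y')) by ring.
by rewrite ler_wpM2l // mulr_ge0 ?nm_ge0.
Qed.

Definition vfun (y y' : dH2 D) : B -> C^o := fun b => dot y (sigma b y').

Lemma vfun_lin y y' : linear (vfun y y').
Proof. by move=> k b b'; rewrite /vfun (repP rsi) dotPr. Qed.
Lemma vfun_bound y y' b : nm (vfun y y' b) <= (nm y * nm y') * nm b.
Proof.
rewrite (le_trans (CauchySchwarz _ _)) // -mulrA ler_wpM2l ?nm_ge0 //.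
by rewrite mulrC rep_contractive.
Qed.

(** Coefficients of z at elementary vectors are coefficients of its slices by vector functionals.
    The slice enters as any [s] with the right values on elementary tensors, so that [slice] need
    not yet be known to be genuine. *)
Lemma tens_sep (z : A ⊗ B) : (forall y y' (s : A ⊗ B -> A), linear s ->
    bounded s -> (forall a b, s (elt a b) = vfun y y' b *: a) -> s z = 0) -> z = 0.
Proof.
move=> hz; apply: tens_ext => x' y'; rewrite (lin0 (rep_lin1 rPi _)).
apply: dense_dot => x y; rewrite dot0r.
have yy0 : 0 <= nm y * nm y' by rewrite mulr_ge0 ?nm_ge0.
have [s [ls bs sE]] := extend (V := A ⊗ B) (W := A) (g := ep) (g' := fun p => vfun y y' p.2 *: p.1)
  (c := nm y * nm y') yy0 tens_dense
  (slice_bound yy0 (@vfun_lin y y') (@vfun_bound y y')).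
have s0 : s z = 0.
  apply: (hz y y') => //; first by exists (nm y * nm y'); rewrite ?mulr_ge0 ?nm_ge0.
  by move=> a b; exact: (sE (a, b)).
have -> : dot (h x y) (Pi z (h x' y')) = dot x (pi (s z) x'); last first.
  by rewrite s0 (lin0 (rep_lin1 rpi x')) dot0r.
apply/eqP; rewrite -subr_eq0; apply/eqP.
pose F (w : A ⊗ B) : C^o := dot (h x y) (Pi w (h x' y')) - dot x (pi (s w) x').
have lF : linear F.
  move=> k u v; rewrite /F (repP rPi) dotPr (linP ls) (repP rpi) dotPr scalerBr.
  by rewrite opprD addrACA.
have bF : bounded F.
  exists (nm (h x y) * nm (h x' y') + nm x * nm x' * (nm y * nm y')).
    by rewrite addr_ge0 ?mulr_ge0 ?nm_ge0.
  move=> w; rewrite /F (le_trans (nmB _ _)) // mulrDl lerD //.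
    rewrite (le_trans (CauchySchwarz _ _)) // -mulrA ler_wpM2l ?nm_ge0 // mulrC.
    exact: (rep_contractive rPi).
  rewrite (le_trans (CauchySchwarz _ _)) // -!mulrA ler_wpM2l ?nm_ge0 //.
  rewrite (le_trans (rep_contractive rpi _ _)) // mulrC ler_wpM2l ?nm_ge0 //.
  by rewrite mulrA.
apply/nm_le0; rewrite -[0](mul0r (nm z)).
apply: (dense_bound (f := F) (g := ep)) => //; first exact: tens_dense.
move=> l; rewrite mul0r (lc_lin lF) (_ : lc _ _ = 0) ?nm0 //.
apply: big1 => p _; rewrite /= /F act dot_h (sE p.2) (linZ (rep_lin1 rpi x')) dotZr.
by rewrite mulrC subrr scaler0.
Qed.

End Basic.
End TensorData.

Section TotalEquality.
Variable R : realType.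
Local Notation C := R[i].

Lemma linclosed_eq (V : completeNormedModType C) (W : normedModType C) (f g : V -> W) :
  linear f -> linear g -> bounded f -> bounded g -> is_linclosed [set v | f v = g v].
Proof.
move=> lf lg [c c0 hc] [d d0 hd]; split => /=.
- by rewrite (lin0 lf) (lin0 lg).
- by move=> k u v e1 e2; rewrite (linP lf) (linP lg) e1 e2.
- move=> v hv; apply/eqP; rewrite -subr_eq0; apply/eqP; apply: nm_small => e e0.
  have k0 : 0 < c + d + 1 by lra.
  have [u /= uE vu] := hv (e / (c + d + 1)) ltac:(by rewrite divr_gt0).
  have -> : f v - g v = f (v - u) - g (v - u).
    by rewrite (linB lf) (linB lg) uE opprB addrA subrK.
  move: vu; rewrite ltr_pdivlMr // => vu.
  rewrite (le_trans (nmB _ _)) // (le_trans (lerD (hc _) (hd _))) //.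
  have := nm_ge0 (v - u); nra.
Qed.

Lemma total_eq (V : completeNormedModType C) (W : normedModType C) (f g : V -> W) (S : set V) :
  linear f -> linear g -> bounded f -> bounded g -> closed_span S = setT ->
  (forall s, S s -> f s = g s) -> forall v, f v = g v.
Proof.
move=> lf lg bf bg ST h; apply: (total_ind ST); last exact: h.
exact: linclosed_eq.
Qed.

Lemma linclosed_zero (V : completeNormedModType C) (W : normedModType C) (f : V -> W) :
  linear f -> bounded f -> is_linclosed [set v | f v = 0].
Proof.
move=> lf bf; apply: (linclosed_eq (g := fun=> 0)) => //.
  by move=> k u v; rewrite scaler0 addr0.
by exists 0 => // v; rewrite nm0 mul0r.
Qed.

Lemma bounded_comp (V W X : normedModType C) (f : W -> X) (g : V -> W) :
  bounded f -> bounded g -> bounded (fun v => f (g v)).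
Proof.
move=> [c c0 hc] [d d0 hd]; exists (c * d); first by rewrite mulr_ge0.
by move=> v; rewrite (le_trans (hc _)) // -mulrA ler_wpM2l.
Qed.
Lemma lin_comp (V W X : lmodType C) (f : W -> X) (g : V -> W) :
  linear f -> linear g -> linear (fun v => f (g v)).
Proof. by move=> lf lg k u v; rewrite (linP lg) (linP lf). Qed.
Lemma bounded_id (V : normedModType C) : bounded (@id V).
Proof. by exists 1 => // v; rewrite mul1r. Qed.

Lemma adj_lin_bounded (A B : cstarAlgebra R) (f : A -> B) : linear f -> bounded f ->
  linear (fun a => cadj (f (cadj a))) /\ bounded (fun a => cadj (f (cadj a))).
Proof.
move=> lf [c c0 hc]; split; last by exists c => // v; rewrite nm_adj -(nm_adj v).
by move=> k a b; rewrite cadjP (linP lf) cadjP conjCK.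
Qed.
End TotalEquality.

Section Slices.
Variables (R : realType) (T : tensorModel R).
Local Notation C := R[i].
Local Notation "A ⊗ B" := (tensor T A B).
Local Notation elt := (elt T).

Section BD.
Variable B : cstarAlgebra R.
Lemma bdual_lin (f : B -> C^o) : bdual f -> linear f. Proof. by case. Qed.
Lemma bdual_bounded (f : B -> C^o) : bdual f -> bounded f.
Proof. by case/bdualP. Qed.
Lemma bdualI (f : B -> C^o) : linear f -> bounded f -> bdual f.
Proof. by move=> lf bf; apply/bdualP. Qed.
End BD.
Lemma bdual_comp (A B : cstarAlgebra R) (f : B -> C^o) (s : A -> B) : bdual f -> linear s -> bounded s ->
  bdual (fun a => f (s a)).
Proof.
move=> bf ls bs; apply: bdualI.
  exact: (lin_comp (bdual_lin bf) ls).
exact: (bounded_comp (bdual_bounded bf) bs).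
Qed.
Section BD2.
Variable B : cstarAlgebra R.
Lemma bdual_mulr (f : B -> C^o) b : bdual f -> bdual (fun c => f (c *c b)).
Proof. by move=> bf; apply: bdual_comp => //; [exact: cmul_linl|exact: bounded_cmull]. Qed.
Lemma bdual_mull (f : B -> C^o) b : bdual f -> bdual (fun c => f (b *c c)).
Proof. by move=> bf; apply: bdual_comp => //; [exact: cmul_linr|exact: bounded_cmulr]. Qed.
Lemma bdual_adj (f : B -> C^o) : bdual f -> bdual (fun b => Num.conj (f (cadj b))).
Proof.
move=> bf; apply: bdualI.
  by move=> k a b; rewrite cadjP (linP (bdual_lin bf)) rmorphD rmorphM /= conjCK.
have [c c0 hc] := bdual_bounded bf; exists c => // b.
by rewrite nm_conj -(nm_adj b).
Qed.
End BD2.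

Section Two.
Variables A B : cstarAlgebra R.
Implicit Types (z w : A ⊗ B).

Lemma slice_spec (f : B -> C^o) : bdual f ->
  [/\ linear (slice f : A ⊗ B -> A), bounded (slice f : A ⊗ B -> A)
    & forall (a : A) (b : B), slice f (elt a b) = f b *: a].
Proof.
move=> /bdualP[lf [c c0 hc]].
have [s [ls bs sE]] := extend (V := A ⊗ B) (W := A) (g := @ep R T A B) (g' := fun p => f p.2 *: p.1)
  c0 (@tens_dense R T A B) (@slice_bound R T A B f c c0 lf hc).
have : exists h : A ⊗ B -> A, [/\ linear h, continuous h & forall (a : A) (b : B), h (elt a b) = f b *: a].
  exists s; split => //; first by apply: bounded_continuous => //; exists c.
  by move=> a b; exact: (sE (a, b)).
move=> /(the_spec (fun=> 0)) [] h1 h2 h3; split => //.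
exact: continuous_bounded.
Qed.

Definition lslice (f : A -> C^o) : A ⊗ B -> B :=
  the (fun=> 0) (fun h => [/\ linear h, bounded h & forall (a : A) (b : B), h (elt a b) = f a *: b]).

Lemma lslice_spec (f : A -> C^o) : bdual f ->
  [/\ linear (lslice f), bounded (lslice f) & forall (a : A) (b : B), lslice f (elt a b) = f a *: b].
Proof.
move=> /bdualP[lf [c c0 hc]].
have [s [ls bs sE]] := extend (V := A ⊗ B) (W := B) (g := @ep R T A B) (g' := fun p => f p.1 *: p.2)
  c0 (@tens_dense R T A B) (@lslice_bound R T A B f c c0 lf hc).
have ex : exists h : A ⊗ B -> B, [/\ linear h, bounded h & forall (a : A) (b : B), h (elt a b) = f a *: b].
  by exists s; split => //; [exists c|move=> a b; exact: (sE (a, b))].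
exact: (the_spec (fun=> 0) ex).
Qed.

Section Slice.
Variable f : B -> C^o.
Hypothesis bf : bdual f.
Lemma slice_lin : linear (slice f : A ⊗ B -> A). Proof. by case: (slice_spec bf). Qed.
Lemma slice_bounded : bounded (slice f : A ⊗ B -> A). Proof. by case: (slice_spec bf). Qed.
Lemma slice_elt (a : A) (b : B) : slice f (elt a b) = f b *: a. Proof. by case: (slice_spec bf). Qed.
End Slice.
Section LSlice.
Variable f : A -> C^o.
Hypothesis bf : bdual f.
Lemma lslice_lin : linear (lslice f). Proof. by case: (lslice_spec bf). Qed.
Lemma lslice_bounded : bounded (lslice f). Proof. by case: (lslice_spec bf). Qed.
Lemma lslice_elt (a : A) (b : B) : lslice f (elt a b) = f a *: b. Proof. by case: (lslice_spec bf). Qed.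
End LSlice.

Lemma slice_mull (f : B -> C^o) (a : A) (b : B) z : bdual f ->
  slice f (elt a b *c z) = a *c slice (fun c => f (b *c c)) z.
Proof.
move=> bf; have bf' := bdual_mull b bf.
apply: (total_eq (f := fun z => slice f (elt a b *c z)) (g := fun z => a *c slice (fun c => f (b *c c)) z) _ _ _ _ (tens_total T A B)).
- exact: (lin_comp (f := slice f) (slice_lin bf) (cmul_linr (elt a b))).
- exact: (lin_comp (f := cmul a) (cmul_linr a) (slice_lin bf')).
- exact: (bounded_comp (f := slice f) (slice_bounded bf) (bounded_cmulr (elt a b))).
- exact: (bounded_comp (f := cmul a) (bounded_cmulr a) (slice_bounded bf')).
- by move=> _ [a' [b' ->]]; rewrite eltM !slice_elt // cmulZr.
Qed.

Lemma slice_mulr (f : B -> C^o) (a : A) (b : B) z : bdual f ->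
  slice f (z *c elt a b) = slice (fun c => f (c *c b)) z *c a.
Proof.
move=> bf; have bf' := bdual_mulr b bf.
apply: (total_eq (f := fun z => slice f (z *c elt a b)) (g := fun z => slice (fun c => f (c *c b)) z *c a) _ _ _ _ (tens_total T A B)).
- exact: (lin_comp (f := slice f) (slice_lin bf) (cmul_linl (elt a b))).
- exact: (lin_comp (f := fun x : A => x *c a) (cmul_linl a) (slice_lin bf')).
- exact: (bounded_comp (f := slice f) (slice_bounded bf) (bounded_cmull (elt a b))).
- exact: (bounded_comp (f := fun x : A => x *c a) (bounded_cmull a) (slice_bounded bf')).
- by move=> _ [a' [b' ->]]; rewrite eltM !slice_elt // cmulZl.
Qed.

Lemma slice_sep z : (forall f, bdual f -> slice f z = 0) -> z = 0.
Proof.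
move=> hz; apply: tens_sep => y y' s ls bs sE.
have bf : bdual (@vfun R T A B y y').
  apply: bdualI; first exact: vfun_lin.
  exists (nm y * nm y'); first by rewrite mulr_ge0 ?nm_ge0.
  exact: vfun_bound.
rewrite -(hz _ bf); apply: (total_eq (f := s) ls (slice_lin bf) bs (slice_bounded bf) (tens_total T A B)).
by move=> _ [a [b ->]]; rewrite sE slice_elt.
Qed.

(** Slicing by g and then applying f bounds f ⊗ g for the minimal norm. This supplies the crude
    estimate that [hom_of_generators] asks for. *)
Lemma prod_functional_bound (f : A -> C^o) (g : B -> C^o) : bdual f -> bdual g ->
  exists2 c : R, 0 <= c & forall l, nm (lc (fun p => f p.1 * g p.2 : C^o) l) <= c * nm (lc (@ep R T A B) l).
Proof.
move=> bf bg.
have [c c0 hc] := bounded_comp (bdual_bounded bf) (slice_bounded bg).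
exists c => // l; have := hc (lc (@ep R T A B) l).
rewrite (lc_lin (lin_comp (bdual_lin bf) (slice_lin bg))).
rewrite (_ : lc _ l = lc (fun p => f p.1 * g p.2 : C^o) l) //.
by apply: eq_bigr => p _ /=; rewrite slice_elt // (linZ (bdual_lin bf)) mulrC.
Qed.

(** The functionals c |-> <b y, c y> in a faithful representation do the work of the Hahn-Banach
    theorem. *)
Lemma bdual_exists (b : B) : (forall f, bdual f -> f b = 0) -> b = 0.
Proof.
have [H [pi rep]] := exists_faithful_rep T B.
move=> hb; apply: (rep_inj rep) => y; rewrite (lin0 (rep_lin1 rep y)).
apply: nm_eq0; apply/eqP; rewrite -sqrf_eq0 -nm_dotxx; apply/eqP.
have -> : dot (pi b y) (pi b y) = 0; last by rewrite nm0.
apply: (hb (fun c => dot (pi b y) (pi c y))); apply: bdualI.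
  by move=> k c d; rewrite (repP rep) dotPr.
exists (nm (pi b y) * nm y); first by rewrite mulr_ge0 ?nm_ge0.
move=> c; rewrite (le_trans (CauchySchwarz _ _)) // -mulrA ler_wpM2l ?nm_ge0 //.
by rewrite mulrC rep_contractive.
Qed.

End Two.
End Slices.

Section Melt.
Variables (R : realType) (T : tensorModel R).
Local Notation "A ⊗ B" := (tensor T A B).
Local Notation elt := (elt T).
Variables A B : cstarAlgebra R.
Local Notation Pi := (dPi (t := td T A B)).
Let rPi : faithful_rep Pi := dPiP (td T A B).

Lemma adj_ml (D : cstarAlgebra R) (m : multiplier D) (a x : D) :
  cadj (ml m a) *c x = cadj a *c ml (madj m) x.
Proof. by rewrite ml_mr /= cadjK. Qed.
Lemma adj_mr (D : cstarAlgebra R) (m : multiplier D) (a : D) :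
  cadj (mr m a) = ml (madj m) (cadj a).
Proof. by rewrite /= cadjK. Qed.

(** This is [positive_contraction] for the C^*-algebra M(A): with a_i, b_i and x fixed, the map
    sending n to the sum of the (n a_i) ⊗ b_i applied to x meets its hypotheses, because multipliers
    move across inner products as their adjoints. *)
Lemma amp_l (m : MA A) l :
  nm (lc (fun p => elt (ml m p.1) p.2) l) <= nm m * nm (lc (@ep R T A B) l).
Proof.
apply: (rep_isometric rPi) => [|x]; first by rewrite mulr_ge0 ?nm_ge0.
pose F (n : MA A) := lc (fun p : A * B => Pi (elt (ml n p.1) p.2) x) l.
have key (n n' : MA A) p p' :
    dot (Pi (elt (ml n p.1) p.2) x) (Pi (elt (ml n' p'.1) p'.2) x) =
    dot (Pi (elt p.1 p.2) x) (Pi (elt (ml (cadj n *c n') p'.1) p'.2) x).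
  by rewrite !(rep_adj rPi) -!(repM rPi) !elt_adj !eltM adj_ml.
have -> : Pi (lc (fun p : A * B => elt (ml m p.1) p.2) l) x = F m.
  by rewrite (lc_lin (rep_lin1 rPi x)).
have F1 : F one = Pi (lc (@ep R T A B) l) x by rewrite (lc_lin (rep_lin1 rPi x)).
have := @positive_contraction R (MA A) _ F (F one).
move=> h; apply: (le_trans (h _ _ _ m)).
- apply: (lc_linfun (F := fun n p => Pi (elt (ml n p.1) p.2) x)) => p k n n' /=.
  by rewrite (linP (elt_linl T _)) (repP rPi).
- by move=> n n'; apply: dot_lc => p p'; rewrite key.
- move=> n; apply: dot_lc => p p'; rewrite -[p'.1]/(ml (one : MA A) p'.1) key.
  by rewrite one_r.
by rewrite F1 -mulrA ler_wpM2l ?nm_ge0 // rep_contractive.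
Qed.

Lemma amp_r (m : MA B) l :
  nm (lc (fun p => elt p.1 (ml m p.2)) l) <= nm m * nm (lc (@ep R T A B) l).
Proof.
apply: (rep_isometric rPi) => [|x]; first by rewrite mulr_ge0 ?nm_ge0.
pose F (n : MA B) := lc (fun p : A * B => Pi (elt p.1 (ml n p.2)) x) l.
have key (n n' : MA B) p p' :
    dot (Pi (elt p.1 (ml n p.2)) x) (Pi (elt p'.1 (ml n' p'.2)) x) =
    dot (Pi (elt p.1 p.2) x) (Pi (elt p'.1 (ml (cadj n *c n') p'.2)) x).
  by rewrite !(rep_adj rPi) -!(repM rPi) !elt_adj !eltM adj_ml.
have -> : Pi (lc (fun p : A * B => elt p.1 (ml m p.2)) l) x = F m.
  by rewrite (lc_lin (rep_lin1 rPi x)).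
have F1 : F one = Pi (lc (@ep R T A B) l) x by rewrite (lc_lin (rep_lin1 rPi x)).
have := @positive_contraction R (MA B) _ F (F one).
move=> h; apply: (le_trans (h _ _ _ m)).
- apply: (lc_linfun (F := fun n p => Pi (elt p.1 (ml n p.2)) x)) => p k n n' /=.
  by rewrite (linP (elt_linr T _)) (repP rPi).
- by move=> n n'; apply: dot_lc => p p'; rewrite key.
- move=> n; apply: dot_lc => p p'; rewrite -[p'.2]/(ml (one : MA B) p'.2) key.
  by rewrite one_r.
by rewrite F1 -mulrA ler_wpM2l ?nm_ge0 // rep_contractive.
Qed.

Lemma melt_op (m : MA A) (n : MA B) : exists L : A ⊗ B -> A ⊗ B,
  [/\ linear L, forall z, nm (L z) <= nm m * nm n * nm z & forall a b, L (elt a b) = elt (ml m a) (ml n b)].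
Proof.
have mn0 : 0 <= nm m * nm n by rewrite mulr_ge0 ?nm_ge0.
have [|L [lL bL LE]] := extend (V := A ⊗ B) (W := A ⊗ B) (g := @ep R T A B)
  (g' := fun p => elt (ml m p.1) (ml n p.2)) mn0 (@tens_dense R T A B).
  move=> l; have := amp_l m [seq (p.1, (p.2.1, ml n p.2.2)) | p <- l].
  rewrite /lc !big_map => h; rewrite (le_trans h) // -mulrA ler_wpM2l ?nm_ge0 //.
  exact: (amp_r n).
by exists L; split => // a b; exact: (LE (a, b)).
Qed.

(** The operators L for m, n and L' for the adjoints form a double centralizer, right multiplication
    being [cadj (L' (cadj z))]. *)
Lemma melt_exists (m : MA A) (n : MA B) : exists p : multiplier (A ⊗ B),
  forall a b, ml p (elt a b) = elt (ml m a) (ml n b).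
Proof.
have [L [lL bL LE]] := melt_op m n.
have [L' [lL' bL' LE']] := melt_op (cadj m) (cadj n).
have BL : bounded L by exists (nm m * nm n); rewrite ?mulr_ge0 ?nm_ge0.
have BL' : bounded L' by exists (nm (cadj m) * nm (cadj n)); rewrite ?mulr_ge0 ?nm_ge0.
have [lL2 BL2] := adj_lin_bounded lL' BL'.
have LR z w : z *c L w = cadj (L' (cadj z)) *c w.
  apply: (total_eq (f := fun z => z *c L w) (g := fun z => cadj (L' (cadj z)) *c w) _ _ _ _ (tens_total T A B)).
  - exact: cmul_linl.
  - exact: (lin_comp (f := fun x : A ⊗ B => x *c w) (cmul_linl w) lL2).
  - exact: bounded_cmull.
  - exact: (bounded_comp (f := fun x : A ⊗ B => x *c w) (bounded_cmull w) BL2).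
  move=> _ [a [b ->]].
  apply: (total_eq (f := fun w => elt a b *c L w) (g := cmul (cadj (L' (cadj (elt a b))))) _ _ _ _ (tens_total T A B)).
  - exact: (lin_comp (f := cmul (elt a b)) (cmul_linr _) lL).
  - exact: cmul_linr.
  - exact: (bounded_comp (f := cmul (elt a b)) (bounded_cmulr _) BL).
  - exact: bounded_cmulr.
  move=> _ [a' [b' ->]]; rewrite LE elt_adj LE' elt_adj !eltM !adj_ml !cadjK.
  by rewrite [madj (cadj m)]madjK [madj (cadj n)]madjK.
by exists (Multiplier LR).
Qed.

End Melt.

Section MeltCalculus.
Variables (R : realType) (T : tensorModel R).
Local Notation "A ⊗ B" := (tensor T A B).
Local Notation "m ⊗M n" := (melt T m n).
Local Notation elt := (elt T).

Lemma mult_total_ext (A : cstarAlgebra R) (S : set A) (m n : multiplier A) :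
  closed_span S = setT -> (forall a, S a -> ml m a = ml n a) -> m = n.
Proof.
move=> ST h; apply: mult_ext.
by apply: (total_eq (ml_linear m) (ml_linear n) (bounded_ml m) (bounded_ml n) ST).
Qed.

Section AB.
Variables A B : cstarAlgebra R.

Lemma ml_melt (m : multiplier A) (n : multiplier B) a b :
  ml (m ⊗M n) (elt a b) = elt (ml m a) (ml n b).
Proof. exact: (the_spec mzero (melt_exists T m n)). Qed.

Lemma tens_mult_ext (p q : multiplier (A ⊗ B)) :
  (forall a b, ml p (elt a b) = ml q (elt a b)) -> p = q.
Proof. by move=> h; apply: (mult_total_ext (tens_total T A B)) => _ [a [b ->]]. Qed.

Lemma meltP (m : multiplier A) (n : multiplier B) p :
  (forall a b, ml p (elt a b) = elt (ml m a) (ml n b)) -> p = m ⊗M n.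
Proof. by move=> h; apply: tens_mult_ext => a b; rewrite h ml_melt. Qed.

Lemma meltM (m m' : multiplier A) (n n' : multiplier B) :
  (m ⊗M n) *M (m' ⊗M n') = (m *M m') ⊗M (n *M n').
Proof. by apply: meltP => a b; rewrite /= !ml_melt. Qed.

Lemma melt_adj (m : multiplier A) (n : multiplier B) :
  madj (m ⊗M n) = madj m ⊗M madj n.
Proof.
apply: meltP => a b; apply: cancel_rP => z.
apply: (total_eq (f := fun z => z *c ml (madj (m ⊗M n)) (elt a b)) (g := fun z => z *c elt (ml (madj m) a) (ml (madj n) b)) _ _ _ _ (tens_total T A B)).
- exact: cmul_linl.
- exact: cmul_linl.
- exact: bounded_cmull.
- exact: bounded_cmull.
move=> _ [a' [b' ->]].
rewrite -[X in X *c _ = _](cadjK (elt a' b')) -adj_ml elt_adj ml_melt elt_adj !eltM.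
by rewrite !adj_ml !cadjK.
Qed.

Lemma melt11 : (mone ⊗M mone : multiplier (A ⊗ B)) = mone.
Proof. by apply/esym/meltP. Qed.

Lemma memb_elt (a : A) (b : B) : memb (elt a b) = memb a ⊗M memb b.
Proof. by apply: meltP => a' b'; rewrite /= eltM. Qed.

Lemma melt_linl (n : multiplier B) : linear (fun m : MA A => (m ⊗M n : MA (A ⊗ B))).
Proof.
move=> k m m'; apply/esym/meltP => a b.
by rewrite /= !ml_melt (linP (elt_linl T _)).
Qed.
Lemma melt_linr (m : multiplier A) : linear (fun n : MA B => (m ⊗M n : MA (A ⊗ B))).
Proof.
move=> k n n'; apply/esym/meltP => a b.
by rewrite /= !ml_melt (linP (elt_linr T _)).
Qed.

Lemma mr_melt (m : multiplier A) (n : multiplier B) a b :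
  mr (m ⊗M n) (elt a b) = elt (mr m a) (mr n b).
Proof.
rewrite -(cadjK (mr _ _)) adj_mr melt_adj elt_adj ml_melt elt_adj.
by rewrite -!adj_mr !cadjK.
Qed.

Lemma nm_melt (m : MA A) (n : MA B) : nm (m ⊗M n : MA (A ⊗ B)) <= nm m * nm n.
Proof.
have [L [lL bL LE]] := melt_op T m n.
have mn0 : 0 <= nm m * nm n by rewrite mulr_ge0 ?nm_ge0.
apply: nm_mlP => // z; rewrite (_ : ml _ z = L z) //.
apply: (total_eq (ml_linear _) lL (bounded_ml _) _ (tens_total T A B)).
  by exists (nm m * nm n).
by move=> _ [a [b ->]]; rewrite ml_melt LE.
Qed.

Lemma melt1_inj (a0 : A) : a0 <> 0 -> injective (fun n : multiplier B => (mone ⊗M n : multiplier (A ⊗ B))).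
Proof.
move=> a00 n n' h; apply: mult_ext => b.
have : ml (mone ⊗M n) (elt a0 b) = ml (mone ⊗M n') (elt a0 b) by rewrite h.
rewrite !ml_melt /= => e.
have e2 : elt a0 (ml n b - ml n' b) = 0 by rewrite (linB (elt_linr T _)) e subrr.
have := nm_elt T a0 (ml n b - ml n' b); rewrite e2 nm0 => /esym/eqP.
rewrite mulf_eq0 => /orP[/eqP/nm_eq0//|/eqP/nm_eq0/eqP].
by rewrite subr_eq0 => /eqP.
Qed.

End AB.
End MeltCalculus.

(** * Homomorphisms prescribed on generators *)

Section Generators.
Variable R : realType.
Local Notation C := R[i].

(** A spectral radius argument in scalar form. The first inequality forces p_n / a to be at least
    the 2^n-th power of p_0 / a; the second lets the square of p_n grow no faster than the powers of
    G with exponent 2^(n+1). Comparing growth rates leaves p_0 <= a G, whatever the constant c. *)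
Lemma power_trick (p : nat -> R) (a c G : R) : 0 <= a -> 0 <= c -> 0 <= G -> (forall n, 0 <= p n) ->
  (forall n, p n ^+ 2 <= a * p n.+1) -> (forall n, p n ^+ 2 <= c * G ^+ (2 ^ n.+1)) ->
  p 0%N <= a * G.
Proof.
move=> a0 c0 G0 p0 h1 h2; rewrite leNgt; apply/negP => lt.
have p00 : 0 < p 0%N by rewrite (le_lt_trans _ lt) // mulr_ge0.
have ap : 0 < a.
  rewrite lt_neqAle a0 andbT; apply/eqP => a00.
  by have := h1 0%N; rewrite -a00 mul0r leNgt exprn_gt0.
pose r n := p n / a.
have r0 n : 0 <= r n by rewrite divr_ge0.
have rr n : r n ^+ 2 <= r n.+1.
  rewrite /r expr_div_n ler_pdivrMr ?exprn_gt0 // [a ^+ 2]expr2 mulrA divfK ?gt_eqF //.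
  by rewrite [X in _ <= X]mulrC h1.
have rn n : r 0%N ^+ (2 ^ n) <= r n.
  elim: n => [|n IH]; first by rewrite expn0 expr1.
  rewrite (le_trans _ (rr n)) // expnSr exprM ler_pXn2r ?nnegrE //.
  by rewrite exprn_ge0.
have rG : G < r 0%N by rewrite ltr_pdivlMr // mulrC.
have bound n : r 0%N ^+ (2 ^ n.+1) <= c / a ^+ 2 * G ^+ (2 ^ n.+1).
  rewrite (@le_trans _ _ (r n ^+ 2)) //.
    by rewrite expnSr exprM ler_pXn2r ?nnegrE ?exprn_ge0.
  rewrite /r expr_div_n ler_pdivrMr ?exprn_gt0 // (le_trans (h2 n)) //.
  by rewrite [X in _ <= X]mulrAC divfK // expf_neq0 // gt_eqF.
have [G00|Gn0] := eqVneq G 0.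
  have := bound 0%N; rewrite G00 expn1 expr0n mulr0 leNgt exprn_gt0 //.
  by rewrite -G00.
have Gp : 0 < G by rewrite lt_neqAle eq_sym Gn0.
pose q := r 0%N / G.
have q1 : 1 < q by rewrite ltr_pdivlMr // mul1r.
have qb n : q ^+ (2 ^ n.+1) <= c / a ^+ 2.
  by rewrite /q expr_div_n ler_pdivrMr ?exprn_gt0.
have bern m : m%:R * (q - 1) <= q ^+ m.
  elim: m => [|m IH]; first by rewrite mul0r expr0 ler01.
  have q1m : 1 <= q ^+ m by rewrite exprn_ege1 // ltW.
  rewrite -natr1 mulrDl mul1r exprS.
  have : 0 <= (q - 1) * (q ^+ m - 1) by rewrite mulr_ge0 // subr_ge0 // ltW.
  nra.
pose N := Num.trunc (c / a ^+ 2 / (q - 1)).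
have := qb N; rewrite leNgt => /negP; apply.
rewrite (lt_le_trans _ (bern _)) // -ltr_pdivrMr ?subr_gt0 //.
rewrite (lt_le_trans (truncnS_gt _)) // ler_nat.
by rewrite ltnW // ltn_expl.
Qed.

(** The index set carries its own product and involution, so that formal combinations can be
    multiplied and starred before they are evaluated, in T by [g] and in M(Z) by [rho]. *)
Variables (T Z : cstarAlgebra R) (I : Type) (im : I -> I -> I) (ist : I -> I).
Variables (g : I -> T) (rho : I -> MA Z).
Hypotheses (gM : forall i j, g (im i j) = g i *c g j) (gS : forall i, g (ist i) = cadj (g i)).
Hypotheses (rM : forall i j, rho (im i j) = rho i *c rho j) (rS : forall i, rho (ist i) = cadj (rho i)).
Hypothesis gT : closed_span [set z | exists i, z = g i] = setT.
Variables (H : hilbertSpace R) (pi : Z -> H -> H).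
Hypothesis rep : faithful_rep pi.
Variables (J1 J2 : Type) (w : J1 -> Z) (x : J2 -> H).
Hypothesis dw : forall z (e : R), 0 < e -> exists l, nm (z - lc w l) < e.
Hypothesis dx : forall v (e : R), 0 < e -> exists l, nm (v - lc x l) < e.
Hypothesis crude : forall j1 j2 j1' j2', exists2 c : R, 0 <= c & forall l,
  nm (lc (fun i => dot (pi (w j1) (x j2)) (pi (ml (rho i) (w j1')) (x j2')) : C^o) l) <= c * nm (lc g l).

Let fm (l l' : seq (C * I)) := [seq (p.1 * q.1, im p.2 q.2) | p <- l, q <- l'].
Let fs (l : seq (C * I)) := [seq (Num.conj p.1, ist p.2) | p <- l].

Let lc_fm (A : cstarAlgebra R) (k : I -> A) l l' : (forall i j, k (im i j) = k i *c k j) ->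
  lc k (fm l l') = lc k l *c lc k l'.
Proof.
move=> kM; rewrite /lc /fm big_allpairs_dep /= cmul_suml; apply: eq_bigr => p _.
rewrite cmul_sumr; apply: eq_bigr => q _ /=.
by rewrite kM cmulZl cmulZr scalerA.
Qed.
Let lc_fs (A : cstarAlgebra R) (k : I -> A) l : (forall i, k (ist i) = cadj (k i)) ->
  lc k (fs l) = cadj (lc k l).
Proof.
move=> kS; rewrite /fs; elim: l => [|p l IH]; first by rewrite !lc_nil cadj0.
by rewrite /= !lc_cons IH cadjP kS.
Qed.

Let P (ys : seq (C * (J1 * J2))) (m : MA Z) : H := lc (fun j => pi (ml m (w j.1)) (x j.2)) ys.
Let P_dot ys ys' (m n : MA Z) : dot (P ys m) (P ys' n) = dot (P ys one) (P ys' (cadj m *c n)).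
Proof.
apply: dot_lc => j j'; rewrite !(rep_adj rep) -!(repM rep); congr dot; congr pi.
by rewrite adj_ml.
Qed.

Let crudeP ys ys' : exists2 c : R, 0 <= c & forall l,
  nm (dot (P ys one) (P ys' (lc rho l))) <= c * nm (lc g l).
Proof.
elim: ys => [|[k [j1 j2]] ys [c c0 hc]].
  by exists 0 => // l; rewrite /P lc_nil dot0l nm0 mul0r.
suff [d d0 hd] : exists2 d : R, 0 <= d & forall l,
    nm (dot (pi (w j1) (x j2)) (P ys' (lc rho l))) <= d * nm (lc g l).
  exists (nm k * d + c); first by rewrite addr_ge0 // mulr_ge0 ?nm_ge0.
  move=> l; rewrite {1}/P lc_cons dotDl dotZl mulrDl (le_trans (nmD _ _)) // lerD ?hc //.
  by rewrite nmM nm_conj -mulrA ler_wpM2l ?nm_ge0.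
clear c c0 hc; elim: ys' => [|[k' [j1' j2']] ys' [d d0 hd]].
  by exists 0 => // l; rewrite /P lc_nil dot0r nm0 mul0r.
have [e e0 he] := crude j1 j2 j1' j2'.
exists (nm k' * e + d); first by rewrite addr_ge0 // mulr_ge0 ?nm_ge0.
move=> l; rewrite /P lc_cons dotPr mulrDl (le_trans (nmD _ _)) // lerD ?hd //.
rewrite nmM -mulrA ler_wpM2l ?nm_ge0 // (le_trans _ (he l)) //.
rewrite (_ : dot _ _ = lc (fun i => dot (pi (w j1) (x j2)) (pi (ml (rho i) (w j1')) (x j2')) : C^o) l) //=.
have lF : linear (fun m : MA Z => dot (pi (w j1) (x j2)) (pi (ml m (w j1')) (x j2')) : C^o).
  by move=> s m n; rewrite /= (repP rep) dotPr.
by rewrite (lc_lin lF).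
Qed.

Let P_bound ys l : nm (P ys (lc rho l)) <= nm (P ys one) * nm (lc g l).
Proof.
pose hh := fix hh n := if n is k.+1 then fm (fs (hh k)) (hh k) else l.
have hg n : nm (lc g (hh n)) = nm (lc g l) ^+ (2 ^ n).
  elim: n => [|n IH]; first by rewrite expn0 expr1.
  by rewrite /= lc_fm // lc_fs // nm_adjM IH -exprM -expnSr.
have hr n : lc rho (hh n.+1) = cadj (lc rho (hh n)) *c lc rho (hh n).
  by rewrite [hh _]/= lc_fm // lc_fs.
pose pp n := nm (P ys (lc rho (hh n))).
have pd n : pp n ^+ 2 = nm (dot (P ys one) (P ys (lc rho (hh n.+1)))).
  by rewrite -nm_dotxx P_dot hr.
have [c c0 hc] := crudeP ys ys.
apply: (@power_trick pp _ c); rewrite ?nm_ge0 //.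
- by move=> n; exact: nm_ge0.
- by move=> n; rewrite pd CauchySchwarz.
- by move=> n; rewrite pd (le_trans (hc _)) // hg.
Qed.

Let rho_bound l : nm (lc rho l) <= 1 * nm (lc g l).
Proof.
rewrite mul1r; apply: nm_mlP => [|z]; first exact: nm_ge0.
apply: (rep_isometric rep) => [|v]; first by rewrite mulr_ge0 ?nm_ge0.
have key l1 l2 : nm (pi (ml (lc rho l) (lc w l1)) (lc x l2)) <= nm (lc g l) * nm (pi (lc w l1) (lc x l2)).
  pose ys := [seq (p.1 * q.1, (p.2, q.2)) | p <- l1, q <- l2].
  have E m : P ys m = pi (ml m (lc w l1)) (lc x l2).
    rewrite (lc_lin (ml_linear m)) (lc_lin (rep_lin1 rep _)) /P /ys /lc big_allpairs_dep /=.
    apply: eq_bigr => p _; rewrite (lin_sum (rep_lin rep _)) scaler_sumr; apply: eq_bigr => q _ /=.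
    by rewrite (linZ (rep_lin rep _)) scalerA.
  by have := P_bound ys l; rewrite !E mulrC.
set m := lc rho l.
have key2 l1 u : nm (pi (ml m (lc w l1)) u) <= nm (lc g l) * nm (lc w l1) * nm u.
  apply: (dense_bound (f := pi (ml m (lc w l1))) (g := x)) => //.
  - exact: (rep_lin rep).
  - exact: (bounded_rep rep).
  - by rewrite mulr_ge0 ?nm_ge0.
  by move=> l2; rewrite (le_trans (key _ _)) // -mulrA ler_wpM2l ?nm_ge0 // rep_contractive.
rewrite mulrAC; apply: (dense_bound (f := fun z => pi (ml m z) v) (g := w)) => //.
- exact: (lin_comp (f := fun z => pi z v) (rep_lin1 rep v) (ml_linear m)).
- exact: (bounded_comp (f := fun z => pi z v) (bounded_rep1 rep v) (bounded_ml m)).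
- by rewrite mulr_ge0 ?nm_ge0.
by move=> l1; rewrite (le_trans (key2 _ _)) // mulrAC.
Qed.

(* The norm of a *-homomorphism on generators is controlled by crude bounds on a total set
   of vectors: iterate |P h|^2 <= |P 1| |P (h^* h)|. *)
Theorem hom_of_generators : exists h : T -> MA Z, starhom h /\ forall i, h (g i) = rho i.
Proof.
have dg : forall v (e : R), 0 < e -> exists l, nm (v - lc g l) < e.
  by apply: total_approx; [exact: gT|move=> v [i ->]; exists i].
have [h [lh bh hE]] := extend (V := T) (W := MA Z) ler01 dg rho_bound.
have bb : bounded h by exists 1.
exists h; split => //; split => //.
- move=> a b.
  apply: (total_eq (f := fun a => h (a *c b)) (g := fun a => h a *c h b) _ _ _ _ gT).
  + exact: (lin_comp (f := h) lh (cmul_linl b)).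
  + exact: (lin_comp (f := fun m : MA Z => m *c h b) (cmul_linl (h b)) lh).
  + exact: (bounded_comp (f := h) bb (bounded_cmull b)).
  + exact: (bounded_comp (f := fun m : MA Z => m *c h b) (bounded_cmull (h b)) bb).
  move=> _ [i ->].
  apply: (total_eq (f := fun b => h (g i *c b)) (g := fun b => h (g i) *c h b) _ _ _ _ gT).
  + exact: (lin_comp (f := h) lh (cmul_linr (g i))).
  + exact: (lin_comp (f := cmul (h (g i))) (cmul_linr (h (g i))) lh).
  + exact: (bounded_comp (f := h) bb (bounded_cmulr (g i))).
  + exact: (bounded_comp (f := cmul (h (g i))) (bounded_cmulr (h (g i))) bb).
  by move=> _ [j ->]; rewrite -gM !hE rM.
- move=> a; rewrite -[LHS]cadjK; congr cadj.
  have [l2 b2] := adj_lin_bounded lh bb.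
  apply: (total_eq (f := fun a => cadj (h (cadj a))) (g := h) l2 lh b2 bb gT).
  by move=> _ [i ->]; rewrite -gS !hE rS cadjK.
Qed.

End Generators.

Section TensorHoms.
Variables (R : realType) (T : tensorModel R).
Local Notation C := R[i].
Local Notation "A ⊗ B" := (tensor T A B).
Local Notation "m ⊗M n" := (melt T m n).
Local Notation elt := (elt T).

Lemma total_range (V : completeNormedModType C) (I J : Type) (g : I -> J -> V) :
  closed_span [set z | exists i j, z = g i j] = setT ->
  closed_span [set z | exists p : I * J, z = g p.1 p.2] = setT.
Proof.
move=> h; apply: (total_sub h) => _ [i [j ->]]; apply: closed_span_sub.
by exists (i, j).
Qed.

Lemma vec_functional (A A' : cstarAlgebra R) (f : A -> MA A') (H : hilbertSpace R) (pi : A' -> H -> H)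
    (u v : H) (a : A') : starhom f -> faithful_rep pi ->
  bdual (fun c : A => dot u (pi (ml (f c) a) v) : C^o).
Proof.
move=> hf rep; apply: bdualI.
  by move=> k c c'; rewrite (starhom_lin hf) /= (repP rep) dotPr.
exists (nm u * nm a * nm v); first by rewrite !mulr_ge0 ?nm_ge0.
move=> c; rewrite (le_trans (CauchySchwarz _ _)) // -!mulrA ler_wpM2l ?nm_ge0 //.
rewrite (le_trans (rep_contractive rep _ _)) //.
have := nm_ml (f c) a; have := starhom_contractive hf c.
have := nm_ge0 v; have := nm_ge0 a; have := nm_ge0 c; have := nm_ge0 (f c).
move: (nm (ml (f c) a)) (nm (f c)) (nm c) (nm a) (nm v) => X F c' s t ? ? ? ? h1 h2.
rewrite mulrA; have : X <= s * c' by nra.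
nra.
Qed.

(** Between elementary vectors the matrix coefficients of f ⊗ g are products of a functional of A
    and one of B, hence bounded on A ⊗ B. [hom_of_generators] improves this crude bound to
    contractivity. *)
Theorem homtens_spec (A B A' B' : cstarAlgebra R) (f : A -> multiplier A') (g : B -> multiplier B') :
  mhom f -> mhom g -> mhom (homtens (T := T) f g) /\
  forall a b, homtens f g (elt a b) = f a ⊗M g b.
Proof.
move=> /mhom_starhom hf /mhom_starhom hg.
suff ex : exists h : A ⊗ B -> multiplier (A' ⊗ B'), mhom h /\ forall a b, h (elt a b) = f a ⊗M g b.
  exact: (the_spec (fun=> mzero) ex).
pose D := td T A' B'.
have [||||||||h [hh hE]] := @hom_of_generators R (A ⊗ B) (A' ⊗ B') (A * B)
  (fun p q => (p.1 *c q.1, p.2 *c q.2)) (fun p => (cadj p.1, cadj p.2))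
  (@ep R T A B) (fun p => f p.1 ⊗M g p.2) _ _ _ _ _ (dH D) (dPi (t := D)) (dPiP D)
  (A' * B')%type (dH1 D * dH2 D)%type (@ep R T A' B') (@hp R T A' B').
- by move=> p q; rewrite /ep eltM.
- by move=> p; rewrite /ep elt_adj.
- by move=> p q; rewrite /= (starhomM _ _ hf) (starhomM _ _ hg) [RHS]meltM.
- by move=> p; rewrite /= (starhom_adj _ hf) (starhom_adj _ hg) [RHS]melt_adj.
- exact: (total_range (tens_total T A B)).
- exact: tens_dense.
- exact: h_dense.
- move=> [a1 b1] [x y] [a1' b1'] [x' y'].
  have [c c0 hc] := prod_functional_bound T
    (vec_functional (dpi (t := D) a1 x) x' a1' hf (dpiP D))
    (vec_functional (dsig (t := D) b1 y) y' b1' hg (dsigP D)).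
  exists c => // l; apply: le_trans (hc l).
  rewrite le_eqVlt; apply/orP; left; apply/eqP; congr nm.
  by apply: eq_bigr => p _ /=; rewrite /ep ml_melt !dact dot_h.
exists h; split; first exact/mhom_starhom.
by move=> a b; exact: (hE (a, b)).
Qed.

Lemma memb_mhom (A : cstarAlgebra R) : mhom (@memb R A).
Proof.
by apply/mhom_starhom; split; [exact: mb_lin|move=> a b; exact: mbM|move=> a; exact: mb_adj].
Qed.

Lemma memb_hom (A B : cstarAlgebra R) (f : A -> B) : starhom f -> mhom (fun a => memb (f a)).
Proof.
move=> hf; apply/mhom_starhom; split.
- by move=> k a b; rewrite (starhom_lin hf); exact: mb_lin.
- by move=> a b; rewrite (starhomM _ _ hf); exact: mbM.
- by move=> a; rewrite (starhom_adj _ hf); exact: mb_adj.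
Qed.

Lemma starhom_of_memb (A B : cstarAlgebra R) (h : A -> multiplier B) :
  mhom h -> (forall a, exists b, h a = memb b) -> exists f : A -> B, starhom f /\ forall a, h a = memb (f a).
Proof.
move=> /mhom_starhom hh /choice [f hf]; exists f; split => //; split.
- by move=> k a b; apply: mb_inj; rewrite /mb -hf (starhom_lin hh) !hf; exact/esym/mb_lin.
- by move=> a b; apply: mb_inj; rewrite /mb -hf (starhomM _ _ hh) !hf; exact/esym/mbM.
- by move=> a; apply: mb_inj; rewrite /mb -hf (starhom_adj _ hh) !hf; exact/esym/mb_adj.
Qed.

End TensorHoms.

(* Making the model of the tensor product a class lets it be found in the context. *)
Existing Class tensorModel.

(** * Extension of nondegenerate homomorphisms *)

Section Extension.
Context {R : realType} {T : tensorModel R}.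

Section One.
Variables (A B : cstarAlgebra R) (f : A -> multiplier B).
Hypotheses (hf : mhom f) (nf : nondegenerate f).

Let sf : starhom (f : A -> MA B). Proof. exact/mhom_starhom. Qed.
Lemma mhom_lin : linear (f : A -> MA B). Proof. exact: starhom_lin sf. Qed.
Lemma mhomM a b : f (a *c b) = f a *M f b. Proof. by case: hf. Qed.
Lemma mhom_adj a : f (cadj a) = madj (f a). Proof. by case: hf. Qed.
Lemma mhom_contractive a : nm (f a : MA B) <= nm a.
Proof. exact: (starhom_contractive sf). Qed.
Lemma mhom_bounded : bounded (f : A -> MA B). Proof. exact: (starhom_bounded sf). Qed.

Let gen (p : A * B) : B := ml (f p.1) p.2.
Let gen_dense z (e : R) : 0 < e -> exists l, nm (z - lc gen l) < e.
Proof.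
have := total_approx (g := gen) nf; apply => _ [a [b ->]]; by exists (a, b).
Qed.

Let amp (m : MA A) l : nm (lc (fun p => ml (f (ml m p.1)) p.2) l) <= nm m * nm (lc gen l).
Proof.
have [H [pi rep]] := exists_faithful_rep T B.
apply: (rep_isometric rep) => [|x]; first by rewrite mulr_ge0 ?nm_ge0.
pose F (n : MA A) := lc (fun p : A * B => pi (ml (f (ml n p.1)) p.2) x) l.
have key (n n' : MA A) p p' :
    dot (pi (ml (f (ml n p.1)) p.2) x) (pi (ml (f (ml n' p'.1)) p'.2) x) =
    dot (pi (ml (f p.1) p.2) x) (pi (ml (f (ml (cadj n *c n') p'.1)) p'.2) x).
  rewrite !(rep_adj rep) -!(repM rep) !adj_ml -!mhom_adj.
  have e (a c : A) (b : B) : ml (f a) (ml (f c) b) = ml (f (a *c c)) b by rewrite mhomM.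
  by rewrite !e adj_ml.
have -> : pi (lc (fun p : A * B => ml (f (ml m p.1)) p.2) l) x = F m.
  by rewrite (lc_lin (rep_lin1 rep x)).
have F1 : F one = pi (lc gen l) x by rewrite (lc_lin (rep_lin1 rep x)).
have := @positive_contraction R (MA A) _ F (F one).
move=> h; apply: (le_trans (h _ _ _ m)).
- apply: (lc_linfun (F := fun n p => pi (ml (f (ml n p.1)) p.2) x)) => p k n n' /=.
  by rewrite mhom_lin /= (repP rep).
- by move=> n n'; apply: dot_lc => p p'; rewrite key.
- move=> n; apply: dot_lc => p p'; rewrite -[p'.1]/(ml (one : MA A) p'.1) key.
  by rewrite one_r.
by rewrite F1 -mulrA ler_wpM2l ?nm_ge0 // rep_contractive.
Qed.

Let ext_op (m : MA A) : exists L : B -> B,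
  [/\ linear L, bounded L & forall a b, L (ml (f a) b) = ml (f (ml m a)) b].
Proof.
have [L [lL bL LE]] := extend (V := B) (W := B) (g := gen) (g' := fun p => ml (f (ml m p.1)) p.2)
  (nm_ge0 m) gen_dense (amp m).
exists L; split => //; first by exists (nm m); rewrite ?nm_ge0.
by move=> a b; exact: (LE (a, b)).
Qed.

Lemma mext_exists (m : multiplier A) : exists n : multiplier B, forall a, n *M f a = f (ml m a).
Proof.
have [L [lL bL LE]] := ext_op m.
have [L' [lL' bL' LE']] := ext_op (madj m).
have [lL2 bL2] := adj_lin_bounded lL' bL'.
have gg (a c : A) (b d : B) : cadj (ml (f a) b) *c ml (f c) d = cadj b *c ml (f (cadj a *c c)) d.
  by rewrite adj_ml -mhom_adj mhomM.
have LL y w : cadj (L w) *c y = cadj w *c L' y.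
  apply: (total_eq (f := cmul (cadj (L w))) (g := fun y => cadj w *c L' y) _ _ _ _ nf).
  - exact: cmul_linr.
  - exact: (lin_comp (f := cmul (cadj w)) (cmul_linr _) lL').
  - exact: bounded_cmulr.
  - exact: (bounded_comp (f := cmul (cadj w)) (bounded_cmulr _) bL').
  move=> _ [a [b ->]]; rewrite -[LHS]cadjK -[RHS]cadjK; congr cadj.
  rewrite !cadjM !cadjK; move: (L' _) (LE' a b) => u ->.
  apply: (total_eq (f := fun w => cadj (ml (f a) b) *c L w) (g := cmul (cadj (ml (f (ml (madj m) a)) b))) _ _ _ _ nf).
  - exact: (lin_comp (f := cmul (cadj (ml (f a) b))) (cmul_linr _) lL).
  - exact: cmul_linr.
  - exact: (bounded_comp (f := cmul (cadj (ml (f a) b))) (bounded_cmulr _) bL).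
  - exact: bounded_cmulr.
  by move=> _ [c [d ->]]; rewrite LE !gg adj_ml [madj (madj m)]madjK.
have LR z w : z *c L w = cadj (L' (cadj z)) *c w.
  by rewrite -[LHS]cadjK cadjM LL cadjM cadjK.
by exists (Multiplier LR) => a; apply: mult_ext => b; exact: LE.
Qed.

Lemma mext_spec (m : multiplier A) a : mext f m *M f a = f (ml m a).
Proof. exact: (the_spec mzero (mext_exists m)). Qed.
Lemma ml_mext (m : multiplier A) a b : ml (mext f m) (ml (f a) b) = ml (f (ml m a)) b.
Proof. by rewrite -mext_spec. Qed.

Lemma nondeg_mult_ext (m n : multiplier B) : (forall a, m *M f a = n *M f a) -> m = n.
Proof.
move=> h; apply: (mult_total_ext nf) => _ [a [b ->]].
by have := congr1 (fun p => ml p b) (h a).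
Qed.

Lemma mextP (m : multiplier A) (n : multiplier B) : (forall a, n *M f a = f (ml m a)) -> n = mext f m.
Proof. by move=> h; apply: nondeg_mult_ext => a; rewrite h mext_spec. Qed.

Lemma mext_memb a : mext f (memb a) = f a.
Proof. by apply/esym/mextP => b; rewrite -mhomM. Qed.
Lemma mext_one : mext f mone = mone.
Proof. by apply/esym/mextP => a; exact: mult_ext. Qed.
Lemma mext_zero : mext f mzero = mzero.
Proof. by apply/esym/mextP => a; rewrite /= (lin0 mhom_lin); exact: mult_ext. Qed.
Lemma mextM (m n : multiplier A) : mext f (m *M n) = mext f m *M mext f n.
Proof.
by apply/esym/mextP => a; rewrite -mmulA !mext_spec.
Qed.
Lemma mext_lin : linear (mext f : MA A -> MA B).
Proof.
move=> k m n; apply/esym/mextP => a.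
rewrite [LHS](_ : _ = k *: (mext f m *M f a : MA B) + (mext f n *M f a)); last exact: mult_ext.
by rewrite !mext_spec -mhom_lin.
Qed.
Lemma mext_adj (m : multiplier A) : mext f (madj m) = madj (mext f m).
Proof.
apply/esym/mextP => a.
rewrite -[LHS]madjK madjM [madj (madj (mext _ _))]madjK.
apply: (can_inj (@madjK R B)); rewrite madjK -!mhom_adj.
apply: nondeg_mult_ext => c.
rewrite -mmulA mext_spec -!mhomM.
by rewrite adj_ml [madj (madj m)]madjK.
Qed.
Lemma mext_starhom : starhom (mext f : MA A -> MA B).
Proof. by split; [exact: mext_lin|exact: mextM|exact: mext_adj]. Qed.
Lemma nm_mext (m : MA A) : nm (mext f m : MA B) <= nm m.
Proof. exact: (starhom_contractive mext_starhom m). Qed.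

End One.

Lemma total_mul (A : cstarAlgebra R) (S : set A) : closed_span S = setT ->
  closed_span [set x | exists a b, S a /\ S b /\ x = a *c b] = setT.
Proof.
move=> ST; apply/seteqP; split => // v _.
have lc1 := closed_span_linclosed [set x | exists a b, S a /\ S b /\ x = a *c b].
have [P0 PD Pc] := lc1.
have step1 b : S b -> forall a, closed_span [set x | exists a b, S a /\ S b /\ x = a *c b] (a *c b).
  move=> Sb; apply: (total_ind ST) => [|a Sa]; last by apply: closed_span_sub; exists a, b.
  split; first by rewrite cmul0l.
    by move=> k u w hu hw; rewrite cmulDl cmulZl; exact: PD.
  move=> u hu; apply: Pc => e e0.
  have b0 : 0 < nm b + 1 by have := nm_ge0 b; lra.
  have [w hw uw] := hu (e / (nm b + 1)) ltac:(by rewrite divr_gt0).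
  exists (w *c b) => //; rewrite -cmulBl (le_lt_trans (nmMle _ _)) //.
  move: uw; rewrite ltr_pdivlMr //; have := nm_ge0 (u - w); nra.
have step2 a : forall b, closed_span [set x | exists a b, S a /\ S b /\ x = a *c b] (a *c b).
  apply: (total_ind ST) => [|b Sb]; last exact: step1.
  split; first by rewrite cmul0r.
    by move=> k u w hu hw; rewrite cmulDr cmulZr; exact: PD.
  move=> u hu; apply: Pc => e e0.
  have b0 : 0 < nm a + 1 by have := nm_ge0 a; lra.
  have [w hw uw] := hu (e / (nm a + 1)) ltac:(by rewrite divr_gt0).
  exists (a *c w) => //; rewrite -cmulBr (le_lt_trans (nmMle _ _)) // mulrC.
  move: uw; rewrite ltr_pdivlMr //; have := nm_ge0 (u - w); nra.
apply: Pc => e e0; have [x hx _] := approx_unit v e0; by exists (v *c x).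
Qed.

Lemma memb_nondeg (A : cstarAlgebra R) : nondegenerate (@memb R A).
Proof.
apply/seteqP; split => // v _; apply/closureP_nm => e e0.
have [x hx _] := approx_unit v e0; exists (v *c x) => //.
by apply: cspan_sub; exists v, x.
Qed.

Lemma mext_memb_id (A : cstarAlgebra R) (m : multiplier A) : mext (@memb R A) m = m.
Proof. by apply/esym/mextP; [exact: memb_mhom|exact: memb_nondeg|move=> a; exact: (@mul_mb R A m a)]. Qed.

Section Composition.
Variables (A B D : cstarAlgebra R) (f : A -> multiplier B) (g : B -> multiplier D).
Hypotheses (hf : mhom f) (nf : nondegenerate f) (hg : mhom g) (ng : nondegenerate g).

Lemma comp_mhom (h : A -> multiplier B) : mhom h -> mhom (fun a => mext g (h a)).
Proof.
move=> /mhom_starhom hh; have eg := mext_starhom hg ng.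
apply/mhom_starhom; split.
- exact: (lin_comp (starhom_lin eg) (starhom_lin hh)).
- by move=> a b; rewrite (starhomM _ _ hh) (starhomM _ _ eg).
- by move=> a; rewrite (starhom_adj _ hh) (starhom_adj _ eg).
Qed.

Lemma comp_nondeg : nondegenerate (fun a => mext g (f a)).
Proof.
apply: (total_sub ng) => _ [b [d ->]].
apply: (total_ind nf (P := fun b => closed_span [set x | exists a b, x = ml (mext g (f a)) b] (ml (g b) d))).
  have [P0 PD Pc] := closed_span_linclosed [set x | exists a b, x = ml (mext g (f a)) b].
  split.
  - by rewrite (lin0 (mhom_lin hg)).
  - by move=> k u v hu hv; rewrite (mhom_lin hg); exact: PD.
  - move=> v hv; apply: Pc => e e0.
    have d0 : 0 < nm d + 1 by have := nm_ge0 d; lra.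
    have [u hu uv] := hv (e / (nm d + 1)) ltac:(by rewrite divr_gt0).
    exists (ml (g u) d) => //.
    rewrite (_ : _ - _ = ml (g (v - u) : MA D) d); last first.
      by rewrite (linB (mhom_lin hg)) /= scaleN1r.
    rewrite (le_lt_trans (nm_ml _ _)) //.
    have := mhom_contractive hg (v - u); move: uv; rewrite ltr_pdivlMr //.
    have := nm_ge0 (v - u); have := nm_ge0 d; have := nm_ge0 (g (v - u) : MA D); nra.
move=> _ [a [b' ->]]; apply: closed_span_sub; exists a, (ml (g b') d).
by rewrite ml_mext.
Qed.

Lemma mext_comp (m : multiplier A) : mext g (mext f m) = mext (fun a => mext g (f a)) m.
Proof.
apply: mextP; [exact: comp_mhom|exact: comp_nondeg|].
by move=> a; rewrite -mextM // mext_spec.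
Qed.
End Composition.

End Extension.

Section TensorExtension.
Context {R : realType} {T : tensorModel R}.
Local Notation "A ⊗ B" := (tensor T A B).
Local Notation "m ⊗M n" := (melt T m n).
Local Notation elt := (elt T).

Lemma total_elt (A B : cstarAlgebra R) (S : set A) (S' : set B) :
  closed_span S = setT -> closed_span S' = setT ->
  closed_span [set z : A ⊗ B | exists a b, [/\ S a, S' b & z = elt a b]] = setT.
Proof.
move=> ST ST'; apply: (total_sub (tens_total T A B)) => _ [a [b ->]].
set U := [set z | _].
have [P0 PD Pc] := closed_span_linclosed U.
move: b; apply: (total_ind ST') => [|b Sb].
  split; first by rewrite (lin0 (elt_linr T _)).
    by move=> k u v hu hv; rewrite (linP (elt_linr T _)); exact: PD.
  move=> v hv; apply: Pc => e e0.
  have a0 : 0 < nm a + 1 by have := nm_ge0 a; lra.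
  have [u hu uv] := hv (e / (nm a + 1)) ltac:(by rewrite divr_gt0).
  exists (elt a u) => //; rewrite -(linB (elt_linr T _)) nm_elt mulrC.
  move: uv; rewrite ltr_pdivlMr //; have := nm_ge0 (v - u); nra.
move: a; apply: (total_ind ST) => [|a Sa]; last by apply: closed_span_sub; exists a, b.
split; first by rewrite (lin0 (elt_linl T _)).
  by move=> k u v hu hv; rewrite (linP (elt_linl T _)); exact: PD.
move=> v hv; apply: Pc => e e0.
have a0 : 0 < nm b + 1 by have := nm_ge0 b; lra.
have [u hu uv] := hv (e / (nm b + 1)) ltac:(by rewrite divr_gt0).
exists (elt u b) => //; rewrite -(linB (elt_linl T _)) nm_elt.
move: uv; rewrite ltr_pdivlMr //; have := nm_ge0 (v - u); nra.
Qed.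

Section HT.
Variables (A B A' B' : cstarAlgebra R) (f : A -> multiplier A') (g : B -> multiplier B').
Hypotheses (hf : mhom f) (hg : mhom g).
Local Notation H := (homtens (T := T) f g).

Lemma homtens_mhom : mhom H. Proof. by case: (homtens_spec T hf hg). Qed.
Lemma homtens_elt a b : H (elt a b) = f a ⊗M g b. Proof. by case: (homtens_spec T hf hg). Qed.

Lemma homtens_uniq (h : A ⊗ B -> multiplier (A' ⊗ B')) : mhom h ->
  (forall a b, h (elt a b) = f a ⊗M g b) -> forall x, h x = H x.
Proof.
move=> hh e; apply: (total_eq (mhom_lin hh) (mhom_lin homtens_mhom) (mhom_bounded hh) (mhom_bounded homtens_mhom) (tens_total T A B)).
by move=> _ [a [b ->]]; rewrite homtens_elt e.
Qed.

Hypotheses (nf : nondegenerate f) (ng : nondegenerate g).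

Lemma homtens_nondeg : nondegenerate H.
Proof.
apply: (total_sub (total_elt nf ng)) => _ [_ [_ [[a [a' ->]] [b [b' ->]] ->]]].
by apply: closed_span_sub; exists (elt a b), (elt a' b'); rewrite homtens_elt ml_melt.
Qed.

Lemma mext_homtens_melt (m : multiplier A) (n : multiplier B) :
  mext H (m ⊗M n) = mext f m ⊗M mext g n.
Proof.
apply/esym; apply: (mextP homtens_mhom homtens_nondeg) => z.
apply: (total_eq (f := fun z => (mext f m ⊗M mext g n) *M H z : MA (A' ⊗ B')) (g := fun z => H (ml (m ⊗M n) z) : MA (A' ⊗ B')) _ _ _ _ (tens_total T A B)).
- exact: (lin_comp (f := @cmul R (MA (A' ⊗ B')) _) (cmul_linr _) (mhom_lin homtens_mhom)).
- exact: (lin_comp (f := H : A ⊗ B -> MA (A' ⊗ B')) (mhom_lin homtens_mhom) (ml_linear _)).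
- exact: (bounded_comp (f := @cmul R (MA (A' ⊗ B')) _) (bounded_cmulr _) (mhom_bounded homtens_mhom)).
- exact: (bounded_comp (f := H : A ⊗ B -> MA (A' ⊗ B')) (mhom_bounded homtens_mhom) (bounded_ml _)).
by move=> _ [a [b ->]]; rewrite ml_melt !homtens_elt meltM !mext_spec.
Qed.
End HT.

Lemma homtens_comp (A B A1 B1 A2 B2 : cstarAlgebra R)
    (f : A -> multiplier A1) (g : B -> multiplier B1) (f' : A1 -> multiplier A2) (g' : B1 -> multiplier B2) :
  mhom f -> mhom g -> mhom f' -> mhom g' -> nondegenerate f' -> nondegenerate g' ->
  forall x, mext (homtens (T := T) f' g') (homtens f g x) =
    homtens (fun a => mext f' (f a)) (fun b => mext g' (g b)) x.
Proof.
move=> hf hg hf' hg' nf' ng'; apply: homtens_uniq.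
- exact: comp_mhom.
- exact: comp_mhom.
- apply: comp_mhom; [exact: homtens_mhom|exact: homtens_nondeg|exact: homtens_mhom].
by move=> a b; rewrite homtens_elt // mext_homtens_melt.
Qed.

End TensorExtension.

Section MultiplierUnit.
Variables (R : realType) (A : cstarAlgebra R).
Implicit Types m : multiplier A.
Lemma mmul1 m : m *M mone = m. Proof. exact: mult_ext. Qed.
Lemma mmul1l m : mone *M m = m. Proof. exact: mult_ext. Qed.
Lemma madj_mone : madj mone = mone :> multiplier A.
Proof. by apply: mult_ext => a /=; rewrite cadjK. Qed.
End MultiplierUnit.

Section MlLinear.
Variables (R : realType) (A : cstarAlgebra R).
Implicit Types (m : multiplier A) (a b : A).
Lemma ml0 m : ml m 0 = 0. Proof. exact: (lin0 (ml_linear m)). Qed.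
Lemma mlP m (k : R[i]) a b : ml m (k *: a + b) = k *: ml m a + ml m b.
Proof. exact: (ml_linear m). Qed.
Lemma mlB m a b : ml m (a - b) = ml m a - ml m b. Proof. exact: (linB (ml_linear m)). Qed.
Lemma mlD m a b : ml m (a + b) = ml m a + ml m b. Proof. exact: (linD (ml_linear m)). Qed.
Lemma mlZ m (k : R[i]) a : ml m (k *: a) = k *: ml m a. Proof. exact: (linZ (ml_linear m)). Qed.
End MlLinear.

Section NormContinuity.
Variables (R : realType) (X : topologicalType).
Local Notation C := R[i].

Lemma continuous_nmP (V : normedModType C) (f : X -> V) :
  continuous f <-> forall x (e : R), 0 < e -> \forall y \near x, nm (f x - f y) < e.
Proof.
split=> [cf x e e0|h x].
  have /cvgrPdist_lt /(_ e%:C) := cf x; rewrite ltcR => /(_ e0).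
  by apply: filterS => y; rewrite nmE ltcR.
apply/cvgrPdist_lt => e e0.
have [e' eE] : exists r : R, e = r%:C.
  by exists (complex.Re e); move: e0; case: e => a b; rewrite ltcE /= => /andP[/eqP -> _].
subst e; rewrite ltcR in e0.
by have := h x e' e0; apply: filterS => y; rewrite nmE ltcR.
Qed.

(** The uniform bound on the multipliers reduces strict continuity to a total set of vectors. *)
Lemma strict_continuity (D : cstarAlgebra R) (S : set D) (v : X -> multiplier D) :
  closed_span S = setT -> (forall s, nm (v s : MA D) <= 1) ->
  (forall d, S d -> continuous (fun s => ml (v s) d)) ->
  forall d, continuous (fun s => ml (v s) d).
Proof.
move=> ST v1; apply: (total_ind ST); split.
- apply/continuous_nmP => x e e0; apply: nearW => y.
  by rewrite !ml0 subrr nm0.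
- move=> k a b /continuous_nmP ca /continuous_nmP cb; apply/continuous_nmP => x e e0.
  have k0 : 0 < nm k + 1 by have := nm_ge0 k; lra.
  have := ca x (e / 2 / (nm k + 1)) ltac:(by rewrite !divr_gt0).
  have := cb x (e / 2) ltac:(by rewrite divr_gt0).
  apply: filterS2 => y h1 h2; rewrite !mlP.
  rewrite opprD addrACA -scalerBr (le_lt_trans (nmD _ _)) // nmZ.
  move: h2; rewrite ltr_pdivlMr // => h2.
  have := nm_ge0 k; have := nm_ge0 (ml (v x) a - ml (v y) a); nra.
- move=> d hd; apply/continuous_nmP => x e e0.
  have [a /continuous_nmP ca da] := hd (e / 3) ltac:(by rewrite divr_gt0).
  have := ca x (e / 3) ltac:(by rewrite divr_gt0).
  apply: filterS => y h.
  have -> : ml (v x) d - ml (v y) d = ml (v x) (d - a) + (ml (v x) a - ml (v y) a) - ml (v y) (d - a).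
    by rewrite !mlB; cmod R D.
  have h1 := nmB (ml (v x) (d - a) + (ml (v x) a - ml (v y) a)) (ml (v y) (d - a)).
  have h2 := nmD (ml (v x) (d - a)) (ml (v x) a - ml (v y) a).
  have h3 := nm_ml (v x) (d - a); have h4 := nm_ml (v y) (d - a).
  have := v1 x; have := v1 y; have := nm_ge0 (d - a); nra.
Qed.

End NormContinuity.

(** * Group C*-algebras and the unitary w_G *)

Section GroupModel.
Context {R : realType} {G : TopologicalGroup.type} {T : tensorModel R}.
Hypothesis hG : locally_compact_group G.
Variable S : groupModel R G.
Local Notation C := R[i].
Local Notation cstar := (cstarAlgebra R).
Local Notation "m ⊗M n" := (melt T m n).
Local Notation elt := (elt T).
Local Notation CG := (CG S).
Local Notation C0 := (C0 S).
Local Notation u := (@uG R G S).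

Lemma uG_rep : unitary_rep u. Proof. by case: (CG_P S). Qed.

Lemma gint_spec (D : cstar) (v : G -> multiplier D) : unitary_rep v -> integrates u v (gint (S := S) v).
Proof.
move=> hv; have [_ /(_ D v hv) [phi [h _]]] := CG_P S.
by apply: the_spec; exists phi.
Qed.

Lemma gint_uniq (D : cstar) (v : G -> multiplier D) phi : unitary_rep v -> integrates u v phi -> phi = gint (S := S) v.
Proof.
move=> hv h; have [_ /(_ D v hv) [psi [_ uniq]]] := CG_P S.
by rewrite -(uniq _ h) -(uniq _ (gint_spec hv)).
Qed.

Section Unitary.
Variables (D : cstar) (v : G -> multiplier D).
Hypothesis hv : unitary_rep v.
Lemma urep1 : v 1%g = mone. Proof. by case: hv. Qed.
Lemma urepM s t : v (s * t)%g = v s *M v t. Proof. by case: hv. Qed.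
Lemma urep_adj s : madj (v s) = v (s^-1)%g. Proof. by case: hv. Qed.
Lemma urep_cont d : continuous (fun s => ml (v s) d). Proof. by case: hv. Qed.
Lemma urepV s : v s *M madj (v s) = mone.
Proof. by rewrite urep_adj -urepM mulgV urep1. Qed.
Lemma urepVl s : madj (v s) *M v s = mone.
Proof. by rewrite urep_adj -urepM mulVg urep1. Qed.
Lemma nm_urep s : nm (v s : MA D) <= 1.
Proof. by apply: (nm_isometry (@one_l R D)); exact: urepVl. Qed.
End Unitary.

Lemma tensor_rep (D D' : cstar) (v : G -> multiplier D) (w : G -> multiplier D') :
  unitary_rep v -> unitary_rep w -> unitary_rep (fun s => v s ⊗M w s).
Proof.
move=> hv hw; split.
- by rewrite (urep1 hv) (urep1 hw) melt11.
- by move=> s t; rewrite (urepM hv) (urepM hw) meltM.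
- by move=> s; rewrite melt_adj (urep_adj hv) (urep_adj hw).
apply: (strict_continuity (tens_total T D D')).
  move=> s; rewrite (le_trans (nm_melt T _ _)) // mulr_ile1 ?nm_ge0 //.
    exact: (nm_urep hv).
  exact: (nm_urep hw).
move=> _ [a [b ->]]; apply/continuous_nmP => s e e0.
have e1 : 0 < e / 2 / (nm a + nm b + 1).
  by rewrite !divr_gt0 //; have := nm_ge0 a; have := nm_ge0 b; lra.
have /continuous_nmP /(_ s _ e1) h1 := urep_cont hv (d := a).
have /continuous_nmP /(_ s _ e1) h2 := urep_cont hw (d := b).
apply: filterS2 h1 h2 => t h1 h2; rewrite !ml_melt.
have -> : elt (ml (v s) a) (ml (w s) b) - elt (ml (v t) a) (ml (w t) b) =
    elt (ml (v s) a - ml (v t) a) (ml (w s) b) + elt (ml (v t) a) (ml (w s) b - ml (w t) b).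
  by rewrite (linB (elt_linr T _)) (linB (elt_linl T _)) addrA subrK.
rewrite (le_lt_trans (nmD _ _)) // !nm_elt.
have := nm_ml (w s) b; have := nm_ml (v t) a; have := nm_urep hv t; have := nm_urep hw s.
move: h1 h2; have c0 : 0 < nm a + nm b + 1 by have := nm_ge0 a; have := nm_ge0 b; lra.
rewrite !ltr_pdivlMr //; have := nm_ge0 a; have := nm_ge0 b.
have := nm_ge0 (ml (v s) a - ml (v t) a); have := nm_ge0 (ml (w s) b - ml (w t) b).
have := nm_ge0 (ml (v t) a); have := nm_ge0 (ml (w s) b).
set x := nm (_ - _); set y := nm (_ - _); set p := nm (ml _ _); set q := nm (ml _ _).
move: (nm (w s : MA D')) (nm (v t : MA D)) => ws vt.
move=> q0 p0 y0 x0 b0 a0 h1 h2 ws1 vt1 pa qb.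
have pa' : p <= nm b by nra.
have qa' : q <= nm a by nra.
nra.
Qed.

Lemma integrates_memb : integrates u u (@memb R CG).
Proof.
split; [exact: memb_mhom|exact: memb_nondeg|by move=> s; exact: mext_memb_id].
Qed.

Lemma integrates_comp (D D' : cstar) (v : G -> multiplier D) (phi : CG -> multiplier D)
    (psi : D -> multiplier D') : mhom psi -> nondegenerate psi -> integrates u v phi ->
  integrates u (fun s => mext psi (v s)) (fun c => mext psi (phi c)).
Proof.
move=> hpsi npsi [hphi nphi e]; split.
- exact: comp_mhom.
- exact: comp_nondeg.
- by move=> s; rewrite -mext_comp // e.
Qed.

Lemma mext_rep (D D' : cstar) (v : G -> multiplier D) (psi : D -> multiplier D') :
  mhom psi -> nondegenerate psi -> unitary_rep v -> unitary_rep (fun s => mext psi (v s)).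
Proof.
move=> hpsi npsi hv; split.
- by rewrite (urep1 hv) mext_one.
- by move=> s t; rewrite (urepM hv) mextM.
- by move=> s; rewrite -mext_adj // (urep_adj hv).
apply: (strict_continuity npsi).
  by move=> s; rewrite (le_trans (nm_mext hpsi npsi _)) // (nm_urep hv).
move=> _ [d [d' ->]]; apply/continuous_nmP => s e e0.
have c0 : 0 < nm d' + 1 by have := nm_ge0 d'; lra.
have e1 : 0 < e / (nm d' + 1) by rewrite divr_gt0.
have /continuous_nmP /(_ s _ e1) := urep_cont hv (d := d).
apply: filterS => t; rewrite !ml_mext // ltr_pdivlMr // => h.
rewrite (_ : _ - _ = ml (psi (ml (v s) d - ml (v t) d) : MA D') d'); last first.
  by rewrite (linB (mhom_lin hpsi)) /= scaleN1r.
rewrite (le_lt_trans (nm_ml _ _)) //.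
have := mhom_contractive hpsi (ml (v s) d - ml (v t) d).
have := nm_ge0 (ml (v s) d - ml (v t) d); have := nm_ge0 d'.
have := nm_ge0 (psi (ml (v s) d - ml (v t) d) : MA D'); nra.
Qed.

(** Both sides integrate the same representation, so uniqueness in the universal property identifies
    them. Identities between representations of G are transported to C^*(G) in this way. *)
Lemma gint_mext (D D' : cstar) (v : G -> multiplier D) (psi : D -> multiplier D') :
  mhom psi -> nondegenerate psi -> unitary_rep v ->
  forall c, mext psi (gint (S := S) v c) = gint (S := S) (fun s => mext psi (v s)) c.
Proof.
move=> hpsi npsi hv c.
have := integrates_comp hpsi npsi (gint_spec hv).
by move/(gint_uniq (mext_rep hpsi npsi hv)) => /(congr1 (fun F => F c)).
Qed.

(* Translate a function with nonzero Haar integral. *)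
Lemma C0_nonvanishing s : exists f : C0, ev s f <> 0.
Proof.
have [cM cV _ _] := hG; have [IL _ [f cf If] _ _] := haarP S.
have [_ [K cK fK]] := cf.
have [s0 fs0] : exists s0, f s0 <> 0.
  apply: contrapT => h; apply: If.
  have f0 t : f t = 0 by apply: contrapT => ft; apply: h; exists t.
  have fE : f = (fun t => (-1) * f t + f t) by apply/funext => t; rewrite f0 mulr0 addr0.
  by rewrite fE (IL (-1) f f cf cf) mulN1r addNr.
have [_ _ _ _ h] := C0_P S.
pose g t := f (s0 * (s^-1 * t))%g.
have ct (r : G) : continuous (fun t : G => (r * t)%g).
  move=> t; apply: (@continuous_comp _ _ _ (fun t : G => (r, t)) (fun p : G * G => (p.1 * p.2)%g)); last exact: cM.
  by apply: cvg_pair; [exact: cvg_cst|exact: cvg_id].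
have cg : continuous g.
  move=> t; rewrite /g.
  apply: (@continuous_comp _ _ _ (fun t : G => (s^-1 * t)%g) (fun t => f (s0 * t)%g)); first exact: ct.
  apply: (@continuous_comp _ _ _ (fun t : G => (s0 * t)%g) f); [exact: ct|exact: (proj1 cf)].
have vg : vanishes_at_infinity g.
  move=> e e0; exists [set (s * (s0^-1 * t))%g | t in K].
    apply: continuous_compact => //; apply: continuous_subspaceT => t.
    apply: (@continuous_comp _ _ _ (fun t : G => (s0^-1 * t)%g) (fun t => (s * t)%g)); exact: ct.
  move=> t nt; rewrite /g fK ?normr0 ?ler0c ?ltW // => Kt; apply: nt.
  by exists (s0 * (s^-1 * t))%g => //; rewrite mulKg mulVKg.
have [F hF] := (h g).1 (conj cg vg).
by exists F; rewrite hF /g mulVg mulg1.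
Qed.

Lemma ev_lin s : linear (@ev R G S s). Proof. by case: (C0_P S) => h _ _ _ _ k f g; rewrite h. Qed.
Lemma evM s (f g : C0) : ev s (f *c g) = ev s f * ev s g. Proof. by case: (C0_P S). Qed.
Lemma ev_adj s (f : C0) : ev s (cadj f) = Num.conj (ev s f). Proof. by case: (C0_P S). Qed.
Lemma ev_inj (f g : C0) : (forall s, ev s f = ev s g) -> f = g.
Proof. by case: (C0_P S) => _ _ _ h _ /h. Qed.

(** Boundedness is extracted from the algebraic structure: if |g| <= 1 and (1 - q)^2 = 1 - g^* g
    with q self-adjoint, then evaluating at s gives 1 - |g(s)|^2 = |1 - q(s)|^2 >= 0. *)
Lemma ev_bdual s : bdual (@ev R G S s).
Proof.
apply: bdualI; first exact: ev_lin.
exists 1 => // f; rewrite mul1r.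
suff one_ g : nm (g : C0) <= 1 -> nm (ev s g) <= 1.
  have [->|f0] := eqVneq f 0; first by rewrite (lin0 (@ev_lin s)) !nm0.
  have na : 0 < nm f by rewrite lt_neqAle nm_ge0 andbT eq_sym; apply/eqP => /nm_eq0/eqP; apply/negP.
  have nk : nm ((nm f)^-1%:C : C) = (nm f)^-1 by rewrite nm_real // invr_ge0 ltW.
  have := one_ ((nm f)^-1%:C *: f); rewrite (linZ (@ev_lin s)) nmZ nk mulVf ?gt_eqF //.
  by move=> /(_ (lexx _)); rewrite [nm (_ *: _)]nmM nk ler_pdivrMl // mulr1.
move=> g1; have [|q [_ qE qa _]] := @square_root R C0 (cadj g *c g).
  by rewrite nm_adjM expr_le1 ?nm_ge0.
have {}qa : cadj q = q by apply: qa; rewrite cadjM cadjK.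
have qr : Num.conj (ev s q) = ev s q by rewrite -ev_adj qa.
have E : ev s q + ev s q = (ev s g * Num.conj (ev s g)) + ev s q * Num.conj (ev s q).
  rewrite -(linD (@ev_lin s)) qE (linD (@ev_lin s)) !evM ev_adj qr mulrC //.
rewrite !conj_mul_nm in E.
have {E} : 1 - (nm (ev s g) ^+ 2)%:C = (1 - ev s q) * Num.conj (1 - ev s q) :> C.
  rewrite rmorphB rmorph1 /= qr mulrBl mul1r mulrBr mulr1.
  have -> : ev s q * ev s q = (nm (ev s q) ^+ 2)%:C by rewrite -conj_mul_nm qr.
  have -> : (nm (ev s g) ^+ 2)%:C = ev s q + ev s q - (nm (ev s q) ^+ 2)%:C :> C by rewrite E addrK.
  by ring.
rewrite conj_mul_nm => /(congr1 (@complex.Re R)) /= h.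
rewrite -(@ler_pXn2r _ 2) ?nnegrE ?nm_ge0 // expr1n -subr_ge0 h; exact: sqr_ge0.
Qed.

End GroupModel.

Section FundamentalUnitary.
Context {R : realType} {G : TopologicalGroup.type} {T : tensorModel R}.
Hypothesis hG : locally_compact_group G.
Variable S : groupModel R G.
Local Notation C := R[i].
Local Notation cstar := (cstarAlgebra R).
Local Notation "A ⊗ B" := (tensor T A B).
Local Notation "m ⊗M n" := (melt T m n).
Local Notation elt := (elt T).
Local Notation CG := (CG S).
Local Notation C0 := (C0 S).
Local Notation u := (@uG R G S).
Local Notation evslice := (@evslice R G T S CG).

Lemma evslice_spec s : starhom (evslice s) /\ forall (f : C0) c, evslice s (elt f c) = ev s f *: c.
Proof.
suff ex : exists h : C0 ⊗ CG -> CG, starhom h /\ forall f d, h (elt f d) = ev s f *: d.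
  exact: (the_spec (fun=> 0) ex).
have be := ev_bdual S s.
have ls := @lslice_lin R T C0 CG _ be.
have bs := @lslice_bounded R T C0 CG _ be.
have Es := @lslice_elt R T C0 CG _ be.
exists (lslice (@ev R G S s)); split => //; split => //.
- move=> z w.
  apply: (total_eq (f := fun z => lslice (@ev R G S s) (z *c w)) (g := fun z => lslice (@ev R G S s) z *c lslice (@ev R G S s) w) _ _ _ _ (tens_total T C0 CG)).
  + exact: (lin_comp (f := lslice (@ev R G S s)) ls (cmul_linl w)).
  + exact: (lin_comp (f := fun x : CG => x *c lslice (@ev R G S s) w) (cmul_linl _) ls).
  + exact: (bounded_comp (f := lslice (@ev R G S s)) bs (bounded_cmull w)).
  + exact: (bounded_comp (f := fun x : CG => x *c lslice (@ev R G S s) w) (bounded_cmull _) bs).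
  move=> _ [a [b ->]].
  apply: (total_eq (f := fun w => lslice (@ev R G S s) (elt a b *c w)) (g := fun w => lslice (@ev R G S s) (elt a b) *c lslice (@ev R G S s) w) _ _ _ _ (tens_total T C0 CG)).
  + exact: (lin_comp (f := lslice (@ev R G S s)) ls (cmul_linr _)).
  + exact: (lin_comp (f := cmul (lslice (@ev R G S s) (elt a b))) (cmul_linr _) ls).
  + exact: (bounded_comp (f := lslice (@ev R G S s)) bs (bounded_cmulr _)).
  + exact: (bounded_comp (f := cmul (lslice (@ev R G S s) (elt a b))) (bounded_cmulr _) bs).
  by move=> _ [a' [b' ->]]; rewrite eltM !Es evM cmulZl cmulZr scalerA.
- move=> z; rewrite -[LHS]cadjK; congr cadj.
  have [l2 b2] := adj_lin_bounded ls bs.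
  apply: (total_eq l2 ls b2 bs (tens_total T C0 CG)).
  by move=> _ [a [b ->]]; rewrite elt_adj !Es ev_adj cadjZ conjCK cadjK.
Qed.

Lemma evslice_hom s : starhom (evslice s). Proof. by case: (evslice_spec s). Qed.
Lemma evslice_elt s (f : C0) c : evslice s (elt f c) = ev s f *: c. Proof. by case: (evslice_spec s). Qed.

Lemma evslice_slice s (f : CG -> C^o) z : bdual f -> ev s (slice f z) = f (evslice s z).
Proof.
move=> bf.
apply: (total_eq (f := fun z => ev s (slice f z)) (g := fun z => f (evslice s z)) _ _ _ _ (tens_total T C0 CG)).
- exact: (lin_comp (f := @ev R G S s) (@ev_lin R G S s) (@slice_lin R T C0 CG _ bf)).
- exact: (lin_comp (f := f) (bdual_lin bf) (starhom_lin (evslice_hom s))).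
- exact: (bounded_comp (f := @ev R G S s) (bdual_bounded (ev_bdual S s)) (@slice_bounded R T C0 CG _ bf)).
- exact: (bounded_comp (f := f) (bdual_bounded bf) (starhom_bounded (evslice_hom s))).
move=> _ [a [b ->]]; rewrite slice_elt // evslice_elt (linZ (@ev_lin R G S s)) (linZ (bdual_lin bf)).
exact: mulrC.
Qed.

Lemma evslice_sep z : (forall s, evslice s z = 0) -> z = 0.
Proof.
move=> h; apply: slice_sep => f bf; apply: ev_inj => s.
by rewrite evslice_slice // h (lin0 (bdual_lin bf)) (lin0 (@ev_lin R G S s)).
Qed.

(** Evaluation at s in the first leg, taken with values in multipliers so that [mext] extends it to
    M(C_0(G) ⊗ C^*(G)). By [evm_sep] these extensions separate multipliers, and identities for w_G
    become pointwise identities for [u s]. *)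
Definition evm s (z : C0 ⊗ CG) : multiplier CG := memb (evslice s z).

Lemma evm_mhom s : mhom (evm s). Proof. exact: (memb_hom (evslice_hom s)). Qed.
Lemma evm_nondeg s : nondegenerate (evm s).
Proof.
have [f hf] := C0_nonvanishing hG S s.
apply: (total_sub (memb_nondeg CG)) => _ [a [b ->]].
apply: closed_span_sub; exists (elt ((ev s f)^-1 *: f) a), b; rewrite /evm evslice_elt.
by rewrite (linZ (@ev_lin R G S s)) [_ *: ev s f]mulVf ?scale1r //; apply/eqP.
Qed.

Lemma evm_sep (w w' : multiplier (C0 ⊗ CG)) : (forall s, mext (evm s) w = mext (evm s) w') -> w = w'.
Proof.
move=> h; apply: mult_ext => z; apply/eqP; rewrite -subr_eq0; apply/eqP/evslice_sep => s.
apply: (@mb_inj R); rewrite (linB (starhom_lin (evslice_hom s))) (linB (@mb_lin R CG)) (lin0 (@mb_lin R CG)).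
have e m : mb (evslice s (ml m z)) = mext (evm s) m *M evm s z.
  by rewrite (mext_spec (evm_mhom s) (evm_nondeg s)).
by rewrite !e h subrr.
Qed.

Lemma mext_evm_melt s (f : C0) (n : multiplier CG) : mext (evm s) (memb f ⊗M n) = ev s f *: (n : MA CG).
Proof.
apply/esym; apply: (mextP (evm_mhom s) (evm_nondeg s)) => z; rewrite /evm.
rewrite (_ : _ *M _ = mb (ev s f *: ml n (evslice s z))); last first.
  by apply: mult_ext => c /=; rewrite mlM cmulZl.
congr memb.
apply: (total_eq (f := fun z => ev s f *: ml n (evslice s z)) (g := fun z => evslice s (ml (memb f ⊗M n) z)) _ _ _ _ (tens_total T C0 CG)).
- exact: (lin_comp (f := fun c : CG => ev s f *: ml n c) (lin_comp (f := fun c : CG => ev s f *: c) (@linearZ_ R CG _) (ml_linear n)) (starhom_lin (evslice_hom s))).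
- exact: (lin_comp (f := evslice s) (starhom_lin (evslice_hom s)) (ml_linear _)).
- exact: (bounded_comp (f := fun c : CG => ev s f *: ml n c) (bounded_comp (f := fun c : CG => ev s f *: c) (@boundedZ R CG _) (bounded_ml n)) (starhom_bounded (evslice_hom s))).
- exact: (bounded_comp (f := evslice s) (starhom_bounded (evslice_hom s)) (bounded_ml _)).
by move=> _ [a [b ->]]; rewrite ml_melt !evslice_elt /= evM mlZ scalerA.
Qed.

Lemma mext_evm_one s (n : multiplier CG) : mext (evm s) (mone ⊗M n) = n.
Proof.
have [f hf] := C0_nonvanishing hG S s.
have e : mext (evm s) (memb f ⊗M n) = mext (evm s) (memb f ⊗M mone) *M mext (evm s) (mone ⊗M n).
  by rewrite -(mextM (evm_mhom s) (evm_nondeg s)) meltM mmul1 mmul1l.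
have := congr1 (fun m : MA CG => (ev s f)^-1 *: m) e; rewrite !mext_evm_melt.
rewrite scalerA mulVf ?scale1r; last exact/eqP.
move=> e2; rewrite [RHS]e2 (_ : _ *M _ = ev s f *: (mext (evm s) (mone ⊗M n) : MA CG)); last exact: mult_ext.
by rewrite scalerA mulVf ?scale1r //; exact/eqP.
Qed.

Lemma rt_spec s (f : C0) t : ev t (rt s f) = ev (t * s)%g f.
Proof.
suff ex : exists g : C0, forall t, ev t g = ev (t * s)%g f by exact: (the_spec 0 ex t).
have [cM cV _ _] := hG.
have cr (r : G) : continuous (fun t : G => (t * r)%g).
  move=> x; apply: (@continuous_comp _ _ _ (fun t : G => (t, r)) (fun p : G * G => (p.1 * p.2)%g)); last exact: cM.
  by apply: cvg_pair; [exact: cvg_id|exact: cvg_cst].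
have [_ _ _ _ h] := C0_P S.
have [cf vf] : continuous (fun t => ev t f) /\ vanishes_at_infinity (fun t => ev t f).
  by apply/h; exists f.
apply/h; split.
  move=> x; apply: (@continuous_comp _ _ _ (fun t : G => (t * s)%g) (fun t => ev t f)); [exact: cr|exact: cf].
move=> e e0; have [K cK hK] := vf e e0.
exists [set (t * s^-1)%g | t in K].
  by apply: continuous_compact => //; apply: continuous_subspaceT; exact: cr.
by move=> x nx; apply: hK => Kx; apply: nx; exists (x * s)%g; rewrite // mulgK.
Qed.

Lemma rt_hom s : starhom (@rt R G S s).
Proof.
split.
- by move=> k f g; apply: ev_inj => t; rewrite rt_spec !(linP (@ev_lin R G S _)) !rt_spec.
- by move=> f g; apply: ev_inj => t; rewrite rt_spec !evM !rt_spec.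
- by move=> f; apply: ev_inj => t; rewrite rt_spec !ev_adj !rt_spec.
Qed.

Lemma rtM s t (f : C0) : rt s (rt t f) = rt (s * t)%g f.
Proof. by apply: ev_inj => r; rewrite !rt_spec mulgA. Qed.
Lemma rt1 (f : C0) : rt 1%g f = f.
Proof. by apply: ev_inj => r; rewrite rt_spec mulg1. Qed.

Lemma rt_mhom (D : cstar) (mu : C0 -> multiplier D) s : mhom mu -> mhom (fun f => mu (rt s f)).
Proof.
move=> /mhom_starhom hm; have hr := rt_hom s; apply/mhom_starhom; split.
- exact: (lin_comp (starhom_lin hm) (starhom_lin hr)).
- by move=> a b; rewrite (starhomM _ _ hr) (starhomM _ _ hm).
- by move=> a; rewrite (starhom_adj _ hr) (starhom_adj _ hm).
Qed.
Lemma rt_nondeg (D : cstar) (mu : C0 -> multiplier D) s : nondegenerate mu -> nondegenerate (fun f => mu (rt s f)).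
Proof.
move=> nm; apply: (total_sub nm) => _ [a [b ->]]; apply: closed_span_sub.
by exists (rt s^-1%g a), b; rewrite rtM mulgV rt1.
Qed.

Definition wG_prop := forall s (f : C0) c, evslice s (ml (wG T S) (elt f c)) = ev s f *: ml (u s) c.

(** The second alternative is excluded by [wG_genuine] as soon as there is a nonzero covariant
    representation. *)
Lemma wG_cases : wG_prop \/ wG T S = mzero.
Proof.
have [h|h] := pselect (exists w : multiplier (C0 ⊗ CG), forall s (f : C0) c,
    evslice s (ml w (elt f c)) = ev s f *: ml (u s) c).
  by left; exact: (the_spec mzero h).
by right; exact: the_junk.
Qed.

Hypothesis wG_ok : wG_prop.
Local Notation w := (wG T S).

Lemma mext_evm_w s : mext (evm s) w = u s.
Proof.
apply/esym; apply: (mextP (evm_mhom s) (evm_nondeg s)) => z; rewrite /evm.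
rewrite (_ : _ *M _ = mb (ml (u s) (evslice s z))); last exact: (@mul_mb R CG).
congr memb.
apply: (total_eq (f := fun z => ml (u s) (evslice s z)) (g := fun z => evslice s (ml w z)) _ _ _ _ (tens_total T C0 CG)).
- exact: (lin_comp (f := ml (u s)) (ml_linear _) (starhom_lin (evslice_hom s))).
- exact: (lin_comp (f := evslice s) (starhom_lin (evslice_hom s)) (ml_linear _)).
- exact: (bounded_comp (f := ml (u s)) (bounded_ml _) (starhom_bounded (evslice_hom s))).
- exact: (bounded_comp (f := evslice s) (starhom_bounded (evslice_hom s)) (bounded_ml _)).
by move=> _ [a [b ->]]; rewrite wG_ok evslice_elt mlZ.
Qed.

Lemma w_unitary : madj w *M w = mone /\ w *M madj w = mone.
Proof.
split; apply: evm_sep => s; rewrite (mextM (evm_mhom s) (evm_nondeg s)) (mext_adj (evm_mhom s) (evm_nondeg s)) mext_evm_w (mext_one (evm_mhom s) (evm_nondeg s)).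
  exact: (urepVl (uG_rep S)).
exact: (urepV (uG_rep S)).
Qed.

Lemma w_commute (f : C0) : w *M (memb f ⊗M mone) = (memb f ⊗M mone) *M w.
Proof.
apply: evm_sep => s; rewrite !(mextM (evm_mhom s) (evm_nondeg s)) mext_evm_w mext_evm_melt.
by apply: mult_ext => c /=; rewrite mlZ.
Qed.

Section W.
Variables (D : cstar) (mu : C0 -> multiplier D).
Hypotheses (hmu : mhom mu) (nmu : nondegenerate mu).
Local Notation H := (homtens (T := T) mu (@memb R CG)).
Definition Wmu : multiplier (D ⊗ CG) := mext H w.

Lemma HW_mhom : mhom H. Proof. exact: (homtens_mhom hmu (memb_mhom _)). Qed.
Lemma HW_nondeg : nondegenerate H.
Proof. exact: (homtens_nondeg hmu (memb_mhom _) nmu (memb_nondeg _)). Qed.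
Local Notation mextH := (mext H).

Lemma Wmu_unitary : madj Wmu *M Wmu = mone /\ Wmu *M madj Wmu = mone.
Proof.
have [h1 h2] := w_unitary; rewrite /Wmu -(mext_adj HW_mhom HW_nondeg) -!(mextM HW_mhom HW_nondeg).
by rewrite h1 h2 (mext_one HW_mhom HW_nondeg).
Qed.

Lemma mextH_melt (m : multiplier C0) (n : multiplier CG) : mextH (m ⊗M n) = mext mu m ⊗M n.
Proof.
by rewrite (mext_homtens_melt hmu (memb_mhom _) nmu (memb_nondeg _)) mext_memb_id.
Qed.

Lemma Wmu_commute (f : C0) : Wmu *M (mu f ⊗M mone) = (mu f ⊗M mone) *M Wmu.
Proof.
have -> : mu f ⊗M mone = mextH (memb f ⊗M mone) by rewrite mextH_melt (mext_memb hmu nmu).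
by rewrite /Wmu -!(mextM HW_mhom HW_nondeg) w_commute.
Qed.
End W.

(** Evaluated at t, both sides are u (t s) = u t u s. *)
Lemma mext_rt s : mext (homtens (T := T) (fun f : C0 => memb (rt s f)) (@memb R CG)) w = w *M (mone ⊗M u s).
Proof.
pose mu := fun f : C0 => memb (rt s f).
have hmu : mhom mu by apply: rt_mhom; exact: memb_mhom.
have nmu : nondegenerate mu by apply: rt_nondeg; exact: memb_nondeg.
have hH := HW_mhom hmu; have nH := HW_nondeg hmu nmu.
apply: evm_sep => t.
rewrite (mextM (evm_mhom t) (evm_nondeg t)) mext_evm_w mext_evm_one.
rewrite (mext_comp hH nH (evm_mhom t) (evm_nondeg t)) -(urepM (uG_rep S)) -mext_evm_w; congr mext.
apply/funext => z.
have hc : mhom (fun a => mext (evm t) (homtens mu (@memb R CG) a)).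
  exact: (comp_mhom (evm_mhom t) (evm_nondeg t) hH).
apply: (total_eq (mhom_lin hc) (mhom_lin (evm_mhom _)) (mhom_bounded hc) (mhom_bounded (evm_mhom _)) (tens_total T C0 CG)).
move=> _ [f [c ->]]; rewrite (homtens_elt hmu (memb_mhom _)) -memb_elt (mext_memb (evm_mhom t) (evm_nondeg t)).
by rewrite /evm !evslice_elt rt_spec.
Qed.

Lemma Wmu_rt (D : cstar) (mu : C0 -> multiplier D) s : mhom mu -> nondegenerate mu ->
  Wmu (fun f => mu (rt s f)) = Wmu mu *M (mone ⊗M u s).
Proof.
move=> hmu nmu.
pose r := fun f : C0 => memb (rt s f).
have hr : mhom r by apply: rt_mhom; exact: memb_mhom.
have nr : nondegenerate r by apply: rt_nondeg; exact: memb_nondeg.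
have e : homtens (T := T) (fun f => mu (rt s f)) (@memb R CG) =
    fun x => mext (homtens (T := T) mu (@memb R CG)) (homtens r (@memb R CG) x).
  apply/funext => x; rewrite (homtens_comp hr (memb_mhom _) hmu (memb_mhom _) nmu (memb_nondeg _)).
  congr (homtens _ _ x); apply/funext => y; first by rewrite (mext_memb hmu nmu).
  by rewrite mext_memb_id.
rewrite /Wmu e -(mext_comp (HW_mhom hr) (HW_nondeg hr nr) (HW_mhom hmu) (HW_nondeg hmu nmu)).
rewrite mext_rt (mextM (HW_mhom hmu) (HW_nondeg hmu nmu)) (mextH_melt hmu nmu).
by rewrite (mext_one hmu nmu).
Qed.

Lemma Wmu_conj (D : cstar) (mu : C0 -> multiplier D) (v : multiplier D) : mhom mu -> nondegenerate mu ->
  v *M madj v = mone -> madj v *M v = mone ->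
  forall mu', mhom mu' -> nondegenerate mu' -> (forall f, mu' f = madj v *M mu f *M v) ->
  Wmu mu' = (madj v ⊗M mone) *M Wmu mu *M (v ⊗M mone).
Proof.
move=> hmu nmu v1 v2 mu' hmu' nmu' e.
have V1 : (v ⊗M mone) *M (madj v ⊗M mone) = mone :> multiplier (D ⊗ CG).
  by rewrite meltM v1 mmul1 melt11.
have HE x : homtens (T := T) mu' (@memb R CG) x = (madj v ⊗M mone) *M homtens mu (@memb R CG) x *M (v ⊗M mone).
  apply/esym; move: x; apply: homtens_uniq => //; first exact: memb_mhom.
    have hH := HW_mhom hmu; apply/mhom_starhom; split.
    - exact: (lin_comp (f := fun m : MA (D ⊗ CG) => (madj v ⊗M mone : MA (D ⊗ CG)) *c m *c (v ⊗M mone)) (lin_comp (f := fun m : MA (D ⊗ CG) => m *c (v ⊗M mone)) (cmul_linl _) (cmul_linr _)) (mhom_lin hH)).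
    - move=> x y; rewrite (mhomM hH).
      set H := homtens _ _; set p := madj v ⊗M mone; set q := v ⊗M mone.
      change (p *M (H x *M H y) *M q = (p *M H x *M q) *M (p *M H y *M q)).
      by rewrite -!mmulA [q *M (p *M _)]mmulA V1 mmul1l.
    - by move=> x; rewrite (mhom_adj hH) [RHS]madjM madjM !melt_adj madj_mone madjK mmulA.
  by move=> f c; rewrite (homtens_elt hmu (memb_mhom _)) !meltM -e mmul1 mmul1l.
rewrite /Wmu; apply/esym; apply: (mextP (HW_mhom hmu') (HW_nondeg hmu' nmu')) => x; rewrite !HE.
rewrite -!mmulA [(v ⊗M mone) *M (madj v ⊗M mone *M _)]mmulA V1.
by rewrite mmul1l -(mext_spec (HW_mhom hmu) (HW_nondeg hmu nmu)) !mmulA.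
Qed.

End FundamentalUnitary.

Arguments slice_bounded {R T A B f} bf.
Arguments slice_elt {R T A B f} bf a b.
Section MembRange.
Context {R : realType}.
Local Notation C := R[i].

(** The embedding of Z in M(Z) is isometric and Z is complete, so a bounded map that takes a total
    set into Z takes all its values there. *)
Lemma memb_range (T : completeNormedModType C) (Z : cstarAlgebra R) (h : T -> MA Z) (S : set T) :
  linear h -> bounded h -> closed_span S = setT -> (forall s, S s -> exists y, h s = mb y) ->
  forall z, exists y, h z = mb y.
Proof.
move=> lh bh ST hS; apply: (total_ind ST) => //; split.
- by exists 0; rewrite (lin0 lh) (lin0 (@mb_lin R Z)).
- by move=> k u v [y hy] [y' hy']; exists (k *: y + y'); rewrite (linP lh) hy hy' (linP (@mb_lin R Z)).
- move=> z hz; have [K K0 hK] := bh.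
  have k1 : 0 < K + 1 by lra.
  have ex (n : nat) : exists y, nm (h z - mb y) < n.+1%:R^-1.
    have [w [y hy] zw] := hz (n.+1%:R^-1 / (K + 1)) ltac:(by rewrite !divr_gt0).
    exists y; rewrite -hy -(linB lh) (le_lt_trans (hK _)) //.
    move: zw; rewrite ltr_pdivlMr //; have := nm_ge0 (z - w); move: (n.+1%:R^-1) => i; lra.
  have [y hy] := choice ex.
  have [e e0|l tl] := @complete_nm R Z y.
    have [N hN] := inv_lt_exists (e := e / 2) ltac:(by rewrite divr_gt0).
    exists N => m n Nm Nn; rewrite -nm_mb (linB (@mb_lin R Z)).
    rewrite (le_lt_trans (nm_trans (h z) _ _)) // [nm (mb (y m) - h z)]nm_sym.
    have h1 := lt_trans (hy m) (hN _ Nm); have h2 := lt_trans (hy n) (hN _ Nn). lra.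
  exists l; apply/eqP; rewrite -subr_eq0; apply/eqP; apply: nm_small => e e0.
  have [N hN] := inv_lt_exists (e := e / 2) ltac:(by rewrite divr_gt0).
  have [N' hN'] := tl (e / 2) ltac:(by rewrite divr_gt0).
  have h1 := hN _ (leq_maxl N N'); have h2 := hN' _ (leq_maxr N N'); have h3 := hy (maxn N N').
  rewrite (le_trans (nm_trans (mb (y (maxn N N'))) _ _)) //.
  rewrite -(linB (@mb_lin R Z)) nm_mb; have := lt_trans h3 h1; lra.
Qed.

End MembRange.

(** * Approximate units in one tensor leg, and slices of coactions *)

Section Approximation.
Context {R : realType} {T : tensorModel R}.
Local Notation C := R[i].
Local Notation "A ⊗ B" := (tensor T A B).
Local Notation "m ⊗M n" := (melt T m n).
Variables A B : cstarAlgebra R.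

Lemma amp_lin (z : A ⊗ B) : linear (fun m : MA B => ml (mone ⊗M m) z).
Proof. by move=> k m n; rewrite (melt_linr T (mone : MA A)). Qed.

Lemma nm_amp (m : MA B) (z : A ⊗ B) : nm (ml (mone ⊗M m) z) <= nm m * nm z.
Proof.
rewrite (le_trans (nm_ml _ _)) // ler_wpM2r ?nm_ge0 // (le_trans (nm_melt T _ _)) //.
by rewrite ler_piMl ?nm_ge0 // nm_one.
Qed.

Lemma amp_comp (m n : MA B) (z : A ⊗ B) :
  ml (mone ⊗M m) (ml (mone ⊗M n) z) = ml (mone ⊗M (m *c n)) z.
Proof. by rewrite -[LHS]/(ml ((mone ⊗M m) *M (mone ⊗M n)) z) meltM mmul1. Qed.

Lemma amp_one (z : A ⊗ B) : ml (mone ⊗M (one : MA B)) z = z.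
Proof. by rewrite [X in ml X](melt11 T A B). Qed.

(** The contraction m stands for the factors 1 - x chosen earlier. Approximants are composed as (1 -
    y)(1 - x), and |1 - y| <= 1 preserves the estimate already obtained; this is how one element
    serves for several tensors. *)
Lemma tens_approx (z : A ⊗ B) (m : MA B) (e : R) : nm m <= 1 -> 0 < e ->
  exists x : B, nm (one - mb x) <= 1 /\ nm (ml (mone ⊗M ((one - mb x) *c m)) z) < e.
Proof.
move: m e; apply: (total_ind (tens_total T A B) (P := fun z => forall (m : MA B) (e : R), nm m <= 1 -> 0 < e ->
  exists x : B, nm (one - mb x) <= 1 /\ nm (ml (mone ⊗M ((one - mb x) *c m)) z) < e)); last first.
  move=> _ [a [b ->]] m e m1 e0.
  have a0 : 0 < nm a + 1 by have := nm_ge0 a; lra.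
  have [x hx x1] := approx_unit_l (ml m b) (eps := e / (nm a + 1)) ltac:(by rewrite divr_gt0).
  exists x; split => //; rewrite ml_melt nm_elt /= scaleN1r mulrC.
  move: hx; rewrite ltr_pdivlMr //; have := nm_ge0 (ml m b - x *c ml m b); nra.
split.
- move=> m e m1 e0; exists 0; rewrite (lin0 (@mb_lin R B)) subr0; split; first exact: nm_one.
  by rewrite ml0 nm0.
- move=> k u v hu hv m e m1 e0.
  have k1 : 0 < nm k + 1 by have := nm_ge0 k; lra.
  have [x [x1 ux]] := hu m (e / 2 / (nm k + 1)) m1 ltac:(by rewrite !divr_gt0).
  have m1' : nm ((one - mb x) *c m) <= 1 by rewrite (le_trans (nmMle _ _)) // mulr_ile1 ?nm_ge0.
  have [y [y1 vy]] := hv _ (e / 2) m1' ltac:(by rewrite divr_gt0).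
  exists (x + y - y *c x).
  have E : one - mb (x + y - y *c x) = (one - mb y) *c (one - mb x) :> MA B.
    rewrite (linB (@mb_lin R B)) (linD (@mb_lin R B)) mbM cmulBl !cmulBr !one_l one_r; cmod R (MA B).
  rewrite E; split; first by rewrite (le_trans (nmMle _ _)) // mulr_ile1 ?nm_ge0.
  rewrite -cmulA mlP (le_lt_trans (nmD _ _)) // nmZ.
  have h := nm_amp (one - mb y) (ml (mone ⊗M ((one - mb x) *c m)) u).
  rewrite amp_comp in h.
  move: ux; rewrite ltr_pdivlMr // => ux.
  have := nm_ge0 (ml (mone ⊗M ((one - mb x) *c m)) u); have := nm_ge0 k.
  have := nm_ge0 (ml (mone ⊗M ((one - mb y) *c ((one - mb x) *c m))) u).
  have := nm_ge0 (one - mb y); move: h ux vy y1.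
  set p := nm (ml _ u); set q := nm (ml _ u); set r := nm (ml _ v); set s := nm (one - mb y).
  move=> h1 h2 h3 h4 h5 h6 h7 h8.
  have : p <= q by nra.
  nra.
- move=> v hv m e m1 e0.
  have [u hu uv] := hv (e / 2) ltac:(by rewrite divr_gt0).
  have [x [x1 ux]] := hu m (e / 2) m1 ltac:(by rewrite divr_gt0).
  exists x; split => //.
  have m1' : nm ((one - mb x) *c m) <= 1 by rewrite (le_trans (nmMle _ _)) // mulr_ile1 ?nm_ge0.
  rewrite -[v](subrK u) mlD (le_lt_trans (nmD _ _)) //.
  have := nm_amp ((one - mb x) *c m) (v - u); have := nm_ge0 (v - u); nra.
Qed.

Lemma tens_approx2 (z z' : A ⊗ B) (e : R) : 0 < e ->
  exists x : B, nm (z - ml (mone ⊗M memb x) z) < e /\ nm (z' - ml (mone ⊗M memb x) z') < e.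
Proof.
move=> e0; have [x [x1 hx]] := tens_approx z (@nm_one R B) e0.
have [y [y1 hy]] := tens_approx z' x1 e0.
exists (x + y - y *c x).
have E : one - mb (x + y - y *c x) = (one - mb y) *c (one - mb x) :> MA B.
  rewrite (linB (@mb_lin R B)) (linD (@mb_lin R B)) mbM cmulBl !cmulBr !one_l one_r; cmod R (MA B).
have sub (w : A ⊗ B) : w - ml ((mone : MA A) ⊗M memb (x + y - y *c x)) w = ml ((mone : MA A) ⊗M ((one - mb y) *c (one - mb x))) w.
  by rewrite -E -[in LHS](amp_one w) amp_one [RHS](linB (amp_lin w)) amp_one.
rewrite !sub; split => //; rewrite -amp_comp (le_lt_trans (nm_amp _ _)) //.
rewrite one_r in hx; have := nm_ge0 (ml (mone ⊗M (one - mb x)) z); nra.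
Qed.

Lemma tens_approx_r (z : A ⊗ B) (e : R) : 0 < e ->
  exists x : B, nm (z - mr (mone ⊗M memb x) z) < e.
Proof.
move=> e0; have [x [hx _]] := tens_approx2 (cadj z) 0 e0.
exists (cadj x); rewrite -nm_adj cadjB adj_mr melt_adj madj_mone.
rewrite (_ : madj (memb (cadj x)) = memb x) //.
by rewrite -[LHS](mb_adj (cadj x)) cadjK.
Qed.

Lemma slice_amp_l (g : B -> C^o) (e : B) (z : A ⊗ B) : bdual g ->
  slice g (ml (mone ⊗M memb e) z) = slice (fun b => g (e *c b)) z.
Proof.
move=> bg; have bg' := bdual_mull e bg.
apply: (total_eq (f := fun z => slice g (ml (mone ⊗M memb e) z)) (g := slice (fun b => g (e *c b))) _ _ _ _ (tens_total T A B)).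
- exact: (lin_comp (f := slice g) (slice_lin bg) (ml_linear _)).
- exact: slice_lin.
- by have := bounded_comp (slice_bounded bg : bounded (slice g : A ⊗ B -> A)) (bounded_ml (mone ⊗M memb e)).
- exact: slice_bounded.
by move=> _ [a [b ->]]; rewrite ml_melt !slice_elt.
Qed.

Lemma bounded_mr (D : cstarAlgebra R) (m : multiplier D) : bounded (mr m).
Proof. by exists (opn m); [exact: opn_ge0|exact: nm_mr]. Qed.

Lemma slice_amp_r (g : B -> C^o) (c : B) (z : A ⊗ B) : bdual g ->
  slice g (mr (mone ⊗M memb c) z) = slice (fun b => g (b *c c)) z.
Proof.
move=> bg; have bg' := bdual_mulr c bg.
apply: (total_eq (f := fun z => slice g (mr (mone ⊗M memb c) z)) (g := slice (fun b => g (b *c c))) _ _ _ _ (tens_total T A B)).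
- exact: (lin_comp (f := slice g) (slice_lin bg) (mr_linear _)).
- exact: slice_lin.
- by have := bounded_comp (slice_bounded bg : bounded (slice g : A ⊗ B -> A)) (bounded_mr (mone ⊗M memb c)).
- exact: slice_bounded.
by move=> _ [a [b ->]]; rewrite mr_melt !slice_elt.
Qed.

End Approximation.

Section CoactionAction.
Context {R : realType} {G : TopologicalGroup.type} {T : tensorModel R}.
Variable S : groupModel R G.
Local Notation C := R[i].
Local Notation "A ⊗ B" := (tensor T A B).
Local Notation elt := (elt T).
Local Notation CG := (CG S).
Local Notation onec c := (melt T mone (memb c)).

Section One.
Variable A : coaction T S.
Local Notation delta := (@co_map R G T S A).

Lemma co_mhom : mhom delta. Proof. by case: (co_P A) => [[]]. Qed.
Lemma co_nondeg : nondegenerate delta. Proof. by case: (co_P A) => [[]]. Qed.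
Lemma co_inj : injective delta. Proof. by case: (co_P A) => [[]]. Qed.
Lemma co_tilde a : tildeM (delta a). Proof. by case: (co_P A). Qed.
Lemma co_total : closed_span [set x | exists a c, memb x = delta a *M onec c] = setT.
Proof. by case: (co_P A). Qed.

(** Slices are defined on A ⊗ C^*(G), not on its multipliers, so delta(a) is always sliced through
    delta(a)(1 ⊗ c) or (1 ⊗ c) delta(a), which lie in the algebra because delta(a) is in
    [tildeM]. *)
Definition dr (a : A) (c : CG) : A ⊗ CG := the 0 (fun x => delta a *M onec c = memb x).
Definition dl (c : CG) (a : A) : A ⊗ CG := the 0 (fun x => onec c *M delta a = memb x).

Lemma drP a c : delta a *M onec c = memb (dr a c).
Proof. by have [h1 h2] := co_tilde a c; exact: (the_spec 0 h1). Qed.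
Lemma dlP a c : onec c *M delta a = memb (dl c a).
Proof. by have [h1 h2] := co_tilde a c; exact: (the_spec 0 h2). Qed.

Lemma dr_lin c : linear (fun a => dr a c).
Proof.
move=> k a b; apply: (@mb_inj R); rewrite [RHS](@mb_lin R).
rewrite /mb -!drP (mhom_lin co_mhom); exact: mult_ext.
Qed.
Lemma dr_linr a : linear (dr a).
Proof.
move=> k c d; apply: (@mb_inj R); rewrite [RHS](@mb_lin R).
rewrite /mb -!drP (_ : memb (k *: c + d) = k *: (memb c : MA CG) + memb d); last exact: (@mb_lin R CG).
by rewrite (melt_linr T (mone : MA A)); apply: mult_ext => x /=; rewrite mlP.
Qed.
Lemma nm_dr a c : nm (dr a c) <= nm a * nm c.
Proof.
rewrite -nm_mb /mb -drP (le_trans (opnM _ _)) //.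
rewrite ler_pM ?opn_ge0 //; first exact: (mhom_contractive co_mhom).
rewrite (le_trans (nm_melt T (mone : MA A) (memb c : MA CG))) //.
by rewrite nm_mb ler_piMl ?nm_ge0 // nm_one.
Qed.
Lemma dr_mul a c d : dr a (c *c d) = mr (onec d) (dr a c).
Proof.
apply: (@mb_inj R); rewrite -mb_mul /mb -drP [RHS](_ : _ = memb (dr a c) *M onec d) //.
rewrite -drP -mmulA meltM mmul1; congr (_ *M _); congr melt; exact: (@mbM R CG).
Qed.
Lemma dr_elt a c a' c' : dr a c *c elt a' c' = ml (delta a) (elt a' (c *c c')).
Proof. by rewrite -[LHS]/(ml (memb (dr a c)) _) -drP /= ml_melt. Qed.
Lemma dl_dr a c e : ml (onec e) (dr a c) = mr (onec c) (dl e a).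
Proof.
apply: (@mb_inj R); rewrite -mul_mb -mb_mul /mb.
rewrite [LHS](_ : _ = onec e *M memb (dr a c)) // [RHS](_ : _ = memb (dl e a) *M onec c) //.
by rewrite -drP -dlP mmulA.
Qed.

(** The action on a of the functional b |-> f (b c). Carrying the factorization (f, c) along makes
    it defined without Cohen's theorem; [dual_act_factor] relates it to [dual_act]. *)
Definition Act (f : CG -> C^o) (c : CG) (a : A) : A := slice f (dr a c).

Lemma Act_lin f c : bdual f -> linear (Act f c).
Proof. by move=> bf; exact: (lin_comp (f := slice f) (slice_lin bf) (@dr_lin c)). Qed.
Lemma dr_bounded c : bounded (fun a => dr a c).
Proof. by exists (nm c) => [|a]; rewrite ?nm_ge0 // mulrC nm_dr. Qed.
Lemma dr_boundedr a : bounded (dr a).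
Proof. by exists (nm a) => [|c]; rewrite ?nm_ge0 // nm_dr. Qed.
Lemma Act_bounded f c : bdual f -> bounded (Act f c).
Proof. by move=> bf; exact: (bounded_comp (f := slice f) (slice_bounded bf) (@dr_bounded c)). Qed.
Lemma Act_linr f a : bdual f -> linear (fun c => Act f c a).
Proof. by move=> bf; exact: (lin_comp (f := slice f) (slice_lin bf) (@dr_linr a)). Qed.
Lemma Act_boundedr f a : bdual f -> bounded (fun c => Act f c a).
Proof. by move=> bf; exact: (bounded_comp (f := slice f) (slice_bounded bf) (@dr_boundedr a)). Qed.
Lemma Act_mulr f c d a : bdual f -> Act f (c *c d) a = Act (fun b => f (b *c d)) c a.
Proof. by move=> bf; rewrite /Act dr_mul slice_amp_r. Qed.

Lemma slice_dl f e c a : bdual f -> slice f (ml (onec e) (dr a c)) = slice (fun b => f (b *c c)) (dl e a).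
Proof. by move=> bf; rewrite dl_dr slice_amp_r. Qed.

Lemma slice_small (f : CG -> C^o) (z : A ⊗ CG) : bdual f ->
  (forall e : R, 0 < e -> exists2 w, slice f w = 0 & nm (z - w) < e) -> slice f z = 0.
Proof.
move=> bf; by have [_ _] := linclosed_zero (slice_lin bf) (slice_bounded bf : bounded (slice f : A ⊗ CG -> A)); apply.
Qed.

(* This is what makes [slice_tilde] a genuine description. *)
Lemma Act_indep g c g' c' a : bdual g -> bdual g' -> (forall b, g (b *c c) = g' (b *c c')) ->
  Act g c a = Act g' c' a.
Proof.
move=> bg bg' e; apply/eqP; rewrite -subr_eq0; apply/eqP; apply: nm_small => eps eps0.
have [K K0 hK] : bounded (slice g : A ⊗ CG -> A) by exact: slice_bounded.
have [K' K0' hK'] : bounded (slice g' : A ⊗ CG -> A) by exact: slice_bounded.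
have k1 : 0 < K + K' + 1 by lra.
(* Multiplying by 1 ⊗ x on the left changes both slices little, and by [slice_dl] turns them into
   slices of one element [dl x a] by the functionals b |-> g (b c) and b |-> g' (b c'), which
   agree. *)
have [x [h1 h2]] := tens_approx2 (dr a c) (dr a c') (e := eps / (K + K' + 1)) ltac:(by rewrite divr_gt0).
have E : slice g (ml (onec x) (dr a c)) = slice g' (ml (onec x) (dr a c')).
  by rewrite !slice_dl //; congr slice; apply/funext => b.
have -> : Act g c a - Act g' c' a = slice g (dr a c - ml (onec x) (dr a c)) - slice g' (dr a c' - ml (onec x) (dr a c')).
  by rewrite (linB (slice_lin bg)) (linB (slice_lin bg')) E opprB addrA subrK.
rewrite (le_trans (nmB _ _)) // (le_trans (lerD (hK _) (hK' _))) //.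
move: h1 h2; rewrite !ltr_pdivlMr //.
have := nm_ge0 (dr a c - ml (onec x) (dr a c)); have := nm_ge0 (dr a c' - ml (onec x) (dr a c')); nra.
Qed.

Lemma dual_act_factor f g c a : bdual g -> (forall b, f b = g (b *c c)) -> dual_act f a = Act g c a.
Proof.
move=> bg fg.
have h : forall g' c' x, bdual g' -> (forall b, f b = g' (b *c c')) ->
    delta a *M onec c' = memb x -> Act g c a = slice g' x.
  move=> g' c' x bg' fg' ex.
  have -> : x = dr a c' by apply: (@mb_inj R); rewrite /mb -ex drP.
  by apply: Act_indep => // b; rewrite -fg -fg'.
apply: the_uniq => [|y hy]; first exact: h.
by rewrite (hy g c (dr a c)) // drP.
Qed.

(** The g in a factorization f = g(. c) need not lie in E. Hence (id ⊗ g)(delta(a)(1 ⊗ c)) is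
    approximated by elements Act (f(x .)) y a, and f(x .) does lie in E; stability on one side
    serves each direction. *)
Lemma sub_EP (E : set (CG -> C^o)) : (forall f, E f -> bdual f) ->
  (forall f c, E f -> E (fun b => f (b *c c))) -> (forall f c, E f -> E (fun b => f (c *c b))) ->
  (forall f, E f -> dual_act f (0 : A) = 0) ->
  forall a, sub_E E a <-> forall f c, E f -> Act f c a = 0.
Proof.
move=> Eb Er El E0 a; split=> [h f c Ef|h f Ef].
  by rewrite -(dual_act_factor (f := fun b => f (b *c c))) //; [exact/h/Er|exact: Eb].
have [[g [c [bg fg]]]|nf] := pselect (exists g c, bdual g /\ forall b, f b = g (b *c c)).
  rewrite (dual_act_factor a bg fg); apply: slice_small => // e e0.
  have [x [hx _]] := tens_approx2 (dr a c) (dr a c) e0.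
  exists (ml (onec x) (dr a c)) => //; rewrite slice_dl //.
  have -> : (fun b => g (b *c c)) = f by apply/funext => b; rewrite fg.
  apply: slice_small; first exact: Eb.
  move=> d d0; have [y hy] := tens_approx_r (dl x a) d0.
  exists (mr (onec y) (dl x a)) => //; rewrite -dl_dr slice_amp_l; last exact: Eb.
  exact/h/El.
(* Without a factorization the description of f . a holds vacuously and does not mention a, so its
   value is the one at 0. *)
rewrite -(E0 f Ef) /dual_act /slice_tilde; congr the; apply/funext => x; apply/propext.
by split=> _ g c ? bg fg; case: nf; exists g, c.
Qed.

End One.
End CoactionAction.

(** * Coactions and the action of the Fourier-Stieltjes algebra *)

Section Flip.
Context {R : realType} {T : tensorModel R}.
Local Notation C := R[i].
Local Notation "A ⊗ B" := (tensor T A B).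
Local Notation "m ⊗M n" := (melt T m n).
Local Notation elt := (elt T).

Lemma mb_starhom (A : cstarAlgebra R) : starhom (@mb R A).
Proof. exact/mhom_starhom/memb_mhom. Qed.

Lemma flip_exists (A B : cstarAlgebra R) :
  exists h : A ⊗ B -> B ⊗ A, starhom h /\ forall a b, h (elt a b) = elt b a.
Proof.
pose D := td T B A.
have [||||||||h [hh hE]] := @hom_of_generators R (A ⊗ B) (B ⊗ A) (A * B)
  (fun p q => (p.1 *c q.1, p.2 *c q.2)) (fun p => (cadj p.1, cadj p.2))
  (@ep R T A B) (fun p => @mb R _ (elt p.2 p.1)) _ _ _ _ _ (dH D) (dPi (t := D)) (dPiP D)
  (B * A)%type (dH1 D * dH2 D)%type (@ep R T B A) (@hp R T B A).
- by move=> p q; rewrite /ep eltM.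
- by move=> p; rewrite /ep elt_adj.
- move=> p q; rewrite -[LHS]/(mb (elt (p.2 *c q.2) (p.1 *c q.1))) -eltM; exact: mbM.
- move=> p; rewrite -[LHS]/(mb (elt (cadj p.2) (cadj p.1))) -elt_adj; exact: mb_adj.
- exact: (total_range (tens_total T A B)).
- exact: tens_dense.
- exact: h_dense.
- move=> [b1 a1] [x y] [b1' a1'] [x' y'].
  have [c c0 hc] := prod_functional_bound T
    (vec_functional (dsig (t := D) a1 y) y' a1' (mb_starhom A) (dsigP D))
    (vec_functional (dpi (t := D) b1 x) x' b1' (mb_starhom B) (dpiP D)).
  exists c => // l; apply: le_trans (hc l).
  rewrite le_eqVlt; apply/orP; left; apply/eqP; congr nm.
  by apply: eq_bigr => p _ /=; rewrite /ep eltM !dact dot_h mulrC.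
have [f [hf fE]] : exists f : A ⊗ B -> B ⊗ A, starhom f /\ forall z, h z = memb (f z).
  apply: starhom_of_memb; first exact/mhom_starhom.
  apply: (memb_range (starhom_lin hh) (starhom_bounded hh) (tens_total T A B)).
  by move=> _ [a [b ->]]; exists (elt b a); exact: (hE (a, b)).
exists f; split => // a b; apply: (@mb_inj R); rewrite /mb -fE; exact: (hE (a, b)).
Qed.

Lemma totalT (V : completeNormedModType C) : closed_span [set: V] = setT.
Proof. by apply/seteqP; split => // v _; apply: closed_span_sub. Qed.

Lemma nondeg_memb (A B : cstarAlgebra R) (h : A -> B) : starhom h ->
  closed_span (range h) = setT -> nondegenerate (fun a => memb (h a)).
Proof.
move=> hh rh; apply: (total_sub (total_mul rh)) => _ [_ [_ [[a _ <-] [[b _ <-] ->]]]].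
by apply: closed_span_sub; exists a, (h b).
Qed.

Section FlipMultipliers.
Variables (A B : cstarAlgebra R) (h : A ⊗ B -> B ⊗ A).
Hypotheses (hh : starhom h) (hE : forall a b, h (elt a b) = elt b a).

Lemma flip_nondeg : nondegenerate (fun z => memb (h z)).
Proof.
apply: nondeg_memb => //; apply: (total_sub (tens_total T B A)) => _ [b [a ->]].
by apply: closed_span_sub; exists (elt a b); rewrite ?hE.
Qed.

Lemma mext_flip m n : mext (fun z => memb (h z)) (m ⊗M n) = n ⊗M m.
Proof.
apply/esym; apply: (mextP (memb_hom hh) flip_nondeg) => z.
rewrite [LHS](@mul_mb R (B ⊗ A)) /mb; congr memb.
apply: (total_eq (f := fun z => ml (n ⊗M m) (h z)) (g := fun z => h (ml (m ⊗M n) z)) _ _ _ _ (tens_total T A B)).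
- exact: (lin_comp (f := ml (n ⊗M m)) (ml_linear _) (starhom_lin hh)).
- exact: (lin_comp (f := h) (starhom_lin hh) (ml_linear _)).
- exact: (bounded_comp (f := ml (n ⊗M m)) (bounded_ml _) (starhom_bounded hh)).
- exact: (bounded_comp (f := h) (starhom_bounded hh) (bounded_ml _)).
by move=> _ [a [b ->]]; rewrite ml_melt !hE ml_melt.
Qed.

End FlipMultipliers.
End Flip.

Section SliceHomtens.
Context {R : realType} {T : tensorModel R}.
Local Notation C := R[i].
Local Notation "A ⊗ B" := (tensor T A B).
Variables (A B D : cstarAlgebra R) (pi : A -> multiplier D).
Hypothesis hp : mhom pi.

Lemma slice_homtens (g : B -> C^o) (x : A ⊗ B) w (c' : B) : bdual g ->
  slice g (ml (homtens pi (@memb R B) x) (elt T w c')) = ml (pi (slice (fun b => g (b *c c')) x)) w.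
Proof.
move=> bg; have bg' := bdual_mulr c' bg.
have amp (F F' : cstarAlgebra R) (f : F -> multiplier F') y : mhom f -> linear (fun x => ml (f x) y) /\ bounded (fun x => ml (f x) y).
  move=> hf; split=> [k z z'|]; first by rewrite (mhom_lin hf).
  exists (nm y); rewrite ?nm_ge0 // => z; rewrite (le_trans (nm_ml (f z) y)) // mulrC.
  by rewrite ler_wpM2l ?nm_ge0 // (mhom_contractive hf).
have [l1 b1] := amp _ _ _ (elt T w c') (homtens_mhom hp (memb_mhom B)); have [l2 b2] := amp _ _ _ w hp.
apply: (total_eq (f := fun x => slice g (ml (homtens pi (@memb R B) x) (elt T w c')))
  (g := fun x => ml (pi (slice (fun b => g (b *c c')) x)) w) _ _ _ _ (tens_total T A B)).
- exact: (lin_comp (f := slice g) (slice_lin bg) l1).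
- exact: (lin_comp (f := fun x => ml (pi x) w) l2 (slice_lin bg')).
- by have := bounded_comp (slice_bounded bg : bounded (slice g : D ⊗ B -> _)) b1.
- exact: (bounded_comp (f := fun x => ml (pi x) w) b2 (slice_bounded bg')).
move=> _ [a [b ->]]; rewrite (homtens_elt hp (memb_mhom _)) ml_melt !slice_elt //=.
by rewrite (linZ l2).
Qed.
End SliceHomtens.

Section Commutation.
Context {R : realType} {G : TopologicalGroup.type} {T : tensorModel R}.
Variables (S : groupModel R G) (A : coaction T S).
Local Notation C := R[i].
Local Notation cstar := (cstarAlgebra R).
Local Notation "A ⊗ B" := (tensor T A B).
Local Notation "m ⊗M n" := (melt T m n).
Local Notation elt := (elt T).
Local Notation CG := (CG S).
Local Notation u := (@uG R G S).
Local Notation onec c := (melt T mone (memb c)).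
Local Notation delta := (@co_map R G T S A).
Local Notation Hd := (homtens delta (@memb R CG)).
Local Notation H2 := (homtens (@memb R A) (deltaG T (S := S))).

Lemma uu_rep : unitary_rep (fun s => u s ⊗M u s).
Proof. exact: (tensor_rep (uG_rep S) (uG_rep S)). Qed.
Lemma deltaG_mhom : mhom (deltaG T (S := S)).
Proof. by have [] := gint_spec S uu_rep. Qed.
Lemma deltaG_nondeg : nondegenerate (deltaG T (S := S)).
Proof. by have [] := gint_spec S uu_rep. Qed.

Let hd : mhom Hd := homtens_mhom (co_mhom A) (memb_mhom CG).
Let nd : nondegenerate Hd := homtens_nondeg (co_mhom A) (memb_mhom CG) (co_nondeg A) (memb_nondeg CG).
Let h2 : mhom H2 := homtens_mhom (memb_mhom A) deltaG_mhom.
Let n2 : nondegenerate H2 := homtens_nondeg (memb_mhom A) deltaG_mhom (memb_nondeg A) deltaG_nondeg.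

Lemma mext_dr (B : cstar) (f : A ⊗ CG -> multiplier B) a c : mhom f -> nondegenerate f ->
  mext f (delta a) *M mext f (onec c) = f (dr a c).
Proof. by move=> hf nf; rewrite -(mextM hf nf) drP (mext_memb hf nf). Qed.

Lemma mext_Hd_one c : mext Hd (onec c) = onec c.
Proof.
rewrite (mext_homtens_melt (co_mhom A) (memb_mhom _) (co_nondeg A) (memb_nondeg _)).
by rewrite (mext_one (co_mhom A) (co_nondeg A)) mext_memb_id.
Qed.

Section Genuine.
Variable th : (A ⊗ CG) ⊗ CG -> A ⊗ (CG ⊗ CG).
Hypotheses (hth : starhom th) (thE : forall a b d, th (elt (elt a b) d) = elt a (elt b d)).
Hypothesis coass : forall a, mext (fun x => memb (th x)) (mext Hd (delta a)) = mext H2 (delta a).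
Local Notation Y a := (mext H2 (delta a)).

Definition slice2 (f g : CG -> C^o) (z : CG ⊗ CG) : C^o := f (slice g z).

Lemma slice2_bdual f g : bdual f -> bdual g -> bdual (slice2 f g).
Proof. by move=> bf bg; exact: (bdual_comp bf (slice_lin bg) (slice_bounded bg)). Qed.

Lemma slice2_elt f g b d : bdual f -> bdual g -> slice2 f g (elt b d) = f b * g d.
Proof. by move=> bf bg; rewrite /slice2 slice_elt // (linZ (bdual_lin bf)) mulrC. Qed.

Lemma slice2_th f g z : bdual f -> bdual g -> slice (slice2 f g) (th z) = slice f (slice g z).
Proof.
move=> bf bg; have b2 := slice2_bdual bf bg.
have TT := total_elt (T := T) (tens_total T A CG) (totalT CG).
apply: (total_eq (f := fun z => slice (slice2 f g) (th z)) (g := fun z => slice f (slice g z)) _ _ _ _ TT).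
- exact: (lin_comp (f := slice (slice2 f g)) (slice_lin b2) (starhom_lin hth)).
- exact: (lin_comp (f := slice f) (slice_lin bf) (slice_lin bg)).
- by have := bounded_comp (slice_bounded b2 : bounded (slice (slice2 f g) : A ⊗ (CG ⊗ CG) -> _)) (starhom_bounded hth).
- exact: (bounded_comp (f := slice f) (slice_bounded bf) (slice_bounded bg)).
move=> _ [_ [d [[a [b ->]] _ ->]]]; rewrite thE !slice_elt // slice2_elt //.
by rewrite (linZ (slice_lin bf)) slice_elt // scalerA mulrC.
Qed.

Lemma th_nondeg : nondegenerate (fun z => memb (th z)).
Proof.
apply: nondeg_memb => //.
have TT := total_elt (T := T) (totalT A) (tens_total T CG CG).
apply: (total_sub TT) => _ [a [_ [_ [b [d ->]] ->]]].
by apply: closed_span_sub; exists (elt (elt a b) d); rewrite ?thE.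
Qed.

(** By coassociativity [Y a] is also (delta ⊗ id)(delta(a)), whose iterated slice is f . (g . a).
    Each of the two slots holds a product: one factor brings delta into the algebra through [dr],
    the other remains as a vector and is absorbed by the functional. *)
Lemma slice2_Y_mul f g a a' d1 d2 c1 c2 : bdual f -> bdual g ->
  slice (slice2 f g) (ml (Y a) (elt a' (elt (d1 *c d2) (c1 *c c2)))) =
  Act f (d1 *c d2) (Act g (c1 *c c2) a) *c a'.
Proof.
move=> bf bg.
have -> : ml (Y a) (elt a' (elt (d1 *c d2) (c1 *c c2))) = th (ml (Hd (dr a c1)) (elt (elt a' (d1 *c d2)) c2)).
  rewrite -coass -thE.
  have -> : forall m z, ml (mext (fun x => memb (th x)) m) (th z) = th (ml m z).
    move=> m z; apply: (@mb_inj R); rewrite -mul_mb; exact: (mext_spec (memb_hom hth) th_nondeg m z).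
  congr th.
  rewrite -(mext_dr a c1 hd nd) mext_Hd_one /=; congr ml; by rewrite ml_melt.
rewrite slice2_th // (slice_homtens (co_mhom A)) // (_ : slice _ (dr a c1) = Act g (c1 *c c2) a); last by rewrite Act_mulr.
by rewrite -dr_elt slice_mulr // (Act_mulr d1 d2 _ bf).
Qed.

Lemma slice2_Y f g a a' d c : bdual f -> bdual g ->
  slice (slice2 f g) (ml (Y a) (elt a' (elt d c))) = Act f d (Act g c a) *c a'.
Proof.
move=> bf bg; have b2 := slice2_bdual bf bg.
have TT (D : cstar) : closed_span [set x : D | exists a b, setT a /\ setT b /\ x = a *c b] = setT.
  exact/total_mul/totalT.
have lF : linear (fun k => slice (slice2 f g) (ml (Y a) (elt a' k))).
  apply: (lin_comp (f := slice (slice2 f g)) (slice_lin b2)).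
  exact: (lin_comp (f := ml (Y a)) (ml_linear _) (elt_linr T a')).
have bF : bounded (fun k => slice (slice2 f g) (ml (Y a) (elt a' k))).
  have bb : bounded (fun k : CG ⊗ CG => elt a' k) by exists (nm a'); rewrite ?nm_ge0 // => k; rewrite nm_elt.
  have := bounded_comp (bounded_ml (Y a)) bb => bb'.
  by have := bounded_comp (slice_bounded b2 : bounded (slice (slice2 f g) : A ⊗ (CG ⊗ CG) -> _)) bb'.
have bl (c0 : CG) : bounded (fun d : CG => elt d c0) by exists (nm c0); rewrite ?nm_ge0 // => k; rewrite nm_elt mulrC.
have br (c0 : CG) : bounded (fun d : CG => elt c0 d) by exists (nm c0); rewrite ?nm_ge0 // => k; rewrite nm_elt.
move: d; apply: (total_eq (f := fun d => slice (slice2 f g) (ml (Y a) (elt a' (elt d c))))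
  (g := fun d => Act f d (Act g c a) *c a') _ _ _ _ (TT CG)).
- exact: (lin_comp (f := fun k => slice (slice2 f g) (ml (Y a) (elt a' k))) lF (elt_linl T c)).
- exact: (lin_comp (f := fun x => x *c a') (cmul_linl a') (Act_linr _ bf)).
- exact: (bounded_comp (f := fun k => slice (slice2 f g) (ml (Y a) (elt a' k))) bF (bl c)).
- exact: (bounded_comp (f := fun x => x *c a') (bounded_cmull a') (Act_boundedr _ bf)).
move=> _ [d1 [d2 [_ [_ ->]]]].
move: c; apply: (total_eq (f := fun c => slice (slice2 f g) (ml (Y a) (elt a' (elt (d1 *c d2) c))))
  (g := fun c => Act f (d1 *c d2) (Act g c a) *c a') _ _ _ _ (TT CG)).
- exact: (lin_comp (f := fun k => slice (slice2 f g) (ml (Y a) (elt a' k))) lF (elt_linr T (d1 *c d2))).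
- exact: (lin_comp (f := fun x => x *c a') (cmul_linl a')
    (lin_comp (f := Act f (d1 *c d2)) (Act_lin _ bf) (Act_linr _ bg))).
- exact: (bounded_comp (f := fun k => slice (slice2 f g) (ml (Y a) (elt a' k))) bF (br _)).
- have B1 : bounded (fun c => Act f (d1 *c d2) (Act g c a)).
    exact: (bounded_comp (f := Act f (d1 *c d2)) (Act_bounded _ _ bf) (Act_boundedr _ bg)).
  exact: (bounded_comp (f := fun x => x *c a') (bounded_cmull a') B1).
by move=> _ [c1 [c2 [_ [_ ->]]]]; exact: slice2_Y_mul.
Qed.

(** The flip of the last two legs fixes [Y a] and exchanges f ⊗ g with g ⊗ f. It fixes [Y a] since
    it fixes each u s ⊗ u s, hence the integrated form [deltaG]. *)
Lemma Act_comm_genuine (f g : CG -> C^o) (c d : CG) (a : A) : bdual f -> bdual g ->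
  Act f d (Act g c a) = Act g c (Act f d a).
Proof.
move=> bf bg; apply: (@cancel_lP R A) => a'.
have [fl [hfl flE]] := flip_exists CG CG.
pose fm := fun z : CG ⊗ CG => memb (fl z).
have nfl : nondegenerate fm := flip_nondeg hfl flE.
have hfm : mhom fm := memb_hom hfl.
pose h := homtens (T := T) (@memb R A) fm.
have hh : mhom h := homtens_mhom (memb_mhom A) hfm.
have nh : nondegenerate h := homtens_nondeg (memb_mhom A) hfm (memb_nondeg A) nfl.
have hY : mext h (Y a) = Y a.
  rewrite (mext_comp h2 n2 hh nh); congr mext; apply/funext => x.
  rewrite (homtens_comp (memb_mhom A) deltaG_mhom (memb_mhom A) hfm (memb_nondeg A) nfl).
  have -> : (fun a => mext (@memb R A) (memb a)) = @memb R A by apply/funext => b; exact: mext_memb_id.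
  congr (homtens _ _ x); apply/funext => b.
  rewrite /deltaG (gint_mext hfm nfl uu_rep); congr gint; apply/funext => s.
  exact: (mext_flip hfl flE).
have [k [hk kE]] : exists k : A ⊗ (CG ⊗ CG) -> A ⊗ (CG ⊗ CG), starhom k /\ forall z, h z = memb (k z).
  apply: starhom_of_memb => //.
  apply: (memb_range (h := h) (mhom_lin hh) (mhom_bounded hh) (tens_total T A _)) => _ [x [y ->]].
  by exists (elt x (fl y)); rewrite /h (homtens_elt (memb_mhom A) hfm) -memb_elt.
have kelt x b e : k (elt x (elt b e)) = elt x (elt e b).
  apply: (@mb_inj R); rewrite /mb -kE /h (homtens_elt (memb_mhom A) hfm) /fm flE.
  by rewrite -memb_elt.
have kY z : ml (Y a) (k z) = k (ml (Y a) z).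
  apply: (@mb_inj R); rewrite -mul_mb.
  have e := mext_spec hh nh (Y a) z; rewrite hY !kE in e; exact: e.
have sk z : slice (slice2 f g) (k z) = slice (slice2 g f) z.
  have b2 := slice2_bdual bf bg; have b2' := slice2_bdual bg bf.
  have TT := total_elt (T := T) (totalT A) (tens_total T CG CG).
  apply: (total_eq (f := fun z => slice (slice2 f g) (k z)) (g := slice (slice2 g f)) _ _ _ _ TT).
  - exact: (lin_comp (f := slice (slice2 f g)) (slice_lin b2) (starhom_lin hk)).
  - exact: slice_lin.
  - by have := bounded_comp (slice_bounded b2 : bounded (slice (slice2 f g) : A ⊗ (CG ⊗ CG) -> _)) (starhom_bounded hk).
  - exact: slice_bounded.
  move=> _ [x [_ [_ [b [e ->]] ->]]].
  by rewrite kelt !slice_elt // !slice2_elt // mulrC.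
by rewrite -slice2_Y // -kelt kY sk slice2_Y.
Qed.

End Genuine.

Lemma total_set0 (V : completeNormedModType C) (P : set V) : closed_span P = setT ->
  (forall v, P v -> v = 0) -> forall v : V, v = 0.
Proof.
move=> PT P0; apply: (total_ind PT) => //.
exact: (linclosed_zero (f := @id V) _ (@bounded_id R V)).
Qed.

Lemma Act_comm (f g : CG -> C^o) (c d : CG) (a : A) : bdual f -> bdual g -> Act f d (Act g c a) = Act g c (Act f d a).
Proof.
move=> bf bg.
have [_ _ coass _] := co_P A.
have [ex|nex] := pselect (exists h : (A ⊗ CG) ⊗ CG -> A ⊗ (CG ⊗ CG),
    starhom h /\ forall a b d, h (elt (elt a b) d) = elt a (elt b d)).
  have [hth thE] := the_spec (fun=> 0) ex.
  exact: (Act_comm_genuine hth thE coass).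
(* If reassociation were junk, the left side of coassociativity would not depend on the element, so
   [mext H2] would vanish on all of delta(A). Then [H2] is zero on a total set, and its
   nondegeneracy makes A ⊗ (C^*(G) ⊗ C^*(G)) zero; as norms of elementary tensors multiply, the
   claim is then trivial. *)
have th0 : @tensA R T A CG CG = fun=> 0 by exact: the_junk.
have Y0 b : mext H2 (delta b) = mzero.
  have -> : mext H2 (delta b) = mext H2 (delta 0) by rewrite -!coass th0.
  have -> : delta 0 = mzero by have := lin0 (mhom_lin (co_mhom A)).
  exact: mext_zero.
have H0 x : H2 x = mzero.
  apply: (total_eq (f := H2 : _ -> MA _) (g := fun=> 0) (mhom_lin h2) _ (mhom_bounded h2) _ (co_total A)).
  - by move=> k v w; rewrite scaler0 addr0.
  - by exists 0 => // v; rewrite nm0 mul0r.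
  move=> y [b [e ye]].
  have -> : y = dr b e by apply: (@mb_inj R); rewrite /mb ye drP.
  by rewrite -mext_dr // Y0; apply: mult_ext => z.
have Z0 : forall z : A ⊗ (CG ⊗ CG), z = 0.
  by apply: (total_set0 n2) => _ [x [y ->]]; rewrite H0.
have [x0|/eqP xn] := eqVneq (Act f d (Act g c a) - Act g c (Act f d a)) 0.
  by apply/eqP; rewrite -subr_eq0 x0.
have [c0|/eqP cn] := eqVneq c 0.
  by rewrite c0 !(lin0 (Act_linr _ bg)) (lin0 (Act_lin _ bf)).
have : nm (elt (Act f d (Act g c a) - Act g c (Act f d a)) (elt c c)) = 0 by rewrite [elt _ _]Z0 nm0.
by rewrite !nm_elt => /eqP; rewrite !mulf_eq0 => /orP[/eqP /nm_eq0//|/orP[]/eqP/nm_eq0//].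
Qed.

End Commutation.

Section Equivariance.
Context {R : realType} {G : TopologicalGroup.type} {T : tensorModel R}.
Variable S : groupModel R G.
Local Notation cstar := (cstarAlgebra R).
Local Notation "A ⊗ B" := (tensor T A B).
Local Notation elt := (elt T).
Local Notation CG := (CG S).
Local Notation onec c := (melt T mone (memb c)).
Variables (A B : coaction T S) (phi : A -> B).
Hypothesis eqv : equivariant phi.

Lemma equivariant_hom : starhom phi. Proof. by case: eqv. Qed.

Lemma amplification : exists k : A ⊗ CG -> B ⊗ CG,
  [/\ starhom k, forall a c, k (elt a c) = elt (phi a) c
    & forall z, homtens (fun a => memb (phi a)) (@memb R CG) z = memb (k z)].
Proof.
have hp := memb_hom equivariant_hom.
have hh := homtens_mhom (T := T) hp (memb_mhom CG).
have [k [hk kE]] : exists k : A ⊗ CG -> B ⊗ CG, starhom k /\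
    forall z, homtens (fun a => memb (phi a)) (@memb R CG) z = memb (k z).
  apply: starhom_of_memb => //.
  apply: (memb_range (h := homtens _ _) (mhom_lin hh) (mhom_bounded hh) (tens_total T A CG)) => _ [a [c ->]].
  by exists (elt (phi a) c); rewrite (homtens_elt hp (memb_mhom _)) -memb_elt.
exists k; split => // a c; apply: (@mb_inj R).
by rewrite /mb -kE (homtens_elt hp (memb_mhom _)) memb_elt.
Qed.

Let good (a : A) (n : multiplier (B ⊗ CG)) := tildeM n /\
  forall d x, co_map a *M onec d = memb x ->
    n *M onec d = homtens (fun a => memb (phi a)) (@memb R CG) x.

(** Where the description fails, delta(phi b) is the junk value 0, so phi b = 0 by injectivity.
    Differences of good elements are good, so adding a good b to a bad a gives a bad element, and
    phi b = phi (a + b) - phi a = 0. One failure thus forces phi = 0, but then the multiplier 0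
    meets the description. *)
Lemma tilde_ext_genuine a : exists n, good a n.
Proof.
have [//|nex] := pselect (exists n, good a n).
have hp := memb_hom equivariant_hom.
have hh := homtens_mhom (T := T) hp (memb_mhom CG).
have bad b : ~ (exists n, good b n) -> phi b = 0.
  move=> nb; apply: (co_inj (A := B)); have [_ ->] := eqv.
  have -> : co_map (0 : B) = mzero by have := lin0 (mhom_lin (co_mhom B)).
  exact: (the_junk mzero nb).
have mlDr (D : cstar) (m n p : MA D) : (m - n) *M p = (m *M p : MA D) - (n *M p).
  by apply: mult_ext => x.
have phi0 b : phi b = 0.
  have [gb|] := pselect (exists n, good b n); last exact: bad.
  have [gab|nab] := pselect (exists n, good (a + b) n); last first.
    by have := bad _ nab; rewrite (linD (starhom_lin equivariant_hom)) (bad _ nex) add0r.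
  case: nex; case: gb => n [tn hn]; case: gab => n' [tn' hn'].
  exists ((n' : MA _) - n); split.
    move=> c; have [[x hx] [y hy]] := tn c; have [[x' hx'] [y' hy']] := tn' c; split.
      by exists (x' - x); rewrite mlDr hx hx' -[RHS]/(mb _) (linB (@mb_lin R _)).
    exists (y' - y); rewrite -[RHS]/(mb _) (linB (@mb_lin R _)) /mb -hy -hy'.
    by apply: mult_ext => z /=; rewrite mlD -scaleN1r mlZ.
  move=> d x ax; rewrite mlDr (hn d (dr b d)) ?drP // (hn' d (x + dr b d)).
    by rewrite -(linB (mhom_lin hh)) addrK.
  rewrite (linD (mhom_lin (co_mhom A))) -[RHS]/(mb _) (linD (@mb_lin R _)) /mb -ax -drP.
  by apply: mult_ext.
exists mzero; split.
  by move=> c; split; exists 0; rewrite -[memb 0]/(mb 0) (lin0 (@mb_lin R _)); apply: mult_ext => z //=; rewrite ml0.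
move=> d x _; have -> : homtens (fun a => memb (phi a)) (@memb R CG) x = (0 : MA (B ⊗ CG)).
  apply: (total_eq (f := homtens _ _ : _ -> MA _) (g := fun=> 0) (mhom_lin hh) _ (mhom_bounded hh) _ (tens_total T A CG)).
  - by move=> k v w; rewrite scaler0 addr0.
  - by exists 0 => // v; rewrite nm0 mul0r.
  move=> _ [b [c ->]]; rewrite (homtens_elt hp (memb_mhom _)) phi0 -memb_elt.
  by rewrite -[memb _]/(mb _) (lin0 (elt_linl T c)) (lin0 (@mb_lin R _)).
exact: mult_ext.
Qed.

Lemma equivariant_Act f c (a : A) : bdual f -> Act f c (phi a) = phi (Act f c a).
Proof.
move=> bf; have [k [hk kE kh]] := amplification.
have [_ h] := the_spec mzero (tilde_ext_genuine a).
have -> : Act f c (phi a) = slice f (k (dr a c)).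
  rewrite /Act; congr slice; apply: (@mb_inj R); rewrite /mb -drP -kh.
  by have [_ ->] := eqv; apply: h; rewrite drP.
apply: (total_eq (f := fun z => slice f (k z)) (g := fun z => phi (slice f z)) _ _ _ _ (tens_total T A CG)).
- exact: (lin_comp (f := slice f) (slice_lin bf) (starhom_lin hk)).
- exact: (lin_comp (f := phi) (starhom_lin equivariant_hom) (slice_lin bf)).
- by have := bounded_comp (slice_bounded bf : bounded (slice f : B ⊗ CG -> B)) (starhom_bounded hk).
- exact: (bounded_comp (f := phi) (starhom_bounded equivariant_hom) (slice_bounded bf)).
by move=> _ [b [d ->]]; rewrite kE !slice_elt // (linZ (starhom_lin equivariant_hom)).
Qed.

End Equivariance.

(** * A bipolar theorem for pointwise closed spaces of functionals *)

Section Bipolar.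
Context {R : realType}.
Local Notation C := R[i].
Variable V : lmodType C.

(** Induction on the list. If some functional in E is nonzero at the head x, normalise it to g0 with
    g0 x = 1, subtract f(x) g0 from f, and continue inside the subspace of E vanishing at x; the
    assumption on common zeros passes to that subspace by correcting y with a multiple of x. *)
Lemma finite_agreement (l : seq V) (E : set (V -> C^o)) (f : V -> C^o) :
  (exists g, E g) -> (forall g, E g -> linear g) ->
  (forall (k : C) g h, E g -> E h -> E (fun x => k * g x + h x)) ->
  linear f -> (forall y, (forall g, E g -> g y = 0) -> f y = 0) ->
  exists2 g, E g & {in l, g =1 f}.
Proof.
elim: l E f => [|x l IH] E f [g1 Eg1] lE cE lf vf; first by exists g1.
have [h|] := pselect (forall g, E g -> g x = 0).
  have [g Eg gl] := IH E f (ex_intro _ _ Eg1) lE cE lf vf.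
  by exists g => // y; rewrite inE => /predU1P[->|/gl//]; rewrite h // vf.
move=> /existsNP[g] /not_implyP[Eg /eqP gx].
have [g0 Eg0 g0x] : exists2 g0, E g0 & g0 x = 1.
  (* This is g / g(x), in the shape k g + h under which E is closed. *)
  exists (fun y => ((g x)^-1 - 1) * g y + g y); first exact: cE.
  by rewrite mulrBl mul1r subrK mulVf.
pose E' : set (V -> C^o) := [set g | E g /\ g x = 0].
pose f' : V -> C^o := fun y => f y - f x * g0 y.
have [|||||g' [Eg' g'x] g'l] := IH E' f'.
- exists (fun y => (- g1 x) * g0 y + g1 y); split; first exact: cE.
  by rewrite g0x mulr1 addNr.
- by move=> h [/lE].
- by move=> k h1 h2 [E1 h1x] [E2 h2x]; split; [exact: cE|rewrite h1x h2x mulr0 addr0].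
- move=> k u v; rewrite /f' (linP lf) (linP (lE _ Eg0)) mulrDr scalerBr opprD.
  rewrite -![k *: _]/(k * _) [f x * (k * _)]mulrCA; rewrite -!addrA; congr (_ + _).
  by rewrite addrCA.
- move=> y hy; suff e : f y = g0 y * f x by rewrite /f' e mulrC subrr.
  have z0 : f (- g0 y *: x + y) = 0.
    apply: vf => h Eh; rewrite (linP (lE _ Eh)).
    rewrite -[- g0 y *: _]/(- g0 y * h x) mulNr mulrC -mulNr.
    apply: (hy (fun z => (- h x) * g0 z + h z)); split; first exact: cE.
    by rewrite g0x mulr1 addNr.
  move: z0; rewrite (linP lf) -[_ *: _]/(_ * _) mulNr addrC => /eqP.
  by rewrite subr_eq0 => /eqP.
exists (fun y => f x * g0 y + g' y); first exact: cE.
move=> y; rewrite inE => /predU1P[->|/g'l ->]; first by rewrite g0x g'x mulr1 addr0.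
by rewrite /f' addrC subrK.
Qed.

Lemma agreement_closure (E : set (V -> C^o)) (f : V -> C^o) :
  (forall l : seq V, exists2 g, E g & {in l, g =1 f}) -> closure (E : set {ptws V -> C^o}) f.
Proof.
move=> h U Uf.
pose B (l : seq V) : set {ptws V -> C^o} := fun g => {in l, (g : V -> C^o) =1 f}.
pose F : set_system {ptws V -> C^o} := filter_from setT B.
have FF : Filter F.
  apply: filter_from_filter; first by exists [::].
  move=> l l' _ _; exists (l ++ l') => // g gl.
  by split=> x xl; apply: gl; rewrite mem_cat xl ?orbT.
have cF : F --> (f : {ptws V -> C^o}).
  apply/cvg_sup => x A [/= A' [[A'' oA'' <-] fA'' AA]].
  exists [:: x] => // g gx; apply: AA => /=.
  by rewrite gx ?inE.
have [l _ lU] := cF U Uf.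
by have [g Eg gl] := h l; exists g; split => //; exact: lU.
Qed.

End Bipolar.

(** In the topology of pointwise convergence only finite sets of points matter, so the separation
    argument reduces to linear algebra. *)
Lemma bipolar (R : realType) (A : cstarAlgebra R) (E : set (A -> (R[i])^o)) :
  (forall f, E f -> bdual f) -> (exists f, E f) ->
  (forall (k : R[i]) f g, E f -> E g -> E (fun x => k * f x + g x)) ->
  (forall f, bdual f -> closure (E : set {ptws A -> (R[i])^o}) f -> E f) ->
  forall f, bdual f -> (forall y, (forall g, E g -> g y = 0) -> f y = 0) -> E f.
Proof.
move=> bE neE lE cE f bf vf; apply: cE => //; apply: agreement_closure => l.
by apply: finite_agreement => // [g /bE bg|]; exact: bdual_lin.
Qed.

Section Conjugation.
Context {R : realType} {T : tensorModel R}.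
Local Notation C := R[i].

Lemma linclosed_preim (V : completeNormedModType C) (W : normedModType C) (f : V -> W) (P : set W) :
  linear f -> bounded f -> is_linclosed P -> is_linclosed [set v | P (f v)].
Proof.
move=> lf [K K0 hK] [P0 PD Pc]; split => /=.
- by rewrite (lin0 lf).
- by move=> k v w hv hw; rewrite (linP lf); exact: PD.
- move=> v hv; apply: Pc => e e0.
  have K1 : 0 < K + 1 by lra.
  have [w hw vw] := hv (e / (K + 1)) ltac:(by rewrite divr_gt0).
  exists (f w) => //; rewrite -(linB lf) (le_lt_trans (hK _)) //.
  by move: vw; rewrite ltr_pdivlMr //; have := nm_ge0 (v - w); lra.
Qed.

Lemma total_image (V W : completeNormedModType C) (f : V -> W) (P : set V) :
  linear f -> bounded f -> (forall w, exists v, f v = w) -> closed_span P = setT ->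
  closed_span [set f v | v in P] = setT.
Proof.
move=> lf bf sf PT; apply/seteqP; split => // w _; have [v <-] := sf w.
move: v; apply: (total_ind PT); last by move=> v Pv; apply: closed_span_sub; exists v.
exact: linclosed_preim (closed_span_linclosed _).
Qed.

Section Conj.
Variables (A B : cstarAlgebra R) (f : A -> multiplier B) (v : multiplier B).
Hypotheses (hf : mhom f) (nf : nondegenerate f) (v1 : madj v *M v = mone) (v2 : v *M madj v = mone).
Definition conjm x : multiplier B := v *M f x *M madj v.

Lemma conj_mul (m n : multiplier B) : v *M m *M madj v *M (v *M n *M madj v) = v *M (m *M n) *M madj v.
Proof. by rewrite -!mmulA [madj v *M (v *M _)]mmulA v1 mmul1l. Qed.

Lemma conjm_mhom : mhom conjm.
Proof.
apply/mhom_starhom; split.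
- exact: (lin_comp (f := fun m : MA B => (v : MA B) *c m *c madj v) (lin_comp (f := fun m : MA B => m *c madj v) (cmul_linl _) (cmul_linr _)) (mhom_lin hf)).
- by move=> x y; rewrite /conjm (mhomM hf) -conj_mul.
- by move=> x; rewrite /conjm (mhom_adj hf) [RHS]madjM madjM madjK mmulA.
Qed.

Lemma conjm_nondeg : nondegenerate conjm.
Proof.
apply: (total_sub (total_image (ml_linear v) (bounded_ml v) _ nf)) => [w|_ [_ [a [b ->]] <-]].
  by exists (ml (madj v) w); rewrite -[LHS]/(ml (v *M madj v) w) v2.
apply: closed_span_sub; exists a, (ml v b).
by rewrite -[RHS]/(ml (v *M f a *M (madj v *M v)) b) v1 mmul1.
Qed.

Lemma mext_conjm m : mext conjm m = v *M mext f m *M madj v.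
Proof.
apply/esym/mextP => [||a]; [exact: conjm_mhom|exact: conjm_nondeg|].
by rewrite /conjm conj_mul mext_spec.
Qed.
End Conj.

Local Notation "A ⊗ B" := (tensor T A B).
Local Notation "m ⊗M n" := (melt T m n).

Section Amp.
Variables (A B D : cstarAlgebra R) (f : A -> multiplier B).
Hypotheses (hf : mhom f) (nf : nondegenerate f).
Definition ampm x : multiplier (B ⊗ D) := f x ⊗M mone.

Lemma ampm_mhom : mhom ampm.
Proof.
apply/mhom_starhom; split.
- exact: (lin_comp (f := fun m : MA B => m ⊗M (mone : MA D)) (melt_linl T _) (mhom_lin hf)).
- by move=> x y; rewrite /ampm (mhomM hf) [RHS]meltM mmul1.
- by move=> x; rewrite /ampm (mhom_adj hf) [RHS]melt_adj madj_mone.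
Qed.

Lemma ampm_nondeg : nondegenerate ampm.
Proof.
apply: (total_sub (total_elt nf (totalT D))) => _ [_ [d [[a [b ->]] _ ->]]].
by apply: closed_span_sub; exists a, (elt T b d); rewrite ml_melt.
Qed.

Lemma mext_ampm m : mext ampm m = mext f m ⊗M mone.
Proof.
apply/esym/mextP => [||a]; [exact: ampm_mhom|exact: ampm_nondeg|].
by rewrite /ampm meltM mext_spec // mmul1.
Qed.
End Amp.

Lemma mext_homtens_comp (A B D F : cstarAlgebra R) (f : A -> multiplier B) (g : B -> multiplier D) :
  mhom f -> nondegenerate f -> mhom g -> nondegenerate g ->
  forall m : multiplier (A ⊗ F), mext (homtens g (@memb R F)) (mext (homtens f (@memb R F)) m) =
    mext (homtens (fun a => mext g (f a)) (@memb R F)) m.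
Proof.
move=> hf nf hg ng m.
have hF := memb_mhom F; have nF := memb_nondeg F.
rewrite (mext_comp (homtens_mhom hf hF) (homtens_nondeg hf hF nf nF)
  (homtens_mhom hg hF) (homtens_nondeg hg hF ng nF)); congr mext; apply/funext => x.
rewrite (homtens_comp hf hF hg hF ng nF); congr (homtens _ _ x).
by apply/funext => y; exact: mext_memb_id.
Qed.

End Conjugation.

(** * Dual actions and double crossed products *)

Section DualAction.
Context {R : realType} {G : TopologicalGroup.type} {T : tensorModel R}.
Hypothesis hG : locally_compact_group G.
Variable S : groupModel R G.
Local Notation cstar := (cstarAlgebra R).
Local Notation "A ⊗ B" := (tensor T A B).
Local Notation "m ⊗M n" := (melt T m n).
Local Notation elt := (elt T).
Local Notation CG := (CG S).
Local Notation C0 := (C0 S).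

Lemma covariantP (A : coaction T S) (D : cstar) (pi : A -> multiplier D) (mu : C0 -> multiplier D) :
  covariant pi mu <-> [/\ mhom pi, nondegenerate pi, mhom mu, nondegenerate mu
    & forall a, mext (homtens pi (@memb R CG)) (co_map a) = Wmu mu *M (pi a ⊗M mone) *M madj (Wmu mu)].
Proof. by []. Qed.

(** If w_G were the junk value 0, covariance would make the extension of pi ⊗ id vanish on delta(A),
    hence pi ⊗ id vanish on the total set delta(A)(1 ⊗ C^*(G)); nondegeneracy then gives D ⊗ C^*(G)
    = 0, against the nonzero d ⊗ c. *)
Lemma wG_genuine (A : coaction T S) (D : cstar) (pi : A -> multiplier D) (mu : C0 -> multiplier D)
  (d : D) (c : CG) : covariant pi mu -> d <> 0 -> c <> 0 -> wG_prop (T := T) S.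
Proof.
move=> [hpi npi hmu nmu cov] d0 c0; have [//|w0] := wG_cases (T := T) S.
have hH := homtens_mhom (T := T) hpi (memb_mhom CG).
have nH := homtens_nondeg (T := T) hpi (memb_mhom CG) npi (memb_nondeg CG).
have cov0 a : mext (homtens (T := T) pi (@memb R CG)) (co_map a) = mzero.
  rewrite cov w0 (mext_zero (homtens_mhom hmu (memb_mhom CG)) (homtens_nondeg hmu (memb_mhom CG) nmu (memb_nondeg CG))).
  exact: mult_ext.
have H0 x : homtens (T := T) pi (@memb R CG) x = mzero.
  apply: (total_eq (f := homtens pi (@memb R CG) : _ -> MA _) (g := fun=> 0) (mhom_lin hH) _ (mhom_bounded hH) _ (co_total A)).
  - by move=> k v w; rewrite scaler0 addr0.
  - by exists 0 => // v; rewrite nm0 mul0r.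
  move=> y [b [e ye]].
  have -> : y = dr b e by apply: (@mb_inj R); rewrite /mb ye drP.
  by rewrite -(mext_dr _ _ hH nH) cov0; apply: mult_ext => z.
have Z0 : forall z : D ⊗ CG, z = 0 by apply: (total_set0 nH) => _ [x [y ->]]; rewrite H0.
have : nm (elt d c) = 0 by rewrite [elt _ _]Z0 nm0.
by rewrite nm_elt => /eqP; rewrite mulf_eq0 => /orP[] /eqP /nm_eq0.
Qed.

Hypothesis wG_ok : wG_prop (T := T) S.
Variables (A : coaction T S) (P : crossedProduct A).

Let hA : mhom (jA P). Proof. by case: (cp_cov P). Qed.
Let nA : nondegenerate (jA P). Proof. by case: (cp_cov P). Qed.
Let h0 : mhom (jG P). Proof. by case: (cp_cov P). Qed.
Let n0 : nondegenerate (jG P). Proof. by case: (cp_cov P). Qed.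

(** Translation replaces W by W (1 ⊗ u s), and 1 ⊗ u s commutes with jA a ⊗ 1, so the covariance
    identity is unchanged. The universal property then produces the dual action. *)
Lemma covariant_rt s : covariant (jA P) (fun f => jG P (rt s f)).
Proof.
apply/covariantP; split => //; [exact: rt_mhom|exact: rt_nondeg|move=> a].
have [_ _ _ _ ->] := (covariantP _ _).1 (cp_cov P).
rewrite (Wmu_rt hG wG_ok) // madjM melt_adj madj_mone -!mmulA; congr (_ *M _).
by rewrite [RHS]mmulA meltM mmul1l mmul1 [RHS]mmulA meltM mmul1 (urepV (uG_rep S)).
Qed.

Lemma dual_endo s : exists h : P -> P, [/\ starhom h,
    forall a, mext (fun x => memb (h x)) (jA P a) = jA P a,
    forall f, mext (fun x => memb (h x)) (jG P f) = jG P (rt s f)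
  & forall a f x, memb x = jA P a *M jG P f -> memb (h x) = jA P a *M jG P (rt s f)].
Proof.
have [psi [[hpsi npsi pA pG] _]] := cp_univ P (covariant_rt s).
have gen a f x : memb x = jA P a *M jG P f -> psi x = jA P a *M jG P (rt s f).
  by move=> e; rewrite -(mext_memb hpsi npsi) e (mextM hpsi npsi) pA pG.
have [h [hh hE]] : exists h : P -> P, starhom h /\ forall x, psi x = memb (h x).
  apply: starhom_of_memb => //.
  apply: (memb_range (h := psi : P -> MA P) (mhom_lin hpsi) (mhom_bounded hpsi) (cp_span P)) => x [a [f e]].
  have [y ye] := cp_mem P a (rt s f).
  by exists y; rewrite (gen a f) // -ye.
have e : psi = fun x => memb (h x) by apply/funext.
exists h; split => //; first by rewrite -e.
  by rewrite -e.
by move=> a f x xe; rewrite -hE (gen a f).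
Qed.

Lemma dual_actionP s : [/\ starhom (dual_action (P := P) s), bijective (dual_action (P := P) s),
    forall a, mext (fun x => memb (dual_action (P := P) s x)) (jA P a) = jA P a
  & forall f, mext (fun x => memb (dual_action (P := P) s x)) (jG P f) = jG P (rt s f)].
Proof.
suff ex : exists h : P -> P, [/\ starhom h, bijective h,
    forall a, mext (fun x => memb (h x)) (jA P a) = jA P a
  & forall f, mext (fun x => memb (h x)) (jG P f) = jG P (rt s f)].
  exact: (the_spec id ex).
have [h [hh hA' hG' hgen]] := dual_endo s.
have [k [hk _ _ kgen]] := dual_endo s^-1%g.
have inv (h1 h2 : P -> P) t1 t2 : starhom h1 -> starhom h2 -> (forall f : C0, rt t1 (rt t2 f) = f) ->
    (forall a f x, memb x = jA P a *M jG P f -> memb (h1 x) = jA P a *M jG P (rt t1 f)) ->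
    (forall a f x, memb x = jA P a *M jG P f -> memb (h2 x) = jA P a *M jG P (rt t2 f)) ->
    cancel h2 h1.
  move=> hh1 hh2 t12 g1 g2.
  apply: (total_eq (f := fun x => h1 (h2 x)) (g := id) _ _ _ _ (cp_span P)).
  - exact: (lin_comp (starhom_lin hh1) (starhom_lin hh2)).
  - by [].
  - exact: (bounded_comp (starhom_bounded hh1) (starhom_bounded hh2)).
  - exact: bounded_id.
  move=> x [a [f e]]; apply: (@mb_inj R); rewrite /mb (g1 a (rt t2 f)) ?(g2 a f) //.
  by rewrite t12.
exists h; split => //; exists k; [apply: inv kgen hgen|apply: inv hgen kgen] => // f.
  by rewrite (rtM hG) mulVg rt1.
by rewrite (rtM hG) mulgV rt1.
Qed.

End DualAction.

Section DoubleDual.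
Context {R : realType} {G : TopologicalGroup.type} {T : tensorModel R}.
Hypothesis hG : locally_compact_group G.
Variable S : groupModel R G.
Local Notation "A ⊗ B" := (tensor T A B).
Local Notation "m ⊗M n" := (melt T m n).
Local Notation CG := (CG S).
Local Notation C0 := (C0 S).
Local Notation u := (@uG R G S).
Hypothesis wG_ok : wG_prop (T := T) S.
Variables (A : coaction T S) (P : crossedProduct A) (Q : actionCrossedProduct S (dual_action (P := P))).

Local Notation al := (dual_action (P := P)).
Local Notation nu := (iG Q).
Definition dA (a : A) : multiplier Q := mext (iP Q) (jA P a).
Definition dG (f : C0) : multiplier Q := mext (iP Q) (jG P f).
Local Notation W := (Wmu (T := T) dG).

Let hA : mhom (jA P). Proof. by case: (cp_cov P). Qed.
Let nA : nondegenerate (jA P). Proof. by case: (cp_cov P). Qed.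
Let h0 : mhom (jG P). Proof. by case: (cp_cov P). Qed.
Let n0 : nondegenerate (jG P). Proof. by case: (cp_cov P). Qed.
Lemma iP_mhom : mhom (iP Q). Proof. by case: (acp_cov Q). Qed.
Lemma iP_nondeg : nondegenerate (iP Q). Proof. by case: (acp_cov Q). Qed.
Lemma nu_rep : unitary_rep nu. Proof. by case: (acp_cov Q). Qed.
Lemma iP_cov s x : iP Q (al s x) = nu s *M iP Q x *M madj (nu s).
Proof. by case: (acp_cov Q). Qed.

Lemma dA_mhom : mhom dA. Proof. exact: (comp_mhom iP_mhom iP_nondeg hA). Qed.
Lemma dA_nondeg : nondegenerate dA. Proof. exact: (comp_nondeg nA iP_mhom iP_nondeg). Qed.
Lemma dG_mhom : mhom dG. Proof. exact: (comp_mhom iP_mhom iP_nondeg h0). Qed.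
Lemma dG_nondeg : nondegenerate dG. Proof. exact: (comp_nondeg n0 iP_mhom iP_nondeg). Qed.

Lemma mext_al s (m : multiplier P) :
  mext (iP Q) (mext (fun x => memb (al s x)) m) = nu s *M mext (iP Q) m *M madj (nu s).
Proof.
have [ha ba _ _] := dual_actionP hG wG_ok P s.
have na : nondegenerate (fun x => memb (al s x)).
  apply: nondeg_memb => //; rewrite (_ : range _ = setT) ?totalT //.
  by apply/seteqP; split => // x _; case: ba => k _ ak; exists (k x).
rewrite (mext_comp (memb_hom ha) na iP_mhom iP_nondeg) -(mext_conjm iP_mhom iP_nondeg (urepVl nu_rep s) (urepV nu_rep s)).
by congr mext; apply/funext => x; rewrite (mext_memb iP_mhom iP_nondeg) iP_cov.
Qed.

Lemma nu_dG s f : nu s *M dG f *M madj (nu s) = dG (rt s f).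
Proof. by rewrite /dG -mext_al; have [_ _ _ ->] := dual_actionP hG wG_ok P s. Qed.

Lemma W_one : madj W *M W = mone /\ W *M madj W = mone.
Proof. exact: (Wmu_unitary hG wG_ok dG_mhom dG_nondeg). Qed.

Lemma W_dA a : W *M (dA a ⊗M mone) *M madj W = mext (homtens dA (@memb R CG)) (co_map a).
Proof.
have hc := memb_mhom CG; have nc := memb_nondeg CG.
have [_ _ _ _ cov] := (covariantP _ _).1 (cp_cov P).
rewrite -(mext_homtens_comp hA nA iP_mhom iP_nondeg) cov.
have hH := homtens_mhom (T := T) iP_mhom hc; have nH := homtens_nondeg (T := T) iP_mhom hc iP_nondeg nc.
rewrite !(mextM hH nH) (mext_adj hH nH) (mext_homtens_melt iP_mhom hc iP_nondeg nc) (mext_one hc nc).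
by rewrite /Wmu (mext_homtens_comp h0 n0 iP_mhom iP_nondeg).
Qed.

Lemma W_dG f : W *M (dG f ⊗M mone) *M madj W = dG f ⊗M mone.
Proof. by rewrite (Wmu_commute hG wG_ok dG_mhom dG_nondeg) -mmulA W_one.2 mmul1. Qed.

(** Both sides are the unitary attached to f |-> dG (rt s^-1 f): once because translating w_G
    multiplies it by u, once because nu implements the translation. *)
Lemma W_u s : W *M (mone ⊗M madj (u s)) = (madj (nu s) ⊗M mone) *M W *M (nu s ⊗M mone).
Proof.
rewrite -(Wmu_conj dG_mhom dG_nondeg (urepV nu_rep s) (urepVl nu_rep s)
  (mu' := fun f => dG (rt s^-1%g f))).
- rewrite (Wmu_rt hG wG_ok) ?urep_adj //; [exact: uG_rep|exact: dG_mhom|exact: dG_nondeg].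
- exact/rt_mhom/dG_mhom.
- exact/rt_nondeg/dG_nondeg.
by move=> f; rewrite -nu_dG -(urep_adj nu_rep) madjK.
Qed.

Lemma W_nu s : W *M (nu s ⊗M u s) *M madj W = nu s ⊗M mone.
Proof.
have e : (nu s ⊗M mone) *M W *M (mone ⊗M madj (u s)) = W *M (nu s ⊗M mone).
  rewrite -mmulA W_u !mmulA meltM (urepV nu_rep) mmul1 melt11 mmul1l //.
have -> : W *M (nu s ⊗M u s) = (nu s ⊗M mone) *M W.
  rewrite -[nu s ⊗M u s](_ : (nu s ⊗M mone) *M (mone ⊗M u s) = _).
    by rewrite mmulA -e -mmulA meltM (urepVl (uG_rep S)) mmul1 melt11 mmul1.
  by rewrite meltM mmul1 mmul1l.
by rewrite -mmulA W_one.2 mmul1.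
Qed.

(** Before conjugation the pair is covariant because 1 ⊗ u s commutes with P ⊗ 1. Conjugation by W
    then absorbs the factor u s, fixes dG ⊗ 1 because W commutes with it, and turns dA ⊗ 1 into the
    coaction by covariance. *)
Lemma Tmap_exists : exists F : Q -> multiplier (Q ⊗ CG), [/\ mhom F, nondegenerate F,
  forall a, mext F (dA a) = mext (homtens dA (@memb R CG)) (co_map a),
  forall f, mext F (dG f) = dG f ⊗M mone
  & forall s, mext F (nu s) = nu s ⊗M mone].
Proof.
have hp := ampm_mhom (T := T) CG iP_mhom; have np := ampm_nondeg (T := T) CG iP_nondeg.
have [psi [[hpsi npsi pP pG] _]] : exists! psi, acp_integrates (iP Q) nu
    (ampm (T := T) CG (iP Q)) (fun s => nu s ⊗M u s) psi.
  apply: (acp_univ Q); split => //; first exact: (tensor_rep nu_rep (uG_rep S)).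
  by move=> s x; rewrite /ampm iP_cov melt_adj !meltM mmul1 (urepV (uG_rep S)).
have [W1 W2] := W_one.
have pm m : mext psi (mext (iP Q) m) = mext (iP Q) m ⊗M mone.
  rewrite -(mext_ampm CG iP_mhom iP_nondeg) (mext_comp iP_mhom iP_nondeg hpsi npsi); congr mext; exact/funext.
exists (conjm psi W); split.
- exact: conjm_mhom.
- exact: conjm_nondeg.
- by move=> a; rewrite mext_conjm // -W_dA /dA pm.
- by move=> f; rewrite mext_conjm // -[in RHS]W_dG /dG pm.
- by move=> s; rewrite mext_conjm // pG W_nu.
Qed.

End DoubleDual.

Arguments lslice_lin {R T A B f} bf.
Arguments lslice_bounded {R T A B f} bf.
Arguments lslice_elt {R T A B f} bf a b.
(** * Invariance of large ideals *)

Section SubAlgebra.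
Context {R : realType}.
Local Notation C := R[i].

Definition is_subalgebra (A : cstarAlgebra R) (P : set A) : Prop :=
  [/\ is_linclosed P, forall a b, P a -> P b -> P (a *c b) & forall a, P a -> P (cadj a)].

(** The closure proof is a parameter of the type, so that the structures declared on it can recover
    the closure properties from the type itself. *)
Definition subc (A : cstarAlgebra R) (P : set A) of is_subalgebra P : Type := {a : A | P a}.

Variables (A : cstarAlgebra R) (P : set A) (H : is_subalgebra P).
Local Notation D := (subc H).
Definition subv (d : D) : A := @sval A P d.

Lemma subvP (d : D) : P (subv d). Proof. exact: svalP. Qed.
Lemma subv_inj : injective subv.
Proof.
by move=> [a pa] [b pb] /= e; rewrite /subv /= in e; subst b; congr exist; exact: Prop_irrelevance.
Qed.

Let PL : is_linclosed P. Proof. by case: H. Qed.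
Let P0 : P 0. Proof. by case: PL. Qed.
Let PP k a b : P a -> P b -> P (k *: a + b). Proof. by case: PL => _ h _; exact: h. Qed.
Let PZ k a : P a -> P (k *: a). Proof. by move=> pa; rewrite -[k *: a]addr0; exact: PP. Qed.
Let PD a b : P a -> P b -> P (a + b). Proof. by move=> pa pb; rewrite -[a]scale1r; exact: PP. Qed.
Let PM a b : P a -> P b -> P (a *c b). Proof. by case: H => _ h _; exact: h. Qed.
Let PS a : P a -> P (cadj a). Proof. by case: H => _ _ h; exact: h. Qed.

Definition sub0 : D := exist _ 0 P0.
Definition subD (d e : D) : D := exist _ _ (PD (subvP d) (subvP e)).
Definition subZ k (d : D) : D := exist _ _ (PZ k (subvP d)).
Definition subM (d e : D) : D := exist _ _ (PM (subvP d) (subvP e)).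
Definition subS (d : D) : D := exist _ _ (PS (subvP d)).

HB.instance Definition _ := gen_eqMixin D.
HB.instance Definition _ := gen_choiceMixin D.

Fact subDA : associative subD. Proof. by move=> a b c; apply: subv_inj; exact: addrA. Qed.
Fact subDC : commutative subD. Proof. by move=> a b; apply: subv_inj; exact: addrC. Qed.
Fact subD0 : left_id sub0 subD. Proof. by move=> a; apply: subv_inj; exact: add0r. Qed.
Fact subDN : left_inverse sub0 (subZ (-1)) subD.
Proof. by move=> a; apply: subv_inj; rewrite /subv /= scaleN1r addNr. Qed.
HB.instance Definition _ := GRing.isZmodule.Build D subDA subDC subD0 subDN.

Fact subZA k l a : subZ k (subZ l a) = subZ (k * l) a. Proof. by apply: subv_inj; exact: scalerA. Qed.
Fact subZ1 : left_id 1 subZ. Proof. by move=> a; apply: subv_inj; exact: scale1r. Qed.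
Fact subZDr : right_distributive subZ +%R. Proof. by move=> k a b; apply: subv_inj; exact: scalerDr. Qed.
Fact subZDl a : {morph subZ^~ a : k l / k + l}. Proof. by move=> k l; apply: subv_inj; exact: scalerDl. Qed.
HB.instance Definition _ := GRing.Zmodule_isLmodule.Build C D subZA subZ1 subZDr subZDl.

Definition subnorm (d : D) : C := `|subv d|.
Fact subnormD d e : subnorm (d + e) <= subnorm d + subnorm e. Proof. exact: ler_normD. Qed.
Fact subnormZ k d : subnorm (k *: d) = `|k| * subnorm d. Proof. exact: normrZ. Qed.
Fact subnorm0 d : subnorm d = 0 -> d = 0.
Proof. by move=> /eqP; rewrite normr_eq0 => /eqP e; exact: subv_inj. Qed.
HB.instance Definition _ := @Lmodule_isNormed.Build C D subnorm subnormD subnormZ subnorm0.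

Lemma nm_subv (d : D) : nm (subv d) = nm d. Proof. by []. Qed.
Lemma subv_lin : linear subv. Proof. by []. Qed.

Lemma sub_complete (s : nat -> D) : (forall e : R, 0 < e -> exists N, forall m n : nat, (N <= m)%N -> (N <= n)%N ->
  nm (s m - s n) < e) -> exists l, tends s l.
Proof.
move=> cs; have [|l hl] := @complete_nm R A (fun n => subv (s n)).
  move=> e /cs[N hN]; exists N => m n Nm Nn.
  by rewrite -(linB subv_lin) nm_subv hN.
have Pl : P l.
  have [_ _ Pc] := PL; apply: Pc => e /hl[N hN]; exists (subv (s N)); first exact: subvP.
  by rewrite nm_sym hN.
by exists (exist _ l Pl) => e /hl[N hN]; exists N => n Nn; rewrite -nm_subv (linB subv_lin) hN.
Qed.
HB.instance Definition _ := Uniform_isComplete.Build D (seq_complete sub_complete).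

Definition subcarrier : completeNormedModType C := D.

Fact subMA : associative subM. Proof. by move=> a b c; apply: subv_inj; exact: cmulA. Qed.
Fact subMDl a b c : subM (a + b) c = subM a c + subM b c. Proof. by apply: subv_inj; exact: cmulDl. Qed.
Fact subMDr a b c : subM a (b + c) = subM a b + subM a c. Proof. by apply: subv_inj; exact: cmulDr. Qed.
Fact subMZl k a b : subM (k *: a) b = k *: subM a b. Proof. by apply: subv_inj; exact: cmulZl. Qed.
Fact subMZr k a b : subM a (k *: b) = k *: subM a b. Proof. by apply: subv_inj; exact: cmulZr. Qed.
Fact subSK : involutive subS. Proof. by move=> a; apply: subv_inj; exact: cadjK. Qed.
Fact subSD a b : subS (a + b) = subS a + subS b. Proof. by apply: subv_inj; exact: cadjD. Qed.
Fact subSZ k a : subS (k *: a) = Num.conj k *: subS a. Proof. by apply: subv_inj; exact: cadjZ. Qed.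
Fact subSM a b : subS (subM a b) = subM (subS b) (subS a). Proof. by apply: subv_inj; exact: cadjM. Qed.
Fact subnormM a b : `|subM a b| <= `|a| * `|b|. Proof. exact: cnormM. Qed.
Fact subnormE a : `|subM (subS a) a| = `|a| ^+ 2. Proof. exact: cnormE. Qed.

Definition subalgebra : cstarAlgebra R :=
  @CStarAlgebra R subcarrier subM subS subMA subMDl subMDr subMZl subMZr
    subSK subSD subSZ subSM subnormM subnormE.

End SubAlgebra.

Section SliceFacts.
Context {R : realType} {T : tensorModel R}.
Local Notation C := R[i].
Local Notation "A ⊗ B" := (tensor T A B).
Local Notation "m ⊗M n" := (melt T m n).
Local Notation elt := (elt T).
Variables A B : cstarAlgebra R.
Implicit Types (z : A ⊗ B) (f : B -> C^o) (x : A -> C^o).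

Lemma lslice_ml x (n : multiplier B) z : bdual x -> ml n (lslice x z) = lslice x (ml (mone ⊗M n) z).
Proof.
move=> bx; apply: (total_eq (f := fun z => ml n (lslice x z)) (g := fun z => lslice x (ml (mone ⊗M n) z)) _ _ _ _ (tens_total T A B)).
- exact: (lin_comp (f := ml n) (ml_linear _) (lslice_lin bx)).
- exact: (lin_comp (f := lslice x) (lslice_lin bx) (ml_linear _)).
- exact: (bounded_comp (f := ml n) (bounded_ml _) (lslice_bounded bx)).
- exact: (bounded_comp (f := lslice x) (lslice_bounded bx) (bounded_ml _)).
by move=> _ [a [b ->]]; rewrite ml_melt !lslice_elt // mlZ.
Qed.

Lemma lslice_mr x (n : multiplier B) z : bdual x -> mr n (lslice x z) = lslice x (mr (mone ⊗M n) z).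
Proof.
move=> bx; apply: (total_eq (f := fun z => mr n (lslice x z)) (g := fun z => lslice x (mr (mone ⊗M n) z)) _ _ _ _ (tens_total T A B)).
- exact: (lin_comp (f := mr n) (mr_linear _) (lslice_lin bx)).
- exact: (lin_comp (f := lslice x) (lslice_lin bx) (mr_linear _)).
- exact: (bounded_comp (f := mr n) (bounded_mr _) (lslice_bounded bx)).
- exact: (bounded_comp (f := lslice x) (lslice_bounded bx) (bounded_mr _)).
by move=> _ [a [b ->]]; rewrite mr_melt !lslice_elt // (linZ (mr_linear n)).
Qed.

Lemma lslice_adj x z : bdual x -> cadj (lslice x z) = lslice (fun a => Num.conj (x (cadj a))) (cadj z).
Proof.
move=> bx; have bx' := bdual_adj bx; apply: (can_inj (@cadjK R B)); rewrite cadjK.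
have [l1 b1] := adj_lin_bounded (lslice_lin (T := T) (B := B) bx') (lslice_bounded (T := T) (B := B) bx').
apply: (total_eq (f := lslice x) (g := fun z => cadj (lslice (fun a => Num.conj (x (cadj a))) (cadj z))) (lslice_lin bx) l1 (lslice_bounded bx) b1 (tens_total T A B)).
by move=> _ [a [b ->]]; rewrite elt_adj !lslice_elt // cadjZ conjCK !cadjK.
Qed.

Lemma slice_lslice f x z : bdual f -> bdual x -> f (lslice x z) = x (slice f z).
Proof.
move=> bf bx; apply: (total_eq (f := fun z => f (lslice x z)) (g := fun z => x (slice f z)) _ _ _ _ (tens_total T A B)).
- exact: (lin_comp (f := f) (bdual_lin bf) (lslice_lin bx)).
- exact: (lin_comp (f := x) (bdual_lin bx) (slice_lin bf)).
- exact: (bounded_comp (f := f) (bdual_bounded bf) (lslice_bounded bx)).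
- exact: (bounded_comp (f := x) (bdual_bounded bx) (slice_bounded bf)).
move=> _ [a [b ->]]; rewrite slice_elt // lslice_elt // (linZ (bdual_lin bf)) (linZ (bdual_lin bx)).
exact: mulrC.
Qed.

Lemma slice_amp f (m : multiplier A) z : bdual f -> slice f (ml (m ⊗M mone) z) = ml m (slice f z).
Proof.
move=> bf; apply: (total_eq (f := fun z => slice f (ml (m ⊗M mone) z)) (g := fun z => ml m (slice f z)) _ _ _ _ (tens_total T A B)).
- exact: (lin_comp (f := slice f) (slice_lin bf) (ml_linear _)).
- exact: (lin_comp (f := ml m) (ml_linear _) (slice_lin bf)).
- by have := bounded_comp (slice_bounded bf : bounded (slice f : A ⊗ B -> A)) (bounded_ml (m ⊗M mone)).
- exact: (bounded_comp (f := ml m) (bounded_ml _) (slice_bounded bf)).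
by move=> _ [a [b ->]]; rewrite ml_melt !slice_elt // mlZ.
Qed.

(* The multiplier (x (k' . k) (x) id)(W) of B. *)
Section SliceMult.
Variables (W : multiplier (A ⊗ B)) (x : A -> C^o) (bx : bdual x) (k' k : A).

Fact slice_mult_subproof a b :
  a *c lslice x (ml (memb k' ⊗M mone) (ml W (elt k b))) =
  lslice x (mr (memb k ⊗M mone) (mr W (elt k' a))) *c b.
Proof.
rewrite -[LHS]/(ml (memb a) _) lslice_ml // -[X in lslice x X]/(ml ((mone ⊗M memb a) *M (memb k' ⊗M mone)) _).
rewrite meltM mmul1 mmul1l -memb_elt -[X in lslice x X]/(elt k' a *c ml W (elt k b)) ml_mr.
rewrite -[RHS]/(mr (memb b) _) (lslice_mr _ _ bx).
by rewrite -[X in _ = lslice x X]/(mr ((memb k ⊗M mone) *M (mone ⊗M memb b)) _) meltM mmul1 mmul1l -memb_elt.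
Qed.

Definition slice_mult : multiplier B := Multiplier slice_mult_subproof.
End SliceMult.

Lemma slice_mult_adj W x (bx : bdual x) k' k :
  madj (slice_mult W bx k' k) = slice_mult (madj W) (bdual_adj bx) (cadj k) (cadj k').
Proof.
apply: mult_ext => b; rewrite -[LHS]/(cadj (lslice x (mr (memb k ⊗M mone) (mr W (elt k' (cadj b)))))) lslice_adj //.
rewrite [cadj (mr (memb k ⊗M mone) _)]adj_mr [cadj (mr W _)]adj_mr elt_adj cadjK melt_adj madj_mone.
by rewrite -[madj (memb k)](@mb_adj R A).
Qed.

Lemma slice_mult_bound W x (bx : bdual x) : exists2 K : R, 0 <= K &
  forall k' k, nm (slice_mult W bx k' k : MA B) <= K * (nm k' * nm k).
Proof.
have [K K0 hK] := lslice_bounded (T := T) (B := B) bx; have W0 : 0 <= nm (W : MA (A ⊗ B)) by exact: nm_ge0.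
exists (K * nm (W : MA (A ⊗ B))); first by rewrite mulr_ge0.
move=> k' k; apply: nm_mlP => [|b]; first by rewrite !mulr_ge0 // nm_ge0.
rewrite (le_trans (hK _)) // -!mulrA ler_wpM2l // (le_trans (nm_ml _ _)) //.
have h1 : nm (memb k' ⊗M mone : MA (A ⊗ B)) <= nm k'.
  rewrite (le_trans (nm_melt T (memb k' : MA A) (mone : MA B))) // nm_mb.
  by rewrite ler_piMr ?nm_ge0 // nm_one.
have h2 := nm_ml W (elt k b); rewrite nm_elt in h2.
rewrite (le_trans (ler_pM (nm_ge0 _) (nm_ge0 _) h1 h2)) //.
by rewrite mulrCA.
Qed.

Lemma slice_mult_linl W x (bx : bdual x) k : linear (fun k' => slice_mult W bx k' k : MA B).
Proof.
move=> c p q; apply: mult_ext => b /=.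
rewrite (_ : memb (c *: p + q) = c *: (memb p : MA A) + memb q); last exact: (@mb_lin R A).
by rewrite (melt_linl T (mone : MA B)) -(linP (lslice_lin bx)).
Qed.
Lemma slice_mult_linr W x (bx : bdual x) k' : linear (slice_mult W bx k' : A -> MA B).
Proof.
move=> c p q; apply: mult_ext => b /=.
by rewrite (linP (elt_linl T b)) !mlP (linP (lslice_lin bx)).
Qed.

(** As W is unitary, the tensor W^* (q ⊗ b) is sliced to x(k' q) b = b. The slicing map is therefore
    onto, and the images of elementary tensors are total. *)
Lemma slice_mult_total W x (bx : bdual x) k' q : madj W *M W = mone -> W *M madj W = mone -> x (k' *c q) = 1 ->
  closed_span [set z | exists k b, z = ml (slice_mult W bx k' k) b] = setT.
Proof.
move=> W1 W2 xk.
pose F z := lslice x (ml (memb k' ⊗M mone) (ml W z)).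
have lF : linear F.
  exact: (lin_comp (f := lslice x) (lslice_lin bx) (lin_comp (f := ml (memb k' ⊗M mone)) (ml_linear _) (ml_linear _))).
have bF : bounded F.
  exact: (bounded_comp (f := lslice x) (lslice_bounded bx) (bounded_comp (f := ml (memb k' ⊗M mone)) (bounded_ml _) (bounded_ml _))).
have sF b : exists z, F z = b.
  exists (ml (madj W) (elt q b)); rewrite /F -[ml W _]/(ml (W *M madj W) _) W2 /= ml_melt lslice_elt //.
  by rewrite xk scale1r.
apply: (total_sub (total_image lF bF sF (tens_total T A B))) => _ [_ [k [b ->]] <-].
by apply: closed_span_sub; exists k, b.
Qed.

End SliceFacts.

Section Invariance.
Context {R : realType} {G : TopologicalGroup.type} {T : tensorModel R}.
Hypothesis hG : locally_compact_group G.
Variable S : groupModel R G.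
Local Notation C := R[i].
Local Notation cstar := (cstarAlgebra R).
Local Notation "A ⊗ B" := (tensor T A B).
Local Notation "m ⊗M n" := (melt T m n).
Local Notation elt := (elt T).
Local Notation CG := (CG S).
Local Notation C0 := (C0 S).
Local Notation u := (@uG R G S).
Hypothesis wG_ok : wG_prop (T := T) S.

Variables (Q : cstar) (mu : C0 -> multiplier Q) (nu : G -> multiplier Q).
Hypotheses (hmu : mhom mu) (nmu : nondegenerate mu) (hnu : unitary_rep nu).
Local Notation W := (Wmu (T := T) mu).
Local Notation Hm := (homtens (T := T) mu (@memb R CG)).
Hypothesis W_cov : forall s, W *M (mone ⊗M madj (u s)) = (madj (nu s) ⊗M mone) *M W *M (nu s ⊗M mone).
Hypothesis Q0 : exists q : Q, q <> 0.

Variable E : set (CG -> C^o).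
Hypothesis bE : forall f, E f -> bdual f.
Let N : set CG := [set y | forall f, E f -> f y = 0].
Hypothesis uN : forall s y, N y -> N (ml (u s) y).

Lemma ml_mext_evm s (m : multiplier (C0 ⊗ CG)) z :
  ml (mext (evm s) m) (evslice s z) = evslice s (ml m z).
Proof.
apply: (@mb_inj R); rewrite -mul_mb.
exact: (mext_spec (evm_mhom S s) (evm_nondeg hG S s) m z).
Qed.

(** For k = mu(g) k1 the slice is mu(h) k1, where h is the function s |-> g(s) f(u'(s) y) on G; this
    function vanishes when u'(s) y lies in N for every s. The generality in [w'] and [u'] covers W
    and W^* together. *)
Lemma Wmu_slice w' u' (k : Q) y f : (forall s, mext (evm s) w' = u' s) -> (forall s, N (ml (u' s) y)) ->
  E f -> slice f (ml (mext Hm w') (elt k y)) = 0.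
Proof.
move=> ww uy Ef; have bf := bE Ef.
have hH := HW_mhom (T := T) (S := S) hmu; have nH := HW_nondeg (T := T) (S := S) hmu nmu.
move: k; apply: (total_ind nmu) => [|_ [g [k1 ->]]].
  apply: (linclosed_zero (f := fun k => slice f (ml (mext Hm w') (elt k y)))).
    exact: (lin_comp (f := slice f) (slice_lin bf) (lin_comp (f := ml (mext Hm w')) (ml_linear _) (elt_linl T y))).
  have b1 : bounded (fun k : Q => elt k y) by exists (nm y); rewrite ?nm_ge0 // => k; rewrite nm_elt mulrC.
  have b2 := bounded_comp (bounded_ml (mext Hm w')) b1.
  by have := bounded_comp (slice_bounded bf : bounded (slice f : Q ⊗ CG -> Q)) b2.
pose h (z : C0 ⊗ CG) : MA (Q ⊗ CG) := @cmul R (MA (Q ⊗ CG)) (Hm z) (memb k1 ⊗M mone).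
have lh : linear h :=  (lin_comp (f := fun m : MA (Q ⊗ CG) => m *c (memb k1 ⊗M mone)) (cmul_linl _) (mhom_lin hH)).
have bh : bounded h :=  (bounded_comp (f := fun m : MA (Q ⊗ CG) => m *c (memb k1 ⊗M mone)) (bounded_cmull _) (mhom_bounded hH)).
have helt (a : C0) c : h (elt a c) = mb (elt (ml (mu a) k1) c).
  rewrite /h (homtens_elt hmu (memb_mhom _)) -[LHS]/((mu a ⊗M memb c) *M (memb k1 ⊗M mone)) meltM mmul1 /mb memb_elt; congr (_ ⊗M _).
  exact: (@mul_mb R Q).
have [L hL] := choice (memb_range lh bh (tens_total T C0 CG) (fun z zz => let: ex_intro a (ex_intro c e) := zz in
  ex_intro _ (elt (ml (mu a) k1) c) (etrans (congr1 h e) (helt a c)))).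
have lL : linear L.
  by move=> k p q; apply: (@mb_inj R); rewrite -hL lh !hL -(@mb_lin R).
have bL : bounded L.
  by have [K K0 hK] := bh; exists K => // z; rewrite -nm_mb -hL.
have sL z : slice f (L z) = ml (mu (slice f z)) k1.
  have lm : linear (fun x => ml (mu x) k1) by move=> k p q; rewrite (mhom_lin hmu).
  have bm : bounded (fun x => ml (mu x) k1).
    exists (nm k1); rewrite ?nm_ge0 // => x; rewrite (le_trans (nm_ml (mu x) k1)) // mulrC.
    by rewrite ler_wpM2l ?nm_ge0 // (mhom_contractive hmu).
  apply: (total_eq (f := fun z => slice f (L z)) (g := fun z => ml (mu (slice f z)) k1) _ _ _ _ (tens_total T C0 CG)).
  - exact: (lin_comp (f := slice f) (slice_lin bf) lL).
  - exact: (lin_comp (f := fun x => ml (mu x) k1) lm (slice_lin bf)).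
  - by have := bounded_comp (slice_bounded bf : bounded (slice f : Q ⊗ CG -> Q)) bL.
  - exact: (bounded_comp (f := fun x => ml (mu x) k1) bm (slice_bounded bf)).
  move=> _ [a [c ->]]; have -> : L (elt a c) = elt (ml (mu a) k1) c by apply: (@mb_inj R); rewrite -hL helt.
  by rewrite !slice_elt // (linZ lm).
have -> : elt (ml (mu g) k1) y = L (elt g y) by apply: (@mb_inj R); rewrite -hL helt.
have -> : ml (mext Hm w') (L (elt g y)) = L (ml w' (elt g y)).
  apply: (@mb_inj R); rewrite -mul_mb -!hL /h -(mext_spec hH nH).
  exact: (@cmulA R (MA _)).
rewrite sL (_ : slice f (ml w' (elt g y)) = 0).
  by have /= := lin0 (mhom_lin hmu) => ->.
apply: ev_inj => s; rewrite evslice_slice // -ml_mext_evm ww evslice_elt mlZ (linZ (bdual_lin bf)).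
by rewrite uy // scaler0 (lin0 (@ev_lin R G S s)).
Qed.

(* The multipliers of CG which, like the slices of W and W^*, map N into N and
   have norm continuous left translates. *)
Let half : set (MA CG) := [set n | (forall y, N y -> N (ml n y)) /\
  forall s e, 0 < e -> \forall t \near s, nm ((u s *M n : MA CG) - u t *M n) < e].
Let D : set (MA CG) := [set n | half n /\ half (cadj n)].

Lemma N_lin k x y : N x -> N y -> N (k *: x + y).
Proof. by move=> hx hy f Ef; rewrite (linP (bdual_lin (bE Ef))) hx // hy // scaler0 addr0. Qed.

Lemma N_closed x : (forall e : R, 0 < e -> exists2 y, N y & nm (x - y) < e) -> N x.
Proof.
move=> h f Ef.
have [_ _] := linclosed_zero (bdual_lin (bE Ef)) (bdual_bounded (bE Ef)); apply.
by move=> e /h[y hy xy]; exists y => //; exact: hy.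
Qed.

Lemma u_dist s t (n : MA CG) : nm ((u s *M n : MA CG) - u t *M n) <= nm n + nm n.
Proof.
have h r : nm (u r *M n : MA CG) <= nm n.
  rewrite (le_trans (nmMle (u r : MA CG) n)) // ler_piMl ?nm_ge0 //; exact: (nm_urep (uG_rep S) r).
by rewrite (le_trans (nmB _ _)) // lerD.
Qed.

Lemma half_linclosed : is_linclosed half.
Proof.
have mB (p q n : MA CG) : p *M n - q *M n = (p - q) *c n :> MA CG by rewrite cmulBl.
split.
- split; first by move=> y hy f Ef; rewrite -[ml _ y]/(0 : CG) (lin0 (bdual_lin (bE Ef))).
  move=> s e e0; apply: nearW => t; rewrite (le_lt_trans (u_dist _ _ _)) // nm0 addr0 //.
- move=> k p q [Np cp] [Nq cq]; split=> [y hy|s e e0]; first exact: N_lin (Np _ hy) (Nq _ hy).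
  have k1 : 0 < nm k + 1 by have := nm_ge0 k; lra.
  have h1 := cp s (e / 2 / (nm k + 1)) ltac:(by rewrite !divr_gt0).
  have h2 := cq s (e / 2) ltac:(by rewrite divr_gt0).
  apply: filterS2 h1 h2 => t; rewrite ltr_pdivlMr // => h1 h2.
  rewrite mB cmulDr cmulZr -!mB (le_lt_trans (nmD _ _)) // nmZ.
  have := nm_ge0 (u s *M p - u t *M p : MA CG); have := nm_ge0 k; nra.
- move=> n hn; split=> [y hy|s e e0].
    apply: N_closed => e e0; have y1 : 0 < nm y + 1 by have := nm_ge0 y; lra.
    have [m [Nm _] nmm] := hn (e / (nm y + 1)) ltac:(by rewrite divr_gt0).
    exists (ml m y); first exact: Nm.
    rewrite (_ : _ - _ = ml (n - m) y); last by rewrite /= scaleN1r.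
    rewrite (le_lt_trans (nm_ml _ _)) //; move: nmm; rewrite ltr_pdivlMr //.
    have := nm_ge0 y; have := nm_ge0 (n - m); nra.
  have [m [_ cm] nmm] := hn (e / 4) ltac:(by rewrite divr_gt0).
  have h1 := cm s (e / 4) ltac:(by rewrite divr_gt0).
  apply: filterS h1 => t h.
  have -> : u s *M n - u t *M n = (u s *M m - u t *M m) + (u s *M (n - m) - u t *M (n - m)) :> MA CG.
    by rewrite !mB -[in LHS](subrK m n) [LHS](@cmulDr R (MA CG)) [LHS]addrC.
  rewrite (le_lt_trans (nmD _ _)) //; have := u_dist s t (n - m); lra.
Qed.

Lemma half_mul (m n : MA CG) : half m -> (forall y, N y -> N (ml n y)) -> half (m *c n).
Proof.
move=> [Nm cm] Nn; split=> [y hy|s e e0]; first exact: Nm (Nn _ hy).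
have n1 : 0 < nm n + 1 by have := nm_ge0 n; lra.
have h1 := cm s (e / (nm n + 1)) ltac:(by rewrite divr_gt0).
apply: filterS h1 => t.
rewrite ltr_pdivlMr // => h.
have -> : u s *M (m *c n) - u t *M (m *c n) = ((u s *M m : MA CG) - u t *M m) *c n :> MA CG.
  by rewrite cmulBl; congr (_ - _); exact: mmulA.
rewrite (le_lt_trans (nmMle _ _)) //.
have := nm_ge0 (u s *M m - u t *M m : MA CG); nra.
Qed.

Lemma half_u s n : half n -> half (u s *M n).
Proof.
move=> [Nn cn]; split=> [y hy|t e e0]; first exact/uN/Nn.
have [cM _ _ _] := hG.
have ct : continuous (fun t => t * s)%g.
  move=> x; apply: (continuous_comp (f := fun t => (t, s)) (g := fun p : G * G => (p.1 * p.2)%g)).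
    by apply: cvg_pair => //=; exact: cvg_cst.
  exact: cM.
have h1 : \forall t' \near t, nm ((u (t * s)%g *M n : MA CG) - u (t' * s)%g *M n) < e := ct t _ (cn (t * s)%g e e0).
apply: filterS h1 => t'.
by rewrite !(urepM (uG_rep S)).
Qed.

Lemma madj_u_N s y : N y -> N (ml (madj (u s)) y).
Proof. by rewrite (urep_adj (uG_rep S)); exact: uN. Qed.

Lemma D_subalgebra : is_subalgebra D.
Proof.
have [h0 hP hc] := half_linclosed.
split; first split.
- by split; rewrite ?cadj0.
- by move=> k p q [p1 p2] [q1 q2]; split; [exact: hP|rewrite cadjP; exact: hP].
- move=> n hn; split; apply: hc => e /hn[m [m1 m2] nmm]; first by exists m.
  by exists (cadj m) => //; rewrite -cadjB nm_adj.
- move=> a b [a1 a2] [b1 b2]; split; first by apply: half_mul => //; case: b1.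
  by rewrite cadjM; apply: half_mul => //; case: a2.
by move=> a [a1 a2]; split; rewrite ?cadjK.
Qed.

Local Notation DA := (subalgebra D_subalgebra).
Local Notation sv := (@subv R (MA CG) D D_subalgebra).

Lemma D_ul s n : D n -> D (u s *M n).
Proof.
move=> [n1 n2]; split; first exact: half_u.
by rewrite [cadj _]madjM; apply: (half_mul n2) => y; exact: madj_u_N.
Qed.

Lemma D_ur s n : D n -> D (n *M u s).
Proof.
move=> Dn; rewrite -[n *M u s](@cadjK R (MA CG)); have [_ _ hS] := D_subalgebra; apply: (hS).
rewrite [cadj _]madjM (urep_adj (uG_rep S)); apply: D_ul; exact: hS.
Qed.

Definition Dv (s : G) : multiplier DA.
Proof.
refine (@Multiplier R DA (fun d => exist _ _ (D_ul s (subvP d))) (fun d => exist _ _ (D_ur s (subvP d))) _).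
by move=> a b; apply: subv_inj; exact: mmulA.
Defined.

(** The continuity clause of [half] is what strict continuity of left translation on this algebra
    requires. *)
Lemma Dv_rep : unitary_rep Dv.
Proof.
split.
- by apply: mult_ext => d; apply: subv_inj; rewrite /subv /= (urep1 (uG_rep S)); exact: mult_ext.
- by move=> s t; apply: mult_ext => d; apply: subv_inj; rewrite /subv /= (urepM (uG_rep S)); exact: mult_ext.
- move=> s; apply: mult_ext => d; apply: subv_inj; rewrite /subv /= -(urep_adj (uG_rep S)).
  by rewrite [LHS](madjM (madj (sval d)) (u s)) madjK.
- by move=> d; apply/continuous_nmP => s e e0; have [[_ cd] _] := subvP d; exact: cd.
Qed.

Let j (d : DA) : multiplier CG := sv d.
Lemma j_mhom : mhom j. Proof. by apply/mhom_starhom; split. Qed.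

Lemma slice_mult_N w' u' x (bx : bdual x) k' k : (forall s, mext (evm s) w' = u' s) ->
  (forall s y, N y -> N (ml (u' s) y)) -> forall y, N y -> N (ml (slice_mult (mext Hm w') bx k' k) y).
Proof.
move=> ww uu y hy f Ef; rewrite -[ml _ y]/(lslice x _) slice_lslice //; last exact: bE.
rewrite slice_amp; last exact: bE.
rewrite (Wmu_slice k ww _ Ef); first by rewrite ml0 (lin0 (bdual_lin bx)).
by move=> s; exact: uu.
Qed.

Lemma slice_mult_W x (bx : bdual x) k' k y : N y -> N (ml (slice_mult W bx k' k) y).
Proof. by apply: (slice_mult_N (u' := u)) => // s; exact: mext_evm_w. Qed.

Lemma slice_mult_Wadj x (bx : bdual x) k' k y : N y -> N (ml (slice_mult (madj W) bx k' k) y).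
Proof.
rewrite -(mext_adj (HW_mhom hmu) (HW_nondeg hmu nmu)).
apply: (slice_mult_N (u' := fun s => madj (u s))) => s; last by move=> z; exact: madj_u_N.
by rewrite (mext_adj (evm_mhom S s) (evm_nondeg hG S s)) mext_evm_w.
Qed.

(** Covariance of W trades the translation by u s in the second leg for nu s acting on the vectors
    k' and k of the first. Strict continuity of nu thereby becomes norm continuity of the
    translates. *)
Lemma u_slice_mult s x (bx : bdual x) k' k :
  u s *M slice_mult (madj W) bx k' k = slice_mult (madj W) bx (mr (madj (nu s)) k') (ml (nu s) k).
Proof.
have WS : (mone ⊗M u s) *M madj W = (madj (nu s) ⊗M mone) *M madj W *M (nu s ⊗M mone).
  have /(congr1 (@madj R _)) := W_cov s; rewrite !madjM !melt_adj !madj_mone !madjK => ->.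
  by rewrite mmulA.
apply: mult_ext => y; rewrite -[LHS]/(ml (u s) (lslice x _)) lslice_ml //; congr lslice.
rewrite -[LHS]/(ml ((mone ⊗M u s) *M (memb k' ⊗M mone) *M madj W) (elt k y)).
have -> : (mone ⊗M u s) *M (memb k' ⊗M mone) *M madj W =
    (memb (mr (madj (nu s)) k') ⊗M mone) *M madj W *M (nu s ⊗M mone).
  rewrite meltM mmul1l mmul1 -[memb k' ⊗M u s](_ : (memb k' ⊗M mone) *M (mone ⊗M u s) = _); last first.
    by rewrite meltM mmul1 mmul1l.
  rewrite -mmulA WS !mmulA meltM mmul1; congr (_ ⊗M _ *M _ *M _).
  exact: (@mb_mul R Q).
by rewrite -[LHS]/(ml (_ ⊗M _) (ml (madj W) (ml (nu s ⊗M mone) _))) ml_melt.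
Qed.

Lemma half_slice_mult x (bx : bdual x) k' k : half (slice_mult (madj W) bx k' k).
Proof.
split=> [y|s e e0]; first exact: slice_mult_Wadj.
have [K K0 hK] := slice_mult_bound (madj W) bx.
have M0 : 0 < K * (nm k' + nm k) + 1 by have := nm_ge0 k; have := nm_ge0 k'; nra.
have /continuous_nmP /(_ s _ (divr_gt0 e0 M0)) h1 := urep_cont hnu (d := k).
have /continuous_nmP /(_ s _ (divr_gt0 e0 M0)) h2 := urep_cont hnu (d := cadj k').
apply: filterS2 h1 h2 => t h1 h2; rewrite !u_slice_mult.
set a := mr _ k'; set a' := mr _ k'; set b := ml _ k; set b' := ml _ k.
have aa : nm (a - a') = nm (ml (nu s) (cadj k') - ml (nu t) (cadj k')).
  by rewrite -nm_adj cadjB /a /a' !adj_mr !madjK.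
rewrite -{}aa in h2.
have -> : slice_mult (madj W) bx a b - slice_mult (madj W) bx a' b' =
    slice_mult (madj W) bx (a - a') b + slice_mult (madj W) bx a' (b - b') :> MA CG.
  rewrite (linB (slice_mult_linl (madj W) bx b)) (linB (slice_mult_linr (madj W) bx a')).
  by rewrite addrA subrK.
have nb : nm b <= nm k.
  by rewrite (le_trans (nm_ml _ _)) // ler_piMl ?nm_ge0 //; exact: (nm_urep hnu).
have na : nm a' <= nm k'.
  rewrite -nm_adj /a' adj_mr madjK (le_trans (nm_ml _ _)) // nm_adj ler_piMl ?nm_ge0 //.
  exact: (nm_urep hnu).
rewrite (le_lt_trans (nmD _ _)) // (le_lt_trans (lerD (hK _ _) (hK _ _))) //.
move: h1 h2; rewrite !ltr_pdivlMr //.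
have := nm_ge0 (a - a'); have := nm_ge0 (b - b'); have := nm_ge0 b; have := nm_ge0 a'.
move: nb na; move: (nm (a - a')) (nm (b - b')) (nm a') (nm b) (nm k) (nm k') M0 => X Y p q r r' M0 h1 h2 h3 h4 h5 h6 h7 h8.
have : X * q + p * Y <= X * r + r' * Y by nra.
move=> /(ler_wpM2l K0) h9; rewrite -mulrDr (le_lt_trans h9) //.
have [XY|/ltW XY] := leP X Y.
  have : X * r <= Y * r by nra.
  move=> /(ler_wpM2l K0); lra.
have : r' * Y <= X * r' by nra.
move=> /(ler_wpM2l K0); lra.
Qed.

(** The elements of D used here are products of a slice of W^* with a slice of W: the left factor
    gives continuous translates, both factors preserve N, and the adjoint of such a product has the
    same form. Each kind of slice has total range because W is unitary. *)
Lemma j_nondeg : nondegenerate j.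
Proof.
have [q q0] := Q0.
have [x [bx [k' [q' xq]]]] : exists x, bdual x /\ exists k' q' : Q, x (k' *c q') = 1.
  have [x /not_implyP[bx xq]] : exists x : Q -> C^o, ~ (bdual x -> x (cadj q *c q) = 0).
    apply/existsNP => h; apply: q0; apply: nm_eq0; apply/eqP; rewrite -sqrf_eq0 -nm_adjM.
    by rewrite (bdual_exists T h) nm0.
  exists x; split => //; exists (cadj q), ((x (cadj q *c q))^-1 *: q).
  by rewrite cmulZr (linZ (bdual_lin bx)); apply: mulVf; apply/eqP.
have [W1 W2] := Wmu_unitary hG wG_ok hmu nmu.
have T1 := slice_mult_total bx (W := madj W) (B := CG) ltac:(by rewrite madjK) ltac:(by rewrite madjK) xq.
have T2 := slice_mult_total bx W1 W2 xq.
apply: (total_sub T1) => _ [k [b ->]].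
move: b; apply: (total_ind T2) => [|_ [k2 [b ->]]].
  exact: linclosed_preim (ml_linear _) (bounded_ml _) (closed_span_linclosed _).
have Dn : D (slice_mult (madj W) bx k' k *M slice_mult W bx k' k2).
  split; first by apply: (half_mul (half_slice_mult bx k' k)) => y; exact: slice_mult_W.
  rewrite [cadj _]madjM !slice_mult_adj madjK.
  by apply: half_mul; [exact: half_slice_mult|move=> y; exact: slice_mult_W].
by apply: closed_span_sub; exists (exist _ _ Dn), b.
Qed.

(** The integrated form of [Dv], followed by the inclusion of D, sends u s to u s, so by uniqueness
    it is the canonical embedding of C^*(G). Hence C^*(G) multiplies D into D. *)
Theorem annihilator_left_ideal c y : N y -> N (c *c y).
Proof.
have [hphi nphi phiu] := gint_spec S Dv_rep.
have jv s : mext j (Dv s) = u s.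
  by apply/esym/(mextP j_mhom j_nondeg) => d.
have psi : (fun c => mext j (gint (S := S) Dv c)) = @memb R CG.
  rewrite [RHS](gint_uniq (uG_rep S) (integrates_memb S)).
  apply: (gint_uniq (uG_rep S)); split; [exact: (comp_mhom j_mhom j_nondeg)|exact: (comp_nondeg nphi j_mhom j_nondeg)|].
  by move=> s; rewrite -(mext_comp hphi nphi j_mhom j_nondeg) phiu jv.
(* By nondegeneracy C^*(G) is spanned by the d b with d in D. Since b^* d^* lies in D and D is
   self-adjoint, d b lies in D as well, so all of C^*(G) does. *)
have Dc : forall c, D (memb c).
  apply: (total_ind j_nondeg) => [|_ [d [b ->]]].
    by apply: (linclosed_preim (f := @mb R CG)); [exact: mb_lin|exists 1 => // v; rewrite nm_mb mul1r|case: D_subalgebra].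
  have [_ _ hS] := D_subalgebra.
  have Db : D (memb (cadj b) *M j (cadj d)).
    rewrite -psi (mext_spec j_mhom j_nondeg); exact: subvP.
  have := hS _ Db; rewrite [cadj _]madjM -[madj (memb _)](@mb_adj R CG) cadjK.
  by rewrite -(mhom_adj j_mhom) cadjK [X in D X](@mul_mb R CG).
by move=> Ny; have [[h _] _] := Dc c; exact: (h y Ny).
Qed.

End Invariance.

(** * From large ideals to ideals of the double crossed product *)

Section LargeIdeal.
Context {R : realType} {G : TopologicalGroup.type} {T : tensorModel R}.
Hypothesis hG : locally_compact_group G.
Variable S : groupModel R G.
Local Notation C := R[i].
Local Notation "A ⊗ B" := (tensor T A B).
Local Notation elt := (elt T).
Local Notation CG := (CG S).
Local Notation u := (@uG R G S).
Hypothesis wG_ok : wG_prop (T := T) S.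
Variables (L : coaction T S) (P : crossedProduct L) (Q : actionCrossedProduct S (dual_action (P := P))).
Hypothesis Q0 : exists q : Q, q <> 0.
Variable E : set (CG -> C^o).
Hypothesis hE : large_ideal E.

Lemma large_bdual f : E f -> bdual f. Proof. by case: hE => -[h _] _ _ _ _; exact: h. Qed.
Lemma large_nonzero : exists c : CG, c <> 0.
Proof.
case: hE => -[_ [f Ef [x fx]]] _ _ _ _; exists x => x0; apply: fx.
by rewrite x0 (lin0 (bdual_lin (large_bdual Ef))).
Qed.
Lemma large_bipolar f : bdual f -> (forall y, (forall g, E g -> g y = 0) -> f y = 0) -> E f.
Proof.
case: hE => -[_ [g Eg _]] hl _ _ hc; apply: bipolar => //; first exact: large_bdual.
by exists g.
Qed.
Lemma large_ul f s : E f -> E (fun x => f (ml (u s) x)). Proof. by case: hE => _ _ _ h _ /(h _ s)[]. Qed.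
Lemma large_ur f s : E f -> E (fun x => f (mr (u s) x)). Proof. by case: hE => _ _ _ h _ /(h _ s)[]. Qed.

Let ideal F (bF : forall f, F f -> bdual f) :=
  @annihilator_left_ideal R G T hG S wG_ok Q (dG Q) (iG Q) (dG_mhom Q) (dG_nondeg Q) (nu_rep Q)
    (W_u hG wG_ok Q) Q0 F bF.

Lemma large_left f c : E f -> E (fun b => f (c *c b)).
Proof.
move=> Ef; apply: large_bipolar => [|y hy]; first exact/bdual_mull/large_bdual.
apply: (ideal large_bdual _ _ hy) => // s z hz g Eg; exact: hz (large_ul s Eg).
Qed.

(** The left ideal theorem is applied to the conjugate functionals x |-> [Num.conj (f (cadj x))]:
    taking adjoints exchanges the two sides, and right translates of E become left translates. *)
Lemma large_right f c : E f -> E (fun b => f (b *c c)).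
Proof.
move=> Ef; apply: large_bipolar => [|y hy]; first exact/bdual_mulr/large_bdual.
pose st (f : CG -> C^o) : CG -> C^o := fun x => Num.conj (f (cadj x)).
have stK g : st (st g) = g by apply/funext => x; rewrite /st cadjK conjCK.
pose F : set (CG -> C^o) := [set g | E (st g)].
have bF g : F g -> bdual g by move=> /large_bdual /bdual_adj; rewrite -[X in bdual X]/(st (st g)) stK.
have vF z : (forall g, E g -> g (cadj z) = 0) -> forall g, F g -> g z = 0.
  by move=> hz g /hz; rewrite /st cadjK => /(congr1 Num.conj); rewrite conjCK rmorph0.
have := ideal bF _ (cadj c) (vF (cadj y) _); rewrite cadjK => /(_ _ hy (st f)).
have st0 : f (y *c c) = Num.conj (st f (cadj c *c cadj y)) by rewrite /st cadjM !cadjK conjCK.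
rewrite st0 => -> //; [exact: rmorph0| |by rewrite /F /= stK].
move=> s z hz; apply: vF => g Eg; rewrite -[ml (u s) z](cadjK) cadjK.
have -> : cadj (ml (u s) z) = mr (u s^-1%g) (cadj z).
  by apply: (can_inj (@cadjK R CG)); rewrite cadjK adj_mr cadjK (urep_adj (uG_rep S)) invgK.
have := hz (st (fun x => g (mr (u s^-1%g) x))); rewrite /F /= stK => /(_ (large_ur _ Eg)).
by rewrite /st => /(congr1 Num.conj); rewrite conjCK rmorph0.
Qed.

Lemma large_sub_EP (A : coaction T S) : (forall f, E f -> dual_act f (0 : A) = 0) ->
  forall a : A, sub_E E a <-> forall f c, E f -> Act f c a = 0.
Proof.
move=> h0; apply: sub_EP => // f; [exact: large_bdual|move=> c; exact: large_right|move=> c; exact: large_left].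
Qed.

Section Ideal.
Variable F : Q -> multiplier (Q ⊗ CG).
Hypothesis hF : mhom F.

(** This is the kernel of id ⊗ q_E, expressed by slices so that the quotient C^*_E(G) need not be
    formed. *)
Definition annE : set (Q ⊗ CG) := [set z | forall f, E f -> slice f z = 0].
Definition idealJ : set Q := [set z | forall q c, annE (ml (F z) (elt q c))].

Lemma annE_linclosed : is_linclosed annE.
Proof.
have lc f (Ef : E f) := linclosed_zero (slice_lin (T := T) (A := Q) (large_bdual Ef)) (slice_bounded (large_bdual Ef)).
split.
- by move=> f Ef; rewrite (lin0 (slice_lin (large_bdual Ef))).
- by move=> k x y hx hy f Ef; rewrite (linP (slice_lin (large_bdual Ef))) hx // hy // scaler0 addr0.
move=> x hx f Ef; have [_ _ h] := lc f Ef; apply: h => e /hx[y hy xy].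
by exists y => //; exact: hy.
Qed.

Lemma annE_mull z w : annE w -> annE (z *c w).
Proof.
move=> hw; have hP := annE_linclosed.
apply: (total_ind (tens_total T Q CG) (P := fun z => annE (z *c w))) => [|_ [q [c ->]] f Ef].
  exact: (linclosed_preim (cmul_linl w) (bounded_cmull w) hP).
by rewrite slice_mull ?hw ?cmul0r //; [exact: large_left|exact: large_bdual].
Qed.

(** With x from an approximate unit, m w is a limit of elements (m x) w, and m x lies in the
    algebra, where [annE_mull] applies. *)
Lemma annE_ml (m : multiplier (Q ⊗ CG)) w : annE w -> annE (ml m w).
Proof.
move=> hw; have [_ _ hc] := annE_linclosed; apply: hc => e e0.
have m1 : 0 < nm (m : MA (Q ⊗ CG)) + 1 by have := nm_ge0 (m : MA (Q ⊗ CG)); lra.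
have [x hx _] := approx_unit_l w (eps := e / (nm (m : MA (Q ⊗ CG)) + 1)) ltac:(by rewrite divr_gt0).
exists (ml m x *c w); first exact: annE_mull.
rewrite -mlM -mlB (le_lt_trans (nm_ml _ _)) //; move: hx; rewrite ltr_pdivlMr //.
have := nm_ge0 (w - x *c w); have := nm_ge0 (m : MA (Q ⊗ CG)); nra.
Qed.

Lemma idealJ_all z w : idealJ z -> annE (ml (F z) w).
Proof.
move=> hz; apply: (total_ind (tens_total T Q CG) (P := fun w => annE (ml (F z) w))) => [|_ [q [c ->]]]; last exact: hz.
exact: (linclosed_preim (ml_linear _) (bounded_ml _) annE_linclosed).
Qed.

Lemma idealJ_linclosed : is_linclosed idealJ.
Proof.
have [h0 hP hc] := annE_linclosed.
have lz q c := linclosed_preim (f := fun z => ml (F z) (elt q c)).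
have l1 q c : linear (fun z => ml (F z) (elt q c)) by move=> k x y; rewrite (mhom_lin hF).
have b1 q c : bounded (fun z => ml (F z) (elt q c)).
  exists (nm (elt q c)); rewrite ?nm_ge0 // => x; rewrite (le_trans (nm_ml (F x) _)) // mulrC.
  by rewrite ler_wpM2l ?nm_ge0 // (mhom_contractive hF).
split.
- by move=> q c; have [h _ _] := lz q c _ (l1 q c) (b1 q c) annE_linclosed.
- by move=> k x y hx hy q c; have [_ h _] := lz q c _ (l1 q c) (b1 q c) annE_linclosed; exact: h (hx q c) (hy q c).
- move=> x hx q c; have [_ _ h] := lz q c _ (l1 q c) (b1 q c) annE_linclosed; apply: h => e /hx[y hy xy].
  by exists y => //; exact: hy.
Qed.

Lemma idealJ_mulr z z' : idealJ z -> idealJ (z *c z').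
Proof. by move=> hz q c; rewrite (mhomM hF); exact: (idealJ_all (ml (F z') (elt q c)) hz). Qed.
Lemma idealJ_mull z z' : idealJ z -> idealJ (z' *c z).
Proof. by move=> hz q c; rewrite (mhomM hF); exact: (annE_ml (F z') (hz q c)). Qed.

End Ideal.
End LargeIdeal.

(** * The corner maps *)

Section AmplifyCompacts.
Context {R : realType} {T : tensorModel R}.
Local Notation "A ⊗ B" := (tensor T A B).
Local Notation "m ⊗M n" := (melt T m n).
Local Notation elt := (elt T).

Section RightAmp.
Variables D B : cstarAlgebra R.
Definition rampm (k : B) : multiplier (D ⊗ B) := mone ⊗M memb k.

Lemma rampm_mhom : mhom rampm.
Proof.
apply/mhom_starhom; split.
- exact: (lin_comp (f := fun m : MA B => (mone : MA D) ⊗M m) (melt_linr T _) (@mb_lin R B)).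
- by move=> x y; rewrite /rampm [RHS]meltM mmul1; congr (_ ⊗M _); exact: (@mbM R B).
- by move=> x; rewrite /rampm [RHS]melt_adj madj_mone; congr (_ ⊗M _); exact: (@mb_adj R B).
Qed.

Lemma rampm_nondeg : nondegenerate rampm.
Proof.
apply: (total_sub (total_elt (totalT D) (memb_nondeg B))) => _ [d [_ [_ [a [b ->]] ->]]].
by apply: closed_span_sub; exists a, (elt d b); rewrite ml_melt.
Qed.

Lemma mext_rampm m : mext rampm m = mone ⊗M m.
Proof.
apply/esym/mextP => [||a]; [exact: rampm_mhom|exact: rampm_nondeg|].
by rewrite /rampm meltM mmul1; congr (_ ⊗M _); exact: (@mul_mb R B).
Qed.
End RightAmp.

(** Multiplying by 1 ⊗ k brings (id ⊗ g)(z) from the multipliers back into A ⊗ D, where it can be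
    sliced. *)
Lemma homtens_compress (A B D : cstarAlgebra R) (g : B -> multiplier D) (k : D) : mhom g ->
  exists N : A ⊗ B -> A ⊗ D, [/\ linear N, bounded N,
    forall z, memb (N z) = homtens (@memb R A) g z *M (mone ⊗M memb k)
  & forall a b, N (elt a b) = elt a (ml (g b) k)].
Proof.
move=> hg; have hH := homtens_mhom (T := T) (memb_mhom A) hg.
pose h (z : A ⊗ B) : MA (A ⊗ D) := @cmul R (MA (A ⊗ D)) (homtens (@memb R A) g z) (mone ⊗M memb k).
have lh : linear h := lin_comp (f := fun m : MA (A ⊗ D) => m *c (mone ⊗M memb k)) (cmul_linl _) (mhom_lin hH).
have bh : bounded h := bounded_comp (f := fun m : MA (A ⊗ D) => m *c (mone ⊗M memb k)) (bounded_cmull _) (mhom_bounded hH).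
have helt a b : h (elt a b) = mb (elt a (ml (g b) k)).
  rewrite /h (homtens_elt (memb_mhom A) hg) -[LHS]/((memb a ⊗M g b) *M (mone ⊗M memb k)) meltM mmul1 /mb memb_elt.
  congr (_ ⊗M _); exact: (@mul_mb R D).
have [N hN] := choice (memb_range lh bh (tens_total T A B) (fun z zz => let: ex_intro a (ex_intro b e) := zz in
  ex_intro _ (elt a (ml (g b) k)) (etrans (congr1 h e) (helt a b)))).
exists N; split.
- by move=> c p q; apply: (@mb_inj R); rewrite -hN lh !hN -(@mb_lin R).
- by have [K K0 hK] := bh; exists K => // z; rewrite -nm_mb -hN.
- by move=> z; rewrite -[LHS]/(mb _) -hN.
- by move=> a b; apply: (@mb_inj R); rewrite -hN helt.
Qed.

End AmplifyCompacts.

Section Corner.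
Context {R : realType} {G : TopologicalGroup.type} {T : tensorModel R}.
Hypothesis hG : locally_compact_group G.
Variable S : groupModel R G.
Local Notation "A ⊗ B" := (tensor T A B).
Local Notation "m ⊗M n" := (melt T m n).
Local Notation elt := (elt T).
Local Notation CG := (CG S).
Local Notation K := (KL2 S).
Local Notation u := (@uG R G S).
Variable X : crossedModel T S.
Local Notation cr := (crossed X).
Local Notation dcr := (double_crossed X).

Section Maximal.
Variables (A : coaction T S) (Phi0 : dcr A -> A ⊗ K).
Hypotheses (PhiE : forall y, Phi y = memb (Phi0 y)) (Phi0_surj : forall t, exists y, Phi0 y = t).
Hypothesis AK0 : exists t : A ⊗ K, t <> 0.

Local Notation gen a f c x y := (memb x = jA (cr A) a *M jG (cr A) f /\ memb y = iP (dcr A) x *M gint (S := S) (iG (dcr A)) c).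
Local Notation Lam := (gint (S := S) (lambda S)).

Let not_const : ~ (forall y, Phi0 y = 0).
Proof. by move=> h; have [t t0] := AK0; have [y yt] := Phi0_surj t; apply: t0; rewrite -yt. Qed.

(** Junk would make Phi identically zero, whereas [Phi0] maps onto the nonzero algebra A ⊗ K. The
    same contradiction descends to [Theta] and to the integrated form of lambda. *)
Lemma Phi_genuine : acp_integrates (iP (dcr A)) (iG (dcr A)) (@Theta R G T S X A) (fun s => mone ⊗M rho S s)
  (@Phi R G T S X A).
Proof.
have [ex|nex] := pselect (exists psi, acp_integrates (iP (dcr A)) (iG (dcr A)) (@Theta R G T S X A) (fun s => mone ⊗M rho S s) psi).
  exact: (the_spec (fun=> mzero) ex).
case: not_const => y; apply: (@mb_inj R); rewrite /mb -PhiE /Phi (the_junk _ nex).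
by rewrite -[memb 0]/(mb 0) (lin0 (@mb_lin R _)).
Qed.

Let hPhi : mhom (@Phi R G T S X A). Proof. by case: Phi_genuine. Qed.
Let nPhi : nondegenerate (@Phi R G T S X A). Proof. by case: Phi_genuine. Qed.

Lemma Phi0_hom : starhom Phi0.
Proof.
split.
- by move=> k a b; apply: (@mb_inj R); rewrite (@mb_lin R) /mb -!PhiE (mhom_lin hPhi).
- by move=> a b; apply: (@mb_inj R); rewrite mbM /mb -!PhiE (mhomM hPhi).
- by move=> a; apply: (@mb_inj R); rewrite mb_adj /mb -!PhiE (mhom_adj hPhi).
Qed.

Lemma Phi0_gen x c y : memb y = iP (dcr A) x *M gint (S := S) (iG (dcr A)) c ->
  memb (Phi0 y) = Theta x *M mext (@Phi R G T S X A) (gint (S := S) (iG (dcr A)) c).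
Proof.
move=> e; have [_ _ pP _] := Phi_genuine.
by rewrite -PhiE -(mext_memb hPhi nPhi) e (mextM hPhi nPhi) pP.
Qed.

Let not_Theta0 : ~ (forall x, Theta (X := X) (A := A) x = mzero).
Proof.
move=> h; apply: not_const.
apply: (total_eq (f := Phi0) (g := fun=> 0) (starhom_lin Phi0_hom) _ (starhom_bounded Phi0_hom) _ (acp_span (dcr A))).
- by move=> k v w; rewrite scaler0 addr0.
- by exists 0 => // v; rewrite nm0 mul0r.
move=> y [x [c e]]; apply: (@mb_inj R); rewrite /mb (Phi0_gen e) h -[memb 0]/(mb 0) (lin0 (@mb_lin R _)).
exact: mult_ext.
Qed.

Lemma Theta_genuine : cp_integrates (jA (cr A)) (jG (cr A))
    (fun a => mext (homtens (@memb R A) Lam) (co_map a)) (fun f => mone ⊗M Mrep f) (@Theta R G T S X A).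
Proof.
have [ex|nex] := pselect (exists psi, cp_integrates (jA (cr A)) (jG (cr A))
    (fun a => mext (homtens (@memb R A) Lam) (co_map a)) (fun f => mone ⊗M Mrep f) psi).
  exact: (the_spec (fun=> mzero) ex).
by case: not_Theta0 => x; rewrite /Theta (the_junk _ nex).
Qed.

Let hTh : mhom (@Theta R G T S X A). Proof. by case: Theta_genuine. Qed.
Let nTh : nondegenerate (@Theta R G T S X A). Proof. by case: Theta_genuine. Qed.

Lemma Theta_gen a f x : memb x = jA (cr A) a *M jG (cr A) f ->
  Theta x = mext (homtens (@memb R A) Lam) (co_map a) *M (mone ⊗M Mrep f).
Proof.
move=> e; have [_ _ tA tG] := Theta_genuine.
by rewrite -(mext_memb hTh nTh) e (mextM hTh nTh) tA tG.
Qed.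

Let hjA : mhom (jA (cr A)). Proof. by case: (cp_cov (cr A)). Qed.

Lemma Lam_genuine : mhom Lam /\ nondegenerate Lam.
Proof.
have [ex|nex] := pselect (exists phi, integrates u (lambda S) phi).
  by have [] := the_spec (fun=> mzero) ex.
have L0 : Lam = fun=> mzero by exact: the_junk.
have hz : mhom (fun _ : CG => mzero : multiplier K).
  apply/mhom_starhom; split => [k a b|a b|a]; apply: mult_ext => k'; rewrite /= ?scaler0 ?addr0 ?cadj0 //.
have H0 z : homtens (T := T) (@memb R A) (fun _ : CG => mzero : multiplier K) z = mzero.
  have hh := homtens_mhom (T := T) (memb_mhom A) hz.
  apply: (total_eq (f := homtens _ _ : _ -> MA _) (g := fun=> 0) (mhom_lin hh) _ (mhom_bounded hh) _ (tens_total T A CG)).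
  - by move=> k v w; rewrite scaler0 addr0.
  - by exists 0 => // v; rewrite nm0 mul0r.
  move=> _ [a [c ->]]; rewrite (homtens_elt (memb_mhom A) hz); exact: (lin0 (melt_linr T (memb a : MA A))).
(* With the tensor homomorphism zero, the description defining [mext] no longer mentions the
   multiplier; so the value at delta(a) equals the value at delta(0), which is zero. *)
have const m m' : mext (homtens (T := T) (@memb R A) Lam) m = mext (homtens (T := T) (@memb R A) Lam) m'.
  by rewrite L0 /mext; congr the; apply/funext => n; apply/propext; split=> h z; have := h z; rewrite !H0.
case: not_Theta0.
apply: (total_eq (f := @Theta R G T S X A : _ -> MA _) (g := fun=> 0) (mhom_lin hTh) _ (mhom_bounded hTh) _ (cp_span (cr A))).
- by move=> k v w; rewrite scaler0 addr0.
- by exists 0 => // v; rewrite nm0 mul0r.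
move=> x [a [f e]]; rewrite (Theta_gen e) (const _ (co_map 0)).
have [_ _ tA _] := Theta_genuine; rewrite -tA.
have -> : jA (cr A) 0 = mzero by have := lin0 (mhom_lin hjA).
by rewrite (mext_zero hTh nTh); exact: mult_ext.
Qed.

Let hL : mhom Lam. Proof. by case: Lam_genuine. Qed.
Let nL : nondegenerate Lam. Proof. by case: Lam_genuine. Qed.

Lemma tens_nonzero : (exists a : A, a <> 0) /\ exists k : K, k <> 0.
Proof.
have [t t0] := AK0; split; apply: contrapT => /forallNP h; apply: t0.
  apply: (total_set0 (tens_total T A K)) => _ [a [k ->]].
  by have /contrapT -> := h a; rewrite (lin0 (elt_linl T k)).
apply: (total_set0 (tens_total T A K)) => _ [a [k ->]].
by have /contrapT -> := h k; rewrite (lin0 (elt_linr T a)).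
Qed.

Let rho_rep1 : unitary_rep (fun s => mone ⊗M rho S s : multiplier (A ⊗ K)).
Proof.
have [_ _ _ pG] := Phi_genuine.
rewrite (_ : (fun s => mone ⊗M rho S s) = fun s => mext (@Phi R G T S X A) (iG (dcr A) s)).
  exact: (mext_rep hPhi nPhi (nu_rep (dcr A))).
by apply/funext => s; rewrite pG.
Qed.

(** Nothing is checked on L^2(G): s |-> 1 ⊗ rho s is the image of the canonical representation under
    the genuine Phi, and a nonzero a in A lets the factor 1 be cancelled. *)
Lemma rho_rep : unitary_rep (rho S).
Proof.
have [[a a0] _] := tens_nonzero; have inj := melt1_inj (T := T) a0 (B := K).
split.
- by apply: inj; rewrite (urep1 rho_rep1) melt11.
- by move=> s t; apply: inj; rewrite (urepM rho_rep1) meltM mmul1.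
- by move=> s; apply: inj; rewrite -(urep_adj rho_rep1) melt_adj madj_mone.
move=> k; apply/continuous_nmP => s e e0.
have na : 0 < nm a by rewrite lt_neqAle nm_ge0 andbT eq_sym; apply/eqP => /nm_eq0.
have /continuous_nmP /(_ s _ (mulr_gt0 na e0)) := urep_cont rho_rep1 (d := elt a k).
apply: filterS => t; rewrite !ml_melt -(linB (elt_linr T a)) nm_elt.
by rewrite ltr_pM2l.
Qed.

Lemma Phi_gint c : mext (@Phi R G T S X A) (gint (S := S) (iG (dcr A)) c) = mone ⊗M gint (S := S) (rho S) c.
Proof.
have [_ _ _ pG] := Phi_genuine.
rewrite (gint_mext hPhi nPhi (nu_rep (dcr A))).
rewrite -mext_rampm (gint_mext (rampm_mhom A K) (rampm_nondeg A K) rho_rep); congr gint.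
by apply/funext => s; rewrite pG mext_rampm.
Qed.

Lemma Phi0_genE a f c x y : gen a f c x y ->
  memb (Phi0 y) = mext (homtens (@memb R A) Lam) (co_map a) *M (mone ⊗M (Mrep f *M gint (S := S) (rho S) c)).
Proof.
by move=> [xe ye]; rewrite (Phi0_gen ye) Phi_gint (Theta_gen xe) -mmulA meltM mmul1.
Qed.

(* (id (x) lambda)(delta a)(1 (x) k) as a function of k. *)
Lemma right_leg a : exists r : K -> A ⊗ K, [/\ linear r, bounded r,
    forall k, memb (r k) = mext (homtens (@memb R A) Lam) (co_map a) *M (mone ⊗M memb k)
  & forall om c k, bdual om -> slice om (r (ml (Lam c) k)) = Act (fun c' => om (ml (Lam c') k)) c a].
Proof.
have hA := memb_mhom A; have nA := memb_nondeg A.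
have hH := homtens_mhom (T := T) hA hL; have nH := homtens_nondeg (T := T) hA hL nA nL.
pose h (k : K) : MA (A ⊗ K) := @cmul R (MA (A ⊗ K)) (mext (homtens (@memb R A) Lam) (co_map a)) (rampm A k).
have lh : linear h := lin_comp (f := @cmul R (MA (A ⊗ K)) _) (cmul_linr _) (mhom_lin (rampm_mhom A K)).
have bh : bounded h := bounded_comp (f := @cmul R (MA (A ⊗ K)) _) (bounded_cmulr _) (mhom_bounded (rampm_mhom A K)).
have hgen c k N : (forall z, memb (N z) = homtens (@memb R A) Lam z *M (mone ⊗M memb k)) ->
    h (ml (Lam c) k) = mb (N (dr a c)).
  move=> NE; rewrite /mb NE -(mext_dr a c hH nH) -mmulA.
  rewrite (mext_homtens_melt hA hL nA nL) (mext_one hA nA) (mext_memb hL nL) meltM mmul1.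
  by rewrite /h /rampm; congr (_ *M (_ ⊗M _)); apply/esym; exact: (@mul_mb R K).
have hr : forall k, nondegenerate Lam -> exists z, h k = mb z.
  move=> k _; apply: (memb_range lh bh nL) => _ [c [k' ->]].
  by have [N [_ _ NE _]] := homtens_compress A k' hL; exists (N (dr a c)); exact: hgen.
have [r rE] := choice (fun k => hr k nL).
exists r; split.
- by move=> c p q; apply: (@mb_inj R); rewrite -rE lh !rE -(@mb_lin R).
- by have [B B0 hB] := bh; exists B => // z; rewrite -nm_mb -rE.
- by move=> k; rewrite -[LHS]/(mb _) -rE.
move=> om c k bom; have [N [lN bN NE Nelt]] := homtens_compress A k hL.
have -> : r (ml (Lam c) k) = N (dr a c) by apply: (@mb_inj R); rewrite -rE (hgen _ _ _ NE).
have bo : bdual (fun c' => om (ml (Lam c') k)).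
  apply: (bdual_comp bom) => [p x y|]; first by rewrite (mhom_lin hL).
  exists (nm k); rewrite ?nm_ge0 // => x; rewrite (le_trans (nm_ml (Lam x) _)) // mulrC.
  by rewrite ler_wpM2l ?nm_ge0 // (mhom_contractive hL).
apply: (total_eq (f := fun z => slice om (N z)) (g := slice (fun c' => om (ml (Lam c') k))) _ _ _ _ (tens_total T A CG)).
- exact: (lin_comp (f := slice om) (slice_lin bom) lN).
- exact: slice_lin.
- by have := bounded_comp (slice_bounded bom : bounded (slice om : A ⊗ K -> A)) bN.
- exact: slice_bounded.
by move=> _ [b [d ->]]; rewrite Nelt !slice_elt.
Qed.

(** Slicing the K leg of the image of a generator gives, on vectors lambda(e) k', the action on a of
    a functional built from om, lambda and k'. [Act_comm] then interchanges it with the action of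
    g. *)
Lemma Phi0_slice a f c x y om k g d x' y' : bdual om -> bdual g -> gen a f c x y -> gen (Act g d a) f c x' y' ->
  slice om (mr (mone ⊗M memb k) (Phi0 y')) = Act g d (slice om (mr (mone ⊗M memb k) (Phi0 y))).
Proof.
move=> bom bg g1 g2; set v := Mrep f *M gint (S := S) (rho S) c.
have mrE b r x1 y1 : gen b f c x1 y1 ->
    (forall k, memb (r k) = mext (homtens (@memb R A) Lam) (co_map b) *M (mone ⊗M memb k)) ->
    mr (mone ⊗M memb k) (Phi0 y1) = r (ml v k).
  move=> gg rE; apply: (@mb_inj R); rewrite -mb_mul /mb rE.
  rewrite [LHS](_ : _ = memb (Phi0 y1) *M (mone ⊗M memb k)) // (Phi0_genE gg) -mmulA meltM mmul1.
  congr (_ *M (_ ⊗M _)); exact: (@mul_mb R K).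
have [r [lr br rE rs]] := right_leg a; have [r' [lr' br' rE' rs']] := right_leg (Act g d a).
rewrite (mrE _ _ _ _ g1 rE) (mrE _ _ _ _ g2 rE').
apply: (total_eq (f := fun k => slice om (r' k)) (g := fun k => Act g d (slice om (r k))) _ _ _ _ nL).
- exact: (lin_comp (f := slice om) (slice_lin bom) lr').
- exact: (lin_comp (f := Act g d) (Act_lin _ bg) (lin_comp (f := slice om) (slice_lin bom) lr)).
- by have := bounded_comp (slice_bounded bom : bounded (slice om : A ⊗ K -> A)) br'.
- have B1 := bounded_comp (slice_bounded bom : bounded (slice om : A ⊗ K -> A)) br.
  exact: (bounded_comp (f := Act g d) (Act_bounded _ _ bg) B1).
move=> _ [e [k' ->]].
rewrite (rs' om e k' bom).
rewrite (rs om e k' bom).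
apply: Act_comm; [|by []].
apply: (bdual_comp bom) => [p z z'|]; first by rewrite (mhom_lin hL).
exists (nm k'); rewrite ?nm_ge0 // => z; rewrite (le_trans (nm_ml (Lam z) _)) // mulrC.
by rewrite ler_wpM2l ?nm_ge0 // (mhom_contractive hL).
Qed.

Lemma gen_total : closed_span [set t | exists a f c x y, gen a f c x y /\ t = Phi0 y] = setT.
Proof.
have [pl ps] := (starhom_lin Phi0_hom, starhom_bounded Phi0_hom).
apply: (total_sub (total_image pl ps Phi0_surj (acp_span (dcr A)))) => _ [y [x [c ye]] <-].
have [yy yyE] := choice (fun x => acp_mem (dcr A) x c).
have hi := iP_mhom (dcr A).
have ly : linear yy.
  move=> k p q; apply: (@mb_inj R); rewrite (@mb_lin R) /mb !yyE (mhom_lin hi).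
  exact: (@cmul_linl R (MA (dcr A)) (gint (S := S) (iG (dcr A)) c)).
have by_ : bounded yy.
  exists (nm (gint (S := S) (iG (dcr A)) c : MA (dcr A))); rewrite ?nm_ge0 // => z.
  rewrite -[nm (yy z)]nm_mb /mb yyE (le_trans (nmMle (iP (dcr A) z : MA (dcr A)) (gint (S := S) (iG (dcr A)) c))) // mulrC.
  by rewrite ler_wpM2l ?nm_ge0 // (mhom_contractive hi).
have -> : y = yy x by apply: (@mb_inj R); rewrite /mb yyE.
move: x {ye}; apply: (total_ind (cp_span (cr A))) => [|x [a [f xe]]].
  exact: (linclosed_preim (lin_comp (f := Phi0) pl ly) (bounded_comp (f := Phi0) ps by_) (closed_span_linclosed _)).
by apply: closed_span_sub; exists a, f, c, x, (yy x).
Qed.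

End Maximal.
End Corner.

(** * Slicing the twisted coaction on a corner *)

Section CornerMap.
Context {R : realType} {G : TopologicalGroup.type} {T : tensorModel R}.
Hypothesis hG : locally_compact_group G.
Variable S : groupModel R G.
Local Notation C := R[i].
Local Notation cstar := (cstarAlgebra R).
Local Notation "A ⊗ B" := (tensor T A B).
Local Notation "m ⊗M n" := (melt T m n).
Local Notation elt := (elt T).
Local Notation CG := (CG S).
Local Notation C0 := (C0 S).
Local Notation K := (KL2 S).
Variable X : crossedModel T S.
Local Notation cr := (crossed X).
Local Notation dcr := (double_crossed X).

Variables (A : coaction T S) (Phi0 : dcr A -> A ⊗ K).
Hypotheses (PhiE : forall y, Phi y = memb (Phi0 y)) (Phi0_surj : forall t, exists y, Phi0 y = t).
Hypothesis AK0 : exists t : A ⊗ K, t <> 0.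
Local Notation gen a f c x y := (memb x = jA (cr A) a *M jG (cr A) f /\ memb y = iP (dcr A) x *M gint (S := S) (iG (dcr A)) c).

Variables (L : coaction T S) (psi : A -> L) (kap : A ⊗ K -> dcr L).
Local Notation Q := (dcr L).
Hypothesis psi_Act : forall f c a, bdual f -> Act f c (psi a) = psi (Act f c a).
Hypotheses (hk : starhom kap) (kap_inj : injective kap).
Hypothesis kapE : forall a f c x y, gen a f c x y ->
  memb (kap (Phi0 y)) = dA Q (psi a) *M dG Q f *M gint (S := S) (iG Q) c.

Variable F : Q -> multiplier (Q ⊗ CG).
Hypotheses (hF : mhom F) (nF : nondegenerate F)
  (FA : forall a, mext F (dA Q a) = mext (homtens (dA Q) (@memb R CG)) (co_map a))
  (FG : forall f, mext F (dG Q f) = dG Q f ⊗M mone)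
  (FN : forall s, mext F (iG Q s) = iG Q s ⊗M mone).

Lemma slice_dA (g : CG -> C^o) (d : CG) (b : L) (q : Q) : bdual g ->
  slice g (ml (mext (homtens (dA Q) (@memb R CG)) (co_map b)) (elt q d)) = ml (dA Q (Act g d b)) q.
Proof.
move=> bg; have hA := dA_mhom Q; have nA := dA_nondeg Q.
have hH := homtens_mhom (T := T) hA (memb_mhom CG).
have nH := homtens_nondeg (T := T) hA (memb_mhom CG) nA (memb_nondeg CG).
set m := mext _ _.
have la : linear (fun a => ml (dA Q a) q) by move=> k x y; rewrite (mhom_lin hA).
have ba : bounded (fun a => ml (dA Q a) q).
  exists (nm q); rewrite ?nm_ge0 // => x; rewrite (le_trans (nm_ml (dA Q x) _)) // mulrC.
  by rewrite ler_wpM2l ?nm_ge0 // (mhom_contractive hA).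
have be : bounded (fun d : CG => elt q d) by exists (nm q); rewrite ?nm_ge0 // => k; rewrite nm_elt.
have b1 := bounded_comp (bounded_ml m) be.
move: d; apply: (total_eq (f := fun d => slice g (ml m (elt q d))) (g := fun d => ml (dA Q (Act g d b)) q) _ _ _ _ (total_mul (totalT CG))).
- exact: (lin_comp (f := slice g) (slice_lin bg) (lin_comp (f := ml m) (ml_linear _) (elt_linr T q))).
- exact: (lin_comp (f := fun a => ml (dA Q a) q) la (Act_linr b bg)).
- by have := bounded_comp (slice_bounded bg : bounded (slice g : Q ⊗ CG -> Q)) b1.
- exact: (bounded_comp (f := fun a => ml (dA Q a) q) ba (Act_boundedr b bg)).
move=> _ [d1 [d2 [_ [_ ->]]]].
have -> : ml m (elt q (d1 *c d2)) = ml (homtens (dA Q) (@memb R CG) (dr b d1)) (elt q d2).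
  rewrite -(mext_dr b d1 hH nH) (mext_homtens_melt hA (memb_mhom _) nA (memb_nondeg _)) (mext_one hA nA) mext_memb_id.
  by rewrite -[RHS]/(ml m (ml (mone ⊗M memb d1) (elt q d2))) ml_melt.
by rewrite (slice_homtens hA) // (Act_mulr d1 d2 _ bg).
Qed.

(** F leaves the legs coming from C_0(G) and G in the form (.) ⊗ 1, so the slice meets only the
    coaction on psi a, and equivariance of psi moves it to a. *)
Lemma F_kap g d a f c x y x' y' q : bdual g -> gen a f c x y -> gen (Act g d a) f c x' y' ->
  slice g (ml (F (kap (Phi0 y))) (elt q d)) = kap (Phi0 y') *c q.
Proof.
move=> bg g1 g2.
have hn := nu_rep Q.
have FC : mext F (gint (S := S) (iG Q) c) = gint (S := S) (iG Q) c ⊗M mone.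
  rewrite (gint_mext hF nF hn) -[X in _ = X ⊗M _](mext_memb_id) -(mext_ampm CG (memb_mhom Q) (memb_nondeg Q)).
  rewrite (gint_mext (ampm_mhom CG (memb_mhom Q)) (ampm_nondeg CG (memb_nondeg Q)) hn); congr gint.
  by apply/funext => s; rewrite FN (mext_ampm CG (memb_mhom Q) (memb_nondeg Q)) mext_memb_id.
have -> : F (kap (Phi0 y)) = mext (homtens (dA Q) (@memb R CG)) (co_map (psi a)) *M ((dG Q f *M gint (S := S) (iG Q) c) ⊗M mone).
  rewrite -(mext_memb hF nF) (kapE g1) !(mextM hF nF) FA FG FC -mmulA meltM mmul1 //.
rewrite -[ml _ (elt q d)]/(ml (mext _ _) (ml _ (elt q d))) ml_melt slice_dA // psi_Act //.
by rewrite -[RHS]/(ml (memb (kap (Phi0 y'))) q) (kapE g2) -mmulA.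
Qed.

(** V is the action of b |-> g (b d) on the first leg of A ⊗ K. Its boundedness is inherited from
    slicing F, because the injective homomorphism [kap] is isometric; this is what extends the
    prescription from generators. *)
Lemma slice_op (g : CG -> C^o) (d : CG) : bdual g -> exists V : A ⊗ K -> A ⊗ K,
  (forall t q, slice g (ml (F (kap t)) (elt q d)) = kap (V t) *c q) /\
  (forall t om k, bdual om -> slice om (mr (mone ⊗M memb k) (V t)) = Act g d (slice om (mr (mone ⊗M memb k) t))).
Proof.
move=> bg.
have [xx xE] := choice (fun p : A * C0 => cp_mem (cr A) p.1 p.2).
have [yy yE] := choice (fun p : cr A * CG => acp_mem (dcr A) p.1 p.2).
pose y (p : A * C0 * CG) := yy (xx p.1, p.2).
have gy a f c : gen a f c (xx (a, f)) (y (a, f, c)) by split; [exact: xE|exact: yE].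
pose v p := Phi0 (y p); pose v' (p : A * C0 * CG) := Phi0 (y (Act g d p.1.1, p.1.2, p.2)).
have vv p q : slice g (ml (F (kap (v p))) (elt q d)) = kap (v' p) *c q.
  by case: p => [[a f] c]; exact: (F_kap q bg (gy a f c) (gy (Act g d a) f c)).
have lk := starhom_lin hk.
have lT q : linear (fun t => slice g (ml (F (kap t)) (elt q d))).
  have l1 : linear (fun t => ml (F (kap t)) (elt q d)) by move=> k s t; rewrite lk (mhom_lin hF).
  exact: (lin_comp (f := slice g) (slice_lin bg) l1).
have [B B0 hB] := slice_bounded (T := T) (A := Q) bg.
have bT t q : nm (slice g (ml (F (kap t)) (elt q d))) <= B * nm d * nm t * nm q.
  rewrite (le_trans (hB _)) // -!mulrA ler_wpM2l //.
  rewrite (le_trans (nm_ml (F (kap t)) _)) // nm_elt.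
  have := le_trans (mhom_contractive hF (kap t)) (starhom_contractive hk t).
  have := nm_ge0 q; have := nm_ge0 d; have := nm_ge0 (F (kap t) : MA _); have := mulr_ge0 (nm_ge0 d) (nm_ge0 q); nra.
have bd l : nm (lc v' l) <= B * nm d * nm (lc v l).
  rewrite -(starhom_isometric T hk kap_inj) -nm_mb; apply: nm_mlP => [|q].
    by rewrite !mulr_ge0 ?nm_ge0.
  rewrite (le_trans _ (bT (lc v l) q)) // (lc_lin (lT q)) le_eqVlt; apply/orP; left; apply/eqP; congr nm.
  rewrite -[LHS]/(kap (lc v' l) *c q) (lc_lin (lin_comp (f := fun z => z *c q) (cmul_linl q) lk)).
  by apply: eq_bigr => p _; congr (_ *: _); exact: (esym (vv p.2 q)).
have [||V [lV bV VE]] := extend _ _ bd; first by rewrite mulr_ge0 ?nm_ge0.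
- have TT := gen_total PhiE Phi0_surj AK0.
  apply: (total_approx TT) => _ [a [f [c [x0 [y0 [[xe ye] ->]]]]]].
  exists (a, f, c); congr Phi0; apply: (@mb_inj R); rewrite /mb ye; have [xe' ->] := gy a f c.
  by congr (iP _ _ *M _); apply: (@mb_inj R); rewrite /mb xe xe'.
have bV' : bounded V by exists (B * nm d) => //; rewrite mulr_ge0 ?nm_ge0.
have gT : closed_span [set t | exists p, t = v p] = setT.
  apply: (total_sub (gen_total PhiE Phi0_surj AK0)) => _ [a [f [c [x0 [y0 [[xe ye] ->]]]]]].
  apply: closed_span_sub; exists (a, f, c); congr Phi0; apply: (@mb_inj R); rewrite /mb ye; have [xe' ->] := gy a f c.
  by congr (iP _ _ *M _); apply: (@mb_inj R); rewrite /mb xe xe'.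
exists V; split=> [t q|t om k bom].
  apply: (total_eq (f := fun t => slice g (ml (F (kap t)) (elt q d))) (g := fun t => kap (V t) *c q) _ _ _ _ gT).
  - exact: lT.
  - exact: (lin_comp (f := fun z => z *c q) (cmul_linl q) (lin_comp (f := kap) lk lV)).
  - exists (B * nm d * nm q); first by rewrite !mulr_ge0 ?nm_ge0.
    by move=> t'; rewrite (le_trans (bT t' q)) // -!mulrA [nm t' * _]mulrC.
  - exact: (bounded_comp (f := fun z => z *c q) (bounded_cmull q) (bounded_comp (f := kap) (starhom_bounded hk) bV')).
  by move=> _ [p ->]; rewrite VE vv.
pose m : multiplier (A ⊗ K) := mone ⊗M memb k.
apply: (total_eq (f := fun t => slice om (mr m (V t))) (g := fun t => Act g d (slice om (mr m t))) _ _ _ _ gT).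
- exact: (lin_comp (f := slice om) (slice_lin bom) (lin_comp (f := mr m) (mr_linear _) lV)).
- exact: (lin_comp (f := Act g d) (Act_lin _ bg) (lin_comp (f := slice om) (slice_lin bom) (mr_linear _))).
- have b1 := bounded_comp (bounded_mr m) bV'.
  by have := bounded_comp (slice_bounded bom : bounded (slice om : A ⊗ K -> A)) b1.
- have b1 := bounded_comp (slice_bounded bom : bounded (slice om : A ⊗ K -> A)) (bounded_mr m).
  exact: (bounded_comp (f := Act g d) (Act_bounded _ _ bg) b1).
move=> _ [[[a f] c] ->]; rewrite VE.
exact: (Phi0_slice PhiE Phi0_surj AK0 k bom bg (gy a f c) (gy (Act g d a) f c)).
Qed.

Lemma mr_amp_eq0 (t : A ⊗ K) : (forall k, mr (mone ⊗M memb k) t = 0) -> t = 0.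
Proof.
move=> h; apply: cancel_l => z.
apply: (total_eq (f := fun z => t *c z) (g := fun=> 0) (cmul_linr t) _ (bounded_cmulr t) _ (tens_total T A K)).
- by move=> k v w; rewrite scaler0 addr0.
- by exists 0 => // v; rewrite nm0 mul0r.
move=> _ [a [k ->]]; rewrite -[LHS]/(mr (memb (elt a k)) t) memb_elt.
have -> : memb a ⊗M memb k = (mone ⊗M memb k) *M (memb a ⊗M mone) by rewrite meltM mmul1 mmul1l.
by rewrite -[LHS]/(mr (memb a ⊗M mone) (mr (mone ⊗M memb k) t)) h (lin0 (mr_linear _)).
Qed.

Variable E : set (CG -> C^o).
Hypothesis hE : large_ideal E.

Lemma kap_ideal t : idealJ E F (kap t) <->
  forall g d om k, E g -> bdual om -> Act g d (slice om (mr (mone ⊗M memb k) t)) = 0.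
Proof.
split=> [h g d om k Eg bom|h q d g Eg].
  have [V [V1 V2]] := slice_op d (large_bdual hE Eg).
  rewrite -V2 //; have -> : V t = 0.
    apply: kap_inj; rewrite (lin0 (starhom_lin hk)); apply: cancel_l => q.
    by rewrite -V1 h.
  by rewrite (lin0 (mr_linear _)) (lin0 (slice_lin bom)).
have [V [V1 V2]] := slice_op d (large_bdual hE Eg).
rewrite V1 (_ : V t = 0) ?(lin0 (starhom_lin hk)) ?cmul0l //.
apply: mr_amp_eq0 => k; apply: slice_sep => om bom.
by rewrite V2 // h.
Qed.

Lemma kap_elt_ideal (a : A) k : (forall g d, E g -> Act g d a = 0) -> idealJ E F (kap (elt a k)).
Proof.
move=> h; apply/kap_ideal => g d om k' Eg bom.
rewrite mr_melt slice_elt // (linZ (Act_lin _ (large_bdual hE Eg))).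
by rewrite -[mr mone a]/a h // scaler0.
Qed.

(** Compressing the K leg by k^* and choosing om nonzero at k k^* recovers a nonzero multiple of g .
    a. *)
Lemma ideal_kap_elt (a : A) k : k <> 0 -> idealJ E F (kap (elt a k)) -> forall g d, E g -> Act g d a = 0.
Proof.
move=> k0 /kap_ideal h g d Eg.
have [om /not_implyP[bom omk]] : exists om : K -> C^o, ~ (bdual om -> om (k *c cadj k) = 0).
  apply/existsNP => h'; apply: k0; apply: nm_eq0; apply/eqP; rewrite -sqrf_eq0 -nm_Madj.
  by rewrite (bdual_exists T h') nm0.
have := h g d om (cadj k) Eg bom; rewrite mr_melt slice_elt // (linZ (Act_lin _ (large_bdual hE Eg))).
by rewrite -[mr mone a]/a => /eqP; rewrite scaler_eq0 => /orP[/eqP//|/eqP].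
Qed.

Variables (D : cstar) (q : A -> D).
Hypotheses (hq : starhom q) (qE : forall a : A, q a = 0 <-> forall g d, E g -> Act g d a = 0).

Lemma ker_linclosed : is_linclosed [set a | q a = 0].
Proof. exact: linclosed_zero (starhom_lin hq) (starhom_bounded hq). Qed.

Lemma kap_linclosed : is_linclosed [set t | idealJ E F (kap t)].
Proof. exact: linclosed_preim (starhom_lin hk) (starhom_bounded hk) (idealJ_linclosed hE hF). Qed.

Lemma kap_ml (b : A) (s : A ⊗ K) : q b = 0 -> idealJ E F (kap (ml (memb b ⊗M mone) s)).
Proof.
move=> qb; move: s; apply: (total_ind (tens_total T A K)) => [|_ [a [k ->]]].
  exact: linclosed_preim (ml_linear _) (bounded_ml _) kap_linclosed.
by rewrite ml_melt; apply: kap_elt_ideal; apply/qE; rewrite (starhomM _ _ hq) qb cmul0l.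
Qed.

Lemma kap_mr (b : A) (s : A ⊗ K) : q b = 0 -> idealJ E F (kap (mr (memb b ⊗M mone) s)).
Proof.
move=> qb; move: s; apply: (total_ind (tens_total T A K)) => [|_ [a [k ->]]].
  exact: linclosed_preim (mr_linear _) (bounded_mr _) kap_linclosed.
by rewrite mr_melt; apply: kap_elt_ideal; apply/qE; rewrite (starhomM _ _ hq) qb cmul0r.
Qed.

(** The hypothesis has the shape t b w in which the inner products of X^m appear in [kX_lip] and
    [kX_rip]. Approximate units replace first b by b x and then (b x) ⊗ k by t ((b x) ⊗ k). *)
Lemma ker_of_kap (b : A) : (forall t w, idealJ E F (kap (t *c ml (memb b ⊗M mone) w))) -> q b = 0.
Proof.
move=> h; have [_ _ hc] := kap_linclosed; have [_ [k k0]] := tens_nonzero AK0.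
have [_ _ hc'] := ker_linclosed; apply: hc' => e e0.
have [x bx _] := approx_unit b e0; exists (b *c x) => //=; apply/qE.
apply: (ideal_kap_elt k0); apply: hc => d d0.
have [t ht _] := approx_unit_l (elt (b *c x) k) d0; exists (t *c elt (b *c x) k) => //=.
by have := h t (elt x k); rewrite ml_melt.
Qed.

End CornerMap.

(** * Morita compatibility *)

Section Imprimitivity.
Context {R : realType}.
Variables (A B : cstarAlgebra R) (M : imprimitivityBimodule A B).
Implicit Types (v w : M).

Lemma rip_lin w : linear (rip w). Proof. by move=> k y y'; exact: ripDr. Qed.
Lemma ripBl v v' w : rip (v - v') w = rip v w - rip v' w.
Proof. by rewrite ripC [in RHS]ripC [rip v' w]ripC (linB (rip_lin w)) cadjB. Qed.
Lemma lip_lin w : linear (fun v => lip v w). Proof. by move=> k x y; exact: lipDl. Qed.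
Lemma lipBr v v' w : lip w (v - v') = lip w v - lip w v'.
Proof. by rewrite lipC [in RHS]lipC [lip w v']lipC (linB (lip_lin w)) cadjB. Qed.

Lemma nm_rip v : nm (rip v v) = nm v ^+ 2.
Proof.
by have := rip_norm v; rewrite !nmE -rmorphXn => /(congr1 (@complex.Re R)).
Qed.
Lemma nm_lip v : nm (lip v v) = nm v ^+ 2.
Proof.
by have := lip_norm v; rewrite !nmE -rmorphXn => /(congr1 (@complex.Re R)).
Qed.

(** Expanding the inner square of v - v' suffices. This serves for module maps that are known only
    through inner products. *)
Lemma rip_eq v v' : rip v v = rip v v' -> rip v' v = rip v' v' -> v = v'.
Proof.
move=> e1 e2; apply/eqP; rewrite -subr_eq0; apply/eqP/nm_eq0/eqP.
by rewrite -sqrf_eq0 -nm_rip ripBl !(linB (rip_lin _)) e1 e2 !subrr nm0.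
Qed.
Lemma lip_eq v v' : lip v v = lip v v' -> lip v' v = lip v' v' -> v = v'.
Proof.
move=> e1 e2; apply/eqP; rewrite -subr_eq0; apply/eqP/nm_eq0/eqP.
by rewrite -sqrf_eq0 -nm_lip lipBr !(linB (lip_lin _)) e1 e2 !subrr nm0.
Qed.

Lemma rip_actl v w b : rip (ract v b) w = cadj b *c rip v w.
Proof. by rewrite ripC rip_act cadjM -ripC. Qed.
Lemma lip_actr v w a : lip w (lact a v) = lip w v *c cadj a.
Proof. by rewrite lipC lip_act cadjM -lipC. Qed.

(** With b from an approximate unit for <v, v>, the inner square of v - v b is (1 - b)^* applied to
    <v, v> - <v, v> b, and |1 - b| <= 1; hence the tolerance e^2. *)
Lemma ract_approx v (e : R) : 0 < e -> exists b, nm (v - ract v b) < e.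
Proof.
move=> e0; have [b hb b1] := approx_unit (rip v v) (eps := e ^+ 2) ltac:(by rewrite exprn_gt0).
exists b; rewrite -(@ltr_pXn2r _ 2) ?nnegrE ?nm_ge0 ?(ltW e0) // -nm_rip.
have -> : rip (v - ract v b) (v - ract v b) = ml (madj ((one : MA B) - mb b)) (rip v v - rip v v *c b).
  rewrite ripBl !(linB (rip_lin _)) !rip_act !rip_actl [madj _](@cadjB R (MA B)) (@adj_unit R (MA B) one (@one_l R B)).
  by rewrite -[cadj (mb b)](@mb_adj R B) /= scaleN1r cmulBr cmulA.
rewrite (le_lt_trans (nm_ml _ _)) //.
have h1 : nm (madj ((one : MA B) - mb b) : MA B) <= 1 by rewrite [nm _](@nm_adj R (MA B)).
have := nm_ge0 (rip v v - rip v v *c b); nra.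
Qed.

Lemma lact_approx v (e : R) : 0 < e -> exists a, nm (v - lact a v) < e.
Proof.
move=> e0; have [b hb b1] := approx_unit (lip v v) (eps := e ^+ 2) ltac:(by rewrite exprn_gt0).
exists (cadj b); rewrite -(@ltr_pXn2r _ 2) ?nnegrE ?nm_ge0 ?(ltW e0) // -nm_lip.
have -> : lip (v - lact (cadj b) v) (v - lact (cadj b) v) = ml (madj ((one : MA A) - mb b)) (lip v v - lip v v *c b).
  rewrite lipBr !(linB (lip_lin _)) !lip_act !lip_actr cadjK [madj _](@cadjB R (MA A)) (@adj_unit R (MA A) one (@one_l R A)).
  rewrite -[cadj (mb b)](@mb_adj R A) /= scaleN1r cmulBr; cmod R A.
rewrite (le_lt_trans (nm_ml _ _)) //.
have h1 : nm (madj ((one : MA A) - mb b) : MA A) <= 1 by rewrite [nm _](@nm_adj R (MA A)).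
have := nm_ge0 (lip v v - lip v v *c b); nra.
Qed.

End Imprimitivity.

Section GenuineCorner.
Context {R : realType} {G : TopologicalGroup.type} {T : tensorModel R}.
Hypothesis hG : locally_compact_group G.
Variables (S : groupModel R G) (X : crossedModel T S).
Local Notation "A ⊗ B" := (tensor T A B).
Local Notation K := (KL2 S).
Local Notation cr := (crossed X).
Local Notation dcr := (double_crossed X).
Variables (A L : coaction T S) (M : maximalization X A) (i : A -> L).
Let kap (t : M ⊗ K) : dcr L := dcr_map i (dcr_map (mq (m := M)) (Phi_inv X t)).
Hypotheses (kap_inj : injective kap) (AK0 : exists t : M ⊗ K, t <> 0).

(* A map defined by description is constant when the description fails, so
   injectivity of the corner embedding forces all of them to be genuine. *)
Lemma corner_genuine : exists Phi0 : dcr M -> M ⊗ K,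
  [/\ forall y, Phi y = memb (Phi0 y), forall t, exists y, Phi0 y = t, starhom kap
    & forall a f c x y, memb x = jA (cr M) a *M jG (cr M) f ->
      memb y = iP (dcr M) x *M gint (S := S) (iG (dcr M)) c ->
      memb (kap (Phi0 y)) = dA (dcr L) (i (mq a)) *M dG (dcr L) f *M gint (S := S) (iG (dcr L)) c].
Proof.
have [Phi0 [[Pi P1 P2] PhiE]] := mx_max M.
have surj t : exists y, Phi0 y = t by exists (Pi t).
have hPhi := Phi0_hom PhiE surj AK0.
have inv y : Phi_inv X (Phi0 y) = y.
  apply: the_uniq; first exact: PhiE.
  move=> y' e; apply: (can_inj P1); apply: (@mb_inj R).
  by rewrite /mb -PhiE e.
have not_const : ~ (forall t, kap t = kap 0).
  by move=> h; have [t t0] := AK0; apply: t0; exact: kap_inj.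
(* A junk map of single crossed products is zero and makes the induced map of double crossed
   products zero, so its failure also shows in [kap]. *)
have junk (A1 A2 : coaction T S) (h : dcr A1 -> dcr A2) (c : cr A1 -> cr A2) : starhom h ->
    (forall x g y, memb y = iP (dcr A1) x *M gint (S := S) (iG (dcr A1)) g ->
      memb (h y) = iP (dcr A2) (c x) *M gint (S := S) (iG (dcr A2)) g) ->
    (forall x, c x = 0) -> forall y, h y = 0.
  move=> hh hE c0; apply: (total_eq (f := h) (g := fun=> 0) (starhom_lin hh) _ (starhom_bounded hh) _ (acp_span (dcr A1))).
  - by move=> k v w; rewrite scaler0 addr0.
  - by exists 0 => // v; rewrite nm0 mul0r.
  move=> y [x [g e]]; apply: (@mb_inj R); rewrite /mb (hE _ _ _ e) c0 -[memb 0]/(mb 0) (lin0 (@mb_lin R _)).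
  have -> : iP (dcr A2) 0 = mzero by have := lin0 (mhom_lin (iP_mhom (dcr A2))).
  exact: mult_ext.
have [h1 e1] : starhom (dcr_map (X := X) i) /\ forall x c y, memb y = iP (dcr A) x *M gint (S := S) (iG (dcr A)) c ->
    memb (dcr_map (X := X) i y) = iP (dcr L) (cr_map i x) *M gint (S := S) (iG (dcr L)) c.
  have [ex|nex] := pselect (exists h, starhom h /\ forall x c y, memb y = iP (dcr A) x *M gint (S := S) (iG (dcr A)) c ->
    memb (h y) = iP (dcr L) (cr_map i x) *M gint (S := S) (iG (dcr L)) c); first exact: (the_spec (fun=> 0) ex).
  by case: not_const => t; rewrite /kap /dcr_map !(the_junk _ nex).
have [h2 e2] : starhom (dcr_map (X := X) (mq (m := M))) /\ forall x c y, memb y = iP (dcr M) x *M gint (S := S) (iG (dcr M)) c ->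
    memb (dcr_map (X := X) (mq (m := M)) y) = iP (dcr A) (cr_map (mq (m := M)) x) *M gint (S := S) (iG (dcr A)) c.
  have [ex|nex] := pselect (exists h, starhom h /\ forall x c y, memb y = iP (dcr M) x *M gint (S := S) (iG (dcr M)) c ->
    memb (h y) = iP (dcr A) (cr_map (mq (m := M)) x) *M gint (S := S) (iG (dcr A)) c); first exact: (the_spec (fun=> 0) ex).
  case: not_const => t; rewrite /kap; congr (dcr_map i _).
  by rewrite /dcr_map !(the_junk _ nex).
have [_ c1] : starhom (cr_map (X := X) i) /\ forall a f x, memb x = jA (cr A) a *M jG (cr A) f ->
    memb (cr_map (X := X) i x) = jA (cr L) (i a) *M jG (cr L) f.
  have [ex|nex] := pselect (exists h, starhom h /\ forall a f x, memb x = jA (cr A) a *M jG (cr A) f ->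
    memb (h x) = jA (cr L) (i a) *M jG (cr L) f); first exact: (the_spec (fun=> 0) ex).
  by case: not_const => t; rewrite /kap !(junk _ _ _ _ h1 e1) // => x; rewrite /cr_map (the_junk _ nex).
have [_ c2] : starhom (cr_map (X := X) (mq (m := M))) /\ forall a f x, memb x = jA (cr M) a *M jG (cr M) f ->
    memb (cr_map (X := X) (mq (m := M)) x) = jA (cr A) (mq a) *M jG (cr A) f.
  have [ex|nex] := pselect (exists h, starhom h /\ forall a f x, memb x = jA (cr M) a *M jG (cr M) f ->
    memb (h x) = jA (cr A) (mq a) *M jG (cr A) f); first exact: (the_spec (fun=> 0) ex).
  by case: not_const => t; rewrite /kap !(junk _ _ _ _ h2 e2) // => x; rewrite /cr_map (the_junk _ nex).
exists Phi0; split => //.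
  have kE t : exists2 y, Phi0 y = t & kap t = dcr_map i (dcr_map (mq (m := M)) y).
    by have [y <-] := surj t; exists y; rewrite // /kap inv.
  split.
  - move=> k s t; have [y ys es] := kE s; have [z zt et] := kE t.
    rewrite es et -(starhom_lin h1) -(starhom_lin h2) /kap -ys -zt -(starhom_lin hPhi) inv //.
  - move=> s t; have [y ys es] := kE s; have [z zt et] := kE t.
    by rewrite es et -(starhomM _ _ h1) -(starhomM _ _ h2) /kap -ys -zt -(starhomM _ _ hPhi) inv.
  - move=> s; have [y ys es] := kE s.
    by rewrite es -(starhom_adj _ h1) -(starhom_adj _ h2) /kap -ys -(starhom_adj _ hPhi) inv.
move=> a f c x y xe ye; rewrite /kap inv (e1 _ _ _ (e2 _ _ _ ye)); congr (_ *M _).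
have hp := iP_mhom (dcr L); have np := iP_nondeg (dcr L).
by rewrite -(mext_memb hp np) (c1 _ _ _ (c2 _ _ _ xe)) (mextM hp np).
Qed.

End GenuineCorner.

Section Morita.
Context {R : realType} {G : TopologicalGroup.type} {T : tensorModel R}.
Hypothesis hG : locally_compact_group G.
Variables (S : groupModel R G) (X : crossedModel T S).
Variable maxi : forall A : coaction T S, maximalization X A.
Local Notation "A ⊗ B" := (tensor T A B).
Local Notation "m ⊗M n" := (melt T m n).
Local Notation K := (KL2 S).
Local Notation CG := (CG S).
Local Notation cr := (crossed X).
Local Notation dcr := (double_crossed X).
Variables (E : set (CG -> (R[i])^o)) (tau : coactionFunctor maxi).
Hypotheses (hE : large_ideal E) (htau : is_Eization E tau).
Variables (A B : coaction T S) (Z : coactionBimodule A B) (Y : cornerBimodule maxi Z) (Xm : XmBimodule Y).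
Local Notation Q := (dcr (cb_co Z)).
Local Notation qA := (@cf_q _ _ _ _ _ _ tau A).
Local Notation qB := (@cf_q _ _ _ _ _ _ tau B).

Lemma cf_q_hom (D : coaction T S) : starhom (@cf_q _ _ _ _ _ _ tau D).
Proof. by case: (cf_q_equiv tau D). Qed.

(** The arguments excluding junk need a nonzero element of Y, so Y = 0 is settled apart: then X^m =
    0, and fullness of its inner product leaves A^m = 0. *)
Lemma Morita_degenerate : (forall y : Y, y = 0) -> rieffel_Ind Xm (ker qB) = ker qA.
Proof.
move=> Y0.
have X0 (x : Xm) : x = 0.
  apply: (@kX_inj _ _ _ _ _ _ _ _ _ _ Xm); move: (kX x) (kX (0 : Xm)) => [f f' ff] [g g' gg].
  have fg : f = g by apply/funext => t; rewrite [f t]Y0 [g t]Y0.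
  have fg' : f' = g' by apply/funext => t; rewrite [f' t]Y0 [g' t]Y0.
  by subst; congr BMultiplier; exact: Prop_irrelevance.
have A0 : forall a : maxi A, a = 0.
  apply: (total_set0 (lip_full Xm)) => _ [x [y ->]].
  by rewrite (X0 x) (lin0 (lip_lin y)).
apply/seteqP; split=> a _; rewrite (A0 a); first by rewrite /ker /= (lin0 (starhom_lin (cf_q_hom A))).
by have [] := closed_span_linclosed [set a | exists (x y : Xm) b, (ker qB) b /\ a = lip (ract x b) y].
Qed.

Section Nondegenerate.
Hypothesis Y0 : exists y : Y, y <> 0.

Lemma AK_nonzero : exists t : maxi A ⊗ K, t <> 0.
Proof.
have [y y0] := Y0; exists (lip y y) => e; apply: y0; apply: nm_eq0; apply/eqP.
by rewrite -sqrf_eq0 -nm_lip e nm0.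
Qed.
Lemma BK_nonzero : exists t : maxi B ⊗ K, t <> 0.
Proof.
have [y y0] := Y0; exists (rip y y) => e; apply: y0; apply: nm_eq0; apply/eqP.
by rewrite -sqrf_eq0 -nm_rip e nm0.
Qed.
Lemma Q_nonzero : exists q : Q, q <> 0.
Proof.
have [y y0] := Y0; exists (kY y) => e; apply: y0; apply: (kY_inj (c := Y)).
by rewrite e (lin0 (kY_lin (c := Y))).
Qed.

Lemma corner_A_inj : injective (corner_A (maxi := maxi) Z).
Proof.
move=> t t' e; apply: (@cancel_lP R (maxi A ⊗ K)).
apply: (total_eq (f := fun w => t *c w) (g := fun w => t' *c w) (cmul_linr t) (cmul_linr t') (bounded_cmulr t) (bounded_cmulr t') (lip_full Y)).
move=> _ [x [y ->]]; rewrite -!lip_act; congr lip.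
by apply: (kY_inj (c := Y)); rewrite !kY_lact e.
Qed.
Lemma corner_B_inj : injective (corner_B (maxi := maxi) Z).
Proof.
move=> t t' e; apply: (@cancel_rP R (maxi B ⊗ K)).
apply: (total_eq (f := fun w => w *c t) (g := fun w => w *c t') (cmul_linl t) (cmul_linl t') (bounded_cmull t) (bounded_cmull t') (rip_full Y)).
move=> _ [x [y ->]]; rewrite -!rip_act; congr rip.
by apply: (kY_inj (c := Y)); rewrite !kY_ract e.
Qed.

Lemma wG_nondegenerate : wG_prop (T := T) S.
Proof.
have [c c0] := large_nonzero hE.
have [x x0] : exists x : cr (cb_co Z), x <> 0.
  apply: contrapT => /forallNP h; have [q q0] := Q_nonzero; apply: q0.
  apply: (total_set0 (iP_nondeg Q)) => _ [x [q' ->]].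
  by have /contrapT -> := h x; have /= := lin0 (mhom_lin (iP_mhom Q)) => ->.
exact: (wG_genuine (cp_cov (cr (cb_co Z))) x0 c0).
Qed.
Let wG_ok := wG_nondegenerate.

Lemma kerE (D : coaction T S) (a : maxi D) :
  cf_q tau a = 0 <-> forall f c, E f -> Act f c a = 0.
Proof.
have e : ker (@cf_q _ _ _ _ _ _ tau D) = sub_E (A := maxi D) E by exact: htau.
(* The kernel contains 0 and equals [sub_E], so f . 0 has value 0 even where its description is not
   genuine. *)
have h0 f : E f -> dual_act f (0 : maxi D) = 0.
  have : sub_E (A := maxi D) E 0 by rewrite -e /ker /= (lin0 (starhom_lin (cf_q_hom D))).
  exact.
rewrite -(large_sub_EP hG wG_ok Q_nonzero hE h0) -e.
by split.
Qed.

Variable F : Q -> multiplier (Q ⊗ CG).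
Hypotheses (hF : mhom F) (nF : nondegenerate F)
  (FA : forall a, mext F (dA Q a) = mext (homtens (dA Q) (@memb R CG)) (co_map a))
  (FG : forall f, mext F (dG Q f) = dG Q f ⊗M mone)
  (FN : forall s, mext F (iG Q s) = iG Q s ⊗M mone).
Local Notation J := (idealJ E F).
Local Notation kA := (corner_A (maxi := maxi) Z).
Local Notation kB := (corner_B (maxi := maxi) Z).
Local Notation al x t := (bA (kX x) t).
Local Notation be x t := (bB (kX x) t).
Local Notation amp b := (memb b ⊗M mone).

(** Elements of A^m enter from the right, since a acts on a multiplier of Y by
    [al (lact a x) s = al x (mr (amp a) s)]; in the other corner they enter from the left. *)
Lemma corner_A_ideal : [/\ starhom kA,
  is_linclosed [set t | J (kA t)],
  forall (b : maxi A) s, qA b = 0 -> J (kA (mr (amp b) s))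
& forall b : maxi A, (forall t w, J (kA (t *c ml (amp b) w))) -> qA b = 0].
Proof.
have [Phi0 [PhiE sP hk kE]] := corner_genuine corner_A_inj AK_nonzero.
have psi f c (a : maxi A) : bdual f ->
    Act f c (lkA (cb_lk Z) (mq a) : cb_co Z) = lkA (cb_lk Z) (mq (Act f c a)).
  by move=> bf; rewrite (equivariant_Act (cb_A Z)) // (equivariant_Act (mq_equiv (maxi A))).
have kE' a f c x y (g : _ /\ _) := kE a f c x y g.1 g.2.
have hq := cf_q_hom A.
split.
- exact: hk.
- exact: (kap_linclosed hk hF hE).
- move=> b s; exact: (kap_mr PhiE sP AK_nonzero psi hk corner_A_inj kE' hF nF FA FG FN hE hq (@kerE A)).
- move=> b; exact: (ker_of_kap PhiE sP AK_nonzero psi hk corner_A_inj kE' hF nF FA FG FN hE hq (@kerE A)).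
Qed.

Lemma corner_B_ideal : [/\ starhom kB,
  is_linclosed [set t | J (kB t)],
  forall (b : maxi B) s, qB b = 0 -> J (kB (ml (amp b) s))
& forall b : maxi B, (forall t w, J (kB (t *c ml (amp b) w))) -> qB b = 0].
Proof.
have [Phi0 [PhiE sP hk kE]] := corner_genuine corner_B_inj BK_nonzero.
have psi f c (a : maxi B) : bdual f ->
    Act f c (lkB (cb_lk Z) (mq a) : cb_co Z) = lkB (cb_lk Z) (mq (Act f c a)).
  by move=> bf; rewrite (equivariant_Act (cb_B Z)) // (equivariant_Act (mq_equiv (maxi B))).
have kE' a f c x y (g : _ /\ _) := kE a f c x y g.1 g.2.
have hq := cf_q_hom B.
split.
- exact: hk.
- exact: (kap_linclosed hk hF hE).
- move=> b s; exact: (kap_ml PhiE sP BK_nonzero psi hk corner_B_inj kE' hF nF FA FG FN hE hq (@kerE B)).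
- move=> b; exact: (ker_of_kap PhiE sP BK_nonzero psi hk corner_B_inj kE' hF nF FA FG FN hE hq (@kerE B)).
Qed.

Let hA : starhom kA. Proof. by case: corner_A_ideal. Qed.
Let hB : starhom kB. Proof. by case: corner_B_ideal. Qed.
Let Jl z z' : J z -> J (z' *c z). Proof. exact: (idealJ_mull hG wG_ok Q_nonzero hE hF). Qed.
Let Jr z z' : J z -> J (z *c z'). Proof. exact: (idealJ_mulr hE hF). Qed.
Let Jc z : (forall e : R, 0 < e -> exists2 w, J w & nm (z - w) < e) -> J z.
Proof. by have [_ _ h] := idealJ_linclosed hE hF; exact: h. Qed.

Lemma nm_kY (y : Y) : nm (kY y) <= nm y.
Proof.
rewrite -(@ler_pXn2r _ 2) ?nnegrE ?nm_ge0 // -nm_Madj -kY_lip -nm_lip.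
exact: starhom_contractive.
Qed.

Lemma J_kY_closed (y : Y) : (forall e : R, 0 < e -> exists2 z : Y, J (kY z) & nm (y - z) < e) -> J (kY y).
Proof.
move=> h; apply: Jc => e /h[z Jz yz]; exists (kY z) => //.
by rewrite -(linB (kY_lin (c := Y))) (le_lt_trans (nm_kY _)).
Qed.

Lemma J_of_ract (y : Y) : (forall s, J (kY y *c kB s)) -> J (kY y).
Proof.
move=> h; apply: J_kY_closed => e e0; have [s hs] := ract_approx y e0.
by exists (ract y s) => //; rewrite kY_ract.
Qed.

Lemma J_of_lact (y : Y) : (forall s, J (kA s *c kY y)) -> J (kY y).
Proof.
move=> h; apply: J_kY_closed => e e0; have [s hs] := lact_approx y e0.
by exists (lact s y) => //; rewrite kY_lact.
Qed.

Lemma kY_al_be (x : Xm) t s : kY (al x t) *c kB s = kA t *c kY (be x s).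
Proof. by rewrite -kY_ract -kY_lact bA_bB. Qed.

(** A [bmultiplier] is not assumed to be a module map; this is read off from the inner products of
    [kX_rip]. *)
Lemma be_mul (x : Xm) t s : be x (t *c s) = ract (be x t) s.
Proof.
apply: rip_eq; rewrite ?rip_act ?rip_actl !kX_rip ?mlM.
  by rewrite cmulA.
by rewrite -!cmulA.
Qed.
Lemma al_mul (x : Xm) t s : al x (t *c s) = lact t (al x s).
Proof.
apply: lip_eq; rewrite ?lip_act ?lip_actr !kX_lip ?cadjM ?mlM -?cmulA //.
Qed.

Lemma be_ract (x : Xm) b s : be (ract x b) s = be x (ml (amp b) s).
Proof.
have e z t : cadj t *c ml (amp (rip z (ract x b))) s = cadj t *c ml (amp (rip z x)) (ml (amp b) s).
  rewrite rip_act; congr (_ *c _); rewrite -[RHS]/(ml (amp (rip z x) *M amp b) s) meltM mmul1; congr (ml (_ ⊗M _) s).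
  exact: (@mbM R (maxi B)).
by apply: rip_eq; rewrite !kX_rip e.
Qed.
Lemma al_lact (x : Xm) a s : al (lact a x) s = al x (mr (amp a) s).
Proof.
have e z t : s *c ml (amp (lip (lact a x) z)) t = mr (amp a) s *c ml (amp (lip x z)) t.
  rewrite -ml_mr lip_act; congr (_ *c _); rewrite -[RHS]/(ml (amp a *M amp (lip x z)) t) meltM mmul1; congr (ml (_ ⊗M _) t).
  exact: (@mbM R (maxi A)).
apply: lip_eq.
  apply: (can_inj (@cadjK R _)); rewrite -!lipC !kX_lip e //.
by apply: (can_inj (@cadjK R _)); rewrite -!lipC !kX_lip e.
Qed.

Lemma be_bound (x : Xm) : exists2 k : R, 0 <= k & forall t t', nm (be x t - be x t') <= k * nm (t - t').
Proof.
pose r := nm (amp (rip x x) : MA (maxi B ⊗ K)).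
have r0 : 0 <= r by exact: nm_ge0.
(* The inner products give the constant sqrt r; r + 1 dominates it and avoids the root. *)
exists (r + 1) => [|t t']; first lra.
rewrite -(@ler_pXn2r _ 2) ?nnegrE ?mulr_ge0 ?nm_ge0 //; last lra.
rewrite -nm_rip.
have -> : rip (be x t - be x t') (be x t - be x t') = cadj (t - t') *c ml (amp (rip x x)) (t - t').
  by rewrite ripBl !(linB (rip_lin _)) !kX_rip cadjB cmulBl mlB !cmulBr.
rewrite (le_trans (nmMle _ _)) // nm_adj.
have := nm_ml (amp (rip x x)) (t - t'); rewrite -/r; have := nm_ge0 (t - t').
move: (nm (ml _ _)) (nm (t - t')) => p s h1 h2.
have : s * p <= s * (r * s) by rewrite ler_wpM2l.
have : 0 <= s * s by rewrite mulr_ge0.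
move: (mulr_ge0 r0 (mulr_ge0 h1 h1)) (mulr_ge0 (mulr_ge0 r0 r0) (mulr_ge0 h1 h1)).
rewrite expr2; nra.
Qed.

Lemma al_bound (x : Xm) : exists2 k : R, 0 <= k & forall t t', nm (al x t - al x t') <= k * nm (t - t').
Proof.
pose r := nm (amp (lip x x) : MA (maxi A ⊗ K)).
have r0 : 0 <= r by exact: nm_ge0.
exists (r + 1) => [|t t']; first lra.
rewrite -(@ler_pXn2r _ 2) ?nnegrE ?mulr_ge0 ?nm_ge0 //; last lra.
rewrite -nm_lip.
have -> : lip (al x t - al x t') (al x t - al x t') = (t - t') *c ml (amp (lip x x)) (cadj (t - t')).
  rewrite lipBr !(linB (lip_lin _)) !kX_lip cadjB mlB cmulBr !cmulBl; cmod R (maxi A ⊗ K).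
rewrite (le_trans (nmMle _ _)) //.
have := nm_ml (amp (lip x x)) (cadj (t - t')); rewrite -/r nm_adj; have := nm_ge0 (t - t').
move: (nm (ml _ _)) (nm (t - t')) => p s h1 h2.
have : s * p <= s * (r * s) by rewrite ler_wpM2l.
have : 0 <= s * s by rewrite mulr_ge0.
move: (mulr_ge0 r0 (mulr_ge0 h1 h1)) (mulr_ge0 (mulr_ge0 r0 r0) (mulr_ge0 h1 h1)).
rewrite expr2; nra.
Qed.

(** Approximating t by s t turns the image into (x s) t, a product in Q with the element [kB t] of
    J. The estimate is for differences because linearity of [bB] is not part of its definition. *)
Lemma J_be (x : Xm) t : J (kB t) -> J (kY (be x t)).
Proof.
move=> Jt; have [k k0 hk] := be_bound x; apply: J_kY_closed => e e0.
have k1 : 0 < k + 1 by lra.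
have [s hs _] := approx_unit_l t (eps := e / (k + 1)) ltac:(by rewrite divr_gt0).
exists (be x (s *c t)); first by rewrite be_mul kY_ract; exact: Jl.
rewrite (le_lt_trans (hk _ _)) //; move: hs; rewrite ltr_pdivlMr //.
have := nm_ge0 (t - s *c t); nra.
Qed.

Lemma J_al (x : Xm) t : J (kA t) -> J (kY (al x t)).
Proof.
move=> Jt; have [k k0 hk] := al_bound x; apply: J_kY_closed => e e0.
have k1 : 0 < k + 1 by lra.
have [s hs _] := approx_unit t (eps := e / (k + 1)) ltac:(by rewrite divr_gt0).
exists (al x (t *c s)); first by rewrite al_mul kY_lact; exact: Jr.
rewrite (le_lt_trans (hk _ _)) //; move: hs; rewrite ltr_pdivlMr //.
have := nm_ge0 (t - t *c s); nra.
Qed.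

(** J crosses from the lower corner to the upper one through Y: t (x b) s = t (x (b s)), and b s
    lies in J when b is in the kernel. Then the product with any adjoint of Y lies in J, which is
    the hypothesis of the kernel criterion for the upper corner. *)
Lemma ker_lip (x y : Xm) (b : maxi B) : qB b = 0 -> qA (lip (ract x b) y) = 0.
Proof.
move=> qb; have [_ _ kml _] := corner_B_ideal; have [_ _ _ h] := corner_A_ideal; apply: h => t w.
rewrite -[w](@cadjK R (maxi A ⊗ K)) -kX_lip kY_lip; apply: Jr; apply: J_of_ract => s.
by rewrite kY_al_be be_ract; apply/Jl/J_be/kml.
Qed.

Lemma ker_rip (x y : Xm) (a : maxi A) : qA a = 0 -> qB (rip y (lact a x)) = 0.
Proof.
move=> qa; have [_ _ _ h] := corner_B_ideal; have [_ _ kmr _] := corner_A_ideal; apply: h => t w.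
rewrite -[t](@cadjK R (maxi B ⊗ K)) -kX_rip kY_rip; apply: Jl; apply: J_of_lact => s.
by rewrite -kY_al_be al_lact; apply/Jr/J_al/kmr.
Qed.

Lemma Morita_nondegenerate : rieffel_Ind Xm (ker qB) = ker qA.
Proof.
apply/seteqP; split=> a.
  apply: closed_span_ind => [|_ [x [y [b [qb ->]]]]]; last exact: ker_lip.
  exact: linclosed_zero (starhom_lin (cf_q_hom A)) (starhom_bounded (cf_q_hom A)).
rewrite /ker /= => qa; rewrite /rieffel_Ind; set U := [set a | _].
have lU := closed_span_linclosed U; have [_ _ Uc] := lU.
(* For the converse inclusion, <x, y> a <x', w> = <x <y, a x'>, w>, and <y, a x'> is in the kernel
   on the B side by [ker_rip]. Fullness and approximate units then remove the two outer factors. *)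
have h a1 (x' w : Xm) : closed_span U (a1 *c (a *c lip x' w)).
  move: a1; apply: (total_ind (lip_full Xm)) => [|_ [x [y ->]]].
    exact: (linclosed_preim (cmul_linl _) (bounded_cmull _) lU).
  apply: closed_span_sub; exists x, w, (rip y (lact a x')); split; first exact: ker_rip.
  by rewrite -lip_rip !lip_act.
have h2 (x' w : Xm) : closed_span U (a *c lip x' w).
  apply: Uc => e e0; have [a1 ha _] := approx_unit_l (a *c lip x' w) e0.
  by exists (a1 *c (a *c lip x' w)).
have h3 a2 : closed_span U (a *c a2).
  move: a2; apply: (total_ind (lip_full Xm)) => [|_ [x [y ->]]]; last exact: h2.
  exact: (linclosed_preim (cmul_linr _) (bounded_cmulr _) lU).
by apply: Uc => e e0; have [a2 ha _] := approx_unit a e0; exists (a *c a2).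
Qed.

End Nondegenerate.
End Morita.

Theorem theorem6p14 (R : realType) (G : TopologicalGroup.type)
    (hG : locally_compact_group G)
    (T : tensorModel R) (S : groupModel R G) (X : crossedModel T S)
    (maxi : forall A : coaction T S, maximalization X A)
    (E : set (CG S -> (R[i]%C)^o)) (hE : large_ideal E)
    (tau : coactionFunctor maxi) (htau : is_Eization E tau) :
  Morita_compatible tau.
Proof.
move=> A B Z Y Xm.
have [Y0|/existsNP Y0] := pselect (forall y : Y, y = 0); first exact: Morita_degenerate.
have [F [hF nF FA FG FN]] := Tmap_exists hG (wG_nondegenerate hE Y0) (double_crossed X (cb_co Z)).
exact: (Morita_nondegenerate hG hE htau Xm Y0 hF nF FA FG FN).
Qed.
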